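(* Let $L\hookrightarrow II_{2,26}$ be a nondegenerate sublattice of signature $(2,n)$, $n\ge 1$, and let $L^\perp$ be its orthogonal complement in $II_{2,26}$. Assume that the set $R_{-2}(L^\perp)=\{r\in II_{2,26}\mid r^2=-2,\ (r,L)=0\}$ of $(-2)$-roots in $L^\perp$ is non-empty, and put $N(L^\perp)=\#R_{-2}(L^\perp)/2$. Then the quasi pull-back $$\Phi|_L=\left.\frac{\Phi_{12}(Z)}{\prod_{r\in R_{-2}(L^\perp)/\pm1}(Z,r)}\right|_{\mathcal D_L}\in S_{12+N(L^\perp)}(\widetilde{\mathrm O}^+(L),\det)$$ of the Borcherds form $\Phi_{12}$ is a cusp form.
   Context: For a lattice $L$ of signature $(2,n)$ with bilinear form $(\cdot,\cdot)$ (extended $\mathbb C$-bilinearly), $\mathcal D_L$ is one of the two connected components of $\{[x]\in\mathbb P(L\otimes\mathbb C)\mid (x,x)=0,\ (x,\bar x)>0\}$, and $\mathcal D_L^\bullet=\{Z\in L\otimes\mathbb C\mid [Z]\in\mathcal D_L\}$ is the affine cone over it. For a sublattice $L\subset M$ of signature $(2,n)$ in $M$ of signature $(2,m)$ the components are chosen with $\mathcal D_L\subset\mathcal D_M$. $\mathrm O^+(L)\subset \mathrm O(L)$ is the subgroup of elements of real spinor norm 1, i.e. those mapping $\mathcal D_L$ to itself, and $\widetilde{\mathrm O}^+(L)$ is the group of $g\in\mathrm O^+(L)$ acting trivially on the discriminant group $L^\vee/L$. For $\Gamma<\mathrm O^+(L)$ of finite index and a character $\chi$ of $\Gamma$, $M_k(\Gamma,\chi)$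 is the space of modular forms of weight $k$ and character $\chi$: holomorphic functions $F:\mathcal D_L^\bullet\to\mathbb C$ with $F(tZ)=t^{-k}F(Z)$ for all $t\in\mathbb C^*$ and $F(gZ)=\chi(g)F(Z)$ for all $g\in\Gamma$; if $n<3$ one requires in addition that $F$ is holomorphic at the boundary (for $n\ge3$ this is automatic by Koecher's principle). $S_k(\Gamma,\chi)$ is the subspace of cusp forms, i.e. modular forms vanishing at every cusp (boundary component of the Baily–Borel compactification). Fourier expansions: for a primitive isotropic $c\in L$ and $b\in L^\vee$ with $(c,b)=1$, put $L_{c,b}=L\cap c^\perp\cap b^\perp$ (signature $(1,n-1)$), let $C^+$ be a suitably chosen connected component of $\{x\in L_{c,b}\otimes\mathbb R\mid (x,x)>0\}$ and $\mathcal H_c=L_{c,b}\otimes\mathbb R+iC^+$; then $z\mapsto [z]=z+b-\tfrac{(z,z)+(b,b)}{2}c$ identifies $\mathcal H_c$ with $\mathcal D_L$, and for $F\in M_k(\widetilde{\mathrm O}^+(L),\det)$ the function $F_{c,b}(z)=F([z])$ has an expansion $\sum_{l\in L_{c,b}^\vee}f(l)\exp(2\pi i(l,z))$. Holomorphic at the boundary means that for every such $c$, $f(l)\ne0$ only if $l$ lies in the closure of $C^+$. Vanishing at every cusp (of dimension $0$ and $1$) means equivalently that for every such $c$, $f(l)\neq0$ only if moreover $(l,l)>0$. $II_{2,26}\cong 2U\oplus 3E_8(-1)$ is the even unimodular lattice of signature $(2,26)$ ($U$ the hyperbolic plane, $E_8(-1)$ the negative definite even unimodular lattice of rank 8). $\Phi_{12}\in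 M_{12}(\mathrm O^+(II_{2,26}),\det)$ is the Borcherds modular form, the unique (up to scalar) non-zero modular form of weight 12 and character $\det$ for $\mathrm O^+(II_{2,26})$; its divisor is the sum, each with multiplicity one, of the divisors $\mathcal D_r=\{[Z]\in\mathcal D_{II_{2,26}}\mid (Z,r)=0\}$ over all $\pm r\in II_{2,26}$ with $r^2=-2$. In the product defining $\Phi|_L$ one fixes a system of representatives of $R_{-2}(L^\perp)/\pm1$ (a finite set, since $L^\perp$ is negative definite). *)

(* Defs.v *)
From HB Require Import structures.
From mathcomp Require Import all_boot all_order all_algebra finmap.
From mathcomp Require Import all_classical all_reals.
From mathcomp Require Import topology normedtype derive sequences exp trigo.
From mathcomp.analysis.showcase Require Import summability.
From mathcomp Require Import complex.

Set Implicit Arguments.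
Unset Strict Implicit.
Unset Printing Implicit Defensive.

Import Order.TTheory GRing.Theory Num.Theory.
Import numFieldNormedType.Exports.

Local Open Scope ring_scope.
Local Open Scope classical_set_scope.
Local Open Scope complex_scope.

(* The library puts a topology on an abstract numClosedFieldType, but not on
   R[i]; this copies the normed module R[i]^o.  Hence [differentiable] on
   functions 'cV[R[i]]_n.+1 -> R[i] is complex differentiability. *)
#[non_forgetful_inheritance]
HB.instance Definition _ (R : realType) := NormedModule.copy R[i] R[i]^o.

(** A lattice of rank d is Z^d (column vectors) with the bilinear form of an
    integral symmetric Gram matrix S.  L (x) A is 'cV[A]_d. *)

Section Forms.
Variables (A : comNzRingType) (d : nat) (S : 'M[int]_d).

Definition bil (x y : 'cV[A]_d) : A :=
  (x^T *m map_mx intr S *m y) ord0 ord0.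

End Forms.

(* Signature (2,n), by Sylvester's law of inertia. *)
Definition has_signature_2n (R : realType) (n : nat) (S : 'M[int]_n.+2) :=
  S^T = S /\
  exists2 P : 'M[R]_n.+2, P \in unitmx &
    P^T *m map_mx intr S *m P =
    diag_mx (\row_(j < n.+2) (if (j < 2)%N then 1 else -1)).

Definition even_lattice (d : nat) (S : 'M[int]_d) :=
  forall x : 'cV[int]_d, (2 %| bil S x x)%Z.

Definition unimodular (d : nat) (S : 'M[int]_d) := S \in unitmx.

(* II_{2,26}, with respect to an arbitrary Z-basis: the even unimodular lattice
   of signature (2,26) is unique up to isometry. *)
Definition is_II_2_26 (R : realType) (G : 'M[int]_28) :=
  [/\ has_signature_2n R (n := 26) G, even_lattice G & unimodular G].

(* Membership in the dual lattice, inside L (x) Q. *)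
Definition in_dual (d : nat) (S : 'M[int]_d) (b : 'cV[rat]_d) :=
  forall x : 'cV[int]_d, bil S b (map_mx intr x) \is a Num.int.

(* The zero vector is not primitive, being divisible by every k. *)
Definition primitive (d : nat) (c : 'cV[int]_d) :=
  forall (k : int) (y : 'cV[int]_d), c = k *: y -> `|k| = 1.

Section Domain.
Variables (R : realType) (n : nat) (S : 'M[int]_n.+2).
Local Notation VR := 'cV[R]_n.+2.
Local Notation VC := 'cV[R[i]]_n.+2.
Local Notation VQ := 'cV[rat]_n.+2.
Local Notation VZ := 'cV[int]_n.+2.

(* In R[i], 0 < w means that w is real and positive. *)
Definition period_cone : set VC :=
  [set Z | bil S Z Z = 0 /\ 0 < bil S Z (map_mx conjc Z)].

Definition is_component (T : topologicalType) (A C : set T) :=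
  exists2 x, A x & C = connected_component A x.

(* D is an affine cone D_L^bullet.  As C^* is connected, the connected
   components of the cone are exactly the preimages of the connected components
   of its image in the projective space. *)
Definition is_domain_cone (D : set VC) := is_component period_cone D.

Variable D : set VC.

Definition in_O (g : 'M[int]_n.+2) := g^T *m S *m g = S.

Definition Oplus : set 'M[int]_n.+2 :=
  [set g | in_O g /\ [set map_mx intr g *m Z | Z in D] = D].

Definition stable_Oplus : set 'M[int]_n.+2 :=
  [set g | Oplus g /\
    forall x : VQ, in_dual S x ->
      exists y : VZ, map_mx intr g *m x - x = map_mx intr y].

(* D is a submanifold, not an open subset, of L (x) C: F is holomorphic on D
   when it locally extends to a holomorphic function on an open set. *)
Definition holomorphic_on (F : VC -> R[i]) :=
  forall Z, D Z -> exists H : VC -> R[i],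
    \forall W \near Z, differentiable H W /\ (D W -> F W = H W).

Section Cusp.
Variables (c : VZ) (b : VQ).

(* c^perp and b^perp inside L (x) R; these are rational conditions, so this is
   L_{c,b} (x) R. *)
Definition Lcb_real : set VR :=
  [set x | bil S x (map_mx intr c) = 0 /\ bil S x (map_mx ratr b) = 0].

Definition Lcb_dual (l : VQ) :=
  [/\ bil S l (map_mx intr c) = 0, bil S l b = 0 &
    forall x : VZ, bil S x c = 0 -> bil S (map_mx intr x) b = 0 ->
      bil S l (map_mx intr x) \is a Num.int].

Definition Lcb_positive : set VR := [set x | Lcb_real x /\ 0 < bil S x x].

Definition tube (C : set VR) : set VC :=
  [set z | Lcb_real (map_mx (@complex.Re R) z) /\ C (map_mx (@complex.Im R) z)].

Definition tube_point (z : VC) : VC :=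
  z + map_mx ratr b
    - ((bil S z z + ratr (bil S b b)) / 2) *: map_mx intr c.

(* The component C^+: the one for which tube_point maps the tube into D. *)
Definition is_Cplus (C : set VR) :=
  is_component Lcb_positive C /\ forall z, tube C z -> D (tube_point z).

Definition cexp (w : R[i]) : R[i] :=
  (expR (complex.Re w))%:C *
  (cos (complex.Im w) +i* sin (complex.Im w)).

(* The sum over the dual lattice is the limit over all its finite subsets,
   i.e. unconditional (equivalently absolute) convergence. *)
Definition is_fourier_expansion (C : set VR) (F : VC -> R[i]) (f : VQ -> R[i]) :=
  (forall l, f l != 0 -> Lcb_dual l) /\
  forall z, tube C z ->
    partial_sum (fun l : VQ =>
        f l * cexp ((0 +i* (2 * pi)) * bil S (map_mx ratr l) z)) @ totally
      --> F (tube_point z).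

End Cusp.

Definition is_cusp_datum (c : VZ) (b : VQ) (C : set VR) :=
  [/\ primitive c, bil S c c = 0, in_dual S b, bil S (map_mx intr c) b = 1 &
      is_Cplus c b C].

Definition holomorphic_at_boundary (F : VC -> R[i]) :=
  forall c b C, is_cusp_datum c b C ->
    exists2 f, is_fourier_expansion c b C F f &
      forall l, f l != 0 -> closure C (map_mx ratr l).

Definition vanishing_at_cusps (F : VC -> R[i]) :=
  forall c b C, is_cusp_datum c b C ->
    exists2 f, is_fourier_expansion c b C F f &
      forall l, f l != 0 -> closure C (map_mx ratr l) /\ 0 < bil S l l.

(* M_k(Gamma, det).  The boundary condition uses Fourier expansions indexed by
   L_{c,b}^vee, which is appropriate when Gamma contains stable_Oplus. *)
Definition modular_form_det (Gamma : set 'M[int]_n.+2) (k : nat)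
    (F : VC -> R[i]) :=
  [/\ holomorphic_on F,
      forall (t : R[i]) Z, t != 0 -> D Z -> F (t *: Z) = t ^- k * F Z,
      forall g Z, Gamma g -> D Z ->
        F (map_mx intr g *m Z) = (\det g)%:~R * F Z &
      (n < 3)%N -> holomorphic_at_boundary F].

(* S_k(Gamma, det) *)
Definition cusp_form_det (Gamma : set 'M[int]_n.+2) (k : nat)
    (F : VC -> R[i]) :=
  modular_form_det Gamma k F /\ vanishing_at_cusps F.

End Domain.

(* Phi_12, which this determines up to a nonzero scalar. *)
Definition is_borcherds_form (R : realType) (G : 'M[int]_28)
    (D : set 'cV[R[i]]_28) (Phi : 'cV[R[i]]_28 -> R[i]) :=
  modular_form_det (n := 26) G D (Oplus (n := 26) G D) 12 Phi /\
  exists2 Z, D Z & Phi Z != 0.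

Section QuasiPullback.
Variables (R : realType) (n : nat).
(* The columns of B are the images in II_{2,26} of the basis of L. *)
Variables (G : 'M[int]_28) (B : 'M[int]_(28, n.+2)).

Definition perp_roots : set 'cV[int]_28 :=
  [set r | bil G r r = -2 /\ forall x : 'cV[int]_n.+2, bil G r (B *m x) = 0].

Definition half_number_of_roots : nat := (#|` fset_set perp_roots|)./2.

Definition is_pm_representatives (rs : {fset 'cV[int]_28}) :=
  (forall r, r \in rs -> perp_roots r) /\
  (forall r, perp_roots r -> (r \in rs) (+) (- r \in rs)).

(* F is the restriction to DL of the holomorphic function Q = Phi / prod (Z,r)
   on DM; Q is determined on DM by continuity. *)
Definition is_quasi_pullback (DM : set 'cV[R[i]]_28) (DL : set 'cV[R[i]]_n.+2)
    (rs : {fset 'cV[int]_28}) (Phi : 'cV[R[i]]_28 -> R[i])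
    (F : 'cV[R[i]]_n.+2 -> R[i]) :=
  exists Q : 'cV[R[i]]_28 -> R[i],
    [/\ holomorphic_on (n := 26) DM Q,
        forall Z, DM Z ->
          Phi Z = Q Z * \prod_(r <- rs) bil G Z (map_mx intr r) &
        forall Z, DL Z -> F Z = Q (map_mx intr B *m Z)].

End QuasiPullback.

(* Main.v *)
(** In coordinates at a cusp of L, M = II_{2,26} contributes n variables from L
    and p from the negative definite lattice L^perp.  By Koecher's principle,
    applied with units of Pell type in O^+(M), a Fourier coefficient of Phi
    vanishes unless its frequency l + j lies in the dual cone.  If the projection
    l of the frequency to L is not in the open positive cone, this leaves only
    j = 0, so that the l-th coefficient of Phi is constant along L^perp; it is
    zero since Phi vanishes on L.  Away from L the quasi pull-back differs from
    Phi by a factor depending only on the L^perp-coordinate, so its l-th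
    coefficient vanishes there, and on L by continuity.  Thus all frequencies of
    the restriction lie in the open cone, which is the cusp condition.

    The quotient Q exists because Phi changes sign under the reflections in the
    roots and the root hyperplanes are pairwise distinct.  Any isometry of M
    fixing the roots multiplies Q by its determinant; applied to the extensions
    of stable isometries of L by the identity on L^perp, this is modularity. *)

Require Import Defs.
From HB Require Import structures.
From mathcomp Require Import all_boot all_order all_algebra finmap.
From mathcomp Require Import all_classical all_reals.
From mathcomp Require Import topology normedtype landau derive sequences exp trigo.
From mathcomp.analysis.showcase Require Import summability.
From mathcomp Require Import complex.
From mathcomp Require Import zify ring lra.

Set Implicit Arguments.
Unset Strict Implicit.
Unset Printing Implicit Defensive.
Import Order.TTheory GRing.Theory Num.Theory.
Import numFieldNormedType.Exports.
Local Open Scope ring_scope.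
Local Open Scope classical_set_scope.
Local Open Scope complex_scope.

(** Integrals over a period are replaced by [dmean], a limit of averages over dyadic points.
    Goursat's theorem for these means makes the mean along a horizontal period independent of its
    height; Fourier expansions on strips follow, and through s = e(z) a Taylor bound and Cauchy's
    formula on discs. The period domain is a quadric cone and not an open set, so functions on it
    are pulled back to open sets, by [retract] near a point and by [tau] at a cusp.

    Koecher's argument runs in II_{2,26}, where the lattice at a cusp has rank 26, so all n are
    treated at once. The obstacle is that [Q], unlike [Phi], transforms well only under isometries
    fixing the roots: it is periodic along L but not along L^perp. The expansion in all variables is
    therefore made for [Phi]; only its coefficients along L are compared with those of [Q], on
    slices x = t x0 with t nonzero, and t = 0 is reached by a limit. The lattices at the cusp are
    entered through rational bases of integral vectors, so the frequencies first lie in a dual that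
    may be too large; invariance under all translations of L_{c,b} then puts them into the dual of
    L_{c,b}. *)

(** * Real-valued norms and epsilon-delta criteria *)

Section Nrm.
Variable R : realType.

(* The norms of the library on R[i]-modules are R[i]-valued; [nrm] is the
   underlying real number. *)
Definition nrm (V : normedZmodType R[i]) (v : V) : R := complex.Re `|v|.

Lemma nrmE (V : normedZmodType R[i]) (v : V) : `|v| = (nrm v)%:C.
Proof. by rewrite /nrm RRe_real // normr_real. Qed.

Lemma nrm_ge0 (V : normedZmodType R[i]) (v : V) : 0 <= nrm v.
Proof. by rewrite -ler0c -nrmE. Qed.

Lemma nrmD (V : normedZmodType R[i]) (v w : V) : nrm (v + w) <= nrm v + nrm w.
Proof. by rewrite -lecR rmorphD /= -!nrmE ler_normD. Qed.

Lemma nrmN (V : normedZmodType R[i]) (v : V) : nrm (- v) = nrm v.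
Proof. by rewrite /nrm normrN. Qed.

Lemma nrmB (V : normedZmodType R[i]) (v w : V) : nrm (v - w) = nrm (w - v).
Proof. by rewrite -nrmN opprB. Qed.

Lemma nrm0 (V : normedZmodType R[i]) : nrm (0 : V) = 0.
Proof. by rewrite /nrm normr0. Qed.

Lemma nrm0_eq0 (V : normedZmodType R[i]) (v : V) : nrm v = 0 -> v = 0.
Proof. by move=> v0; apply/normr0_eq0; rewrite nrmE v0. Qed.

Lemma nrm_gt0 (V : normedZmodType R[i]) (v : V) : (0 < nrm v) = (v != 0).
Proof. by rewrite -normr_gt0 nrmE -ltcR. Qed.

Lemma nrm_le_sum (V : normedZmodType R[i]) (I : Type) (r : seq I) (P : pred I)
  (F : I -> V) : nrm (\sum_(i <- r | P i) F i) <= \sum_(i <- r | P i) nrm (F i).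
Proof.
apply: (big_ind2 (fun x y => nrm x <= y)); rewrite ?nrm0 // => x1 x2 y1 y2 ? ?.
by apply: le_trans (nrmD _ _) _; apply: lerD.
Qed.

Lemma nrmM (x y : R[i]) : nrm (x * y) = nrm x * nrm y.
Proof. by apply: complexI; rewrite rmorphM /= -!nrmE normrM. Qed.

Lemma nrm1 : nrm (1 : R[i]) = 1.
Proof. by rewrite /nrm normr1. Qed.

Lemma nrmZ (V : normedModType R[i]) (x : R[i]) (v : V) :
  nrm (x *: v) = nrm x * nrm v.
Proof. by apply: complexI; rewrite rmorphM /= -!nrmE normrZ. Qed.

Lemma nrmV (x : R[i]) : nrm x^-1 = (nrm x)^-1.
Proof. by apply: complexI; rewrite fmorphV /= -!nrmE normfV. Qed.

Lemma nrm_real (x : R) : nrm x%:C = `|x|.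
Proof. by rewrite /nrm normc_def /= expr0n addr0 sqrtr_sqr. Qed.

Lemma nrm_sqr (z : R[i]) : nrm z ^+ 2 = complex.Re z ^+ 2 + complex.Im z ^+ 2.
Proof. by apply: complexI; rewrite rmorphXn /= -nrmE -add_Re2_Im2. Qed.

Lemma Re_le_nrm (z : R[i]) : `|complex.Re z| <= nrm z.
Proof. by rewrite -lecR -nrmE normc_ge_Re. Qed.

Lemma Im_le_nrm (z : R[i]) : `|complex.Im z| <= nrm z.
Proof.
rewrite -(ger0_norm (nrm_ge0 z)) -ler_sqr ?nnegrE // !real_normK ?num_real //.
by rewrite nrm_sqr lerDr sqr_ge0.
Qed.

Lemma nrm_le_ReIm (z : R[i]) : nrm z <= `|complex.Re z| + `|complex.Im z|.
Proof.
rewrite -ler_sqr ?nnegrE ?nrm_ge0 ?addr_ge0 // nrm_sqr sqrrD !real_normK ?num_real //.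
by have := mulr_ge0 (normr_ge0 (complex.Re z)) (normr_ge0 (complex.Im z)); lra.
Qed.

Lemma complexRIE (z : R[i]) : z = (complex.Re z)%:C + 'i * (complex.Im z)%:C.
Proof. exact: complexE. Qed.

Lemma nrm_i : nrm ('i : R[i]) = 1.
Proof. by rewrite /nrm normc_def /= expr0n expr1n add0r sqrtr1. Qed.

Lemma nrm_conjc (z : R[i]) : nrm z^* = nrm z.
Proof. by rewrite /nrm normcJ. Qed.

Lemma nrm_distl (V : normedZmodType R[i]) (v w : V) : nrm v - nrm w <= nrm (v - w).
Proof. by rewrite lerBlDr; have := nrmD (v - w) w; rewrite subrK. Qed.

Lemma pos_complex (e : R[i]) : 0 < e -> exists2 d : R, 0 < d & e = d%:C.
Proof.
case: e => a b; rewrite ltcE /= => /andP[/eqP -> a0].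
by exists a.
Qed.

Lemma nbhs_nrm (V : normedModType R[i]) (p : V) (P : V -> Prop) :
  (\forall q \near p, P q) <->
  exists2 d : R, 0 < d & forall q, nrm (q - p) < d -> P q.
Proof.
split.
  move/nbhs_normP => [e /= /pos_complex[d d0 ->] H].
  by exists d => // q qd; apply: H; rewrite /ball_ /= nrmE nrmB ltcR.
move=> [d d0 H]; apply/nbhs_normP; exists d%:C; rewrite /= ?ltcR // => q.
by rewrite /ball_ /= nrmE ltcR nrmB => /H.
Qed.

Lemma cvg_nrm (T : Type) (F : set_system T) (FF : Filter F) (V : normedModType R[i])
    (f : T -> V) (l : V) :
  f @ F --> l <-> forall e : R, 0 < e -> \forall x \near F, nrm (f x - l) < e.
Proof.
split=> [/cvgrPdist_lt H e e0|H].
  have := H e%:C; rewrite ltcR => /(_ e0); apply: filterS => x.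
  by rewrite nrmE ltcR nrmB.
apply/cvgrPdist_lt => _ /pos_complex[d d0 ->].
by apply: filterS (H d d0) => x; rewrite nrmE ltcR nrmB.
Qed.

Lemma cont_nrm (V W : normedModType R[i]) (f : V -> W) (p : V) :
  {for p, continuous f} <->
  forall e : R, 0 < e ->
    exists2 d : R, 0 < d & forall q, nrm (q - p) < d -> nrm (f q - f p) < e.
Proof.
split=> [/cvg_nrm H e e0|H]; first exact/nbhs_nrm/H.
by apply/cvg_nrm => e e0; apply/nbhs_nrm/H.
Qed.

Lemma cont_nrmR (W : normedModType R[i]) (f : R -> W) (p : R) :
  {for p, continuous f} <->
  forall e : R, 0 < e ->
    exists2 d : R, 0 < d & forall q, `|q - p| < d -> nrm (f q - f p) < e.
Proof.
split=> [/cvg_nrm H e e0|H].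
  have /nbhs_normP [d /= d0 Hd] := H _ e0.
  by exists d => // q qd; apply: Hd; rewrite /= distrC.
apply/cvg_nrm => e e0; have [d d0 Hd] := H _ e0.
apply/nbhs_normP; exists d => //= q qd; apply: Hd; by rewrite distrC.
Qed.

Lemma real_complex_continuous : continuous (fun x : R => x%:C : R[i]).
Proof.
move=> x; apply/cont_nrmR => e e0; exists e => // q.
by rewrite -rmorphB /= nrm_real.
Qed.

Lemma diff_eps (V : normedModType R[i]) (f : V -> R[i]) (p : V) :
  differentiable f p -> forall e : R, 0 < e ->
  exists2 d : R, 0 < d & forall v, nrm v < d ->
    nrm (f (p + v) - f p - 'd f p v) <= e * nrm v.
Proof.
move=> df e e0; have /eqaddoP/(_ e%:C) := diff_locally df.
rewrite ltcR => /(_ e0) /nbhs_nrm[d d0 H]; exists d => // v vd.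
have := H v; rewrite subr0 => /(_ vd) /=.
by rewrite !fctE /= !nrmE -rmorphM lecR /= opprD addrA [p + v]addrC.
Qed.

(** The bound [K] supplies the continuity of the differential, which differentiability includes. *)
Lemma eps_diff (V : normedModType R[i]) (f : V -> R[i]) (df : V -> R[i]) (p : V)
    (K : R) :
  linear df -> (forall v, nrm (df v) <= K * nrm v) ->
  (forall e : R, 0 < e -> exists2 d : R, 0 < d & forall v, nrm v < d ->
    nrm (f (p + v) - f p - df v) <= e * nrm v) ->
  differentiable f p.
Proof.
move=> ldf bdf H.
pose dfM := GRing.isLinear.Build _ _ _ _ _ ldf.
pose dfL : {linear V -> R[i]} := HB.pack df dfM.
have cdf : continuous dfL.
  move=> q; apply/cont_nrm => e e0; have K1 : 0 < `|K| + 1 by rewrite ltr_wpDl.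
  exists (e / (`|K| + 1)); first by rewrite divr_gt0.
  move=> v; rewrite ltr_pdivlMr // => vq; rewrite -linearB; apply: le_lt_trans vq.
  apply: le_trans (bdf _) _; rewrite mulrC ler_wpM2l ?nrm_ge0 //.
  by apply: le_trans (ler_norm K) _; rewrite lerDl.
have HH : f \o shift p = cst (f p) + dfL +o_ 0 id.
  apply/eqaddoP => _ /pos_complex[e e0 ->].
  have [d d0 Hd] := H e e0; apply/nbhs_nrm; exists d => // v; rewrite subr0 => vd.
  by rewrite !fctE /= !nrmE -rmorphM lecR /= opprD addrA [v + p]addrC; apply: Hd.
have E := diff_unique cdf HH.
apply/diff_locallyP; rewrite E; split => //.
Qed.
End Nrm.

(** * Dyadic means *)

Section DyadicMean.
Variable R : realType.
Implicit Types (f g : R -> R[i]).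

(** Compactness of [0,1] in the form of a Lebesgue number: [good] is inherited by smaller scales, so
    finitely many local scales can be replaced by one. The predicate may encode a modulus of
    continuity, the inverse of a bound, or local constancy. *)
Lemma unit_interval_uniform (good : R -> R -> Prop) :
  (forall d d' x, d' <= d -> good d x -> good d' x) ->
  (forall x, 0 <= x <= 1 -> exists2 d, 0 < d &
     forall x', `|x' - x| < d -> good d x') ->
  exists2 d, 0 < d & forall x, 0 <= x <= 1 -> good d x.
Proof.
move=> anti H.
have /compact_near_coveringP/(_ R (0^'+) good _) := @segment_compact R 0 1.
move=> /(_ _)[].
  move=> x; rewrite /= in_itv /= => /H[d d0 Hd].
  exists (ball x d, [set e | 0 < e < d]) => /=.
    split; first exact: nbhsx_ballx.
    by near=> e; apply/andP; split; near: e; [exact: nbhs_right_gt|exact: nbhs_right_lt].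
  move=> [y e] /= [xy /andP[e0 ed]]; apply: (anti d); first exact: ltW.
  by apply: Hd; rewrite distrC.
move=> e /= e0 He; exists (e / 2); first by rewrite divr_gt0.
move=> x x01; apply: (He (e / 2)) => /=.
- by rewrite sub0r normrN gtr0_norm ?divr_gt0 // ltr_pdivrMr // ltr_pMr // ltr1n.
- by rewrite divr_gt0.
- by rewrite in_itv.
Unshelve. all: by end_near. Qed.

(** Continuity is two-sided also at 0 and 1. Hence [cont01_uniform] controls points slightly outside
    [0,1], as the periodic case requires. *)
Definition cont01 f := forall x : R, 0 <= x <= 1 -> {for x, continuous f}.

Lemma cont01_bounded f : cont01 f ->
  exists2 B : R, 0 < B & forall x, 0 <= x <= 1 -> nrm (f x) <= B.
Proof.
move=> cf.
(* The scale doubles as the inverse of the bound, so that a smaller scale is a weaker claim. *)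
have [] := @unit_interval_uniform (fun d x => 0 < d -> nrm (f x) <= d^-1).
- move=> d d' x dd' H d'0; have d0 := lt_le_trans d'0 dd'.
  by apply: le_trans (H d0) _; rewrite lef_pV2 ?posrE.
- move=> x x01; have /cont_nrmR/(_ 1 ltr01)[d d0 Hd] := cf x x01.
  pose B := nrm (f x) + 1; have B0 : 0 < B by rewrite ltr_wpDl ?nrm_ge0.
  exists (Num.min d B^-1); first by rewrite lt_min d0 invr_gt0.
  move=> y; rewrite lt_min => /andP[yd _] m0.
  apply: (@le_trans _ _ B); last by rewrite -[leLHS]invrK lef_pV2 ?posrE ?invr_gt0 // ge_min lexx orbT.
  by have := Hd _ yd; have := nrm_distl (f y) (f x); rewrite /B; lra.
- by move=> d d0 H; exists d^-1; rewrite ?invr_gt0 // => x /H; exact.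
Qed.

Lemma cont01_uniform f : cont01 f -> forall e : R, 0 < e -> exists2 d, 0 < d &
  forall x y, 0 <= x <= 1 -> `|y - x| < d -> nrm (f y - f x) < e.
Proof.
move=> cf e e0.
have [] := @unit_interval_uniform
  (fun d x => forall y, `|y - x| < d -> nrm (f y - f x) < e).
- by move=> d d' x dd' H y yx; apply: H; apply: lt_le_trans dd'.
- move=> x x01; have /cont_nrmR/(_ (e / 2))[|d d0 Hd] := cf x x01; first lra.
  exists (d / 2); first lra.
  move=> x' x'x y yx'.
  have E : f y - f x' = (f y - f x) + (f x - f x') by rewrite addrA subrK.
  rewrite E; apply: le_lt_trans (nrmD _ _) _; rewrite [X in _ + X]nrmB.
  have : nrm (f y - f x) < e / 2.
    apply: Hd; have -> : y - x = (y - x') + (x' - x) by rewrite addrA subrK.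
    by apply: le_lt_trans (ler_normD _ _) _; lra.
  have : nrm (f x' - f x) < e / 2 by apply: Hd; lra.
  lra.
- by move=> d d0 H; exists d => // x y x01; apply: H.
Qed.

(** Left-endpoint Riemann sums of mesh 2^-n. A sum of level n+1 is the average of the level-n sums
    over the two halves ([dsumS]), so estimates become inductions on n that rescale the function. *)
Definition dsum f n : R[i] :=
  (2 ^- n)%:C * \sum_(j < 2 ^ n) f (j%:R / 2 ^+ n).

Definition is_dmean f m := forall e : R, 0 < e ->
  exists N, forall n, (N <= n)%N -> nrm (dsum f n - m) <= e.

(* This plays the role of the integral over [0,1]; it is a junk value when the
   dyadic averages do not converge. *)
Definition dmean f : R[i] := get (is_dmean f).

Lemma dsum0 f : dsum f 0 = f 0.
Proof. by rewrite /dsum expr0 invr1 mul1r expn0 big_ord1 mul0r. Qed.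

Lemma dsumS f n : dsum f n.+1 =
  (dsum (fun x => f (x / 2)) n + dsum (fun x => f ((x + 1) / 2)) n) / 2.
Proof.
rewrite /dsum -mulrDr mulrAC [in RHS](_ : 2 = (2 : R)%:C); last by rewrite rmorph_nat.
rewrite -fmorphV -rmorphM /= -invfM -exprSr; congr (_ * _).
have E : (2 ^ n.+1 = 2 ^ n + 2 ^ n)%N by rewrite expnS mul2n addnn.
rewrite -(big_mkord xpredT (fun j => f (j%:R / 2 ^+ n.+1))) E.
rewrite (@big_cat_nat _ _ _ (2 ^ n)) //= ?leq_addr // !big_mkord; congr (_ + _).
  by apply: eq_bigr => j _; rewrite exprSr invfM mulrA.
rewrite -{1}[(2 ^ n)%N]add0n big_addn addnK big_mkord; apply: eq_bigr => j _.
congr f; rewrite natrD natrX exprSr invfM mulrA mulrDl divff //.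
by rewrite expf_eq0 pnatr_eq0 andbF.
Qed.

Lemma half01 (x : R) : 0 <= x <= 1 -> 0 <= x / 2 <= 1.
Proof. by move=> /andP[x0 x1]; apply/andP; split; lra. Qed.

Lemma half01' (x : R) : 0 <= x <= 1 -> 0 <= (x + 1) / 2 <= 1.
Proof. by move=> /andP[x0 x1]; apply/andP; split; lra. Qed.

Lemma nrm2 : nrm (2 : R[i]) = 2.
Proof. by rewrite -[2](rmorph_nat (real_complex R)) nrm_real normr_nat. Qed.

Lemma dsum_bound f n B : (forall x, 0 <= x <= 1 -> nrm (f x) <= B) ->
  nrm (dsum f n) <= B.
Proof.
elim: n f => [|n IH] f H; first by rewrite dsum0; apply: H; rewrite lexx ler01.
rewrite dsumS nrmM nrmV nrm2 ler_pdivrMr // mulr_natr mulr2n; apply: le_trans (nrmD _ _) _; apply: lerD.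
  by apply: IH => x /half01; apply: H.
by apply: IH => x /half01'; apply: H.
Qed.

Lemma dsumD f g n : dsum (fun x => f x + g x) n = dsum f n + dsum g n.
Proof. by rewrite /dsum big_split mulrDr. Qed.

Lemma dsumZ c f n : dsum (fun x => c * f x) n = c * dsum f n.
Proof. by rewrite /dsum -mulr_sumr mulrCA. Qed.

Lemma dsum_cst c n : dsum (fun=> c) n = c.
Proof.
rewrite /dsum sumr_const card_ord -[c *+ _]mulr_natl mulrA.
rewrite -(rmorph_nat (real_complex R)) -rmorphM /= natrX mulVf ?rmorph1 ?mul1r //.
by rewrite expf_eq0 pnatr_eq0 andbF.
Qed.

(** Each half, rescaled to [0,1], satisfies the hypothesis one level lower; at level 0 every sample
    is compared with [f 0]. *)
Lemma dsum_cauchy f e n k :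
  (forall x y, 0 <= x <= 1 -> 0 <= y <= 1 -> `|y - x| <= 2 ^- n -> nrm (f y - f x) <= e) ->
  nrm (dsum f (n + k) - dsum f n) <= e.
Proof.
elim: n f => [|n IH] f H.
  rewrite add0n dsum0 -[f 0](dsum_cst _ k) -mulN1r -dsumZ -dsumD.
  apply: dsum_bound => x x01; rewrite mulN1r; apply: H; rewrite ?lexx ?ler01 //.
  by rewrite expr0 invr1 subr0 ger0_norm; lra.
rewrite addSn !dsumS -mulrBl nrmM nrmV nrm2 ler_pdivrMr // mulr_natr mulr2n opprD addrACA.
have P (x y : R) : `|y - x| <= 2 ^- n -> `|(y - x) / 2| <= 2 ^- n.+1.
  by rewrite normrM (@gtr0_norm _ 2^-1) ?invr_gt0 // exprS invfM mulrC ler_pM2l ?invr_gt0.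
apply: le_trans (nrmD _ _) _; apply: lerD.
  apply: IH => x y /half01 x01 /half01 y01 /P xy; apply: H => //.
  by rewrite -mulrBl.
apply: IH => x y /half01' x01 /half01' y01 /P xy; apply: H => //.
by rewrite -mulrBl opprD addrACA subrr addr0.
Qed.

Lemma dsum_uniform f : cont01 f -> forall e : R, 0 < e ->
  exists N, forall n k, (N <= n)%N -> nrm (dsum f (n + k) - dsum f n) <= e.
Proof.
move=> /cont01_uniform cf e /cf[d d0 H].
have [N HN] : exists N, forall n, (N <= n)%N -> 2 ^- n < d.
  have [N HN] : exists N : nat, d^-1 < N%:R by exists (Num.truncn d^-1).+1; apply: truncnS_gt.
  exists N => n Nn; rewrite -[ltRHS]invrK ltf_pV2 ?posrE ?exprn_gt0 ?invr_gt0 //.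
  apply: lt_trans HN _; rewrite -natrX ltr_nat; apply: leq_ltn_trans Nn _; exact: ltn_expl.
exists N => n k Nn; apply: dsum_cauchy => x y x01 y01 xy; apply/ltW/H => //.
by apply: le_lt_trans xy _; apply: HN.
Qed.

Lemma cauchy_real (u : nat -> R) :
  (forall e, 0 < e -> exists N, forall n k, (N <= n)%N -> `|u (n + k)%N - u n| <= e) ->
  exists l, forall e, 0 < e -> exists N, forall n, (N <= n)%N -> `|u n - l| <= e.
Proof.
move=> H; have cu : cvg (u @ \oo).
  apply/cauchy_cvgP/cauchy_exP => e e0.
  have [N HN] := H (e / 2) ltac:(lra); exists (u N).
  exists N => //= n /= Nn; rewrite /ball /= distrC -(subnKC Nn).
  by apply: le_lt_trans (HN _ _ (leqnn N)) _; lra.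
exists (lim (u @ \oo)) => e e0.
have /cvgrPdist_le/(_ e e0)[N _ HN] := cu.
by exists N => n Nn; rewrite distrC; apply: HN.
Qed.

Lemma dmean_ex f : cont01 f -> exists m, is_dmean f m.
Proof.
move=> /dsum_uniform H.
have [a Ha] : exists a, forall e, 0 < e -> exists N, forall n, (N <= n)%N ->
    `|complex.Re (dsum f n) - a| <= e.
  apply: cauchy_real => e /H[N HN]; exists N => n k /HN h.
  by apply: le_trans (h k); rewrite -raddfB Re_le_nrm.
have [b Hb] : exists b, forall e, 0 < e -> exists N, forall n, (N <= n)%N ->
    `|complex.Im (dsum f n) - b| <= e.
  apply: cauchy_real => e /H[N HN]; exists N => n k /HN h.
  by apply: le_trans (h k); rewrite -raddfB Im_le_nrm.
exists (a +i* b) => e e0; have e2 : 0 < e / 2 by lra.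
have [N1 H1] := Ha _ e2; have [N2 H2] := Hb _ e2.
exists (maxn N1 N2) => n; rewrite geq_max => /andP[/H1 h1 /H2 h2].
by apply: le_trans (nrm_le_ReIm _) _; rewrite !raddfB /=; lra.
Qed.

Lemma is_dmean_unique f m m' : is_dmean f m -> is_dmean f m' -> m = m'.
Proof.
move=> H H'; apply/eqP; rewrite -subr_eq0; apply/eqP/nrm0_eq0/le_anti/andP.
split; last exact: nrm_ge0.
apply/ler_addgt0Pl => e e0; rewrite addr0; have e2 : 0 < e / 2 by lra.
have [N1 H1] := H _ e2; have [N2 H2] := H' _ e2.
have := H1 _ (leq_maxl N1 N2); have := H2 _ (leq_maxr N1 N2).
set s := dsum _ _; have -> : m - m' = (m - s) + (s - m') by rewrite addrA subrK.
by move=> h1 h2; apply: le_trans (nrmD _ _) _; rewrite [nrm (m - s)]nrmB; lra.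
Qed.

Lemma dmeanP f : cont01 f -> is_dmean f (dmean f).
Proof. by move=> /dmean_ex; apply: getPex. Qed.

Lemma dmeanE f m : is_dmean f m -> dmean f = m.
Proof. by move=> H; apply: (is_dmean_unique _ H); apply: (@getPex _ (is_dmean f)); exists m. Qed.

Lemma dmean_cst c : dmean (fun=> c) = c.
Proof.
by apply: dmeanE => e e0; exists 0%N => n _; rewrite dsum_cst subrr nrm0 ltW.
Qed.

Lemma dmeanD f g : cont01 f -> cont01 g ->
  dmean (fun x => f x + g x) = dmean f + dmean g.
Proof.
move=> /dmeanP cf /dmeanP cg; apply: dmeanE => e e0; have e2 : 0 < e / 2 by lra.
have [N1 H1] := cf _ e2; have [N2 H2] := cg _ e2.
exists (maxn N1 N2) => n; rewrite geq_max => /andP[/H1 h1 /H2 h2].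
by rewrite dsumD opprD addrACA; apply: le_trans (nrmD _ _) _; lra.
Qed.

Lemma dmeanZ c f : cont01 f -> dmean (fun x => c * f x) = c * dmean f.
Proof.
move=> /dmeanP cf; apply: dmeanE => e e0; have c0 := nrm_ge0 c.
have [N H] := cf (e / (nrm c + 1)) ltac:(by rewrite divr_gt0 // ltr_wpDl).
exists N => n /H; rewrite dsumZ -mulrBr nrmM ler_pdivlMr ?ltr_wpDl //.
by have := nrm_ge0 (dsum f n - dmean f); nra.
Qed.

Lemma cont01M f g : cont01 f -> cont01 g -> cont01 (fun x => f x * g x).
Proof. by move=> cf cg x x01; apply: cvgM; [apply: cf|apply: cg]. Qed.

Lemma cont01_cst c : cont01 (fun=> c).
Proof. by move=> x x01; apply: cvg_cst. Qed.

Lemma cont01Z c f : cont01 f -> cont01 (fun x => c * f x).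
Proof. exact: (@cont01M (fun=> c) f (@cont01_cst c)). Qed.

Lemma dmeanB f g : cont01 f -> cont01 g ->
  dmean (fun x => f x - g x) = dmean f - dmean g.
Proof.
move=> cf cg; under eq_fun do rewrite -mulN1r.
by rewrite (dmeanD cf (@cont01Z (-1) g cg)) (dmeanZ (-1) cg) mulN1r.
Qed.

Lemma dmean_bound f B : cont01 f ->
  (forall x, 0 <= x <= 1 -> nrm (f x) <= B) -> nrm (dmean f) <= B.
Proof.
move=> /dmeanP cf HB; apply/ler_addgt0Pr => e /cf[N H].
have := H N (leqnn N); have := dsum_bound N HB.
by rewrite nrmB; have := nrm_distl (dmean f) (dsum f N); lra.
Qed.

Lemma dmean_eq f g : (forall x, 0 <= x <= 1 -> f x = g x) -> dmean f = dmean g.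
Proof.
move=> fg; suff E : dsum f = dsum g by rewrite /dmean /is_dmean E.
apply/funext => n; rewrite /dsum; congr (_ * _); apply: eq_bigr => j _; apply: fg.
rewrite divr_ge0 ?exprn_ge0 //= ler_pdivrMr ?exprn_gt0 // mul1r -natrX ler_nat ltnW //.
Qed.

Lemma cont01_affine f a b : 0 <= a -> 0 <= b -> a + b <= 1 -> cont01 f ->
  cont01 (fun x => f (x * a + b)).
Proof.
move=> a0 b0 ab cf x x01.
have /(_ _) := @continuous_comp _ _ _ (fun x : R => x * a + b) f x; apply.
  by apply: cvgD; [apply: cvgM; [exact: cvg_id|exact: cvg_cst]|exact: cvg_cst].
by apply: cf; nra.
Qed.

Lemma cont01_half f : cont01 f -> cont01 (fun x => f (x / 2)).
Proof.
move=> cf; have := @cont01_affine f (2^-1) 0.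
by under eq_fun do rewrite addr0; apply => //; lra.
Qed.

Lemma cont01_half1 f : cont01 f -> cont01 (fun x => f ((x + 1) / 2)).
Proof.
move=> cf; have := @cont01_affine f (2^-1) (2^-1).
by under eq_fun do rewrite -[X in _ * _ + X]mul1r -mulrDl; apply => //; lra.
Qed.

Lemma dmean_bisect f : cont01 f ->
  dmean f = (dmean (fun x => f (x / 2)) + dmean (fun x => f ((x + 1) / 2))) / 2.
Proof.
move=> cf; apply: dmeanE => e e0.
have /dmeanP/(_ e e0)[N1 H1] := cont01_half cf.
have /dmeanP/(_ e e0)[N2 H2] := cont01_half1 cf.
exists (maxn N1 N2).+1; case=> // n; rewrite ltnS geq_max => /andP[/H1 h1 /H2 h2].
rewrite dsumS -mulrBl opprD addrACA nrmM nrmV nrm2.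
by rewrite ler_pdivrMr //; apply: le_trans (nrmD _ _) _; lra.
Qed.

Lemma cont01_id : cont01 (fun x => x%:C).
Proof. by move=> x _; apply: real_complex_continuous. Qed.

(** Bisection gives m = m/2 + 1/4 for the mean m of the identity. *)
Lemma dmean_id : dmean (fun x => x%:C) = 2^-1.
Proof.
set m := dmean _; have := dmean_bisect cont01_id; rewrite -/m.
have -> : dmean (fun x => (x / 2)%:C) = 2^-1 * m.
  rewrite -dmeanZ; last exact: cont01_id.
  by apply: dmean_eq => x _; rewrite rmorphM fmorphV /= rmorph_nat mulrC.
have -> : dmean (fun x => ((x + 1) / 2)%:C) = 2^-1 * m + 2^-1.
  have c1 := @cont01Z 2^-1 _ cont01_id.
  have c2 : cont01 (fun=> 2^-1) := @cont01_cst _.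
  rewrite -(dmeanZ _ cont01_id) -[X in _ + X](dmean_cst 2^-1) -(dmeanD c1 c2).
  by apply: dmean_eq => x _; rewrite mulrDl mul1r rmorphD rmorphM fmorphV /= rmorph_nat mulrC.
move=> H; apply: (@mulfI _ (1 - 2^-1)); last first.
  by rewrite mulrBl mul1r {1}H; field.
by apply/negP => /eqP /(congr1 (fun x => x * 2)); rewrite mulrBl mulVf ?pnatr_eq0 // mul0r => /eqP; rewrite mul1r subr_eq0 -[1]/(1%:R) eqr_nat.
Qed.

Lemma periodic_int f : (forall x, f (x + 1) = f x) -> forall (m : int) x, f (x + m%:~R) = f x.
Proof.
move=> pf; have P (n : nat) x : f (x + n%:R) = f x.
  by elim: n x => [|n IH] x; rewrite ?addr0 // -natr1 addrA pf IH.
case=> n x; first exact: P.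
by rewrite NegzE mulrNz -(P n.+1 (x - _)) pmulrn subrK.
Qed.

Lemma periodic_uniform f : continuous f -> (forall x, f (x + 1) = f x) ->
  forall e : R, 0 < e -> exists2 d, 0 < d &
  forall x y, `|y - x| < d -> nrm (f y - f x) < e.
Proof.
move=> cf pf e e0.
have [d d0 H] := cont01_uniform (fun x _ => cf x) e0; exists d => // x y xy.
rewrite -(periodic_int pf (- Num.floor x) x) -(periodic_int pf (- Num.floor x) y).
apply: H; last by rewrite opprD addrACA subrr addr0.
rewrite mulrNz; have := floor_le x; have := floorD1_gt x.
by rewrite intrD; lra.
Qed.

Lemma dsum_shift f n j : (forall x, f (x + 1) = f x) ->
  dsum (fun x => f (x + j%:R / 2 ^+ n)) n = dsum f n.
Proof.
move=> pf; rewrite /dsum; congr (_ * _); elim: j => [|j IH].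
  by apply: eq_bigr => i _; rewrite mul0r addr0.
have e2 : (2 : R) ^+ n != 0 by rewrite expf_eq0 pnatr_eq0 andbF.
rewrite -IH; case E : (2 ^ n)%N => [|N]; first by rewrite !big_ord0.
rewrite big_ord_recr big_ord_recl /= addrC; congr (_ + _).
  rewrite mul0r add0r -mulrDl -natrD addnS -addSn -E natrD natrX mulrDl divff //.
  by rewrite addrC pf.
by apply: eq_bigr => i _; rewrite -!mulrDl -!natrD /bump /= addnS add1n addSn.
Qed.

(** A dyadic shift only permutes the sample points modulo 1 ([dsum_shift]). A general [t] is reduced
    modulo 1 and truncated to a dyadic number; uniform continuity absorbs the difference. *)
Lemma dmean_shift f t : continuous f -> (forall x, f (x + 1) = f x) ->
  dmean (fun x => f (x + t)) = dmean f.
Proof.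
move=> cf pf; have cft : continuous (fun x => f (x + t)).
  move=> x; apply: (@continuous_comp _ _ _ (fun x => x + t) f) (cf _).
  by apply: cvgD; [exact: cvg_id|exact: cvg_cst].
apply/eqP; rewrite -subr_eq0; apply/eqP/nrm0_eq0/le_anti/andP.
split; last exact: nrm_ge0.
apply/ler_addgt0Pl => e e0; rewrite addr0; have e3 : 0 < e / 3 by lra.
have [d d0 Hd] := periodic_uniform cf pf e3.
have [N1 H1] := dmeanP (fun x _ => cf x) e3.
have [N2 H2] := dmeanP (fun x _ => cft x) e3.
pose N3 := (Num.truncn d^-1).+1; pose n := maxn N1 (maxn N2 N3).
have nd : 2 ^- n < d.
  rewrite -[ltRHS]invrK ltf_pV2 ?posrE ?exprn_gt0 ?invr_gt0 //.
  apply: lt_trans (truncnS_gt _) _; rewrite -/N3 -natrX ltr_nat.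
  by apply: leq_ltn_trans (ltn_expl n _) => //; rewrite !leq_max leqnn !orbT.
have n2 : (0 : R) < 2 ^+ n by rewrite exprn_gt0.
pose m := Num.floor t; pose t' := t - m%:~R.
have t'0 : 0 <= t' by rewrite subr_ge0 floor_le.
pose j := Num.truncn (t' * 2 ^+ n).
have tj : `|t' - j%:R / 2 ^+ n| < d.
  have jt : j%:R <= t' * 2 ^+ n by rewrite truncn_le mulr_ge0 // ltW.
  have tj : t' * 2 ^+ n < j.+1%:R by apply: truncnS_gt.
  have -> : t' - j%:R / 2 ^+ n = (t' * 2 ^+ n - j%:R) / 2 ^+ n.
    by rewrite mulrBl mulfK // gt_eqF.
  apply: le_lt_trans nd; rewrite ger0_norm; last by rewrite divr_ge0 ?subr_ge0 // ltW.
  rewrite ler_pdivrMr // mulVf ?gt_eqF //; rewrite -natr1 in tj; lra.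
have S1 : nrm (dsum (fun x => f (x + t)) n - dsum f n) <= e / 3.
  rewrite -(dsum_shift n j pf) -mulN1r -dsumZ -dsumD; apply: dsum_bound => x _.
  rewrite mulN1r -(periodic_int pf (- m) (x + t)); apply/ltW/Hd.
  have -> // : x + t + (- m)%:~R - (x + j%:R / 2 ^+ n) = t' - j%:R / 2 ^+ n.
  by rewrite mulrNz /t'; ring.
have S2 := H1 n (leq_maxl _ _).
have S3 : nrm (dsum (fun x => f (x + t)) n - dmean (fun x => f (x + t))) <= e / 3.
  by apply: H2; rewrite !leq_max leqnn !orbT.
set a := dmean _ in S3 *; set b := dmean _ in S2 *.
have -> : a - b = - (dsum (fun x => f (x + t)) n - a) +
    ((dsum (fun x => f (x + t)) n - dsum f n) + (dsum f n - b)) by ring.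
apply: le_trans (nrmD _ _) _; rewrite nrmN.
by have := nrmD (dsum (fun x => f (x + t)) n - dsum f n) (dsum f n - b); lra.
Qed.
End DyadicMean.

(** * Continuity of pointwise expressions *)

Section Continuity.
Variables (R : realType) (T : topologicalType) (V : normedModType R[i]).
Implicit Types (k l : T -> R[i]) (f g : T -> V) (x : T).

Lemma contC (W : topologicalType) (c : W) x : {for x, continuous (fun _ : T => c)}.
Proof. exact: cvg_cst. Qed.

Lemma contD f g x : {for x, continuous f} -> {for x, continuous g} ->
  {for x, continuous (fun y => f y + g y)}.
Proof. exact: cvgD. Qed.

Lemma contB f g x : {for x, continuous f} -> {for x, continuous g} ->
  {for x, continuous (fun y => f y - g y)}.
Proof. exact: cvgB. Qed.

Lemma contM k l x : {for x, continuous k} -> {for x, continuous l} ->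
  {for x, continuous (fun y => k y * l y)}.
Proof. exact: cvgM. Qed.

Lemma contZ k f x : {for x, continuous k} -> {for x, continuous f} ->
  {for x, continuous (fun y => k y *: f y)}.
Proof. exact: cvgZ. Qed.

Lemma contV k x : {for x, continuous k} -> k x != 0 ->
  {for x, continuous (fun y => (k y)^-1)}.
Proof. by move=> ck k0; exact: cvgV. Qed.

Lemma cont_comp (U W : topologicalType) (f : T -> U) (g : U -> W) x :
  {for x, continuous f} -> {for f x, continuous g} ->
  {for x, continuous (fun y => g (f y))}.
Proof. exact: continuous_comp. Qed.

Lemma cont_id x : {for x, continuous (fun y : T => y)}.
Proof. exact: cvg_id. Qed.

Lemma contP (U W : topologicalType) (h : T -> U) (k : T -> W) x :
  {for x, continuous h} -> {for x, continuous k} ->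
  {for x, continuous (fun y => (h y, k y))}.
Proof. by move=> ch ck; exact: cvg_pair. Qed.

Lemma contT (W : topologicalType) (f : T -> W) :
  (forall x, {for x, continuous f}) -> continuous f.
Proof. by []. Qed.

End Continuity.

(* Matching syntactically keeps unification from unfolding R[i]. *)
Ltac cont := repeat lazymatch goal with
  | |- {for ?x, continuous (fun _ => ?c)} => exact: contC
  | |- {for ?x, continuous (fun y => y)} => exact: cont_id
  | |- {for ?x, continuous (fun y => real_complex_def _ y)} => exact: real_complex_continuous
  | |- {for ?x, continuous (fun y => GRing.add (@?f y) (GRing.opp (@?g y)))} =>
      apply: (@contB _ _ _ f g x)
  | |- {for ?x, continuous (fun y => GRing.add (@?f y) (@?g y))} =>
      apply: (@contD _ _ _ f g x)
  | |- {for ?x, continuous (fun y => GRing.mul (@?f y) (@?g y))} =>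
      apply: (@contM _ _ f g x)
  | |- {for ?x, continuous (fun y => GRing.scale (@?f y) (@?g y))} =>
      apply: (@contZ _ _ _ f g x)
  | |- _ => match goal with H : ?P |- ?Q => constr_eq P Q; exact H end
  end.

(** * Goursat's theorem *)

Section Goursat.
Variable R : realType.
Implicit Types (f : R[i] -> R[i]) (p u v z : R[i]).

Lemma continuous_segment f p u (x : R) :
  {for p + x%:C * u, continuous f} -> {for x, continuous (fun x : R => f (p + x%:C * u))}.
Proof.
move=> cf; apply: (@cont_comp _ _ _ (fun x : R => p + x%:C * u) f x _ cf).
cont.
Qed.

(** The contour integral of [f] along the segment from [p] to [p + u]. The parallelogram integral
    below goes once around p, p + u, p + u + v, p + v. *)
Definition segment_integral f p u := u * dmean (fun x : R => f (p + x%:C * u)).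
Local Notation I := segment_integral.

Definition parallelogram_integral f p u v :=
  I f p u + I f (p + u) v - I f (p + v) u - I f p v.
Local Notation J := parallelogram_integral.

Definition on_segment (P : R[i] -> Prop) p u :=
  forall x : R, 0 <= x <= 1 -> P (p + x%:C * u).

Definition on_parallelogram (P : R[i] -> Prop) p u v :=
  forall x y : R, 0 <= x <= 1 -> 0 <= y <= 1 -> P (p + x%:C * u + y%:C * v).

Lemma on_segment_cont01 f p u :
  on_segment (fun z => {for z, continuous f}) p u -> cont01 (fun x => f (p + x%:C * u)).
Proof. by move=> H x /H; apply: continuous_segment. Qed.

Lemma on_parallelogram_edges (P : R[i] -> Prop) p u v : on_parallelogram P p u v ->
  [/\ on_segment P p u, on_segment P (p + u) v, on_segment P (p + v) u & on_segment P p v].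
Proof.
have z01 : 0 <= (0 : R) <= 1 by rewrite lexx ler01.
have o01 : 0 <= (1 : R) <= 1 by rewrite lexx ler01.
move=> H; split=> x x01.
- by have := H x 0 x01 z01; rewrite mul0r addr0.
- by have := H 1 x o01 x01; rewrite mul1r.
- by have := H x 1 x01 o01; rewrite mul1r addrAC.
- by have := H 0 x z01 x01; rewrite mul0r addr0.
Qed.

Lemma segment_integral_bisect f p u :
  on_segment (fun z => {for z, continuous f}) p u ->
  I f p u = I f p (u / 2) + I f (p + u / 2) (u / 2).
Proof.
move=> /on_segment_cont01 cf; rewrite /I dmean_bisect //.
rewrite mulrA -mulrDr mulrAC; congr (_ * (_ + _)).
  apply: dmean_eq => x _; congr f; congr (_ + _).
  by rewrite rmorphM fmorphV /= rmorph_nat; ring.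
apply: dmean_eq => x _; congr f; rewrite -addrA; congr (_ + _).
by rewrite rmorphM fmorphV rmorphD /= rmorph_nat; ring.
Qed.

(** The inner edges of the four quarters are traversed twice, in opposite directions. *)
Lemma parallelogram_integral_bisect f p u v :
  on_parallelogram (fun z => {for z, continuous f}) p u v ->
  J f p u v = J f p (u / 2) (v / 2) + J f (p + u / 2) (u / 2) (v / 2)
    + J f (p + v / 2) (u / 2) (v / 2) + J f (p + u / 2 + v / 2) (u / 2) (v / 2).
Proof.
move=> /on_parallelogram_edges[H1 H2 H3 H4].
rewrite {1}/J (segment_integral_bisect H1) (segment_integral_bisect H2).
rewrite (segment_integral_bisect H3) (segment_integral_bisect H4) /J.
have -> : p + u / 2 + u / 2 = p + u by rewrite -addrA -splitr.
have -> : p + u / 2 + v / 2 + u / 2 = p + u + v / 2.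
  by rewrite addrAC -[p + u / 2 + u / 2]addrA -splitr.
have -> : p + v / 2 + v / 2 = p + v by rewrite -addrA -splitr.
have -> : p + u / 2 + v / 2 + v / 2 = p + v + u / 2.
  by rewrite -[_ + v / 2 + v / 2]addrA -splitr addrAC.
have -> : p + v / 2 + u / 2 = p + u / 2 + v / 2 by rewrite addrAC.
ring.
Qed.

Lemma segment_integral_affine a b p u :
  I (fun z => a + b * z) p u = u * (a + b * p + b * u / 2).
Proof.
rewrite /I; congr (_ * _).
have c1 : cont01 (fun x : R => x%:C) := @cont01_id R.
have c2 := @cont01Z _ (b * u) _ c1.
have c3 : cont01 (fun=> a + b * p) := @cont01_cst _ _.
rewrite -(dmean_id R) -(dmeanZ (b * u) c1) -[X in X + _](dmean_cst (a + b * p)) -(dmeanD c3 c2).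
by apply: dmean_eq => x _; ring.
Qed.

Lemma segment_integralD f g p u :
  on_segment (fun z => {for z, continuous f}) p u ->
  on_segment (fun z => {for z, continuous g}) p u ->
  I (fun z => f z + g z) p u = I f p u + I g p u.
Proof.
move=> /on_segment_cont01 cf /on_segment_cont01 cg.
by rewrite /I -mulrDr; congr (_ * _); exact: dmeanD.
Qed.

Lemma segment_integral_bound f p u B :
  on_segment (fun z => {for z, continuous f}) p u ->
  on_segment (fun z => nrm (f z) <= B) p u -> nrm (I f p u) <= nrm u * B.
Proof.
move=> /on_segment_cont01 cf HB; rewrite /I nrmM ler_wpM2l ?nrm_ge0 //.
exact: dmean_bound cf HB.
Qed.

(** The affine function a + b z has boundary integral zero, so only the deviation [g] counts, along
    a perimeter of length 2(|u| + |v|). *)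
Lemma parallelogram_integral_bound f a b p u v B :
  on_parallelogram (fun z => {for z, continuous f}) p u v ->
  on_parallelogram (fun z => nrm (f z - (a + b * z)) <= B) p u v ->
  nrm (J f p u v) <= 2 * (nrm u + nrm v) * B.
Proof.
move=> cf HB; pose aff z := a + b * z; pose g z := f z - aff z.
have caff : continuous aff.
  by apply: contT => z; rewrite /aff; cont.
have cg z : {for z, continuous f} -> {for z, continuous g}.
  by move=> c; exact: (contB c (caff z)).
have E : f = fun z => aff z + g z by apply/funext => z; rewrite /g addrC subrK.
have EI q w : on_segment (fun z => {for z, continuous f}) q w ->
    I f q w = w * (a + b * q + b * w / 2) + I g q w.
  move=> c; rewrite {1}E segment_integralD; first by rewrite segment_integral_affine.
    by move=> x _; exact: caff.
  by move=> x /c; exact: cg.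
have BI q w : on_segment (fun z => {for z, continuous f}) q w ->
   on_segment (fun z => nrm (f z - (a + b * z)) <= B) q w -> nrm (I g q w) <= nrm w * B.
  move=> c bd; apply: segment_integral_bound; last exact: bd.
  by move=> x /c; exact: cg.
have [c1 c2 c3 c4] := on_parallelogram_edges cf.
have [b1 b2 b3 b4] := on_parallelogram_edges HB.
have -> : J f p u v = (I g p u + I g (p + u) v) - (I g (p + v) u + I g p v).
  by rewrite /J !EI //; field.
apply: le_trans (nrmD _ _) _; rewrite nrmN.
have := nrmD (I g p u) (I g (p + u) v); have := nrmD (I g (p + v) u) (I g p v).
have := BI _ _ c1 b1; have := BI _ _ c2 b2; have := BI _ _ c3 b3; have := BI _ _ c4 b4.
lra.
Qed.

Lemma parallelogram_integral_quarter f p u v :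
  on_parallelogram (fun z => {for z, continuous f}) p u v ->
  exists2 ab : bool * bool, true & nrm (J f p u v) <=
    4 * nrm (J f (p + (ab.1%:R / 2) * u + (ab.2%:R / 2) * v) (u / 2) (v / 2)).
Proof.
move=> /parallelogram_integral_bisect E.
have H : nrm (J f p u v) <= nrm (J f p (u / 2) (v / 2)) + nrm (J f (p + u / 2) (u / 2) (v / 2))
    + nrm (J f (p + v / 2) (u / 2) (v / 2)) + nrm (J f (p + u / 2 + v / 2) (u / 2) (v / 2)).
  rewrite E; do 3![apply: le_trans (nrmD _ _) _; rewrite lerD2r].
  exact: lexx.
apply: contrapT => N.
have {}N (a b : bool) : 4 * nrm (J f (p + (a%:R / 2) * u + (b%:R / 2) * v) (u / 2) (v / 2)) < nrm (J f p u v).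
  by rewrite ltNge; apply/negP => le; apply: N; exists (a, b).
have := N false false; have := N false true; have := N true false; have := N true true.
rewrite !mul0r !addr0 !div1r ![2^-1 * _]mulrC; lra.
Qed.

(** Goursat's quartering. The n-th parallelogram is recorded by its corner [s n] in the coordinates
    along [u] and [v], and the corners converge to those of a point q. With K = |u| + |v|, the
    affine approximation at q errs by at most e (2 K 2^-n) on a boundary of length 2 K 2^-n; the
    product cancels the factor 4^n lost by always choosing the worst quarter. *)
Lemma goursat f p u v :
  on_parallelogram (fun z => differentiable f z) p u v -> J f p u v = 0.
Proof.
move=> df.
have cf : on_parallelogram (fun z => {for z, continuous f}) p u v.
  by move=> x y x01 y01; apply/differentiable_continuous/df.
have h2 (n : nat) : (0 : R) < 2 ^- n by rewrite invr_gt0 exprn_gt0.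
have h2S n : 2 ^- n.+1 = (2 ^- n / 2 : R) by rewrite exprSr invfM.
pose P (n : nat) (s : R * R) := [/\ 0 <= s.1, s.1 + 2 ^- n <= 1, 0 <= s.2 & s.2 + 2 ^- n <= 1].
pose Jn (n : nat) (s : R * R) := J f (p + s.1%:C * u + s.2%:C * v) ((2 ^- n)%:C * u) ((2 ^- n)%:C * v).
have onP (Q : R[i] -> Prop) n s : P n s -> on_parallelogram Q p u v ->
    on_parallelogram Q (p + s.1%:C * u + s.2%:C * v) ((2 ^- n)%:C * u) ((2 ^- n)%:C * v).
  move=> [s10 s11 s20 s21] H x y /andP[x0 x1] /andP[y0 y1]; have h := h2 n.
  have := H (s.1 + x * 2 ^- n) (s.2 + y * 2 ^- n).
  have -> : p + (s.1 + x * 2 ^- n)%:C * u + (s.2 + y * 2 ^- n)%:C * v =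
     p + s.1%:C * u + s.2%:C * v + x%:C * ((2 ^- n)%:C * u) + y%:C * ((2 ^- n)%:C * v).
    by rewrite !rmorphD !rmorphM /=; ring.
  by apply; apply/andP; split; nra.
have step (ns : nat * (R * R)) : exists s', P ns.1 ns.2 ->
    [/\ P ns.1.+1 s', nrm (Jn ns.1 ns.2) <= 4 * nrm (Jn ns.1.+1 s'),
     `|s'.1 - ns.2.1| <= 2 ^- ns.1.+1 & `|s'.2 - ns.2.2| <= 2 ^- ns.1.+1].
  case: ns => n s /=; case: (pselect (P n s)) => [Ps|nPs]; last by exists s.
  have [[a b] _ H] := parallelogram_integral_quarter (onP _ _ _ Ps cf).
  exists (s.1 + a%:R * 2 ^- n.+1, s.2 + b%:R * 2 ^- n.+1) => _ /=.
  have h := h2 n; have [s10 s11 s20 s21] := Ps.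
  split.
  - by rewrite /P /= h2S; case: (a); case: (b); rewrite ?mul1r ?mul0r; split; lra.
  - apply: le_trans H _; rewrite ler_pM2l //= /Jn /=.
    set q2 := (p + _ + _ + _ + _).
    have -> : p + (s.1 + a%:R * 2 ^- n.+1)%:C * u + (s.2 + b%:R * 2 ^- n.+1)%:C * v = q2.
      rewrite /q2 h2S !rmorphD !rmorphM !fmorphV /= !rmorph_nat.
      by case: (a); case: (b); rewrite /= ?rmorph0 ?rmorph1; ring.
    have E w : (2 ^- n.+1)%:C * w = (2 ^- n)%:C * w / 2 :> R[i].
      by rewrite h2S rmorphM !fmorphV /= rmorph_nat; ring.
    by rewrite !E.
  - by rewrite addrC addKr normrM normr_nat (gtr0_norm (h2 _)) ler_piMl // ?lern1 ?leq_b1 // ltW.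
  - by rewrite addrC addKr normrM normr_nat (gtr0_norm (h2 _)) ler_piMl // ?lern1 ?leq_b1 // ltW.
have [g Hg] := choice step.
pose s := fix s n := if n is m.+1 then g (m, s m) else (0, 0) : R * R.
have Ps n : P n (s n).
  elim: n => [|n IH]; first by rewrite /P /= expr0 invr1 add0r lexx.
  by have [] := Hg (n, s n) IH.
have JnS n : nrm (J f p u v) <= 4 ^+ n * nrm (Jn n (s n)).
  elim: n => [|n IH].
    by rewrite expr0 mul1r /Jn /= expr0 invr1 !mul1r !mul0r !addr0.
  apply: le_trans IH _; rewrite exprSr -mulrA ler_wpM2l ?exprn_ge0 //.
  by have [] := Hg (n, s n) (Ps n).
have cau (w : R * R -> R) : (forall n, `|w (s n.+1) - w (s n)| <= 2 ^- n.+1) ->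
    forall n k, `|w (s (n + k)%N) - w (s n)| <= 2 ^- n - 2 ^- (n + k).
  move=> H n; elim=> [|k IH]; first by rewrite addn0 !subrr normr0.
  have := H (n + k)%N; rewrite addnS; have := h2S (n + k)%N => -> H'.
  have -> : w (s (n + k).+1) - w (s n) = (w (s (n + k).+1) - w (s (n + k)%N)) + (w (s (n + k)%N) - w (s n)) by ring.
  by apply: le_trans (ler_normD _ _) _; lra.
have small (e : R) : 0 < e -> exists n : nat, 2 ^- n < e.
  move=> e0; pose N := (Num.truncn e^-1).+1; exists N.
  rewrite -[ltRHS]invrK ltf_pV2 ?posrE ?exprn_gt0 ?invr_gt0 //.
  by apply: lt_trans (truncnS_gt _) _; rewrite -natrX ltr_nat ltn_expl.
have lim_ex (w : R * R -> R) : (forall n, `|w (s n.+1) - w (s n)| <= 2 ^- n.+1) ->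
    (forall n, 0 <= w (s n) <= 1) ->
    exists l, 0 <= l <= 1 /\ forall n, `|w (s n) - l| <= 2 ^- n.
  move=> /cau H b01; have [|l Hl] := @cauchy_real R (fun n => w (s n)).
    move=> e /small[N HN]; exists N => n k Nn.
    apply: le_trans (H n k) _; apply: ltW; apply: le_lt_trans HN.
    apply: le_trans (_ : 2 ^- n <= _); first by rewrite gerBl ltW.
    by rewrite lef_pV2 ?posrE ?exprn_gt0 // ler_weXn2l // ler1n.
  exists l; split.
    apply/andP; split; apply/ler_addgt0Pr => e /Hl[N /(_ N (leqnn N))];
      by have /andP := b01 N; rewrite ler_norml => -[? ?] /andP[]; lra.
  move=> n; apply/ler_addgt0Pr => e /Hl[N HN].
  have := HN _ (leq_addl n N); have := H n N; have := h2 (n + N)%N.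
  rewrite [ `|_ - w (s n)|]distrC => ? ? ?.
  have -> : w (s n) - l = (w (s n) - w (s (n + N)%N)) + (w (s (n + N)%N) - l) by ring.
  by apply: le_trans (ler_normD _ _) _; lra.
have [a [a01 Ha]] : exists l, 0 <= l <= 1 /\ forall n, `|(s n).1 - l| <= 2 ^- n.
  apply: (lim_ex fst) => n; first by have [] := Hg (n, s n) (Ps n).
  by have [? ? _ _] := Ps n; have h := h2 n; apply/andP; split; lra.
have [b [b01 Hb]] : exists l, 0 <= l <= 1 /\ forall n, `|(s n).2 - l| <= 2 ^- n.
  apply: (lim_ex snd) => n; first by have [] := Hg (n, s n) (Ps n).
  by have [_ _ ? ?] := Ps n; have h := h2 n; apply/andP; split; lra.
pose q := p + a%:C * u + b%:C * v; pose K := nrm u + nrm v.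
have K0 : 0 <= K by rewrite addr_ge0 ?nrm_ge0.
apply: nrm0_eq0; apply/le_anti; rewrite nrm_ge0 andbT.
suff H (e : R) : 0 < e -> nrm (J f p u v) <= 4 * K ^+ 2 * e.
  apply/ler_addgt0Pl => e e0; rewrite addr0.
  have K1 : 0 < 4 * K ^+ 2 + 1 by rewrite ltr_wpDl ?mulr_ge0 ?sqr_ge0.
  apply: le_trans (H (e / (4 * K ^+ 2 + 1)) _) _; first by rewrite divr_gt0.
  by rewrite mulrA ler_pdivrMr // mulrDr mulr1 [e * _]mulrC lerDl ltW.
move=> e0; have [d d0 Hd] := diff_eps (df a b a01 b01) e0.
have [n Hn] := small (d / (2 * K + 1)) ltac:(by rewrite divr_gt0 // ltr_wpDl // mulr_ge0).
have h := h2 n.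
have := @parallelogram_integral_bound f (f q - 'd f q (1 : R[i]) * q) ('d f q (1 : R[i])) _ _ _ (e * (2 * 2 ^- n * K)) (onP _ _ _ (Ps n) cf).
move=> /(_ _) bd; apply: le_trans (JnS n) _.
rewrite mulrC -ler_pdivlMr ?exprn_gt0 //.
have -> : 4 * K ^+ 2 * e / 4 ^+ n = 2 * (2 ^- n * K) * (e * (2 * 2 ^- n * K)).
  have -> : (4 : R) ^+ n = 2 ^+ n * 2 ^+ n by rewrite -exprMn -natrM.
  by rewrite invfM; ring.
have -> : 2 ^- n * K = nrm ((2 ^- n)%:C * u) + nrm ((2 ^- n)%:C * v).
  by rewrite !nrmM nrm_real (gtr0_norm h) -mulrDr.
apply: bd => x y /andP[x0 x1] /andP[y0 y1].
set z := (X in f X).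
have zq : nrm (z - q) <= 2 * 2 ^- n * K.
  have -> : z - q = ((s n).1 - a + x * 2 ^- n)%:C * u + ((s n).2 - b + y * 2 ^- n)%:C * v.
    by rewrite /z /q !rmorphD !rmorphN !rmorphM /=; ring.
  apply: le_trans (nrmD _ _) _; rewrite !nrmM !nrm_real mulrDr.
  have T (c t : R) : `|c| <= 2 ^- n -> 0 <= t -> t <= 1 -> `|c + t * 2 ^- n| <= 2 * 2 ^- n.
    move=> hc t0 t1; apply: le_trans (ler_normD _ _) _.
    rewrite (@ger0_norm _ (t * _)); last by rewrite mulr_ge0 // ltW.
    have : t * 2 ^- n <= 2 ^- n by rewrite ler_piMl // ltW.
    lra.
  by apply: lerD; rewrite ler_wpM2r ?nrm_ge0 //; apply: T.
have zd : nrm (z - q) < d.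
  apply: le_lt_trans zq _; move: Hn; rewrite ltr_pdivlMr ?ltr_wpDl ?mulr_ge0 //; nra.
have := Hd (z - q) zd.
have -> : 'd f q (z - q) = 'd f q (1 : R[i]) * (z - q).
  by rewrite -{1}[z - q]mulr1 -[(z - q) * 1]/((z - q) *: (1 : R[i])) linearZ /= mulrC.
have -> : q + (z - q) = z by rewrite addrC subrK.
move=> H; apply: le_trans (ler_wpM2l (ltW e0) zq); apply: le_trans H.
by have -> : f z - (f q - 'd f q (1 : R[i]) * q + 'd f q (1 : R[i]) * z) =
  f z - f q - 'd f q (1 : R[i]) * (z - q) by ring.
Qed.

(** The tube lemma for the compact factor [0,1]: joint continuity at every (p, x) becomes uniform in
    x. *)
Lemma joint_uniform (V : normedModType R[i]) (K : V -> R -> R[i]) (p : V) :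
  (forall x, 0 <= x <= 1 -> {for (p, x), continuous (fun w : V * R => K w.1 w.2)}) ->
  forall e : R, 0 < e -> exists2 d : R, 0 < d &
    forall q, nrm (q - p) < d -> forall x, 0 <= x <= 1 -> nrm (K q x - K p x) < e.
Proof.
move=> cK e e0.
have [] := @unit_interval_uniform R
  (fun d x => forall q, nrm (q - p) < d -> nrm (K q x - K p x) < e).
- by move=> d d' x dd' H q qp; apply: H; apply: lt_le_trans dd'.
- move=> x x01; have /cvg_nrm/(_ (e / 2)) := cK x x01.
  rewrite divr_gt0 // => /(_ isT) [[A B] /= [/nbhs_nrm[d1 d10 H1] /nbhs_normP[d2 /= d20 H2]] AB].
  exists (Num.min d1 d2); first by rewrite lt_min d10.
  move=> x'; rewrite lt_min => /andP[_ xx'] q; rewrite lt_min => /andP[qp _].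
  have Bx' : B x' by apply: H2; rewrite /ball_ /= distrC.
  have G1 : nrm (K q x' - K p x) < e / 2 by apply: (AB (q, x')); split => //; apply: H1.
  have G2 : nrm (K p x' - K p x) < e / 2.
    by apply: (AB (p, x')); split => //; apply: H1; rewrite subrr nrm0.
  have -> : K q x' - K p x' = (K q x' - K p x) - (K p x' - K p x) by ring.
  by apply: le_lt_trans (nrmD _ _) _; rewrite nrmN; lra.
- by move=> d d0 H; exists d => // q qp x /H; exact.
Qed.

Lemma joint_cont01 (V : normedModType R[i]) (K : V -> R -> R[i]) (p : V) :
  (forall x, 0 <= x <= 1 -> {for (p, x), continuous (fun w : V * R => K w.1 w.2)}) ->
  cont01 (K p).
Proof.
move=> cK x /cK cp; apply: (@cont_comp R (V * R)%type _ (fun x => (p, x)) _ x _ cp).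
apply: contP; [exact: contC|exact: cont_id].
Qed.

Lemma complexDi (x y : R) : x +i* y = x%:C + 'i * y%:C.
Proof. by rewrite {1}[x +i* y]complexRIE. Qed.

Definition hmean f (y : R) := dmean (fun x : R => f (x +i* y)).

(** Goursat on the rectangle with sides 1 and i(y2 - y1); the two vertical sides cancel by
    periodicity. *)
Lemma hmean_indep f (y1 y2 : R) : y1 <= y2 ->
  (forall z, y1 <= complex.Im z <= y2 -> differentiable f z) ->
  (forall z, y1 <= complex.Im z <= y2 -> f (z + 1) = f z) ->
  hmean f y1 = hmean f y2.
Proof.
move=> y12 df pf; pose h := y2 - y1.
have h0 : 0 <= h by rewrite subr_ge0.
have E (a b : R) : 'i * y1%:C + a%:C * 1 + b%:C * ('i * h%:C) = a +i* (y1 + b * h).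
  clearbody h; rewrite (complexRIE (a +i* _)) [complex.Re _]/= [complex.Im _]/=.
  by move: ('i : R[i]) => I; rewrite !rmorphD !rmorphM; ring.
have on b : 0 <= b <= 1 -> y1 <= y1 + b * h <= y2.
  by move=> /andP[b0 b1]; apply/andP; split; [rewrite lerDl mulr_ge0|rewrite /h in h0 *; nra].
have /goursat : on_parallelogram (fun z => differentiable f z) ('i * y1%:C) 1 ('i * h%:C).
  by move=> a b _ b01; rewrite E; apply: df; exact: on.
rewrite /parallelogram_integral /segment_integral !mul1r.
have -> : dmean (fun x : R => f ('i * y1%:C + 1 + x%:C * ('i * h%:C))) =
    dmean (fun x : R => f ('i * y1%:C + x%:C * ('i * h%:C))).
  apply: dmean_eq => b b01; rewrite addrAC; apply: pf.
  by have := E 0 b; rewrite mul0r addr0 => ->; exact: on.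
rewrite addrAC addrK => /eqP; rewrite subr_eq0 => /eqP.
have -> : dmean (fun x : R => f ('i * y1%:C + x%:C * 1)) = hmean f y1.
  by apply: dmean_eq => a _; have := E a 0; rewrite !mul0r !addr0 => ->.
move=> ->; apply: dmean_eq => a _; have := E a 1; rewrite !mul1r addrAC => ->.
by congr (f (_ +i* _)); rewrite /h addrC subrK.
Qed.

Lemma continuous_hline f (y x : R) :
  {for x +i* y, continuous f} -> {for x, continuous (fun x : R => f (x +i* y))}.
Proof.
have -> : (fun x : R => f (x +i* y)) = fun x => f ('i * y%:C + x%:C * 1).
  by apply/funext => a; rewrite complexDi mulr1 addrC.
by move=> cf; apply: continuous_segment; rewrite mulr1 addrC -complexDi.
Qed.

Lemma hmean_continuous f (y : R) :
  (forall x : R, {for x +i* y, continuous f}) ->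
  forall e : R, 0 < e -> exists2 d : R, 0 < d & forall y', `|y' - y| < d ->
    cont01 (fun x => f (x +i* y')) -> nrm (hmean f y' - hmean f y) <= e.
Proof.
move=> cf e e0.
have [] := @joint_uniform R[i] (fun q x => f (x%:C + 'i * q)) y%:C _ e e0.
  move=> x x01; apply: (@cont_comp _ _ _ (fun w : R[i] * R => w.2%:C + 'i * w.1) f).
    apply: contD.
      apply: (@cont_comp _ _ _ snd (fun x : R => x%:C)); first exact: cvg_snd.
      exact: real_complex_continuous.
    apply: contM; first exact: contC.
    exact: cvg_fst.
  by rewrite /= -complexDi; exact: cf.
move=> d d0 H; exists d => // y' yy' cf'.
have cfy : cont01 (fun x => f (x +i* y)) by move=> x _; exact: continuous_hline.
rewrite /hmean -(dmeanB cf' cfy); apply: dmean_bound.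
  move=> x x01; exact: contB (cf' x x01) (cfy x x01).
move=> x x01; rewrite !complexDi; apply/ltW/H => //.
by rewrite -rmorphB /= nrm_real.
Qed.

(** Serves quotients with a singularity at height [y0] that is removed only as far as continuity.
    The mean is constant above and below [y0], and continuity of the mean at [y0] glues the two
    values. *)
Lemma hmean_indep_cont f (y0 y1 y2 : R) : y1 <= y0 <= y2 ->
  (forall z, y1 <= complex.Im z <= y2 -> {for z, continuous f}) ->
  (forall z, y1 <= complex.Im z <= y2 -> complex.Im z != y0 -> differentiable f z) ->
  (forall z, y1 <= complex.Im z <= y2 -> f (z + 1) = f z) ->
  hmean f y1 = hmean f y2.
Proof.
move=> /andP[y10 y02] cf df pf.
have near0 y : y1 <= y <= y2 -> (forall y', Num.min y y0 <= y' <= Num.max y y0 -> y' != y0 ->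
    hmean f y' = hmean f y) -> y != y0 -> hmean f y = hmean f y0.
  move=> yy H yn.
  have in12 y' : Num.min y y0 <= y' <= Num.max y y0 -> y1 <= y' <= y2.
    rewrite ge_min le_max => /andP[/orP[] ? /orP[] ?]; apply/andP; lra.
  apply/eqP; rewrite -subr_eq0; apply/eqP/nrm0_eq0/le_anti; rewrite nrm_ge0 andbT.
  apply/ler_addgt0Pl => e e0; rewrite addr0.
  have [|d d0 Hd] := @hmean_continuous f y0 _ e e0.
    by move=> x; apply: cf => /=; apply/andP; lra.
  pose t := Num.min (d / 2) `|y - y0|.
  have t0 : 0 < t by rewrite lt_min normr_gt0 subr_eq0 yn divr_gt0.
  pose y' := if y0 < y then y0 + t else y0 - t.
  have ty : t <= `|y - y0| by rewrite ge_min lexx orbT.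
  have td : t < d by apply: le_lt_trans (_ : d / 2 < d); [rewrite ge_min lexx|lra].
  have y'n : y' != y0 by rewrite /y'; case: ifP => _; apply/eqP; lra.
  have y'd : `|y' - y0| < d.
    by rewrite /y'; case: ifP => _; rewrite addrC addKr ?normrN gtr0_norm.
  have y'in : Num.min y y0 <= y' <= Num.max y y0.
    rewrite /y'; move: ty; case: ltP => yy0.
      by rewrite gtr0_norm ?subr_gt0 // => ?; apply/andP; split; lra.
    by rewrite ler0_norm ?subr_le0 // => ?; apply/andP; split; lra.
  rewrite -(H y' y'in y'n); apply: Hd => // x x01; apply: continuous_hline.
  by apply: cf => /=; exact: in12.
have up y : y0 < y <= y2 -> hmean f y = hmean f y0.
  move=> /andP[a b]; apply: near0; [by apply/andP; lra| |by rewrite gt_eqF].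
  move=> y'; rewrite (min_r (ltW a)) (max_l (ltW a)) => /andP[c d] n; apply: hmean_indep => //.
    move=> z /andP[z1 z2]; apply: df; first by apply/andP; lra.
    by rewrite gt_eqF //; apply: lt_le_trans z1; rewrite lt_neqAle eq_sym n.
  by move=> z /andP[z1 z2]; apply: pf; apply/andP; lra.
have dn y : y1 <= y < y0 -> hmean f y = hmean f y0.
  move=> /andP[a b]; apply: near0; [by apply/andP; lra| |by rewrite lt_eqF].
  move=> y'; rewrite (min_l (ltW b)) (max_r (ltW b)) => /andP[c d] n; symmetry; apply: hmean_indep => //.
    move=> z /andP[z1 z2]; apply: df; first by apply/andP; lra.
    by rewrite lt_eqF //; apply: le_lt_trans z2 _; rewrite lt_neqAle n.
  by move=> z /andP[z1 z2]; apply: pf; apply/andP; lra.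
have -> : hmean f y1 = hmean f y0.
  by have [->|?] := eqVneq y1 y0 => //; apply: dn; rewrite lexx lt_neqAle y10 andbT.
symmetry; have [->|?] := eqVneq y2 y0 => //; apply: up.
by rewrite lexx andbT lt_neqAle eq_sym y02 andbT.
Qed.

End Goursat.

(** * The complex exponential and the character e(z) = exp(2 pi i z) *)

Section ComplexExponential.
Variable R : realType.
Implicit Types (w z : R[i]).

Lemma is_derive_eps (f : R -> R) (x a : R) : is_derive x 1 f a ->
  forall e : R, 0 < e -> exists2 d, 0 < d &
    forall h, `|h| < d -> `|f (x + h) - f x - a * h| <= e * `|h|.
Proof.
move=> df e e0; have [df1 dfE] := df.
have /cvgrPdist_le/(_ e e0) := df1; rewrite -[lim _]/('D_1 f x) dfE.
move=> /nbhs_normP[d /= d0 H]; exists d => // h hd.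
have [->|h0] := eqVneq h 0; first by rewrite addr0 mulr0 subr0 subrr normr0 mulr0.
have := H h; rewrite /ball_ /= sub0r normrN => /(_ hd h0).
rewrite -[h *: 1]/(h * 1) mulr1 [h + x]addrC -[h^-1 *: _]/(h^-1 * _) => H'.
have -> : f (x + h) - f x - a * h = - (a - h^-1 * (f (x + h) - f x)) * h by field.
by rewrite normrM normrN ler_wpM2r.
Qed.

Lemma cexpD w w' : cexp (w + w') = cexp w * cexp w'.
Proof.
rewrite /cexp !raddfD /= expRD cosD sinD rmorphM /= mulrACA; congr (_ * _).
by apply/eqP; rewrite eq_complex /=; apply/andP; split; apply/eqP; ring.
Qed.

Lemma cexp0 : cexp (0 : R[i]) = 1.
Proof. by rewrite /cexp /= expR0 cos0 sin0 mul1r. Qed.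

Lemma nrm_cexp w : nrm (cexp w) = expR (complex.Re w).
Proof.
rewrite /cexp nrmM nrm_real gtr0_norm ?expR_gt0 // /nrm normc_def /=.
by rewrite cos2Dsin2 sqrtr1 mulr1.
Qed.

Lemma cexp_diff0 (e : R) : 0 < e -> exists2 d, 0 < d &
  forall h : R[i], nrm h < d -> nrm (cexp h - 1 - h) <= e * nrm h.
Proof.
(* The real part contributes 3 and the imaginary part 5 errors of size t |h|, hence the 8. *)
move=> e0; pose t := Num.min (e / 8) 1.
have t0 : 0 < t by rewrite lt_min divr_gt0 //= ltr01.
have te : t <= e / 8 by rewrite ge_min lexx.
have t1 : t <= 1 by rewrite ge_min lexx orbT.
clearbody t.
have [d1 d10 H1] := is_derive_eps (is_derive_expR (0 : R)) t0.
have [d2 d20 H2] := is_derive_eps (is_derive_cos (0 : R)) t0.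
have [d3 d30 H3] := is_derive_eps (is_derive_sin (0 : R)) t0.
exists (Num.min (Num.min d1 d2) (Num.min d3 t)); first by rewrite !lt_min d10 d20 d30 t0.
case=> x y h; have xh := Re_le_nrm (x +i* y); have yh := Im_le_nrm (x +i* y).
have h0 := nrm_ge0 (x +i* y).
move: xh yh h0 h => /=; set N := nrm _ => xh yh h0.
rewrite !lt_min => /andP[/andP[hd1 hd2] /andP[hd3 ht]].
have := H1 x (le_lt_trans xh hd1); have := H2 y (le_lt_trans yh hd2).
have := H3 y (le_lt_trans yh hd3).
rewrite !add0r expR0 cos0 sin0 oppr0 mul0r !mul1r !subr0 ?addr0 => h3 h2 h1.
have -> : cexp (x +i* y) - 1 - (x +i* y) =
   (expR x * cos y - 1 - x) +i* (expR x * sin y - y).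
  by apply/eqP; rewrite /cexp eq_complex /=; apply/andP; split; apply/eqP; ring.
apply: le_trans (nrm_le_ReIm _) _ => /=.
have c1 : `|cos y| <= 1 by exact: cos_max.
set E := expR x - 1 - x in h1; set Co := cos y in h2 c1 *; set Si := sin y in h3 *.
have -> : expR x * Co - 1 - x = E * Co + (1 + x) * (Co - 1) by rewrite /E; ring.
have -> : expR x * Si - y = (E + x) * (Si - y + y) + (Si - y) by rewrite /E; ring.
have n1 := ler_normD (E * Co) ((1 + x) * (Co - 1)).
have n2 := ler_normD ((E + x) * (Si - y + y)) (Si - y).
have n3 := ler_normD E x; have n4 := ler_normD (Si - y) y.
have n5 := ler_normD 1 x.
rewrite !normrM normr1 in n1 n2 n5.
have a1 := normr_ge0 x; have a2 := normr_ge0 y; have a3 := normr_ge0 E.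
have a4 := normr_ge0 (Co - 1); have a5 := normr_ge0 (E + x).
have a6 := normr_ge0 (Si - y + y); have a7 := normr_ge0 Co.
have tx (s : R) : s <= N -> t * s <= t * N by move=> sN; rewrite ler_wpM2l // ltW.
have tN : t * N <= N by rewrite ler_piMl.
have e1 : `|E| <= t * N by apply: le_trans h1 (tx _ xh).
have e2 : `|Co - 1| <= t * N by apply: le_trans h2 (tx _ yh).
have p6 : `|Si - y| <= t * N by apply: le_trans h3 (tx _ yh).
have p1 : `|E| * `|Co| <= t * N by apply: le_trans e1; apply: ler_piMr.
have x2 : `|1 + x| <= 2 by lra.
have p2 : `|1 + x| * `|Co - 1| <= 2 * (t * N) by apply: ler_pM.
have p3 : `|E + x| <= 2 * N by lra.
have p4 : `|Si - y + y| <= 2 * N by lra.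
have p5 : `|E + x| * `|Si - y + y| <= 4 * (t * N).
  apply: (@le_trans _ _ ((2 * N) * (2 * N))); first by apply: ler_pM.
  have -> : 2 * N * (2 * N) = 4 * (N * N) by ring.
  by rewrite ler_pM2l // ler_wpM2r // ltW.
have p7 : t * N <= e / 8 * N by rewrite ler_wpM2r.
lra.
Qed.

Definition epi z := cexp ((0 +i* (2 * pi)) * z).
Local Notation tpi := (0 +i* (2 * pi) : R[i]).

Lemma nrm_tpi : nrm tpi = 2 * pi.
Proof.
rewrite /nrm normc_def /= expr0n add0r sqrtr_sqr ger0_norm // mulr_ge0 //.
exact: pi_ge0.
Qed.

Lemma tpi_neq0 : tpi != 0.
Proof. by rewrite -nrm_gt0 nrm_tpi mulr_gt0 // pi_gt0. Qed.

Lemma epiD z w : epi (z + w) = epi z * epi w.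
Proof. by rewrite /epi mulrDr cexpD. Qed.

Lemma epi0 : epi 0 = 1.
Proof. by rewrite /epi mulr0 cexp0. Qed.

Lemma nrm_epi z : nrm (epi z) = expR (- (2 * pi * complex.Im z)).
Proof. by rewrite /epi nrm_cexp; case: z => a b /=; rewrite mul0r sub0r. Qed.

Lemma epi_neq0 z : epi z != 0.
Proof. by rewrite -nrm_gt0 nrm_epi expR_gt0. Qed.

Lemma epiN z : epi (- z) = (epi z)^-1.
Proof. by apply: (mulfI (epi_neq0 z)); rewrite -epiD subrr epi0 divff ?epi_neq0. Qed.

Lemma epi_real (x : R) : epi x%:C = cos (2 * pi * x) +i* sin (2 * pi * x).
Proof.
by rewrite /epi /cexp /= !mul0r mulr0 subr0 expR0 mul1r add0r.
Qed.

Lemma epi1 : epi 1 = 1.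
Proof.
rewrite -[X in epi X](rmorph1 (real_complex R)) epi_real mulr1.
by rewrite mulr_natl cos2pi sin2pi.
Qed.

Lemma epi_half : epi (2^-1)%:C = -1.
Proof.
rewrite epi_real mulrAC divff ?pnatr_eq0 // mul1r cospi sinpi.
by apply/eqP; rewrite eq_complex /= oppr0 !eqxx.
Qed.

Lemma epi_nat z n : epi (n%:R * z) = epi z ^+ n.
Proof.
elim: n => [|n IH]; first by rewrite mul0r epi0.
by rewrite -natr1 mulrDl mul1r epiD IH exprSr.
Qed.

Lemma epi_int (k : int) : epi k%:~R = 1.
Proof.
have P n : epi n%:R = 1 by rewrite -[n%:R]mulr1 epi_nat epi1 expr1n.
by case: k => n; rewrite ?NegzE ?mulrNz ?epiN P // invr1.
Qed.

Lemma epiDint z (k : int) : epi (z + k%:~R) = epi z.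
Proof. by rewrite epiD epi_int mulr1. Qed.

Lemma epi_eq1 z : epi z = 1 -> exists k : int, z = k%:~R.
Proof.
move=> z1; have Im0 : complex.Im z = 0.
  have /expR_inj/eqP : expR (- (2 * pi * complex.Im z)) = expR 0.
    by rewrite expR0 -nrm_epi z1 nrm1.
  by rewrite oppr_eq0 !mulf_eq0 pnatr_eq0 /= gt_eqF ?pi_gt0 //= => /eqP.
pose k := Num.floor (complex.Re z); pose t := complex.Re z - k%:~R.
have zE : z = k%:~R + t%:C.
  rewrite [z]complexRIE Im0 mulr0 addr0 /t rmorphB /= rmorph_int.
  by rewrite addrC subrK.
exists k; rewrite zE; suff -> : t = 0 by rewrite rmorph0 addr0.
have t0 : 0 <= t by rewrite subr_ge0 floor_le.
have t1 : t < 1 by rewrite ltrBlDr addrC; have := floorD1_gt (complex.Re z); rewrite intrD.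
apply/eqP/negPn/negP => tn0; have tp : 0 < t by rewrite lt_neqAle eq_sym tn0.
have : epi t%:C = 1 by rewrite -z1 zE addrC epiDint.
rewrite epi_real => -[c1 _].
(* cos(2 pi t) = 1 - 2 sin(pi t)^2 is smaller than 1 for t strictly between 0 and 1. *)
have : 0 < sin (pi * t) by apply: sin_gt0_pi; rewrite mulr_gt0 ?pi_gt0 //= gtr_pMr ?pi_gt0.
have E : 2 * pi * t = (pi * t) *+ 2 by rewrite -mulrA mulr_natl.
move: c1; rewrite E cos_mulr2n; have := cos2Dsin2 (pi * t); nra.
Qed.

Lemma epi_diff0 (e : R) : 0 < e -> exists2 d, 0 < d &
  forall h : R[i], nrm h < d -> nrm (epi h - 1 - tpi * h) <= e * nrm h.
Proof.
move=> e0; have p0 : (0 : R) < 2 * pi by rewrite mulr_gt0 // pi_gt0.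
have [d d0 H] := cexp_diff0 (divr_gt0 e0 p0).
exists (d / (2 * pi)); first by rewrite divr_gt0.
move=> h; rewrite ltr_pdivlMr // mulrC -nrm_tpi -nrmM => /H.
by rewrite nrmM nrm_tpi mulrA divfK ?gt_eqF.
Qed.

Lemma epi_differentiable z : differentiable epi z.
Proof.
apply: (@eps_diff R _ _ (fun h => epi z * (tpi * h)) z (nrm (epi z * tpi))).
- by move=> a u v; rewrite -[a *: u]/(a * u) -[a *: _ in RHS]/(a * _); ring.
- by move=> v; rewrite mulrA nrmM.
- move=> e e0; have n0 : 0 < nrm (epi z) by rewrite nrm_gt0 epi_neq0.
  have [d d0 H] := epi_diff0 (divr_gt0 e0 n0).
  exists d => // v /H Hv.
  have -> : epi (z + v) - epi z - epi z * (tpi * v) = epi z * (epi v - 1 - tpi * v).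
    by rewrite epiD; ring.
  by rewrite nrmM -ler_pdivlMl // mulrA [_^-1 * e]mulrC.
Qed.

Lemma epi_continuous : continuous epi.
Proof. by move=> z; apply/differentiable_continuous/epi_differentiable. Qed.

End ComplexExponential.

(** * Differentiability of pointwise expressions *)

Section Differentiability.
Variables (R : realType) (V : normedModType R[i]).
Implicit Types (f g : V -> R[i]) (p : V).

Lemma difC (c : R[i]) p : differentiable (fun _ : V => c) p.
Proof. exact: differentiable_cst. Qed.

Lemma dif_id p : differentiable (fun q : V => q) p.
Proof. by have [] := is_diff_id p. Qed.

Lemma difD f g p : differentiable f p -> differentiable g p ->
  differentiable (fun q => f q + g q) p.
Proof. exact: differentiableD. Qed.

Lemma difN f p : differentiable f p -> differentiable (fun q => - f q) p.
Proof. exact: differentiableN. Qed.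

Lemma difB f g p : differentiable f p -> differentiable g p ->
  differentiable (fun q => f q - g q) p.
Proof. exact: differentiableB. Qed.

Lemma difM f g p : differentiable f p -> differentiable g p ->
  differentiable (fun q => f q * g q) p.
Proof. exact: differentiableM. Qed.

Lemma difV f p : differentiable f p -> f p != 0 -> differentiable (fun q => (f q)^-1) p.
Proof. exact: differentiableV. Qed.

Lemma dif_comp (U W : normedModType R[i]) (h : V -> U) (k : U -> W) p :
  differentiable h p -> differentiable k (h p) -> differentiable (fun q => k (h q)) p.
Proof. exact: differentiable_comp. Qed.

End Differentiability.

Ltac dif := repeat lazymatch goal with
  | |- differentiable (fun _ => ?c) _ => exact: difC
  | |- differentiable (fun y => y) _ => exact: dif_id
  | |- differentiable (fun y => GRing.add (@?f y) (GRing.opp (@?g y))) ?x =>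
      apply: (@difB _ _ f g x)
  | |- differentiable (fun y => GRing.add (@?f y) (@?g y)) ?x =>
      apply: (@difD _ _ f g x)
  | |- differentiable (fun y => GRing.mul (@?f y) (@?g y)) ?x =>
      apply: (@difM _ _ f g x)
  | |- differentiable (fun y => GRing.opp (@?f y)) ?x =>
      apply: (@difN _ _ f x)
  | |- differentiable (fun y => epi (@?f y)) ?x =>
      apply: (@dif_comp _ _ _ _ f (@epi _) x); last exact: epi_differentiable
  | |- _ => match goal with
     | H : ?P |- ?Q => constr_eq P Q; exact H
     | H : differentiable ?f _ |- differentiable (fun y => ?g y) _ => constr_eq f g; exact H
     end
  end.

(** * Quotients with a removable singularity *)

Section RemovableSingularity.
Variable R : realType.
Implicit Types (f u : R[i] -> R[i]) (z c a b : R[i]).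

(* Where [u z = 0] the quotient is the junk value 0, so that subtracting
   [c * u] first, with [c] the ratio of the derivatives, makes it continuous. *)
Definition removed_quotient f u v c z := (f z - v - c * u z) / u z + c.

Lemma removed_quotientK f u v c z : (u z = 0 -> f z = v) ->
  f z - v = u z * removed_quotient f u v c z.
Proof.
move=> H; rewrite /removed_quotient; have [u0|u0] := eqVneq (u z) 0; last by field.
by rewrite u0 mul0r H // subrr.
Qed.

Lemma removed_quotient_dif f u v c z : differentiable f z -> differentiable u z ->
  u z != 0 -> differentiable (removed_quotient f u v c) z.
Proof.
move=> df du u0; rewrite /removed_quotient; dif.
exact: difV.
Qed.

(** [a] and [b] are the derivatives of [f] and [u] at [z]. The numerator f - v - (a/b) u is o(h)
    while |u| is at least |b||h|/2, so the quotient tends to 0, which is also its default value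
    where [u] vanishes. *)
Lemma removed_quotient_cont f u v a b z : b != 0 -> u z = 0 -> f z = v ->
  (forall e : R, 0 < e -> exists2 d, 0 < d & forall h, nrm h < d ->
     nrm (f (z + h) - v - a * h) <= e * nrm h) ->
  (forall e : R, 0 < e -> exists2 d, 0 < d & forall h, nrm h < d ->
     nrm (u (z + h) - b * h) <= e * nrm h) ->
  {for z, continuous (removed_quotient f u v (a / b))}.
Proof.
move=> b0 u0 fz Hf Hu; have B0 : 0 < nrm b by rewrite nrm_gt0.
set c := a / b; have c0 := nrm_ge0 c.
apply/cont_nrm => e e0.
have [d1 d10 H1] := Hu (nrm b / 2) ltac:(by rewrite divr_gt0).
(* Makes the numerator at most e |b| |h| / 4, half of e times the lower bound for |u|. *)
pose t := e * nrm b / (4 * (1 + nrm c)).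
have C1 : 0 < 1 + nrm c by rewrite ltr_pwDl.
have t0 : 0 < t by rewrite /t divr_gt0 ?mulr_gt0.
have tE : t * (1 + nrm c) = e * nrm b / 4 by rewrite /t; field; rewrite gt_eqF.
clearbody t.
have [d2 d20 H2] := Hf _ t0; have [d3 d30 H3] := Hu _ t0.
exists (Num.min d1 (Num.min d2 d3)); first by rewrite !lt_min d10 d20.
move=> q; rewrite !lt_min => /andP[/H1 h1 /andP[/H2 h2 /H3 h3]].
rewrite /removed_quotient u0 fz subrr mulr0 subr0 mul0r add0r addrK.
have Eq : z + (q - z) = q by rewrite addrC subrK.
rewrite !Eq in h1 h2 h3; move: (q - z) h1 h2 h3 => h h1 h2 h3.
have [uq0|uq0] := eqVneq (u q) 0; first by rewrite uq0 invr0 mulr0 nrm0.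
have nu : nrm b * nrm h / 2 <= nrm (u q).
  have := nrm_distl (b * h) (b * h - u q); rewrite opprB addrCA subrr addr0.
  by rewrite [nrm (b * h - _)]nrmB nrmM; lra.
rewrite nrmM nrmV ltr_pdivrMr ?nrm_gt0 //.
have -> : f q - v - c * u q = (f q - v - a * h) - c * (u q - b * h).
  by rewrite /c; field.
apply: le_lt_trans (nrmD _ _) _; rewrite nrmN nrmM.
have uq : 0 < nrm (u q) by rewrite nrm_gt0.
have h0 := nrm_ge0 h.
have : nrm c * nrm (u q - b * h) <= nrm c * (t * nrm h) by rewrite ler_wpM2l.
have : t * (1 + nrm c) * nrm h = e * nrm b / 4 * nrm h by rewrite tE.
have : e * (nrm b * nrm h / 2) <= e * nrm (u q) by rewrite ler_wpM2l // ltW.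
have : 0 < e * nrm (u q) by rewrite mulr_gt0.
lra.
Qed.

End RemovableSingularity.

(** * Fourier expansion in one variable *)

Section Fourier.
Variable R : realType.
Implicit Types (f g : R[i] -> R[i]) (z : R[i]) (y : R) (k : int).
Local Notation tpi := (0 +i* (2 * pi) : R[i]).

Definition hcont f y := forall x : R, {for x +i* y, continuous f}.

Lemma hcont_cont01 f y : hcont f y -> cont01 (fun x => f (x +i* y)).
Proof. by move=> cf x _; exact: continuous_hline. Qed.

Lemma hmeanB f g y : hcont f y -> hcont g y ->
  hmean (fun z => f z - g z) y = hmean f y - hmean g y.
Proof. by move=> /hcont_cont01 cf /hcont_cont01 cg; exact: dmeanB. Qed.

Lemma hmeanZ c f y : hcont f y -> hmean (fun z => c * f z) y = c * hmean f y.
Proof. by move=> /hcont_cont01 cf; exact: dmeanZ. Qed.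

Lemma hmean_bound f y B : hcont f y -> (forall x : R, nrm (f (x +i* y)) <= B) ->
  nrm (hmean f y) <= B.
Proof. by move=> /hcont_cont01 cf HB; apply: dmean_bound cf _ => x _; exact: HB. Qed.

Lemma hmean_shift f y (t : R) : hcont f y -> (forall x : R, f (x +i* y + 1) = f (x +i* y)) ->
  hmean (fun z => f (z + t%:C)) y = hmean f y.
Proof.
move=> cf pf; rewrite /hmean.
have E (x s : R) : (x +i* y) + s%:C = (x + s) +i* y.
  by apply/eqP; rewrite eq_complex /= addr0 !eqxx.
rewrite -(@dmean_shift _ (fun x : R => f (x +i* y)) t).
- by apply: dmean_eq => x _; rewrite E.
- by move=> x; exact: continuous_hline.
- by move=> x; rewrite -E pf.
Qed.

Lemma epi_lin_continuous (a b : R[i]) : continuous (fun z => epi (a * z + b)).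
Proof.
apply: contT => z; apply: (@cont_comp _ _ _ (fun z => a * z + b) (@epi R)).
  by cont.
exact: epi_continuous.
Qed.

(** A shift by half a period, 1/(2k), negates the character, so its mean equals its own negative. *)
Lemma hmean_epi k z0 y : hmean (fun z => epi (- (k%:~R * (z - z0)))) y = (k == 0)%:R.
Proof.
have [->|k0] := eqVneq k 0.
  by rewrite -[RHS](dmean_cst 1); apply: dmean_eq => x _; rewrite mulr0z mul0r oppr0 epi0.
pose f z := epi (- (k%:~R * (z - z0))).
have cf : hcont f y.
  move=> x; have -> : f = fun z => epi (- k%:~R * z + k%:~R * z0).
    by apply/funext => z; rewrite /f; congr epi; ring.
  exact: epi_lin_continuous.
have := @hmean_shift f y (2 * k%:~R)^-1 cf.
have -> : (fun z => f (z + ((2 * k%:~R)^-1)%:C)) = fun z => -1 * f z.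
  apply/funext => z; rewrite /f.
  have -> : - (k%:~R * (z + ((2 * k%:~R)^-1)%:C - z0)) = - (2^-1)%:C + - (k%:~R * (z - z0)) :> R[i].
    rewrite !fmorphV rmorphM /= rmorph_nat rmorph_int.
    by field; rewrite intr_eq0.
  by rewrite epiD epiN epi_half invrN invr1.
rewrite hmeanZ // => /(_ _) H.
have {}H : -1 * hmean f y = hmean f y.
  apply: H => x; rewrite /f.
  have -> : - (k%:~R * (x +i* y + 1 - z0)) = - (k%:~R * (x +i* y - z0)) + (- k)%:~R.
    by rewrite mulrNz; ring.
  by rewrite epiDint.
apply/eqP; rewrite -/f -(mulrI_eq0 _ (@mulfI _ 2 _)) ?pnatr_eq0 //.
by rewrite mulrC mulr_natr mulr2n -{1}H mulN1r addNr.
Qed.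

(** The character is evaluated at the complex point and not only at its real part; this makes the
    coefficient independent of the height ([hcoef_indep]). *)
Definition hcoef f k y := hmean (fun z => f z * epi (- (k%:~R * z))) y.

Definition fourier_sum f z K y :=
  \sum_(j < (K.*2).+1) hcoef f (j%:Z - K%:Z) y * epi ((j%:Z - K%:Z)%:~R * z).

Section Strip.
Variables (f : R[i] -> R[i]) (y1 y2 : R).
Hypothesis df : forall z, y1 <= complex.Im z <= y2 -> differentiable f z.
Hypothesis pf : forall z, y1 <= complex.Im z <= y2 -> f (z + 1) = f z.

Lemma strip_periodic_int k z : y1 <= complex.Im z <= y2 -> f (z + k%:~R) = f z.
Proof.
have P n w : y1 <= complex.Im w <= y2 -> f (w + n%:R) = f w.
  move=> w12; elim: n => [|n IH]; first by rewrite addr0.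
  rewrite -natr1 addrA pf ?IH // -[n%:R](rmorph_nat (real_complex R)).
  by case: (w) w12 => a b /=; rewrite addr0.
case: k => n z12; first exact: P.
rewrite NegzE mulrNz -[LHS](P n.+1) ?subrK //.
rewrite -[n.+1%:~R](rmorph_nat (real_complex R)) -rmorphN.
by case: (z) z12 => a b /=; rewrite addr0.
Qed.

Lemma epi_dif (a b z : R[i]) : differentiable (fun w => epi (- (a * (w - b)))) z.
Proof. by dif. Qed.

Lemma hcoef_indep k y y' : y1 <= y <= y2 -> y1 <= y' <= y2 -> hcoef f k y = hcoef f k y'.
Proof.
wlog yy' : y y' / y <= y'.
  by move=> H h h'; have [/H|/ltW/H] := leP y y'; [apply|move=> ->].
move=> /andP[a b] /andP[c d]; apply: hmean_indep => // z /andP[za zb].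
  have dfz : differentiable f z by apply: df; apply/andP; lra.
  by dif.
rewrite pf; last by apply/andP; lra.
by rewrite mulrDr mulr1 opprD -mulrNz epiDint.
Qed.

Lemma fourier_sum_indep z K y y' : y1 <= y <= y2 -> y1 <= y' <= y2 ->
  fourier_sum f z K y = fourier_sum f z K y'.
Proof.
by move=> h h'; apply: eq_bigr => j _; rewrite (hcoef_indep _ h h').
Qed.

Lemma strip_hcont y : y1 <= y <= y2 -> hcont f y.
Proof. by move=> h x; apply/differentiable_continuous/df. Qed.

Lemma Im_intM k z : complex.Im (k%:~R * z) = k%:~R * complex.Im z.
Proof. by rewrite -(rmorph_int (real_complex R)); case: z => a b /=; rewrite mul0r addr0. Qed.

Lemma hcoef_bound k y B : y1 <= y <= y2 -> (forall x : R, nrm (f (x +i* y)) <= B) ->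
  nrm (hcoef f k y) <= B * expR (2 * pi * k%:~R * y).
Proof.
move=> yy HB; apply: hmean_bound.
  move=> x; apply: contM; first exact: strip_hcont.
  have -> : (fun z => epi (- (k%:~R * z))) = fun z : R[i] => epi (- k%:~R * z + 0).
    by apply/funext => z; rewrite addr0 mulNr.
  exact: epi_lin_continuous.
move=> x; rewrite nrmM nrm_epi; apply: ler_pM (HB x) _; rewrite ?nrm_ge0 ?expR_ge0 //.
by rewrite raddfN /= Im_intM /= mulrN opprK mulrA.
Qed.

Section Point.
Variable z0 : R[i].
Hypothesis z012 : y1 < complex.Im z0 < y2.
Local Notation y0 := (complex.Im z0).

(** Chernoff's device for the convergence of Fourier series. [u] vanishes exactly at the translates
    z0 + k, where [f] takes the value f(z0). Hence [psi], the quotient of f - f(z0) by [u], is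
    continuous on the strip and differentiable off the height of [z0]; [cj] are its coefficients
    centred at [z0], and [c] is the ratio of the derivatives at [z0]. *)
Let u z := epi (z - z0) - 1.
Let c := 'd f z0 (1 : R[i]) / tpi.
Let psi := removed_quotient f u (f z0) c.
Let cj k y := hmean (fun z => psi z * epi (- (k%:~R * (z - z0)))) y.

Let u_dif z : differentiable u z. Proof. by rewrite /u; dif. Qed.

Let u_eq0 z : u z = 0 -> exists k : int, z = z0 + k%:~R.
Proof.
by move=> /eqP; rewrite subr_eq0 => /eqP/epi_eq1[k zk]; exists k; rewrite -zk addrC subrK.
Qed.

Let in_z0 : y1 <= y0 <= y2.
Proof. by move: z012 => /andP[a b]; apply/andP; split; exact: ltW. Qed.

Let f_u0 z : u z = 0 -> f z = f z0.
Proof. by move=> /u_eq0[k ->]; rewrite strip_periodic_int. Qed.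

Let u_neq0 z : complex.Im z != y0 -> u z != 0.
Proof.
move=> zy; apply/negP => /eqP/u_eq0[k zk]; move/negP: zy; apply; rewrite zk.
by rewrite -(rmorph_int (real_complex R)); case: (z0) => a b /=; rewrite addr0.
Qed.

Let psi_dif z : y1 <= complex.Im z <= y2 -> u z != 0 -> differentiable psi z.
Proof. by move=> z12 uz; apply: removed_quotient_dif => //; exact: df. Qed.

Let psi_cont z : y1 <= complex.Im z <= y2 -> {for z, continuous psi}.
Proof.
move=> z12; have [uz|uz] := eqVneq (u z) 0; last first.
  exact/differentiable_continuous/psi_dif.
have [k zk] := u_eq0 uz.
apply: (removed_quotient_cont (tpi_neq0 R) uz (f_u0 uz)).
  move=> e e0; have [d d0 Hd] := diff_eps (df in_z0) e0.
  exists (Num.min d (Num.min (y0 - y1) (y2 - y0))).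
    by move: z012 => /andP[? ?]; rewrite !lt_min d0 !subr_gt0; apply/andP.
  move=> h; rewrite !lt_min => /andP[hd /andP[h1 h2]].
  have -> : f (z + h) = f (z0 + h).
    rewrite zk addrAC strip_periodic_int //.
    have := Im_le_nrm h; rewrite raddfD /= ler_norml => /andP[? ?].
    by apply/andP; lra.
  have -> : 'd f z0 (1 : R[i]) * h = 'd f z0 h.
    by rewrite -{2}[h]mulr1 -[h * 1]/(h *: (1 : R[i])) linearZ /= mulrC.
  exact: Hd.
move=> e e0; have [d d0 Hd] := epi_diff0 e0; exists d => // h /Hd.
rewrite /u zk; have -> : z0 + k%:~R + h - z0 = h + k%:~R by ring.
by rewrite epiDint.
Qed.

Let psi_per z : y1 <= complex.Im z <= y2 -> psi (z + 1) = psi z.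
Proof.
move=> z12; rewrite /psi /removed_quotient /u pf //.
by have -> : epi (z + 1 - z0) = epi (z - z0) by rewrite addrAC (epiD _ 1) epi1 mulr1.
Qed.

Let E_cont k y : hcont (fun z => epi (- (k%:~R * (z - z0)))) y.
Proof. by move=> x; apply/differentiable_continuous/epi_dif. Qed.

Let cj_cont k y : y1 <= y <= y2 -> hcont (fun z => psi z * epi (- (k%:~R * (z - z0)))) y.
Proof. by move=> yy x; apply: contM; [exact: psi_cont|exact: E_cont]. Qed.

Let cj_indep k : cj k y1 = cj k y2.
Proof.
apply: (@hmean_indep_cont R _ y0 y1 y2 in_z0).
- by move=> z z12; apply: contM; [exact: psi_cont|exact/differentiable_continuous/epi_dif].
- move=> z z12 zy; apply: difM; last exact: epi_dif.
  by apply: psi_dif => //; exact: u_neq0.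
- move=> z z12; rewrite psi_per // addrAC mulrDr mulr1 opprD -mulrNz.
  by rewrite epiDint.
Qed.

(** From f - f(z0) = (e(z - z0) - 1) psi, the k-th term of the expansion at [z0] is cj (k-1) - cj k,
    plus f(z0) when k = 0. The sum telescopes. The two surviving terms are placed on the edge of the
    strip where each is exponentially small. *)
Lemma fourier_sum_telescope K y : y1 <= y <= y2 ->
  fourier_sum f z0 K y - f z0 = cj (- K.+1%:Z) y2 - cj K%:Z y1.
Proof.
move=> yy; have y11 : y1 <= y1 <= y2.
  by move: z012 => /andP[? ?]; apply/andP; lra.
rewrite (fourier_sum_indep _ _ yy y11) -cj_indep.
have step k : hcoef f k y1 * epi (k%:~R * z0) - f z0 * (k == 0)%:R = cj (k - 1) y1 - cj k y1.
  rewrite /cj -hmeanB; [|exact: cj_cont..].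
  rewrite -(hmean_epi k z0 y1) -hmeanZ; last exact: E_cont.
  rewrite mulrC /hcoef -hmeanZ; last first.
    move=> x; apply: contM; first exact: strip_hcont.
    have := @epi_dif k%:~R 0 (x +i* y1); under eq_fun do rewrite subr0.
    by move/differentiable_continuous.
  rewrite -hmeanB.
  - apply: dmean_eq => x _; set z := x +i* y1.
    have Ez : epi (k%:~R * z0) * (f z * epi (- (k%:~R * z))) = f z * epi (- (k%:~R * (z - z0))).
      by rewrite mulrCA -epiD; congr (_ * epi _); ring.
    have Ek : epi (- ((k - 1)%:~R * (z - z0))) = epi (z - z0) * epi (- (k%:~R * (z - z0))).
      by rewrite -epiD; congr epi; rewrite rmorphB; ring.
    rewrite Ez Ek; have := @removed_quotientK R f u (f z0) c z (@f_u0 z).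
    by rewrite -/psi /u => H; rewrite -mulrBl H; ring.
  - move=> x; apply: contM; first exact: contC.
    apply: contM; first exact: strip_hcont.
    have := @epi_dif k%:~R 0 (x +i* y1); under eq_fun do rewrite subr0.
    by move/differentiable_continuous.
  - by move=> x; apply: contM; [exact: contC|exact: E_cont].
have -> : f z0 = \sum_(j < (K.*2).+1) f z0 * (j%:Z - K%:Z == 0)%:R.
  have Kl : (K < (K.*2).+1)%N by rewrite ltnS -addnn leq_addr.
  rewrite (bigD1 (Ordinal Kl)) //= subrr eqxx mulr1 big1 ?addr0 // => j jK.
  rewrite subr_eq0 eqz_nat; suff -> : (nat_of_ord j == K) = false by rewrite mulr0.
  by apply/negbTE; apply: contra jK => /eqP jK; apply/eqP/val_inj.
rewrite /fourier_sum -sumrB; under eq_bigr do rewrite step.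
rewrite -(big_mkord xpredT (fun j => cj (j%:Z - K%:Z - 1) y1 - cj (j%:Z - K%:Z) y1)).
rewrite (@telescope_sumr_eq _ 0 _ (fun j => - cj (j%:Z - K%:Z - 1) y1)) //.
  have -> : (K.*2).+1%:Z - K%:Z - 1 = K%:Z by rewrite -addnn -addn1 !PoszD; ring.
  have -> : 0%:Z - K%:Z - 1 = - K.+1%:Z by rewrite -addn1 PoszD; ring.
  by rewrite opprK addrC.
move=> j _; have -> : j.+1%:Z - K%:Z - 1 = j%:Z - K%:Z by rewrite -addn1 PoszD; ring.
by rewrite opprK addrC.
Qed.

Lemma fourier_error K y B : y1 <= y <= y2 -> nrm (f z0) <= B ->
  (forall x : R, nrm (f (x +i* y1)) <= B) -> (forall x : R, nrm (f (x +i* y2)) <= B) ->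
  nrm (fourier_sum f z0 K y - f z0) <=
    2 * B / (1 - expR (2 * pi * (y0 - y2))) * expR (2 * pi * (y0 - y2)) ^+ K.+1 +
    2 * B / (1 - expR (2 * pi * (y1 - y0))) * expR (2 * pi * (y1 - y0)) ^+ K.+1.
Proof.
move=> yy B0 B1 B2; have /andP[h1 h2] := z012.
have p0 : (0 : R) < 2 * pi by rewrite mulr_gt0 // pi_gt0.
have q1l : expR (2 * pi * (y1 - y0)) < 1 by rewrite expR_lt1 pmulr_rlt0 // subr_lt0.
have q2l : expR (2 * pi * (y0 - y2)) < 1 by rewrite expR_lt1 pmulr_rlt0 // subr_lt0.
have q1p := expR_gt0 (2 * pi * (y1 - y0)).
have q2p := expR_gt0 (2 * pi * (y0 - y2)).
have Bp : 0 <= B := le_trans (nrm_ge0 _) B0.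
have y1n : y1 != y0 by rewrite lt_eqF.
have y2n : y2 != y0 by rewrite gt_eqF.
have psiE z : complex.Im z != y0 -> psi z = (f z - f z0) / u z.
  by move=> /u_neq0 uz; rewrite /psi /removed_quotient; field.
have nepi k x (t : R) : nrm (epi (- (k%:~R * (x +i* t - z0)))) = expR (2 * pi * (t - y0)) `^ k%:~R.
  rewrite -expRM nrm_epi raddfN /= Im_intM raddfB /=; congr expR.
  by rewrite mulrN opprK mulrCA mulrC.
have nf x : nrm (f (x +i* y1) - f z0) <= 2 * B.
  by apply: le_trans (nrmD _ _) _; rewrite nrmN; have := B1 x; lra.
have nf2 x : nrm (f (x +i* y2) - f z0) <= 2 * B.
  by apply: le_trans (nrmD _ _) _; rewrite nrmN; have := B2 x; lra.
have nez x (t : R) : nrm (epi (x +i* t - z0)) = expR (2 * pi * (y0 - t)).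
  by rewrite nrm_epi raddfB /=; congr expR; ring.
rewrite fourier_sum_telescope //; apply: le_trans (nrmD _ _) _; rewrite nrmN.
apply: lerD.
  apply: hmean_bound; first by apply: cj_cont; apply/andP; lra.
  move=> x; rewrite nrmM nepi psiE // nrmM nrmV.
  have -> : expR (2 * pi * (y2 - y0)) `^ (- K.+1%:Z)%:~R = expR (2 * pi * (y0 - y2)) ^+ K.+1.
    by rewrite -expRM -expRM_natr; congr expR; rewrite mulrNz; ring.
  rewrite ler_wpM2r ?exprn_ge0 ?expR_ge0 //.
  apply: ler_pM; rewrite ?nrm_ge0 ?invr_ge0 ?nrm_ge0 //.
  rewrite lef_pV2 ?posrE ?subr_gt0 ?nrm_gt0 ?u_neq0 //.
  have := nrm_distl 1 (epi (x +i* y2 - z0)); rewrite nrm1 nez nrmB.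
  by [].
apply: hmean_bound; first by apply: cj_cont; apply/andP; lra.
move=> x; rewrite nrmM nepi psiE // nrmM nrmV.
have -> : expR (2 * pi * (y1 - y0)) `^ K%:Z%:~R = expR (2 * pi * (y1 - y0)) ^+ K.
  by rewrite -expRM -expRM_natr.
(* On the lower edge |e(z - z0)| is 1/q with q = exp(2 pi (y1 - y0)), so |u| is at least 1/q - 1.
   Its inverse q/(1 - q) supplies the factor that raises the exponent from K to K + 1. *)
rewrite exprS mulrA ler_wpM2r ?exprn_ge0 ?expR_ge0 // -mulrA.
apply: ler_pM; rewrite ?nrm_ge0 ?invr_ge0 ?nrm_ge0 //.
have -> : (1 - expR (2 * pi * (y1 - y0)))^-1 * expR (2 * pi * (y1 - y0)) =
   (expR (2 * pi * (y0 - y1)) - 1)^-1.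
  have -> : expR (2 * pi * (y0 - y1)) = (expR (2 * pi * (y1 - y0)))^-1.
    by rewrite -expRN; congr expR; ring.
  move: (expR _) q1p q1l => q qp ql.
  have q0 : q != 0 by rewrite gt_eqF.
  have q1 : 1 - q != 0 by rewrite gt_eqF // subr_gt0.
  by field; rewrite q0 mulN1r.
rewrite lef_pV2 ?posrE ?subr_gt0 ?nrm_gt0 ?u_neq0 //; last first.
  by rewrite expR_gt1 mulr_gt0 // subr_gt0.
by have := nrm_distl (epi (x +i* y1 - z0)) 1; rewrite nrm1 nez.
Qed.

End Point.
End Strip.
End Fourier.

(** * Taylor's bound and Cauchy's formula on a disc *)

Section Disc.
Variable R : realType.
Implicit Types (f : R[i] -> R[i]) (s z : R[i]).

Lemma expR_small (t : R) : 0 < t -> t < 1 -> exists2 Y : R, 0 < Y & expR (2 * pi * - Y) = t.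
Proof.
move=> t0 t1; have p0 : (0 : R) < 2 * pi by rewrite mulr_gt0 // pi_gt0.
exists (- ln t / (2 * pi)); first by rewrite divr_gt0 // oppr_gt0 ln_lt0 // t0.
by rewrite mulNr opprK mulrCA divff ?gt_eqF // mulr1 lnK.
Qed.

Lemma diff1E f s h : 'd f s h = 'd f s (1 : R[i]) * h.
Proof. by rewrite -{1}[h]mulr1 -[h * 1]/(h *: (1 : R[i])) linearZ /= mulrC. Qed.

Section Taylor.
Variables (f : R[i] -> R[i]) (r B : R).
Hypothesis r2 : 2 <= r.
Hypothesis df : forall s, nrm s <= r -> differentiable f s.
Hypothesis fB : forall s, nrm s <= r -> nrm (f s) <= B.

(** e(z) carries the half-plane above [y1] to the punctured disc of radius [r]; the Taylor
    coefficients of [f] at 0 become the Fourier coefficients of [phi]. *)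
Let phi z := f (epi z).
Let d := 'd f 0 (1 : R[i]).
Let y1 := - ln r / (2 * pi).

Let p0 : (0 : R) < 2 * pi.
Proof. by rewrite mulr_gt0 // pi_gt0. Qed.

Let r0 : 0 < r.
Proof. by apply: lt_le_trans r2. Qed.

Let y1lt0 : y1 < 0.
Proof.
by rewrite /y1 mulNr oppr_lt0 divr_gt0 // ln_gt0 //; apply: lt_le_trans r2; rewrite ltr1n.
Qed.

Let expR_y1 : expR (2 * pi * y1) = r^-1.
Proof. by rewrite /y1 mulrCA divff ?gt_eqF // mulr1 expRN lnK. Qed.

Let epi_le z : y1 <= complex.Im z -> nrm (epi z) <= r.
Proof.
move=> yz; rewrite nrm_epi -[leRHS]invrK -expR_y1 -expRN ler_expR lerN2.
by rewrite ler_pM2l.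
Qed.

Let phi_dif z : y1 <= complex.Im z -> differentiable phi z.
Proof.
by move=> yz; apply: dif_comp; [exact: epi_differentiable|apply/df/epi_le].
Qed.

Let phi_per z : phi (z + 1) = phi z.
Proof. by rewrite /phi epiD epi1 mulr1. Qed.

(** Moves the line up to a height Y where q = e(z) is so small that [f] is f(0) + d q up to e|q|.
    For k <= 1 the factor |e(-kz)| is at most 1/|q|, so the error in the mean stays below e. *)
Let coef_le1 k : k <= 1 -> hcoef phi k 0 = f 0 * (k == 0)%:R + d * (k == 1)%:R.
Proof.
move=> k1; apply/eqP; rewrite -subr_eq0; apply/eqP/nrm0_eq0/le_anti; rewrite nrm_ge0 andbT.
apply/ler_addgt0Pl => e e0; rewrite addr0.
have [|t t0 Ht] := diff_eps (df (s := 0) _) e0; first by rewrite nrm0 ltW.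
have m0 : 0 < Num.min (t / 2) (1 / 2) by rewrite lt_min !divr_gt0.
have m1 : Num.min (t / 2) (1 / 2) < 1 by rewrite gt_min; apply/orP; right; lra.
have [Y Y0 HY] := expR_small m0 m1.
have Yt : expR (2 * pi * - Y) < t by rewrite HY gt_min; apply/orP; left; lra.
have Y12 : y1 <= Y <= Y by rewrite lexx andbT ltW // (lt_trans y1lt0).
have y10 : y1 <= 0 <= Y by rewrite !ltW.
have dph z : y1 <= complex.Im z <= Y -> differentiable phi z by move=> /andP[/phi_dif].
rewrite (hcoef_indep dph (fun z _ => phi_per z) k y10 Y12).
have c1 : hcont (fun z => epi (- (k%:~R * (z - 0)))) Y.
  by move=> x; apply/differentiable_continuous/epi_dif.
have c2 : hcont (fun z => epi (- ((k - 1)%:~R * (z - 0)))) Y.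
  by move=> x; apply/differentiable_continuous/epi_dif.
have c3 : hcont (fun z => phi z * epi (- (k%:~R * z))) Y.
  move=> x; apply: contM; first by apply/differentiable_continuous/phi_dif => /=; case/andP: Y12.
  have := @epi_dif R k%:~R 0 (x +i* Y); under eq_fun do rewrite subr0.
  by move/differentiable_continuous.
have -> : (k == 1) = (k - 1 == 0) by rewrite subr_eq0.
have d1 : hcont (fun z => f 0 * epi (- (k%:~R * (z - 0)))) Y.
  by move=> x; apply: contM; [exact: contC|exact: c1].
have d2 : hcont (fun z => d * epi (- ((k - 1)%:~R * (z - 0)))) Y.
  by move=> x; apply: contM; [exact: contC|exact: c2].
have d3 : hcont (fun z => phi z * epi (- (k%:~R * z)) - f 0 * epi (- (k%:~R * (z - 0)))) Y.
  by move=> x; apply: contB; [exact: c3|exact: d1].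
rewrite -(hmean_epi k 0 Y) -(hmean_epi (k - 1) 0 Y) -(hmeanZ (f 0) c1) -(hmeanZ d c2).
rewrite opprD addrA /hcoef -(hmeanB c3 d1) -(hmeanB d3 d2).
apply: hmean_bound; first by move=> x; apply: contB; [exact: d3|exact: d2].
move=> x; set z := x +i* Y.
have E1 : epi (- ((k - 1)%:~R * (z - 0))) = epi z * epi (- (k%:~R * z)).
  by rewrite -epiD subr0; congr epi; rewrite rmorphB; ring.
have -> : phi z * epi (- (k%:~R * z)) - f 0 * epi (- (k%:~R * (z - 0)))
    - d * epi (- ((k - 1)%:~R * (z - 0))) =
    (f (0 + epi z) - f 0 - 'd f 0 (epi z)) * epi (- (k%:~R * z)).
  by rewrite E1 subr0 add0r diff1E /phi -/d; ring.
rewrite nrmM.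
have nz : nrm (epi z) = expR (2 * pi * - Y) by rewrite nrm_epi mulrN.
have := Ht (epi z); rewrite nz => /(_ Yt) H.
apply: le_trans (ler_wpM2r (nrm_ge0 _) H) _.
rewrite -[e * _ * _]mulrA; apply: ler_piMr; first exact: ltW.
rewrite nrm_epi -expRD -[leRHS]expR0 ler_expR.
have -> : 2 * pi * - Y - 2 * pi * complex.Im (- (k%:~R * z)) = (k%:~R - 1) * (2 * pi * Y).
  by rewrite raddfN /= Im_intM /=; ring.
apply: mulr_le0_ge0; last by rewrite mulr_ge0 ?ltW.
by rewrite subr_le0 -[1](rmorph1 (intr : int -> R)) ler_int.
Qed.

(** The expansion at z = 0, that is at the point 1 of the disc, with indices up to 2 is f(0) + d
    plus the coefficient of index 2, which is at most B/r^2. The error from the lower edge is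
    (2B/r^2)/(r - 1), at most 2B/r^2 as r >= 2; the one from the upper edge vanishes as Y grows. *)
Lemma taylor_bound : nrm (f 1 - f 0 - d) <= 3 * B / r ^+ 2 /\ nrm d <= B / r.
Proof.
have B0 : 0 <= B by apply: le_trans (nrm_ge0 _) (fB (s := 0) _); rewrite nrm0 ltW.
have y10 (Y : R) : 0 < Y -> y1 <= 0 <= Y by move=> Y0; rewrite !ltW.
have y11 (Y : R) : 0 < Y -> y1 <= y1 <= Y by move=> Y0; rewrite lexx ltW // (lt_trans y1lt0).
have dph Y z : y1 <= complex.Im z <= Y -> differentiable phi z by move=> /andP[/phi_dif].
have Bph y (x : R) : y1 <= y -> nrm (phi (x +i* y)) <= B by move=> yy; apply/fB/epi_le.
have cb k : nrm (hcoef phi k 0) <= B * expR (2 * pi * k%:~R * y1).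
  rewrite (hcoef_indep (dph 1) (fun z _ => phi_per z) k (y10 _ ltr01) (y11 _ ltr01)).
  apply: (hcoef_bound (dph 1)); first exact: y11.
  by move=> x; apply: Bph.
have cd : hcoef phi 1 0 = d by rewrite coef_le1 // mulr0 add0r mulr1.
split; last first.
  by rewrite -cd; apply: le_trans (cb 1) _; rewrite mulr1 expR_y1.
have c2 : nrm (hcoef phi 2 0) <= B / r ^+ 2.
  apply: le_trans (cb 2) _; rewrite ler_wpM2l // -exprVn -expR_y1 -expRM_natr.
  by rewrite mulrAC.
apply/ler_addgt0Pr => e e0.
pose t := Num.min (1 / 2) (e / (4 * B + 1)).
have B41 : 0 < 4 * B + 1 by rewrite ltr_wpDl // mulr_ge0.
have t0 : 0 < t by rewrite lt_min !divr_gt0.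
have t12 : t <= 1 / 2 by rewrite ge_min lexx.
have te : t * (4 * B + 1) <= e by rewrite -ler_pdivlMr // ge_min lexx orbT.
have t1 : t < 1 by lra.
clearbody t.
have [Y Y0 HY] := expR_small t0 t1.
have z0 : y1 < complex.Im (0 : R[i]) < Y by rewrite /= y1lt0.
have := @fourier_error R phi y1 Y (dph Y) (fun z _ => phi_per z) 0 z0 2 0 B (y10 _ Y0).
have -> : phi 0 = f 1 by rewrite /phi epi0.
have B1 : nrm (f 1) <= B by apply: fB; rewrite nrm1; apply: le_trans r2; rewrite ler1n.
move=> /(_ B1 (fun x => Bph _ x (lexx _)) (fun x => Bph _ x (ltW (lt_trans y1lt0 Y0)))).
rewrite /= sub0r HY subr0 expR_y1.
have -> : fourier_sum phi 0 2 0 = f 0 + d + hcoef phi 2 0.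
  rewrite /fourier_sum !big_ord_recr big_ord0 /= !mulr0 epi0 !mulr1 add0r.
  have -> : 0%:Z - 2%:Z = -2 by [].
  have -> : 1%:Z - 2%:Z = -1 by [].
  have -> : 2%:Z - 2%:Z = 0 by [].
  have -> : 3%:Z - 2%:Z = 1 by [].
  have -> : 4%:Z - 2%:Z = 2 by [].
  rewrite (coef_le1 (k := -2)) // (coef_le1 (k := -1)) // (coef_le1 (k := 0)) //.
  by rewrite cd /= !mulr0 !mulr1 !add0r addr0.
move=> H.
have -> : f 1 - f 0 - d = hcoef phi 2 0 - (f 0 + d + hcoef phi 2 0 - f 1) by ring.
apply: le_trans (nrmD _ _) _; rewrite nrmN.
apply: le_trans (lerD c2 H) _.
have h1 : 2 * B / (1 - t) * t ^+ 3 <= e.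
  apply: le_trans te.
  have -> : 2 * B / (1 - t) * t ^+ 3 = t * (2 * B * (t ^+ 2 / (1 - t))).
    by field; rewrite ?mulN1r gt_eqF // subr_gt0.
  rewrite ler_pM2l //.
  have : t ^+ 2 / (1 - t) <= 1 by rewrite ler_pdivrMr ?subr_gt0 //; nra.
  have : 0 <= t ^+ 2 / (1 - t) by rewrite divr_ge0 ?sqr_ge0 // subr_ge0 ltW.
  by nra.
have h2 : 2 * B / (1 - r^-1) * r^-1 ^+ 3 <= 2 * B / r ^+ 2.
  have -> : 2 * B / (1 - r^-1) * r^-1 ^+ 3 = 2 * B / r ^+ 2 * (r - 1)^-1.
    by field; rewrite !gt_eqF // subr_gt0; apply: lt_le_trans r2; rewrite ltr1n.
  have P : 0 <= 2 * B / r ^+ 2 by apply: divr_ge0; [exact: mulr_ge0|exact: sqr_ge0].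
  have r1 : 1 <= r - 1 by have := r2; lra.
  by rewrite ler_piMr // invf_le1 // (lt_le_trans ltr01 r1).
have -> : 3 * B / r ^+ 2 + e = B / r ^+ 2 + (e + 2 * B / r ^+ 2) by ring.
by rewrite lerD2l lerD.
Qed.

End Taylor.

(** Cauchy's formula for f(s)/s. With G = (f - f(q))/(s - q), shrinking the circle to its centre
    gives the mean G(0) ([E1]), and blowing it up shows that 1/(s - q) has mean 0 ([E2]). So G(0) is
    the mean of f(s)/(s - q) ([E3]), and f(q) = q G(0) because f(0) = 0. *)
Lemma cauchy_quotient f (rho : R) (q : R[i]) : 0 < rho -> nrm q < rho ->
  (forall s, nrm s <= rho -> differentiable f s) -> f 0 = 0 ->
  f q = q * dmean (fun x : R => f (rho%:C * epi x%:C) / (rho%:C * epi x%:C - q)).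
Proof.
move=> rho0 qr df f0; have p0 : (0 : R) < 2 * pi by rewrite mulr_gt0 // pi_gt0.
have [->|qn] := eqVneq q 0; first by rewrite mul0r f0.
have q0 : 0 < nrm q by rewrite nrm_gt0.
pose u s := s - q; pose d := 'd f q (1 : R[i]).
pose G := removed_quotient f u (f q) (d / 1).
have du s : differentiable u s by rewrite /u; dif.
have G_dif s : nrm s <= rho -> s != q -> differentiable G s.
  move=> sr sq; apply: removed_quotient_dif; [exact: df|exact: du|].
  by rewrite /u subr_eq0.
have G_cont s : nrm s <= rho -> {for s, continuous G}.
  move=> sr; have [->|sq] := eqVneq s q; last exact/differentiable_continuous/G_dif.
  apply: removed_quotient_cont; rewrite ?oner_eq0 /u ?subrr //.
    move=> e e0; have [t t0 Ht] := diff_eps (df _ (ltW qr)) e0; exists t => // h /Ht.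
    by rewrite diff1E.
  move=> e e0; exists 1 => // h _; have -> : q + h - q - 1 * h = 0 by ring.
  by rewrite nrm0 mulr_ge0 ?nrm_ge0 // ltW.
have GK s : f s - f q = (s - q) * G s.
  apply: (@removed_quotientK R f u (f q) (d / 1) s).
  by rewrite /u => /eqP; rewrite subr_eq0 => /eqP ->.
pose e z := rho%:C * epi z.
have ne z : nrm (e z) = rho * expR (2 * pi * - complex.Im z).
  by rewrite /e nrmM nrm_real gtr0_norm // nrm_epi mulrN.
have de z : differentiable e z by rewrite /e; dif.
have e_per z : e (z + 1) = e z by rewrite /e epiD epi1 mulr1.
have eR (x : R) : e (x +i* 0) = rho%:C * epi x%:C by [].
have e_le z : 0 <= complex.Im z -> nrm (e z) <= rho.
  move=> z0; rewrite ne; apply: ler_piMr; first exact: ltW.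
  rewrite -[leRHS]expR0 ler_expR mulrN oppr_le0 mulr_ge0 //.
  exact: ltW.
have [y0 y00 Hy0] := @expR_small (nrm q / rho) (divr_gt0 q0 rho0) ltac:(by rewrite ltr_pdivrMr // mul1r).
have e_neq z : complex.Im z != y0 -> e z != q.
  move=> zy; apply: contra zy => /eqP ezq; apply/eqP.
  have : rho * expR (2 * pi * - complex.Im z) = rho * expR (2 * pi * - y0).
    by rewrite -ne ezq Hy0 mulrC divfK ?gt_eqF.
  move/(mulfI (negbT (gt_eqF rho0)))/expR_inj/(mulfI (negbT (gt_eqF p0))).
  exact: oppr_inj.
have E1 : hmean (fun z => G (e z)) 0 = G 0.
  apply/eqP; rewrite -subr_eq0; apply/eqP/nrm0_eq0/le_anti; rewrite nrm_ge0 andbT.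
  apply/ler_addgt0Pl => eps eps0; rewrite addr0.
  have c0 : nrm (0 : R[i]) <= rho by rewrite nrm0 ltW.
  have /cont_nrm/(_ eps eps0)[t t0 Ht] := G_cont 0 c0.
  pose m := Num.min (t / 2 / rho) (nrm q / rho).
  have m0 : 0 < m by rewrite lt_min !divr_gt0.
  have mq : m <= nrm q / rho by rewrite ge_min lexx orbT.
  have mt : rho * m <= t / 2 by rewrite mulrC -ler_pdivlMr // ge_min lexx.
  have qr1 : nrm q / rho < 1 by rewrite ltr_pdivrMr // mul1r.
  clearbody m.
  have [Y Y0 HY] := expR_small m0 (le_lt_trans mq qr1).
  have yY : y0 <= Y.
    move: mq; rewrite -HY -Hy0 ler_expR ler_pM2l //; lra.
  have cGe z : 0 <= complex.Im z -> {for z, continuous (fun z => G (e z))}.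
    move=> z0; apply: (@cont_comp _ _ _ e G).
      exact/differentiable_continuous/de.
    exact/G_cont/e_le.
  rewrite (@hmean_indep_cont R _ y0 0 Y).
  - rewrite -[G 0](dmean_cst (G 0)) -(@dmeanB R (fun x => G (e (x +i* Y)))); last first.
    + exact: cont01_cst.
    + by apply: (@hcont_cont01 R (fun z => G (e z)) Y) => x; apply: cGe; exact: ltW.
    apply: dmean_bound.
      move=> x _; apply: contB; last exact: contC.
      by apply: (@continuous_hline R (fun z => G (e z))); apply: cGe; exact: ltW.
    move=> x _; apply/ltW/Ht; rewrite subr0 ne HY; lra.
  - by rewrite ltW.
  - by move=> z /andP[z0 _]; exact: cGe.
  - move=> z /andP[z0 _] zy; apply: dif_comp; first exact: de.
    by apply: G_dif; [exact: e_le|exact: e_neq].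
  - by move=> z _; rewrite e_per.
have inv_dif z : complex.Im z <= 0 -> differentiable (fun z => (e z - q)^-1) z.
  move=> z0; apply: difV; first by dif; exact: de.
  by rewrite subr_eq0 e_neq // lt_eqF // (le_lt_trans z0).
have E2 : hmean (fun z => (e z - q)^-1) 0 = 0.
  apply/nrm0_eq0/le_anti; rewrite nrm_ge0 andbT.
  apply/ler_addgt0Pl => eps eps0; rewrite addr0.
  have ei : 0 < eps^-1 by rewrite invr_gt0.
  have D0 : 0 < rho + nrm q + eps^-1 by rewrite !addr_gt0.
  have m1 : rho / (rho + nrm q + eps^-1) < 1 by rewrite ltr_pdivrMr // mul1r; lra.
  have [Y Y0 HY] := expR_small (divr_gt0 rho0 D0) m1.
  have nY x : nrm (e (x +i* - Y)) = rho + nrm q + eps^-1.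
    rewrite ne /= opprK -[Y]opprK mulrN expRN HY invf_div mulrC divfK ?gt_eqF //.
  rewrite -(@hmean_indep R _ (- Y) 0).
  - apply: hmean_bound.
      by move=> x; apply/differentiable_continuous/inv_dif; rewrite /= oppr_le0 ltW.
    move=> x; rewrite nrmV -[leRHS]invrK lef_pV2 ?posrE ?invr_gt0 //; last first.
      by rewrite nrm_gt0 subr_eq0 e_neq //= lt_eqF //; lra.
    by have := nrm_distl (e (x +i* - Y)) q; rewrite nY; lra.
  - by rewrite oppr_le0 ltW.
  - by move=> z /andP[_]; exact: inv_dif.
  - by move=> z _; rewrite e_per.
have cinv : hcont (fun z => (e z - q)^-1) 0.
  by move=> x; apply/differentiable_continuous/inv_dif.
have cfe : hcont (fun z => f (e z) * (e z - q)^-1) 0.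
  move=> x; apply: contM; last exact: cinv.
  apply: (@cont_comp _ _ _ e f); first exact/differentiable_continuous/de.
  exact/differentiable_continuous/df/e_le.
have E3 : hmean (fun z => G (e z)) 0 = hmean (fun z => f (e z) * (e z - q)^-1) 0.
  have cq : hcont (fun z => f q * (e z - q)^-1) 0.
    by move=> x; apply: contM; [exact: contC|exact: cinv].
  rewrite -[RHS]subr0 -(mulr0 (f q)) -E2 -(hmeanZ (f q) cinv) -(hmeanB cfe cq).
  apply: dmean_eq => x _.
  have n0 : e (x +i* 0) - q != 0 by rewrite subr_eq0 e_neq //= lt_eqF.
  by rewrite -mulrBl GK; field.
have := GK 0; rewrite f0 !sub0r -E1 E3 mulNr => /eqP.
by rewrite eqr_opp => /eqP.
Qed.

End Disc.

(** * Division by a linear form *)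

Section ParametricMean.
Variables (R : realType) (V : normedModType R[i]).

Lemma difDv (W : normedModType R[i]) (f g : V -> W) p : differentiable f p ->
  differentiable g p -> differentiable (fun q => f q + g q) p.
Proof. exact: differentiableD. Qed.

Lemma difZl (W : normedModType R[i]) (k : V -> R[i]) (w : W) p : differentiable k p ->
  differentiable (fun q => k q *: w) p.
Proof. exact: differentiableZl. Qed.

Lemma dif_line (p v : V) (s : R[i]) : differentiable (fun t : R[i] => p + t *: v) s.
Proof.
apply: (@differentiableD _ _ _ (fun=> p) (fun t : R[i] => t *: v)).
  exact: differentiable_cst.
apply: (@differentiableZl _ _ _ (fun t : R[i] => t) v); exact: dif_id.
Qed.

(** Transfers [taylor_bound] from the line in direction [v] to the differential of [f]. *)
Lemma diff_line (f : V -> R[i]) (p v : V) : differentiable f p ->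
  'd (fun t : R[i] => f (p + t *: v)) (0 : R[i]) (1 : R[i]) = 'd f p v.
Proof.
move=> df; pose g (t : R[i]) := f (p + t *: v).
have dg : differentiable g 0.
  apply: (@dif_comp _ _ _ _ (fun t : R[i] => p + t *: v) f); first exact: dif_line.
  by rewrite scale0r addr0.
apply/eqP; rewrite -subr_eq0; apply/eqP/nrm0_eq0/le_anti; rewrite nrm_ge0 andbT.
apply/ler_addgt0Pl => e e0; rewrite addr0.
have N1 : 0 < 1 + nrm v by rewrite ltr_pwDl ?nrm_ge0.
have e10 : 0 < e / (1 + nrm v) by rewrite divr_gt0.
have [d1 d10 H1] := diff_eps df e10; have [d2 d20 H2] := diff_eps dg e10.
pose t := Num.min (d1 / (2 * (1 + nrm v))) (d2 / 2).
have t0 : 0 < t by rewrite lt_min !divr_gt0 // mulr_gt0.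
have t1 : t * (1 + nrm v) < d1.
  have : t <= d1 / (2 * (1 + nrm v)) by rewrite ge_min lexx.
  by rewrite ler_pdivlMr ?mulr_gt0 //; lra.
have t2 : t < d2 by have : t <= d2 / 2 by [rewrite ge_min lexx orbT]; lra.
clearbody t.
have nt : nrm t%:C = t by rewrite nrm_real gtr0_norm.
have := H1 (t%:C *: v); have := H2 t%:C; rewrite nrmZ nt.
rewrite /g scale0r addr0 add0r => /(_ t2) h2 /(_ _)-h1.
have {}h1 : nrm (f (p + t%:C *: v) - f p - 'd f p (t%:C *: v)) <= e / (1 + nrm v) * (t * nrm v).
  by apply: h1; apply: le_lt_trans t1; rewrite ler_pM2l //; lra.
have E1 : 'd f p (t%:C *: v) = t%:C * 'd f p v by rewrite linearZ.
have E2 : 'd g 0 t%:C = t%:C * 'd g (0 : R[i]) (1 : R[i]).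
  exact: etrans (diff1E g 0 t%:C) (mulrC _ _).
have : nrm (t%:C * ('d g (0 : R[i]) (1 : R[i]) - 'd f p v)) <= t * e.
  have -> : t%:C * ('d g (0 : R[i]) (1 : R[i]) - 'd f p v) =
    (f (p + t%:C *: v) - f p - 'd f p (t%:C *: v)) - (f (p + t%:C *: v) - f p - 'd g 0 t%:C).
    by rewrite E1 E2; ring.
  apply: le_trans (nrmD _ _) _; rewrite nrmN.
  apply: le_trans (lerD h1 h2) _.
  have -> : e / (1 + nrm v) * (t * nrm v) + e / (1 + nrm v) * t = t * e.
    by field; rewrite gt_eqF.
  by [].
by rewrite nrmM nt ler_pM2l.
Qed.

Lemma periodic_unit (f : R -> R[i]) : (forall x, f (x + 1) = f x) ->
  forall x : R, exists2 y : R, 0 <= y <= 1 & f x = f y.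
Proof.
move=> pf x; exists (x - (Num.floor x)%:~R).
  have := floor_le x; have := floorD1_gt x; rewrite intrD => h1 h2.
  by apply/andP; split; lra.
by rewrite -mulrNz periodic_int.
Qed.

Section Parametric.
Variables (K : V -> R -> R[i]) (p : V) (r : R).
Hypothesis r0 : 0 < r.
Hypothesis Kper : forall q x, nrm (q - p) < r -> K q (x + 1) = K q x.
Hypothesis Kdif : forall q x, nrm (q - p) < r -> differentiable (K ^~ x) q.
Hypothesis Kcont : forall q x, nrm (q - p) < r ->
  {for (q, x), continuous (fun w : V * R => K w.1 w.2)}.

Let K_cont01 q : nrm (q - p) < r -> cont01 (K q).
Proof. by move=> qr; apply: joint_cont01 => x _; exact: Kcont. Qed.

Let K_contx q x : nrm (q - p) < r -> {for x, continuous (K q)}.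
Proof.
move=> qr; apply: (@cont_comp R (V * R)%type _ (fun x => (q, x)) _ x _ (Kcont qr)).
apply: contP; [exact: contC|exact: cont_id].
Qed.

Let bounded : exists B rho, [/\ 0 < B, 0 < rho, rho < r &
  forall q x, nrm (q - p) <= rho -> nrm (K q x) <= B].
Proof.
have pr : nrm (p - p) < r by rewrite subrr nrm0.
have [B0 B00 HB0] := cont01_bounded (K_cont01 pr).
have [d d0 Hd] := joint_uniform (fun x _ => Kcont pr) ltr01.
exists (B0 + 1), (Num.min d r / 2); have m0 : 0 < Num.min d r by rewrite lt_min d0.
have md : Num.min d r <= d by rewrite ge_min lexx.
have mr : Num.min d r <= r by rewrite ge_min lexx orbT.
split; [lra|lra|lra|] => q x qp.
have qd : nrm (q - p) < d by lra.
have qr : nrm (q - p) < r by lra.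
have [y y01 ->] := periodic_unit (fun x => Kper x qr) x.
have := Hd q qd y y01; have := HB0 y y01.
by have := nrm_distl (K q y) (K p y); lra.
Qed.

(** On the line s -> p + s v the values are bounded by [B] for |s| <= rho/|v|, and this radius is at
    least 2, as [taylor_bound] demands. *)
Let taylor B rho v x : 0 < B -> 0 < rho -> rho < r ->
  (forall q x, nrm (q - p) <= rho -> nrm (K q x) <= B) -> nrm v <= rho / 2 ->
  nrm (K (p + v) x - K p x - 'd (K ^~ x) p v) <= 3 * B / rho ^+ 2 * nrm v ^+ 2 /\
  nrm ('d (K ^~ x) p v) <= B / rho * nrm v.
Proof.
move=> B0 rho0 rhor HB vrho.
have [->|v0] := eqVneq v 0.
  by rewrite addr0 linear0 subr0 subrr !nrm0 expr0n !mulr0.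
have nv : 0 < nrm v by rewrite nrm_gt0.
pose f (s : R[i]) := K (p + s *: v) x.
have sv s : nrm s <= rho / nrm v -> nrm (p + s *: v - p) <= rho.
  by rewrite addrC addKr nrmZ ler_pdivlMr.
have r2 : 2 <= rho / nrm v by rewrite ler_pdivlMr //; lra.
have df s : nrm s <= rho / nrm v -> differentiable f s.
  move=> /sv sr; apply: (@dif_comp _ _ _ _ (fun t : R[i] => p + t *: v) (K ^~ x)).
    exact: dif_line.
  by apply: Kdif; apply: le_lt_trans rhor.
have [] := taylor_bound r2 df (fun s sr => HB _ x (sv s sr)).
have Ed : 'd f (0 : R[i]) (1 : R[i]) = 'd (K ^~ x) p v.
  by apply: (@diff_line (K ^~ x)); apply: Kdif; rewrite subrr nrm0.
rewrite Ed /f scale1r scale0r addr0 => h1 h2; split.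
  apply: le_trans h1 _; by rewrite expr_div_n invf_div mulrA mulrAC lexx.
by apply: le_trans h2 _; rewrite invf_div mulrA mulrAC lexx.
Qed.

(** Difference quotients in direction [v] are continuous in [x], and by [taylor] they converge to
    the differential uniformly in [x]. *)
Let diff_cont v x : {for x, continuous (fun x => 'd (K ^~ x) p v)}.
Proof.
have [B [rho [B0 rho0 rhor HB]]] := bounded.
apply/cont_nrmR => e e0.
have n0 := nrm_ge0 v.
pose M := 3 * B / rho ^+ 2 * nrm v ^+ 2.
have M0 : 0 <= M by rewrite mulr_ge0 ?sqr_ge0 // divr_ge0 ?sqr_ge0 // mulr_ge0 // ltW.
pose t := Num.min (rho / 2 / (nrm v + 1)) (e / (4 * (M + 1))).
have t0 : 0 < t by rewrite lt_min !divr_gt0 ?mulr_gt0 // ltr_wpDl.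
have tv : t * nrm v <= rho / 2.
  have : t <= rho / 2 / (nrm v + 1) by rewrite ge_min lexx.
  by rewrite ler_pdivlMr ?ltr_wpDl //; nra.
have tM : t * M <= e / 4.
  have : t <= e / (4 * (M + 1)) by rewrite ge_min lexx orbT.
  by rewrite ler_pdivlMr ?mulr_gt0 ?ltr_wpDl //; nra.
clearbody t.
have nt : nrm t%:C = t by rewrite nrm_real gtr0_norm.
have tn0 : t%:C != 0 by rewrite -nrm_gt0 nt.
have tvr : nrm (p + t%:C *: v - p) < r.
  by rewrite addrC addKr nrmZ nt; lra.
have close y : nrm ((K (p + t%:C *: v) y - K p y) / t%:C - 'd (K ^~ y) p v) <= e / 4.
  have [h _] := @taylor B rho (t%:C *: v) y B0 rho0 rhor HB ltac:(by rewrite nrmZ nt).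
  have -> : (K (p + t%:C *: v) y - K p y) / t%:C - 'd (K ^~ y) p v =
    (K (p + t%:C *: v) y - K p y - 'd (K ^~ y) p (t%:C *: v)) / t%:C.
    have -> : 'd (K ^~ y) p (t%:C *: v) = t%:C * 'd (K ^~ y) p v by rewrite linearZ.
    by field.
  rewrite nrmM nrmV nt ler_pdivrMr //; apply: le_trans h _.
  rewrite nrmZ nt exprMn mulrCA -/M; nra.
have cD : {for x, continuous (fun y => (K (p + t%:C *: v) y - K p y) / t%:C)}.
  apply: contM; last exact: contC.
  apply: contB; apply: K_contx => //; by rewrite subrr nrm0.
have /cont_nrmR/(_ (e / 4)) [|d d0 Hd] := cD; first by rewrite divr_gt0.
exists d => // y /Hd; have := close y; have := close x.
set Dy : R[i] := (K (p + t%:C *: v) y - K p y) / t%:C.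
set Dx : R[i] := (K (p + t%:C *: v) x - K p x) / t%:C.
have gen (ax ay : R[i]) : nrm (Dx - ax) <= e / 4 -> nrm (Dy - ay) <= e / 4 ->
    nrm (Dy - Dx) < e / 4 -> nrm (ay - ax) < e.
  move=> h1 h2 h3.
  have -> : ay - ax = - (Dy - ay) + ((Dy - Dx) + (Dx - ax)) by ring.
  apply: le_lt_trans (nrmD _ _) _; rewrite nrmN.
  by have := nrmD (Dy - Dx) (Dx - ax); lra.
exact: gen.
Qed.

(** Differentiation under the mean: the second-order remainder is bounded uniformly in [x], so the
    mean of the differentials is the differential of the mean. *)
Lemma dmean_differentiable : differentiable (fun q => dmean (K q)) p.
Proof.
have [B [rho [B0 rho0 rhor HB]]] := bounded.
have pr : nrm (p - p) < r by rewrite subrr nrm0.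
have ca v : cont01 (fun x => 'd (K ^~ x) p v) by move=> x _; exact: diff_cont.
have dK x : nrm (p - p) < r -> differentiable (K ^~ x) p by exact: Kdif.
apply: (@eps_diff R V _ (fun v => dmean (fun x => 'd (K ^~ x) p v)) p (B / rho)).
- move=> a u v; rewrite -[a *: _ in RHS]/(a * _) -(dmeanZ a (ca u)).
  rewrite -(dmeanD (@cont01Z _ a _ (ca u)) (ca v)).
  by apply: dmean_eq => x _; rewrite linearP.
- move=> v; apply: dmean_bound (ca v) _ => x _.
  have [->|v0] := eqVneq v 0; first by rewrite linear0 !nrm0 mulr0.
  have nv : 0 < nrm v by rewrite nrm_gt0.
  pose c := rho / 2 / nrm v; have c0 : 0 < c by rewrite !divr_gt0.
  have nc : nrm c%:C = c by rewrite nrm_real gtr0_norm.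
  have ncv : nrm (c%:C *: v) = rho / 2 by rewrite nrmZ nc divfK ?gt_eqF.
  have [_] := @taylor B rho (c%:C *: v) x B0 rho0 rhor HB ltac:(by rewrite ncv).
  by rewrite linearZ /= nrmM nrmZ nc mulrCA ler_pM2l.
- move=> e e0; pose M := 3 * B / rho ^+ 2.
  have M0 : 0 < M by rewrite divr_gt0 ?exprn_gt0 // mulr_gt0.
  exists (Num.min (rho / 2) (e / M)).
    by rewrite lt_min; apply/andP; split; apply: divr_gt0.
  move=> v; rewrite lt_min => /andP[v1 v2].
  have vr : nrm (p + v - p) < r by rewrite addrC addKr; lra.
  have c1 := K_cont01 vr; have c2 := K_cont01 pr.
  have c3 : cont01 (fun x => K (p + v) x - K p x).
    by move=> x x01; apply: contB; [exact: c1|exact: c2].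
  rewrite -(dmeanB c1 c2) -(dmeanB c3 (ca v)).
  apply: dmean_bound; first by move=> x x01; apply: contB; [exact: c3|exact: ca].
  move=> x _; have [h _] := @taylor B rho v x B0 rho0 rhor HB (ltW v1).
  apply: le_trans h _; rewrite -/M expr2 mulrA ler_wpM2r ?nrm_ge0 //.
  by rewrite mulrC -ler_pdivlMr // ltW.
Qed.

End Parametric.

(* Cauchy's formula along the lines with direction [w], transversal to the zero
   set of [l], represents the quotient [h / l] as a mean of differentiable
   functions. *)
Lemma divide_linear (h l : V -> R[i]) (w p : V) (d k : R) :
  linear l -> (forall v, nrm (l v) <= k * nrm v) -> l w = 1 -> 0 < d ->
  (forall q, nrm (q - p) < d -> differentiable h q) ->
  (forall q, nrm (q - p) < d -> l q = 0 -> h q = 0) ->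
  exists2 g : V -> R[i], differentiable g p & exists2 d' : R, 0 < d' &
    forall q, nrm (q - p) < d' -> differentiable g q /\ h q = l q * g q.
Proof.
move=> ll lk lw d0 dh h0.
have lD u v : l (u + v) = l u + l v by have := ll 1 u v; rewrite !scale1r.
have l00 : l 0 = 0 by have /eqP := lD 0 0; rewrite addr0 -subr_eq0 opprD addNKr oppr_eq0 => /eqP.
have lZ a u : l (a *: u) = a * l u by have := ll a u 0; rewrite !addr0 l00 addr0.
have lB u v : l (u - v) = l u - l v by rewrite lD -scaleN1r lZ mulN1r.
have k0 : 0 <= k.
  have w0 : 0 < nrm w.
    by rewrite nrm_gt0; apply/eqP => w0; move/eqP: lw; rewrite w0 l00 eq_sym oner_eq0.
  by have := lk w; rewrite lw nrm1 => h1; rewrite -(pmulr_lge0 _ w0); lra.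
have dl q : differentiable l q.
  apply: (@eps_diff R V _ l q k) => // e e0; exists 1 => // v _.
  have -> : l (q + v) - l q - l v = 0 by rewrite lD; ring.
  by rewrite nrm0 mulr_ge0 ?nrm_ge0 // ltW.
have cl q : {for q, continuous l} by apply/differentiable_continuous/dl.
suff [g [d' d'0 Hg]] : exists g, exists2 d' : R, 0 < d' &
    forall q, nrm (q - p) < d' -> differentiable g q /\ h q = l q * g q.
  exists g; last by exists d'.
  by have [] := Hg p ltac:(by rewrite subrr nrm0).
have [lp0|lp0] := eqVneq (l p) 0; last first.
  exists (fun q => h q / l q).
  have n0 : 0 < nrm (l p) by rewrite nrm_gt0.
  have /cont_nrm/(_ _ n0)[d1 d10 H1] := cl p.
  exists (Num.min d d1); first by rewrite lt_min d0.
  move=> q; rewrite lt_min => /andP[qd /H1 ql].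
  have lq0 : l q != 0.
    by apply/eqP => lq; move: ql; rewrite lq sub0r nrmN ltxx.
  split; last by field.
  by apply: difM; [exact: dh|apply: difV => //; exact: dl].
pose nw := nrm w + 1; have nw0 : 0 < nw by rewrite ltr_wpDl ?nrm_ge0.
pose rho := d / (4 * nw); have rho0 : 0 < rho by rewrite divr_gt0 // mulr_gt0.
pose d' := Num.min (d / 4) (rho / (2 * (k + 1))).
have k1 : 0 < k + 1 by rewrite ltr_wpDl.
have d'0 : 0 < d' by rewrite lt_min !divr_gt0 // mulr_gt0.
have d'd : d' <= d / 4 by rewrite ge_min lexx.
have rw : rho * nrm w <= d / 4.
  have : rho * nw = d / 4 by rewrite /rho; field; rewrite gt_eqF.
  by rewrite /nw; nra.
have lq q : nrm (q - p) < d' -> nrm (l q) < rho.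
  move=> qd; have -> : l q = l (q - p) by rewrite lB lp0 subr0.
  apply: le_lt_trans (lk _) _.
  have : d' <= rho / (2 * (k + 1)) by rewrite ge_min lexx orbT.
  by rewrite ler_pdivlMr ?mulr_gt0 //; have := nrm_ge0 (q - p); nra.
clearbody d' rho.
(* q + (s - l q) w is the point on the line through [q] where [l] takes the value s. As a function
   of s, [h] vanishes there at s = 0 and is h(q) at s = l(q), which is the situation of
   [cauchy_quotient]. *)
have inb q s : nrm (q - p) < d' -> nrm s <= rho -> nrm (q + (s - l q) *: w - p) < d.
  move=> qd sr; have -> : q + (s - l q) *: w - p = (q - p) + (s - l q) *: w by rewrite addrAC.
  apply: le_lt_trans (nrmD _ _) _; rewrite nrmZ.
  have := nrmD s (- l q); rewrite nrmN; have := lq q qd; have := nrm_ge0 w; nra.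
pose e (x : R) := rho%:C * epi x%:C.
have ne x : nrm (e x) = rho.
  by rewrite /e nrmM nrm_real gtr0_norm // nrm_epi /= mulr0 oppr0 expR0 mulr1.
pose K q x := h (q + (e x - l q) *: w) / (e x - l q).
have den q x : nrm (q - p) < d' -> e x - l q != 0.
  move=> /lq qr; rewrite subr_eq0; apply/eqP => exq.
  by move: qr; rewrite -exq ne ltxx.
exists (fun q => dmean (K q)); exists d'; first exact: d'0.
move=> q qd; split; last first.
  have /(_ rho (l q) rho0 (lq q qd)) := @cauchy_quotient R (fun s => h (q + (s - l q) *: w)).
  rewrite subrr scale0r addr0 sub0r; apply.
    move=> s sr; apply: (@dif_comp _ _ _ _ (fun t : R[i] => q + (t - l q) *: w) h).
      apply: (@differentiableD _ _ _ (fun=> q) (fun t : R[i] => (t - l q) *: w)).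
        exact: differentiable_cst.
      apply: (@differentiableZl _ _ _ (fun t : R[i] => t - l q) w).
      by dif.
    by apply: dh; exact: inb.
  apply: h0; last by rewrite lD lZ lw mulr1 subrr.
  by have := inb q 0 qd; rewrite nrm0 sub0r; apply; exact: ltW.
have qr u : nrm (u - q) < d' - nrm (q - p) -> nrm (u - p) < d'.
  move=> uq; have -> : u - p = (u - q) + (q - p) by rewrite addrA subrK.
  by apply: le_lt_trans (nrmD _ _) _; lra.
apply: (@dmean_differentiable K q (d' - nrm (q - p))).
- by rewrite subr_gt0.
- by move=> u x _; rewrite /K /e rmorphD /= rmorph1 epiD epi1 mulr1.
- move=> u x /qr ud; rewrite /K; apply: difM; last first.
    by apply: difV; [apply: difB; [exact: difC|exact: dl]|exact: den].
  apply: (@dif_comp _ _ _ _ (fun u => u + (e x - l u) *: w) h).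
    apply: difDv; first exact: dif_id.
    by apply: difZl; apply: difB; [exact: difC|exact: dl].
  by apply: dh; apply: inb => //; rewrite ne.
- move=> u x /qr ud.
  have ce : continuous e.
    apply: contT => y; apply: contM; first exact: contC.
    apply: (@cont_comp _ _ _ (fun y : R => y%:C) (@epi R)).
      exact: real_complex_continuous.
    exact: epi_continuous.
  have c1 : {for (u, x), continuous (fun v : V * R => e v.2 - l v.1)}.
    apply: contB.
      by apply: (@cont_comp _ _ _ snd e); [exact: cvg_snd|exact: ce].
    by apply: (@cont_comp _ _ _ fst l); [exact: cvg_fst|exact: cl].
  apply: contM; last by apply: contV; [exact: c1|exact: den].
  apply: (@cont_comp _ _ _ (fun v : V * R => v.1 + (e v.2 - l v.1) *: w) h).
    apply: contD; first exact: cvg_fst.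
    by apply: contZ; [exact: c1|exact: contC].
  by apply/differentiable_continuous/dh; apply: inb => //; rewrite ne.
Qed.

End ParametricMean.

(** * The norm of a matrix and its entries *)

Section MatrixNorm.
Variables (R : realType) (m n : nat).
Implicit Types v : 'M[R[i]]_(m, n).

Lemma nrm_coord v i j : nrm (v i j) <= nrm v.
Proof.
apply/ler_addgt0Pr => e e0; apply: ltW.
have : ball (0 : 'M[R[i]]_(m, n)) (nrm v + e)%:C v.
  rewrite mx_norm_ball /ball_ /= sub0r normrN nrmE ltcR; lra.
by move=> [_ /(_ i j)]; rewrite /ball /= mxE sub0r normrN nrmE ltcR.
Qed.

Lemma nrm_mx_lt v (d : R) : 0 < d -> (forall i j, nrm (v i j) < d) -> nrm v < d.
Proof.
move=> d0 H; have : ball (0 : 'M[R[i]]_(m, n)) d%:C v.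
  split; first by rewrite ltcR.
  by move=> i j; rewrite /ball /= mxE sub0r normrN nrmE ltcR.
by rewrite mx_norm_ball /ball_ /= sub0r normrN nrmE ltcR.
Qed.

End MatrixNorm.

(** * Symmetric ranges of integers and geometric sums *)

Section Geometric.
Variable R : realType.

Definition zrange K : seq int := [seq j%:Z - K%:Z | j <- iota 0 (K.*2).+1].

Lemma big_zrange (V : nmodType) K (F : int -> V) :
  \sum_(k <- zrange K) F k = \sum_(j < (K.*2).+1) F (j%:Z - K%:Z).
Proof. by rewrite /zrange big_map -[iota _ _]/(index_iota 0 (K.*2).+1) big_mkord. Qed.

Lemma mem_zrange K k : (k \in zrange K) = (`|k| <= K)%N.
Proof.
apply/mapP/idP => [[j]|kK].
  rewrite mem_iota add0n ltnS /= -addnn => jK ->; lia.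
exists (absz (k + K%:Z)); first by rewrite mem_iota add0n ltnS /= -addnn; lia.
lia.
Qed.

Lemma zrange_uniq K : uniq (zrange K).
Proof. by rewrite map_inj_uniq ?iota_uniq // => i j; lia. Qed.

Lemma geometric_bound (q : R) n : 0 <= q -> q < 1 ->
  (1 - q) * \sum_(j < n) q ^+ j <= 1.
Proof.
move=> q0 q1; have -> : (1 - q) * \sum_(j < n) q ^+ j = 1 - q ^+ n.
  elim: n => [|n IH]; first by rewrite big_ord0 mulr0 expr0 subrr.
  by rewrite big_ord_recr /= mulrDr IH exprS; ring.
by rewrite gerBl exprn_ge0.
Qed.

Lemma zrange_geometric (q : R) K : 0 <= q -> q < 1 ->
  \sum_(k <- zrange K) q ^+ `|k| <= 2 / (1 - q).
Proof.
move=> q0 q1; have q1' : 0 < 1 - q by rewrite subr_gt0.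
rewrite ler_pdivlMr // big_zrange mulrC.
rewrite -(big_mkord xpredT (fun j => q ^+ `|j%:Z - K%:Z|)).
rewrite (@big_cat_nat _ _ _ K) //= ?mulrDr; last by rewrite -addnn; lia.
have -> : \sum_(0 <= j < K) q ^+ `|j%:Z - K%:Z| = \sum_(j < K) q ^+ j.+1.
  rewrite big_nat_rev /= big_mkord; apply: eq_bigr => j _; congr (_ ^+ _).
  by have := ltn_ord j; lia.
have -> : \sum_(K <= j < (K.*2).+1) q ^+ `|j%:Z - K%:Z| = \sum_(j < K.+1) q ^+ j.
  rewrite -{1}[K]add0n big_addn big_mkord.
  have -> : ((K.*2).+1 - K = K.+1)%N by rewrite -addnn; lia.
  by apply: eq_bigr => j _; congr (_ ^+ _); lia.
rewrite (_ : 2 = 1 + 1) //; apply: lerD; last exact: geometric_bound.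
apply: le_trans (geometric_bound K q0 q1); rewrite ler_pM2l //.
by apply: ler_sum => j _; rewrite exprS ler_piMl ?exprn_ge0 // ltW.
Qed.

End Geometric.

(** * Fourier expansion on tube domains *)

Section TubeFourier.
Variables (R : realType) (m : nat).
Local Notation VC := 'cV[R[i]]_m.
Local Notation VR := 'cV[R]_m.
Variable Omega : VR -> Prop.
Hypothesis openO : forall y, Omega y -> exists2 d : R, 0 < d &
  forall y' : VR, (forall i, `|y' i 0 - y i 0| < d) -> Omega y'.
Hypothesis convexO : forall y y' (t : R), Omega y -> Omega y' -> 0 <= t <= 1 ->
  Omega (y + t *: (y' - y)).
Implicit Types (phi : VC -> R[i]) (z : VC) (i : 'I_m) (k : int).

Definition Imv z : VR := map_mx (@complex.Im R) z.
Definition in_tube z := Omega (Imv z).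
Definition ev i : VC := delta_mx i 0.

Definition tube_class phi :=
  (forall z, in_tube z -> differentiable phi z) /\
  (forall z i, in_tube z -> phi (z + ev i) = phi z).

(* Multiplying by epi(k z_i) gives the k-th term of the Fourier expansion in the
   i-th variable. *)
Definition Acoef i k phi z :=
  dmean (fun x : R => phi (z + x%:C *: ev i) * epi (- (k%:~R * (z i 0 + x%:C)))).

Lemma ev_coord i j : ev i j 0 = (j == i)%:R.
Proof. by rewrite mxE eqxx andbT. Qed.

Lemma Imv_shift_real z i (x : R) : Imv (z + x%:C *: ev i) = Imv z.
Proof.
apply/colP => j; rewrite !mxE raddfD /= andbT.
by case: (j == i); rewrite ?mulr1 ?mulr0 /= addr0.
Qed.

Lemma Imv_shift z i (w : R[i]) j :
  Imv (z + w *: ev i) j 0 = Imv z j 0 + (if j == i then complex.Im w else 0).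
Proof.
rewrite !mxE raddfD /= andbT; congr (_ + _).
by case: (j == i); rewrite ?mulr1 ?mulr0.
Qed.

Lemma in_tube_real z i x : in_tube z -> in_tube (z + x%:C *: ev i).
Proof. by rewrite /in_tube Imv_shift_real. Qed.

Lemma in_tube_open z : in_tube z -> exists2 d : R, 0 < d &
  forall q, nrm (q - z) < d -> in_tube q.
Proof.
move=> /openO[d d0 H]; exists d => // q qz; apply: H => j.
rewrite !mxE -raddfB; apply: le_lt_trans (Im_le_nrm _) _.
by apply: le_lt_trans qz; have := nrm_coord (q - z) j 0; rewrite !mxE.
Qed.

Lemma convex_line z i (w w' : R[i]) : in_tube (z + w *: ev i) -> in_tube (z + w' *: ev i) ->
  forall s : R[i], complex.Im w <= complex.Im s <= complex.Im w' -> in_tube (z + s *: ev i).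
Proof.
move=> h1 h2 s /andP[ws sw'].
have [E|ne] := eqVneq (complex.Im w) (complex.Im w').
  have Es : complex.Im s = complex.Im w by lra.
  suff : Imv (z + s *: ev i) = Imv (z + w *: ev i) by rewrite /in_tube => ->.
  by apply/colP => j; rewrite !Imv_shift Es.
have d0 : 0 < complex.Im w' - complex.Im w by rewrite lt_neqAle eq_sym subr_eq0 eq_sym ne /=; lra.
pose t := (complex.Im s - complex.Im w) / (complex.Im w' - complex.Im w).
have := @convexO _ _ t h1 h2; rewrite /in_tube; suff -> :
   Imv (z + s *: ev i) = Imv (z + w *: ev i) + t *: (Imv (z + w' *: ev i) - Imv (z + w *: ev i)).
  apply; apply/andP; split; first by apply: divr_ge0; [rewrite subr_ge0|exact: ltW].
  by rewrite ler_pdivrMr // mul1r lerD2r.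
have mxt (a b : VR) j : (a + t *: (b - a)) j 0 = a j 0 + t * (b j 0 - a j 0).
  by rewrite !mxE.
apply/colP => j; rewrite mxt !Imv_shift.
have tE : t * (complex.Im w' - complex.Im w) = complex.Im s - complex.Im w.
  by rewrite /t divfK // gt_eqF.
by case: (j == i); rewrite ?addr0 ?subrr ?mulr0 ?addr0 //; lra.
Qed.

Section Coefficient.
Variable phi : VC -> R[i].
Hypothesis Hphi : tube_class phi.

Let line z i (w : R[i]) := phi (z + w *: ev i).

Lemma line_dif z i w : in_tube (z + w *: ev i) -> differentiable (line z i) w.
Proof.
move=> zT; apply: (@dif_comp _ _ _ _ (fun t : R[i] => z + t *: ev i) phi).
  exact: dif_line.
exact: (Hphi.1).
Qed.

Lemma line_per z i w : in_tube (z + w *: ev i) -> line z i (w + 1) = line z i w.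
Proof. by move=> zT; rewrite /line scalerDl scale1r addrA Hphi.2. Qed.

Let G z i k (w : R[i]) := line z i w * epi (- (k%:~R * w)).

Let G_cont z i k w : in_tube (z + w *: ev i) -> {for w, continuous (G z i k)}.
Proof.
move=> zT; apply: contM; first exact/differentiable_continuous/line_dif.
have := @epi_dif R k%:~R 0 w; under eq_fun do rewrite subr0.
by move/differentiable_continuous.
Qed.

Lemma Acoef_line z i k (t : R[i]) : in_tube (z + t *: ev i) ->
  Acoef i k phi (z + t *: ev i) = epi (- (k%:~R * z i 0)) * hcoef (line z i) k (complex.Im t).
Proof.
move=> zT; have cG : hcont (G z i k) (complex.Im t).
  move=> x; apply: G_cont; rewrite /in_tube; move: zT; rewrite /in_tube.
  suff -> : Imv (z + t *: ev i) = Imv (z + (x +i* complex.Im t) *: ev i) by [].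
  by apply/colP => j; rewrite !Imv_shift.
have pG (x : R) : G z i k (x +i* complex.Im t + 1) = G z i k (x +i* complex.Im t).
  rewrite /G line_per; last first.
    rewrite /in_tube; move: zT; rewrite /in_tube.
    suff -> : Imv (z + t *: ev i) = Imv (z + (x +i* complex.Im t) *: ev i) by [].
    by apply/colP => j; rewrite !Imv_shift.
  by rewrite mulrDr mulr1 opprD -mulrNz epiDint.
rewrite -[hcoef _ _ _]/(hmean (G z i k) (complex.Im t)) -(@hmean_shift R _ _ (complex.Re t) cG pG).
rewrite -dmeanZ; last first.
  move=> x x01; apply: (@continuous_hline R (fun w => G z i k (w + (complex.Re t)%:C))).
  apply: (@cont_comp _ _ _ (fun w => w + (complex.Re t)%:C) (G z i k)).
    by cont.
  have -> : x +i* complex.Im t + (complex.Re t)%:C = (x + complex.Re t) +i* complex.Im t.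
    by apply/eqP; rewrite eq_complex /= addr0 !eqxx.
  exact: cG.
apply: dmean_eq => x _; rewrite /G /line.
have Et : x +i* complex.Im t + (complex.Re t)%:C = x%:C + t.
  by apply/eqP; rewrite eq_complex; case: (t) => a b /=; rewrite addr0 add0r !eqxx.
rewrite Et [RHS]mulrCA -epiD; congr (phi _ * epi _).
  by rewrite scalerDl [x%:C *: _ + _]addrC addrA.
by rewrite mxE mxE ev_coord eqxx mulr1; ring.
Qed.

Lemma Acoef_line0 z i k : in_tube z ->
  Acoef i k phi z = epi (- (k%:~R * z i 0)) * hcoef (line z i) k 0.
Proof.
by move=> zT; have := @Acoef_line z i k 0; rewrite scale0r addr0 => ->.
Qed.

Lemma Acoef_indep z i k (t : R[i]) : in_tube z -> in_tube (z + t *: ev i) ->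
  Acoef i k phi (z + t *: ev i) = Acoef i k phi z.
Proof.
move=> zT tT; rewrite Acoef_line // Acoef_line0 //; congr (_ * _).
have zT0 : in_tube (z + 0 *: ev i) by rewrite scale0r addr0.
have [t0|t0] := leP 0 (complex.Im t).
  apply: (@hcoef_indep R (line z i) 0 (complex.Im t)); rewrite ?lexx ?t0 //.
    by move=> w wt; apply: line_dif; apply: (convex_line zT0 tT).
  by move=> w wt; apply: line_per; apply: (convex_line zT0 tT).
apply: (@hcoef_indep R (line z i) (complex.Im t) 0); rewrite ?lexx ?(ltW t0) //.
  by move=> w wt; apply: line_dif; apply: (convex_line tT zT0).
by move=> w wt; apply: line_per; apply: (convex_line tT zT0).
Qed.

Lemma Acoef_integrand_cont i k z (x : R) : in_tube z ->
  {for x, continuous (fun x : R => phi (z + x%:C *: ev i) * epi (- (k%:~R * (z i 0 + x%:C))))}.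
Proof.
move=> zT; apply: contM.
  apply: (@cont_comp R _ _ (fun x : R => z + x%:C *: ev i) phi).
    apply: contD; first exact: contC.
    by apply: contZ; [exact: real_complex_continuous|exact: contC].
  exact/differentiable_continuous/Hphi.1/in_tube_real.
apply: (@cont_comp R _ _ (fun x : R => - (k%:~R * (z i 0 + x%:C))) (@epi R)); last exact: epi_continuous.
have -> : (fun x : R => - (k%:~R * (z i 0 + x%:C))) = fun x : R => - k%:~R * (z i 0 + x%:C).
  by apply/funext => y; rewrite mulNr.
by cont.
Qed.

Lemma Acoef_bound z i k B : in_tube z -> (forall x : R, nrm (phi (z + x%:C *: ev i)) <= B) ->
  nrm (Acoef i k phi z) <= B * expR (2 * pi * k%:~R * Imv z i 0).
Proof.
move=> zT HB; apply: dmean_bound.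
  by move=> x _; exact: Acoef_integrand_cont.
move=> x _; rewrite nrmM; apply: ler_pM; rewrite ?nrm_ge0 ?HB // nrm_epi raddfN /=.
by rewrite Im_intM raddfD /= addr0 mulrN opprK mulrA mxE.
Qed.

Lemma Acoef_class i k : tube_class (Acoef i k phi).
Proof.
split=> [z zT|z j zT].
  have [r r0 Hr] := in_tube_open zT.
  apply: (@dmean_differentiable R _ (fun q x => phi (q + x%:C *: ev i) * epi (- (k%:~R * (q i 0 + x%:C)))) z r r0).
  - move=> q x /Hr qT; congr (_ * _).
      by rewrite rmorphD rmorph1 scalerDl scale1r addrA Hphi.2 //; exact: in_tube_real.
    by rewrite rmorphD rmorph1 addrA [in LHS]mulrDr mulr1 opprD -mulrNz epiDint.
  - move=> q x /Hr qT; apply: difM.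
      apply: (@dif_comp _ _ _ _ (fun q => q + x%:C *: ev i) phi).
        by apply: difDv; [exact: dif_id|exact: differentiable_cst].
      exact/Hphi.1/in_tube_real.
    dif; exact: differentiable_coord.
  - move=> q x /Hr qT; apply: contM.
      apply: (@cont_comp _ _ _ (fun w : VC * R => w.1 + w.2%:C *: ev i) phi).
        apply: contD; first exact: cvg_fst.
        apply: contZ; last exact: contC.
        by apply: (@cont_comp _ _ _ snd (fun x : R => x%:C)); [exact: cvg_snd|exact: real_complex_continuous].
      exact/differentiable_continuous/Hphi.1/in_tube_real.
    apply: (@cont_comp _ _ _ (fun w : VC * R => - (k%:~R * (w.1 i 0 + w.2%:C))) (@epi R)); last exact: epi_continuous.
    have -> : (fun w : VC * R => - (k%:~R * (w.1 i 0 + w.2%:C))) = fun w : VC * R => - k%:~R * (w.1 i 0 + w.2%:C).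
      by apply/funext => y; rewrite mulNr.
    apply: contM; first exact: contC.
    apply: contD.
      apply: (@cont_comp _ _ _ fst (fun q : VC => q i 0)); first exact: cvg_fst.
      exact/differentiable_continuous/differentiable_coord.
    by apply: (@cont_comp _ _ _ snd (fun x : R => x%:C)); [exact: cvg_snd|exact: real_complex_continuous].
apply: dmean_eq => x _; congr (_ * _).
  by rewrite addrAC Hphi.2 //; exact: in_tube_real.
rewrite mxE ev_coord; case: (i == j); last by rewrite addr0.
by rewrite addrAC [in LHS]mulrDr mulr1 opprD -mulrNz epiDint.
Qed.

Lemma Acoef_expansion z i (e B : R) K : 0 < e ->
  in_tube (z + (- e *i) *: ev i) -> in_tube (z + (e *i) *: ev i) ->
  nrm (phi z) <= B -> (forall x : R, nrm (phi (z + (x +i* - e) *: ev i)) <= B) ->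
  (forall x : R, nrm (phi (z + (x +i* e) *: ev i)) <= B) ->
  nrm (\sum_(k <- zrange K) Acoef i k phi z * epi (k%:~R * z i 0) - phi z) <=
    4 * B / (1 - expR (2 * pi * - e)) * expR (2 * pi * - e) ^+ K.+1.
Proof.
move=> e0 T1 T2 B0 B1 B2.
have inT w : - e <= complex.Im w <= e -> in_tube (z + w *: ev i).
  exact: (convex_line T1 T2).
have zT : in_tube z by have := inT 0; rewrite scale0r addr0; apply => /=; apply/andP; lra.
have z0 : - e < complex.Im (0 : R[i]) < e by rewrite /= oppr_lt0 e0.
have y0 : - e <= 0 <= e by apply/andP; lra.
have := @fourier_error R (line z i) (- e) e (fun w h => line_dif (inT w h)) (fun w h => line_per (inT w h)) 0 z0 K 0 B y0.
have l0 : line z i 0 = phi z by rewrite /line scale0r addr0.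
rewrite l0 => /(_ B0 B1 B2); rewrite /= sub0r subr0.
have -> : fourier_sum (line z i) 0 K 0 = \sum_(k <- zrange K) Acoef i k phi z * epi (k%:~R * z i 0).
  rewrite big_zrange; apply: eq_bigr => j _; rewrite mulr0 epi0 mulr1.
  by rewrite Acoef_line0 // epiN mulrAC mulVf ?mul1r // epi_neq0.
move=> H; apply: le_trans H _.
set Q := expR _; suff -> : 4 * B / (1 - Q) * Q ^+ K.+1 =
  2 * B / (1 - Q) * Q ^+ K.+1 + 2 * B / (1 - Q) * Q ^+ K.+1 by [].
by ring.
Qed.

End Coefficient.

(** Coefficients remain functions on the tube, so one recursion covers expansions in all variables
    and in some of them; the latter give the coefficients along L that still depend on the
    coordinate of L^perp. *)
Fixpoint As (s : seq 'I_m) (ks : seq int) phi : VC -> R[i] :=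
  match s, ks with
  | i :: s', k :: ks' => As s' ks' (Acoef i k phi)
  | _, _ => phi
  end.

Fixpoint chi (s : seq 'I_m) (ks : seq int) z : R[i] :=
  match s, ks with
  | i :: s', k :: ks' => epi (k%:~R * z i 0) * chi s' ks' z
  | _, _ => 1
  end.

Lemma As_class s ks phi : tube_class phi -> tube_class (As s ks phi).
Proof.
elim: s ks phi => [|i s IH] [|k ks] phi //= H.
by apply: IH; exact: Acoef_class.
Qed.

Lemma As_ext s ks phi psi : (forall z, in_tube z -> phi z = psi z) ->
  forall z, in_tube z -> As s ks phi z = As s ks psi z.
Proof.
elim: s ks phi psi => [|i s IH] [|k ks] phi psi H z zT //=; [exact: H|exact: H|exact: H|].
apply: IH zT => w wT; apply: dmean_eq => x _; congr (_ * _).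
by apply: H; exact: in_tube_real.
Qed.

Definition invariant_in i phi :=
  forall z (t : R[i]), in_tube z -> in_tube (z + t *: ev i) -> phi (z + t *: ev i) = phi z.

Lemma Acoef_invariant i j k phi : tube_class phi -> invariant_in i phi ->
  invariant_in i (Acoef j k phi).
Proof.
move=> Hphi inv z t zT tT; have [ij|ij] := eqVneq i j.
  by subst j; exact: Acoef_indep.
apply: dmean_eq => x _; congr (_ * _).
  have -> : z + t *: ev i + x%:C *: ev j = z + x%:C *: ev j + t *: ev i by rewrite addrAC.
  apply: inv; first exact: in_tube_real.
  by rewrite addrAC; exact: in_tube_real.
by rewrite !mxE eqxx andbT eq_sym (negbTE ij) mulr0 addr0.
Qed.

Lemma As_invariant s ks phi i : tube_class phi -> size ks = size s ->
  i \in s \/ invariant_in i phi -> invariant_in i (As s ks phi).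
Proof.
elim: s ks phi => [|j s IH] [|k ks] phi //= Hphi.
  by move=> _ [].
move=> [sz] H; apply: IH => //; first exact: Acoef_class.
case: H => [|inv]; last by right; exact: Acoef_invariant.
rewrite inE => /orP[/eqP ->|]; last by left.
by right => z t zT tT; exact: Acoef_indep.
Qed.

Lemma tube_box z : in_tube z -> exists2 d : R, 0 < d &
  forall w : VC, (forall j, nrm (w j 0 - z j 0) < d) -> in_tube w.
Proof.
move=> /openO[d d0 H]; exists d => // w wz; apply: H => j.
rewrite !mxE -raddfB; exact: le_lt_trans (Im_le_nrm _) (wz j).
Qed.

Lemma invariant_box (S : pred 'I_m) phi z (d : R) : 0 < d ->
  (forall i, S i -> invariant_in i phi) ->
  (forall w : VC, (forall j, nrm (w j 0 - z j 0) < d) -> in_tube w) ->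
  forall w : VC, (forall j, nrm (w j 0 - z j 0) < d) -> (forall j, ~~ S j -> w j 0 = z j 0) ->
  phi w = phi z.
Proof.
move=> d0 inv zT w wd wS.
pose mix (L : seq 'I_m) : VC := \col_j (if j \in L then w j 0 else z j 0).
have mixd L j : nrm (mix L j 0 - z j 0) < d.
  by rewrite mxE; case: (j \in L) => //; rewrite subrr nrm0.
suff H L : phi (mix L) = phi z.
  rewrite -(H (enum 'I_m)); congr phi; apply/colP => j; by rewrite mxE mem_enum.
elim: L => [|i L IH].
  by congr phi; apply/colP => j; rewrite mxE in_nil.
rewrite -IH; have [iL|iL] := boolP (i \in L).
  congr phi; apply/colP => j; rewrite !mxE inE; case: eqP => [->|] //=.
  by rewrite iL.
have E : mix (i :: L) = mix L + (w i 0 - z i 0) *: ev i.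
  apply/colP => j; rewrite !mxE inE eqxx andbT; case: eqP => [->|] /=.
    by rewrite (negbTE iL) mulr1 addrC subrK.
  by rewrite mulr0 addr0.
have [Si|Si] := boolP (S i); last by rewrite E wS // subrr scale0r addr0.
rewrite E; apply: inv => //; first by apply: zT => j; exact: mixd.
by rewrite -E; apply: zT => j; exact: mixd.
Qed.

(** Invariance one variable at a time needs each intermediate point to stay in the tube, which only
    holds inside a box ([invariant_box]). The segment from [z] to [z'] is crossed in finitely many
    steps, each inside such a box. *)
Lemma invariant_const (S : pred 'I_m) phi z z' :
  (forall i, S i -> invariant_in i phi) -> in_tube z -> in_tube z' ->
  (forall j, ~~ S j -> z' j 0 = z j 0) -> phi z' = phi z.
Proof.
move=> inv zT zT' zS; pose g (t : R) : VC := z + t%:C *: (z' - z).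
have gT t : 0 <= t <= 1 -> in_tube (g t).
  move=> t01; rewrite /in_tube; have -> : Imv (g t) = Imv z + t *: (Imv z' - Imv z).
    apply/colP => j; rewrite !mxE raddfD /=; congr (_ + _).
    by case: (z' j 0) => a b; case: (z j 0) => a' b' /=; rewrite mul0r addr0.
  exact: convexO.
have gB t t' j : g t' j 0 - g t j 0 = (t' - t)%:C * (z' j 0 - z j 0).
  by rewrite !mxE rmorphB /=; ring.
pose M := nrm (z' - z) + 1; have M0 : 0 < M by rewrite ltr_wpDl ?nrm_ge0.
have [] := @unit_interval_uniform R (fun d t => forall t', `|t' - t| < d -> phi (g t') = phi (g t)).
- by move=> d d' t dd' H t' tt'; apply: H; apply: lt_le_trans dd'.
- move=> t t01; have [d d0 Hd] := tube_box (gT t t01).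
  have loc t' : `|t' - t| < d / M -> phi (g t') = phi (g t).
    rewrite (ltr_pdivlMr _ _ M0) => tt'; apply: (invariant_box d0 inv Hd).
      move=> j; rewrite gB nrmM nrm_real; apply: le_lt_trans tt'.
      rewrite ler_wpM2l //; have := nrm_coord (z' - z) j 0; rewrite !mxE /M; lra.
    by move=> j /zS E; apply/eqP; rewrite -subr_eq0 gB E subrr mulr0.
  exists (d / M / 2); first by rewrite !divr_gt0.
  have dM : 0 < d / M by rewrite divr_gt0.
  move=> t1 h1 t2 h2; rewrite (loc t1); last by lra.
  apply: loc; have -> : t2 - t = (t2 - t1) + (t1 - t) by rewrite addrA subrK.
  by apply: le_lt_trans (ler_normD _ _) _; lra.
- move=> d d0 H; pose N := (Num.truncn d^-1).+1.
  have N0 : (0 : R) < N%:R by rewrite ltr0n.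
  have Nd : N%:R^-1 < d.
    by rewrite -[ltRHS]invrK ltf_pV2 ?posrE ?invr_gt0 //; exact: truncnS_gt.
  have step n : (n <= N)%N -> phi (g (n%:R / N%:R)) = phi z.
    elim: n => [|n IH] nN; first by rewrite mul0r /g scale0r addr0.
    rewrite -(IH (ltnW nN)); apply: H.
      by rewrite divr_ge0 //= ler_pdivrMr // mul1r ler_nat ltnW.
    by rewrite -mulrBl -natr1 addrC addKr mul1r gtr0_norm ?invr_gt0.
  have := step N (leqnn N); rewrite divff ?gt_eqF // /g scale1r addrC subrK.
  by [].
Qed.

Definition box_bound (y : VR) (e : R) phi (B : R) :=
  forall z, (forall j, `|Imv z j 0 - y j 0| <= e) -> in_tube z /\ nrm (phi z) <= B.

Lemma tube_class_int phi z i (n : int) : tube_class phi -> in_tube z ->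
  phi (z + n%:~R *: ev i) = phi z.
Proof.
move=> Hphi zT; have P (k : nat) w : in_tube w -> phi (w + k%:R *: ev i) = phi w.
  elim: k => [|k IH] wT; first by rewrite scale0r addr0.
  rewrite -natr1 scalerDl scale1r addrA Hphi.2 ?IH //.
  by rewrite -(rmorph_nat (real_complex R)); exact: in_tube_real.
case: n => n; first exact: P.
rewrite NegzE mulrNz scaleNr -[LHS](P n.+1) ?subrK //.
by rewrite -scaleNr -[n.+1%:~R](rmorph_nat (real_complex R)) -rmorphN; exact: in_tube_real.
Qed.

(** The bound must be uniform in all real parts. In the induction, [s] lists the variables whose
    real part is already free; a variable is added by compactness of [0,1] and periodicity. The
    radius [d] again encodes the bound as its inverse. *)
Lemma local_bound phi z : tube_class phi -> in_tube z -> exists e B : R,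
  [/\ 0 < e, 0 <= B & box_bound (Imv z) e phi B].
Proof.
move=> Hphi zT; set y := Imv z.
have P (s : seq 'I_m) : forall z', Imv z' = y -> exists2 d : R, 0 < d & forall w,
    (forall j, j \in s -> `|Imv w j 0 - y j 0| < d) ->
    (forall j, j \notin s -> nrm (w j 0 - z' j 0) < d) ->
    in_tube w /\ nrm (phi w) <= d^-1.
  elim: s => [|i s IH] z' z'y.
    have z'T : in_tube z' by rewrite /in_tube z'y.
    have [d1 d10 H1] := tube_box z'T.
    have /differentiable_continuous/cont_nrm/(_ _ ltr01)[d2 d20 H2] := Hphi.1 z' z'T.
    pose B := nrm (phi z') + 1; have B0 : 0 < B by rewrite ltr_wpDl ?nrm_ge0.
    pose d := Num.min (Num.min d1 d2) B^-1.
    have d0 : 0 < d by rewrite !lt_min d10 d20 invr_gt0.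
    have dd1 : d <= d1 by rewrite !ge_min lexx.
    have dd2 : d <= d2 by rewrite !ge_min lexx !orbT.
    have dB : B <= d^-1 by rewrite -[leLHS]invrK lef_pV2 ?posrE ?invr_gt0 // ge_min lexx orbT.
    exists d => // w _ wz; split; first by apply: H1 => j; apply: lt_le_trans (wz j _) dd1.
    apply: le_trans dB; have := H2 w; rewrite /B => /(_ _)-H.
    have {}H : nrm (phi w - phi z') < 1.
      apply: H; apply: nrm_mx_lt => // a b; rewrite ord1 !mxE.
      by apply: lt_le_trans dd2; exact: wz.
    by have := nrm_distl (phi w) (phi z'); lra.
  pose zx (x : R) : VC := \col_j (if j == i then x +i* y i 0 else z' j 0).
  have zxy x : Imv (zx x) = y.
    apply/colP => j; rewrite !mxE; case: eqP => [-> //|_].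
    by have := congr1 (fun v : VR => v j 0) z'y; rewrite !mxE.
  have zxi x : zx x i 0 = x +i* y i 0 by rewrite mxE eqxx.
  have zxj x j : j != i -> zx x j 0 = z' j 0 by move=> ji; rewrite mxE (negbTE ji).
  have [is_|is_] := boolP (i \in s).
    have [d d0 H] := IH z' z'y; exists d => // w w1 w2; apply: H => j js.
      by apply: w1; rewrite inE js orbT.
    apply: w2; rewrite inE negb_or js andbT; apply: contraNneq js => ->; exact: is_.
  pose hyp (d x : R) (w : VC) := [/\ (forall j, j \in s -> `|Imv w j 0 - y j 0| < d),
     nrm (w i 0 - (x +i* y i 0)) < d &
     forall j, j != i -> j \notin s -> nrm (w j 0 - z' j 0) < d].
  have [] := @unit_interval_uniform R (fun d x => 0 < d -> forall w, hyp d x w ->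
      in_tube w /\ nrm (phi w) <= d^-1).
  - move=> d d' x dd' H d'0 w [w1 w2 w3].
    have d0 : 0 < d by apply: lt_le_trans dd'.
    have [|wT wB] := H d0 w.
      split; [move=> j js|..|move=> j ji js]; apply: lt_le_trans dd'; [exact: w1|exact: w2|exact: w3].
    by split => //; apply: le_trans wB _; rewrite lef_pV2 ?posrE.
  - move=> x _; have [d d0 H] := IH (zx x) (zxy x); exists (d / 2); first by rewrite divr_gt0.
    move=> x' xx' _ w [w1 w2 w3].
    have [|j js|wT wB] := H w.
    + by move=> j js; apply: lt_trans (w1 j js) _; lra.
    + have [->|ji] := eqVneq j i.
        rewrite zxi; have -> : w i 0 - (x +i* y i 0) = (w i 0 - (x' +i* y i 0)) + (x' - x)%:C.
          by rewrite rmorphB /= !complexDi; ring.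
        by apply: le_lt_trans (nrmD _ _) _; rewrite nrm_real; lra.
      by rewrite zxj //; apply: lt_trans (w3 j ji js) _; lra.
    by split => //; apply: le_trans wB _; rewrite lef_pV2 ?posrE ?divr_gt0 //; lra.
  - move=> d d0 H; exists d => // w w1 w2.
    pose x := complex.Re (w i 0); pose n := Num.floor x.
    pose w' := w + (- n)%:~R *: ev i.
    have w'E : w = w' + n%:~R *: ev i by rewrite /w' mulrNz scaleNr subrK.
    have w'i : w' i 0 = (x - n%:~R) +i* complex.Im (w i 0).
      rewrite !mxE !eqxx mulr1 mulrNz -(rmorph_int (real_complex R)) /x.
      by case: (w i 0) => a b /=; apply/eqP; rewrite eq_complex /= oppr0 addr0 !eqxx.
    have w'j j : j != i -> w' j 0 = w j 0.
      by move=> ji; rewrite !mxE (negbTE ji) mulr0 addr0.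
    have Iw' j : Imv w' j 0 = Imv w j 0.
      by rewrite /w' -(rmorph_int (real_complex R)) Imv_shift_real.
    have [||wT wB] := H (x - n%:~R) _ d0 w'.
    + have := floor_le x; have := floorD1_gt x; rewrite intrD -/n => h1 h2.
      by apply/andP; split; lra.
    + split.
      * by move=> j js; rewrite Iw'; apply: w1; rewrite inE js orbT.
      * rewrite w'i; have -> : (x - n%:~R) +i* complex.Im (w i 0) - ((x - n%:~R) +i* y i 0) =
           'i * (complex.Im (w i 0) - y i 0)%:C.
          by rewrite !complexDi rmorphB /=; ring.
        rewrite nrmM nrm_i mul1r nrm_real; have := w1 i; rewrite mxE; apply.
        by rewrite inE eqxx.
      * by move=> j ji js; rewrite w'j //; apply: w2; rewrite inE negb_or ji.
    + have wwT : in_tube w.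
        rewrite /in_tube; move: wT; rewrite /in_tube; congr Omega.
        by apply/colP => j; exact: Iw'.
      by split => //; rewrite w'E tube_class_int.
have [d d0 H] := P (enum 'I_m) z erefl.
exists (d / 2), d^-1; split; [by rewrite divr_gt0|by rewrite invr_ge0 ltW|].
move=> w wy; apply: H => j; last by rewrite mem_enum.
by move=> _; apply: le_lt_trans (wy j) _; lra.
Qed.

End TubeFourier.

(** * Absolute convergence of the multiple Fourier series *)

Section TubeSeries.
Variables (R : realType) (m : nat).
Local Notation VC := 'cV[R[i]]_m.
Local Notation VR := 'cV[R]_m.
Variable Omega : VR -> Prop.
Hypothesis openO : forall y, Omega y -> exists2 d : R, 0 < d &
  forall y' : VR, (forall i, `|y' i 0 - y i 0| < d) -> Omega y'.
Hypothesis convexO : forall y y' (t : R), Omega y -> Omega y' -> 0 <= t <= 1 ->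
  Omega (y + t *: (y' - y)).
Implicit Types (phi : VC -> R[i]) (z : VC) (i : 'I_m) (k : int).

Fixpoint zbox K n : seq (seq int) :=
  if n is n'.+1 then [seq k :: ks | k <- zrange K, ks <- zbox K n'] else [:: [::]].

Lemma zboxS K n : zbox K n.+1 = [seq k :: ks | k <- zrange K, ks <- zbox K n].
Proof. by []. Qed.

Lemma big_zbox (V : nmodType) K n (F : seq int -> V) :
  \sum_(ks <- zbox K n.+1) F ks = \sum_(k <- zrange K) \sum_(ks <- zbox K n) F (k :: ks).
Proof. by rewrite zboxS big_allpairs_dep. Qed.

Lemma mem_zbox K n ks : (ks \in zbox K n) = (size ks == n) && all (fun k : int => (`|k| <= K)%N) ks.
Proof.
elim: n ks => [|n IH] [|k ks]; rewrite ?inE ?zboxS //.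
  by apply/negP => /allpairsP[[a b] [_ _]].
rewrite [RHS]/=; apply/allpairsP/idP => [[[a b] [ha hb [-> ->]]]|].
  by move: ha hb; rewrite mem_zrange IH eqSS => -> /andP[-> ->].
rewrite eqSS => /and3P[sk kK aK]; exists (k, ks); rewrite mem_zrange IH.
by split => //=; apply/andP.
Qed.

Lemma zbox_uniq K n : uniq (zbox K n).
Proof.
elim: n => // n IH; rewrite zboxS; apply: allpairs_uniq => //; first exact: zrange_uniq.
by move=> [a b] [c d] _ _ /= [-> ->].
Qed.

Lemma zbox_weight (q : R) K n : 0 <= q -> q < 1 ->
  \sum_(ks <- zbox K n) \prod_(k <- ks) q ^+ `|k| <= (2 / (1 - q)) ^+ n.
Proof.
move=> q0 q1; elim: n => [|n IH]; first by rewrite /= big_seq1 big_nil expr0.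
rewrite big_zbox exprS.
under eq_bigr do (under eq_bigr do rewrite big_cons; rewrite -mulr_sumr).
rewrite -mulr_suml; apply: ler_pM => //.
- by apply: sumr_ge0 => k _; rewrite exprn_ge0.
- by apply: sumr_ge0 => ks _; apply: prodr_ge0 => k _; rewrite exprn_ge0.
- exact: zrange_geometric.
Qed.

(** The coefficient does not depend on the i-th variable, so it may be estimated at height y_i - e
    for k >= 0 and y_i + e for k < 0; either way a factor exp(-2 pi e |k|) is gained. *)
Lemma Acoef_box (y : VR) (e B : R) i k phi : tube_class Omega phi -> 0 < e ->
  box_bound Omega y e phi B ->
  box_bound Omega y e (Acoef i k phi)
    (B * expR (2 * pi * k%:~R * y i 0) * expR (2 * pi * - e) ^+ `|k|).
Proof.
move=> Hphi e0 HB z zy; have [zT _] := HB z zy; split=> //.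
pose h := if 0 <= k then - e else e.
pose t : R[i] := (y i 0 + h - Imv z i 0) *i.
have Iw j : Imv (z + t *: ev R i) j 0 = if j == i then y i 0 + h else Imv z j 0.
  by rewrite Imv_shift; case: eqP => [->|_] /=; rewrite ?addr0 // addrC subrK.
have wb j : `|Imv (z + t *: ev R i) j 0 - y j 0| <= e.
  rewrite Iw; case: eqP => [->|_]; last exact: zy.
  by rewrite addrAC subrr add0r /h; case: ifP => _; rewrite ?normrN gtr0_norm.
have [wT _] := HB _ wb.
rewrite -(Acoef_indep convexO Hphi k zT wT).
apply: le_trans (Acoef_bound Hphi k wT (B := B) _) _.
  move=> x; apply: (HB _ _).2 => j; rewrite Imv_shift_real; exact: wb.
rewrite Iw eqxx -[leRHS]mulrA -expRM_natr -expRD.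
have [B0|B0] := leP 0 B; last first.
  by have := le_lt_trans (nrm_ge0 _) (le_lt_trans (HB z zy).2 B0); rewrite ltxx.
rewrite ler_wpM2l // ler_expR mulrDr lerD2l /h.
case: (k) => n /=; rewrite ?NegzE //.
  by rewrite mulrAC lexx.
by rewrite mulrNz mulrN mulNr -mulrN mulrAC lexx.
Qed.

Lemma nrm_epi_coord k z i :
  nrm (epi (k%:~R * z i 0)) = expR (- (2 * pi * k%:~R * Imv z i 0)).
Proof. by rewrite nrm_epi Im_intM mulrA mxE. Qed.

Lemma As_term_bound s ks phi z (e B : R) : tube_class Omega phi -> 0 < e ->
  box_bound Omega (Imv z) e phi B -> size ks = size s ->
  nrm (As s ks phi z * chi s ks z) <= B * \prod_(k <- ks) expR (2 * pi * - e) ^+ `|k|.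
Proof.
move=> Hphi e0 HB; elim: s ks phi B Hphi HB => [|i s IH] [|k ks] phi B Hphi HB //=.
  move=> _; rewrite big_nil !mulr1; apply: (HB z _).2 => j.
  by rewrite subrr normr0 ltW.
move=> [sz]; rewrite big_cons.
have H := IH ks _ _ (Acoef_class openO Hphi i k) (Acoef_box i k Hphi e0 HB) sz.
rewrite mulrCA nrmM nrm_epi_coord.
apply: le_trans (ler_wpM2l (expR_ge0 _) H) _.
set Q := expR _ ^+ `|k|; set P := \prod_(_ <- _) _; set E := expR (2 * pi * k%:~R * _).
rewrite expRN -/E; have E0 : E != 0 by rewrite gt_eqF // expR_gt0.
by have -> : E^-1 * (B * E * Q * P) = B * (Q * P) by field.
Qed.

(** [C] has to be independent of [phi], since the induction applies the statement to every
    coefficient in the first variable. Their errors carry the weights q^|k| of [Acoef_box], of total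
    at most 2/(1 - q); the exponential factors of [Acoef_box] cancel against the character. *)
Lemma As_expansion s (y : VR) (e : R) : 0 < e -> exists2 C : R, 0 <= C &
  forall phi B K z, tube_class Omega phi -> 0 <= B -> box_bound Omega y e phi B ->
    Imv z = y ->
    nrm (\sum_(ks <- zbox K (size s)) As s ks phi z * chi s ks z - phi z) <=
      C * B * expR (2 * pi * - e) ^+ K.+1.
Proof.
move=> e0; set q := expR (2 * pi * - e).
have q0 : 0 <= q by exact: expR_ge0.
have q1 : q < 1 by rewrite expR_lt1 pmulr_rlt0 ?oppr_lt0 // mulr_gt0 // pi_gt0.
have q1' : 0 < 1 - q by rewrite subr_gt0.
elim: s => [|i s [C C0 IH]].
  exists 0 => // phi B K z _ _ _ _ /=; rewrite big_seq1 mulr1 subrr nrm0 !mul0r lexx //.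
exists (C * (2 / (1 - q)) + 4 / (1 - q)); first by have h := ltW q1'; rewrite addr_ge0 // ?[0 <= C * _]mulr_ge0 // divr_ge0.
move=> phi B K z Hphi B0 HB zy.
have zB : forall j, `|Imv z j 0 - y j 0| <= e by move=> j; rewrite zy subrr normr0 ltW.
pose psi k := Acoef i k phi.
pose S k := \sum_(ks <- zbox K (size s)) As s ks (psi k) z * chi s ks z.
have -> : \sum_(ks <- zbox K (size (i :: s))) As (i :: s) ks phi z * chi (i :: s) ks z - phi z =
   \sum_(k <- zrange K) epi (k%:~R * z i 0) * (S k - psi k z) +
   (\sum_(k <- zrange K) psi k z * epi (k%:~R * z i 0) - phi z).
  rewrite addrA -big_split -[size (i :: s)]/(size s).+1 big_zbox; congr (_ - _).
  apply: eq_bigr => k _; rewrite [RHS]/= [psi k z * _]mulrC -mulrDr subrK mulr_sumr.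
  by apply: eq_bigr => ks _; rewrite mulrCA.
rewrite [(_ + _) * B]mulrDl [(_ + _) * q ^+ _]mulrDl; apply: le_trans (nrmD _ _) _; apply: lerD.
  apply: le_trans (nrm_le_sum _ _ _) _.
  apply: (@le_trans _ _ (\sum_(k <- zrange K) C * B * q ^+ K.+1 * q ^+ `|k|)).
    apply: ler_sum => k _; rewrite nrmM nrm_epi_coord zy.
    have B'0 : 0 <= B * expR (2 * pi * k%:~R * y i 0) * q ^+ `|k|.
      by rewrite !mulr_ge0 ?expR_ge0 ?exprn_ge0.
    have H := IH _ _ K z (Acoef_class openO Hphi i k) B'0 (Acoef_box i k Hphi e0 HB) zy.
    apply: le_trans (ler_wpM2l (expR_ge0 _) H) _.
    set E := expR (2 * pi * k%:~R * _); rewrite expRN -/E.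
    have E0 : E != 0 by rewrite gt_eqF // expR_gt0.
    set Q := q ^+ K.+1; set Q' := q ^+ `|k|.
    by have -> : E^-1 * (C * (B * E * Q') * Q) = C * B * Q * Q' by field.
  rewrite -mulr_sumr.
  have -> : C * (2 / (1 - q)) * B * q ^+ K.+1 = C * B * q ^+ K.+1 * (2 / (1 - q)) by ring.
  by rewrite ler_wpM2l ?zrange_geometric // !mulr_ge0 // exprn_ge0.
have bw (h x : R) : `|h| <= e -> in_tube Omega (z + (x +i* h) *: ev R i) /\
     nrm (phi (z + (x +i* h) *: ev R i)) <= B.
  move=> he; apply: HB => j; rewrite Imv_shift zy addrAC subrr add0r.
  by case: (j == i) => //=; rewrite normr0 ltW.
have ne : `|- e| <= e by rewrite normrN gtr0_norm.
have pe : `|e| <= e by rewrite gtr0_norm.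
have T1 : in_tube Omega (z + (- e *i) *: ev R i).
  have -> : (- e *i) = 0 +i* - e :> R[i] by apply/eqP; rewrite eq_complex /= oppr0 !eqxx.
  exact: (bw _ 0 ne).1.
have := @Acoef_expansion R m Omega convexO phi Hphi z i e B K e0 T1 (bw _ 0 pe).1 (HB z zB).2
  (fun x => (bw _ x ne).2) (fun x => (bw _ x pe).2).
by rewrite -/q -[4 / (1 - q) * B]mulrAC.
Qed.

Lemma expr_small (q e : R) : 0 <= q -> q < 1 -> 0 < e ->
  exists N, forall n, (N <= n)%N -> q ^+ n <= e.
Proof.
move=> q0 q1 e0; have /cvgrPdist_le/(_ e e0)[N _ HN] : (fun n => q ^+ n) @ \oo --> (0 : R).
  by apply: cvg_expr; rewrite ger0_norm.
exists N => n Nn; have := HN n Nn; rewrite /= sub0r normrN ger0_norm //.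
exact: exprn_ge0.
Qed.

Lemma fourier_converges s phi z : tube_class Omega phi -> in_tube Omega z ->
  forall e : R, 0 < e -> exists K0, forall K, (K0 <= K)%N ->
  nrm (\sum_(ks <- zbox K (size s)) As s ks phi z * chi s ks z - phi z) <= e.
Proof.
move=> Hphi zT e e0; have [d [B [d0 B0 HB]]] := local_bound openO Hphi zT.
have [C C0 HC] := As_expansion s (Imv z) d0.
have q0 : 0 <= expR (2 * pi * - d) by exact: expR_ge0.
have q1 : expR (2 * pi * - d) < 1 by rewrite expR_lt1 pmulr_rlt0 ?oppr_lt0 // mulr_gt0 // pi_gt0.
have CB : 0 < C * B + 1 by rewrite ltr_wpDl // mulr_ge0.
have [N HN] := expr_small q0 q1 (divr_gt0 e0 CB).
exists N => K NK; apply: le_trans (HC phi B K z Hphi B0 HB erefl) _.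
have := HN K.+1 (leqW NK); rewrite ler_pdivlMr //.
have : 0 <= expR (2 * pi * - d) ^+ K.+1 by rewrite exprn_ge0.
have : 0 <= C * B by rewrite mulr_ge0.
by nra.
Qed.

Lemma fourier_abs_bounded s phi z : tube_class Omega phi -> in_tube Omega z ->
  exists M : R, forall K,
  \sum_(ks <- zbox K (size s)) nrm (As s ks phi z * chi s ks z) <= M.
Proof.
move=> Hphi zT; have [d [B [d0 B0 HB]]] := local_bound openO Hphi zT.
have q0 : 0 <= expR (2 * pi * - d) by exact: expR_ge0.
have q1 : expR (2 * pi * - d) < 1 by rewrite expR_lt1 pmulr_rlt0 ?oppr_lt0 // mulr_gt0 // pi_gt0.
exists (B * (2 / (1 - expR (2 * pi * - d))) ^+ size s) => K.
apply: (@le_trans _ _ (\sum_(ks <- zbox K (size s)) B * \prod_(k <- ks) expR (2 * pi * - d) ^+ `|k|)).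
  rewrite big_seq [leRHS]big_seq; apply: ler_sum => ks; rewrite mem_zbox => /andP[/eqP sz _].
  exact: As_term_bound.
by rewrite -mulr_sumr ler_wpM2l // zbox_weight.
Qed.

(** Cauchy's estimate with no shift of height: only values over the same imaginary part enter. This
    is what allows comparing the points of an orbit in [koecher]. *)
Lemma As_line_bound s ks phi z B : tube_class Omega phi -> in_tube Omega z ->
  (forall w, Imv w = Imv z -> nrm (phi w) <= B) -> size ks = size s ->
  nrm (As s ks phi z * chi s ks z) <= B.
Proof.
elim: s ks phi B => [|i s IH] [|k ks] phi B //= Hphi zT HB.
  by move=> _; rewrite mulr1; apply: HB.
move=> [sz].
have := IH ks _ (B * expR (2 * pi * k%:~R * Imv z i 0)) (Acoef_class openO Hphi i k) zT _ sz.
move=> /(_ _)-H; rewrite mulrCA nrmM nrm_epi_coord expRN mulrC ler_pdivrMr ?expR_gt0 //.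
apply: H => w wz; rewrite -wz; apply: (Acoef_bound Hphi).
  by rewrite /in_tube wz.
by move=> x; apply: HB; rewrite Imv_shift_real.
Qed.

Lemma As_factor s ks phi (P : VC -> R[i]) z : tube_class Omega phi -> in_tube Omega z ->
  (forall i w (x : R), i \in s -> P (w + x%:C *: ev R i) = P w) ->
  As s ks (fun w => P w * phi w) z = P z * As s ks phi z.
Proof.
elim: s ks phi => [|i s IH] [|k ks] phi //= Hphi zT HP.
rewrite -IH //; last first.
- by move=> j w x js; apply: HP; rewrite inE js orbT.
- exact: Acoef_class.
apply: (As_ext (Omega := Omega)) zT => w wT; rewrite /Acoef -dmeanZ; last first.
  by move=> x _ A /(Acoef_integrand_cont Hphi wT).
by apply: dmean_eq => x _; rewrite HP ?inE ?eqxx // mulrA.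
Qed.

Lemma As_translate s ks phi (c : VC) (a : R[i]) : tube_class Omega phi ->
  Imv c = 0 -> (forall z, in_tube Omega z -> phi (z + c) = a * phi z) ->
  forall z, in_tube Omega z -> As s ks phi (z + c) * chi s ks c = a * As s ks phi z.
Proof.
move=> Hphi c0; elim: s ks phi a Hphi => [|i s IH] [|k ks] phi a Hphi H z zT /=;
  try by rewrite mulr1; exact: H.
rewrite mulrCA; have ai w : in_tube Omega w ->
    Acoef i k phi (w + c) = a * epi (- (k%:~R * c i 0)) * Acoef i k phi w.
  move=> wT; rewrite /Acoef -dmeanZ; last by move=> x _ A /(Acoef_integrand_cont Hphi wT).
  apply: dmean_eq => x _; rewrite addrAC H; last exact: in_tube_real.
  have -> : - (k%:~R * ((w + c) i 0 + x%:C)) = - (k%:~R * (w i 0 + x%:C)) + - (k%:~R * c i 0).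
    by rewrite mxE; ring.
  by rewrite epiD; move: (phi _) (epi _) (epi _) => u v u'; ring.
rewrite (IH ks _ _ (Acoef_class openO Hphi i k) ai) // epiN.
by field; exact: epi_neq0.
Qed.

End TubeSeries.

(** * Unconditional sums by exhaustion *)

Section Summation.
Variables (R : realType) (I : choiceType).

Lemma ler_sum_subset (F : I -> R) (a b : seq I) : uniq a -> uniq b -> {subset a <= b} ->
  (forall x, 0 <= F x) -> \sum_(x <- a) F x <= \sum_(x <- b) F x.
Proof.
move=> ua ub ab F0; rewrite [leRHS](bigID (mem a)) /= -[X in _ <= X + _]big_filter.
have pe : perm_eq [seq x <- b | x \in a] a.
  apply: uniq_perm; rewrite ?filter_uniq // => x; rewrite mem_filter andb_idr //.
  exact: ab.
by rewrite (perm_big _ pe) lerDl sumr_ge0.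
Qed.

Lemma totally_exhaustion (t : I -> R[i]) (Bx : nat -> seq I) (l : R[i]) (M : R) :
  (forall K, uniq (Bx K)) ->
  (forall K K', (K <= K')%N -> {subset Bx K <= Bx K'}) ->
  (forall x, t x != 0 -> exists K, x \in Bx K) ->
  (forall e : R, 0 < e -> exists K0, forall K, (K0 <= K)%N -> nrm (\sum_(x <- Bx K) t x - l) <= e) ->
  (forall K, \sum_(x <- Bx K) nrm (t x) <= M) ->
  partial_sum t @ totally --> l.
Proof.
move=> uB mB cB conv bd; have FF : Filter (@totally I) := @filter_filter _ _ (@totally_filter I).
apply/cvg_nrm => e e0.
pose N K := \sum_(x <- Bx K) nrm (t x).
have hs : has_sup (range N).
  by split; [exists (N 0%N); exists 0%N|exists M => _ [K _ <-]; exact: bd].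
have e3 : 0 < e / 3 by rewrite divr_gt0.
have [_ [K1 _ <-] HK1] := sup_adherent e3 hs.
have [K0 HK0] := conv _ e3.
pose K := maxn K1 K0.
have NK : sup (range N) - e / 3 < N K.
  apply: lt_le_trans HK1 _; apply: ler_sum_subset => // [|x]; last exact: nrm_ge0.
  exact/mB/leq_maxl.
exists [fset x in Bx K]%fset => // J /= KJ.
have -> : partial_sum t J = \sum_(x <- J) t x by rewrite /partial_sum big_seq_fsetE.
rewrite (bigID (mem (Bx K))) /= -big_filter.
have pe : perm_eq [seq x <- J | x \in Bx K] (Bx K).
  apply: uniq_perm; rewrite ?filter_uniq ?fset_uniq // => x; rewrite mem_filter andb_idr // => xB.
  by move/fsubsetP: KJ; apply; rewrite inE.
rewrite (perm_big _ pe) /=.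
have [K' HK'] : exists K', (K <= K')%N /\ forall x, x \in (J : seq I) -> t x != 0 -> x \in Bx K'.
  elim: (J : seq I) => [|x s [K' [KK' IH]]]; first by exists K.
  have [tx|tx] := eqVneq (t x) 0.
    exists K'; split => // y; rewrite inE => /orP[/eqP ->|]; [by rewrite tx eqxx|exact: IH].
  have [K2 HK2] := cB x tx; exists (maxn K' K2); split.
    by rewrite leq_max KK'.
  move=> y; rewrite inE => /orP[/eqP -> _|ys ty].
    by apply: mB HK2; exact: leq_maxr.
  by apply: (mB K'); [exact: leq_maxl|exact: IH].
have {}HK' := HK'; case: HK' => KK' HK'.
have rest : nrm (\sum_(x <- J | x \notin Bx K) t x) <= e / 3.
  apply: le_trans (nrm_le_sum _ _ _) _.
  have -> : \sum_(x <- J | x \notin Bx K) nrm (t x) =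
      \sum_(x <- [seq x <- J | (x \notin Bx K) && (t x != 0)]) nrm (t x).
    rewrite big_filter big_mkcondr /=; apply: eq_bigr => x _.
    by case: eqVneq => [->|] //=; rewrite nrm0.
  apply: (@le_trans _ _ (\sum_(x <- [seq x <- Bx K' | x \notin Bx K]) nrm (t x))).
    apply: ler_sum_subset => [|||x]; rewrite ?filter_uniq ?fset_uniq ?nrm_ge0 //.
    by move=> x; rewrite !mem_filter => /andP[/andP[-> tx] xJ] /=; exact: HK'.
  have NE : N K' = N K + \sum_(x <- [seq x <- Bx K' | x \notin Bx K]) nrm (t x).
    rewrite /N (bigID (mem (Bx K))) /= -big_filter big_filter; congr (_ + _); last by rewrite big_filter.
    rewrite -big_filter; apply: perm_big; apply: uniq_perm; rewrite ?filter_uniq // => x.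
    rewrite mem_filter andb_idr //; exact: mB.
  have : N K' <= sup (range N) by apply: sup_upper_bound => //; exists K'.
  by lra.
have := HK0 K (leq_maxr _ _); set A := \sum_(x <- Bx K) t x.
set A' := \sum_(x <- J | _) t x in rest *.
have -> : A + A' - l = (A - l) + A' by ring.
by move=> h; apply: le_lt_trans (nrmD _ _) _; lra.
Qed.

End Summation.

(** * Lattices of signature (2,n) *)

Section Bilinear.
Variables (A : comNzRingType) (d : nat) (S : 'M[int]_d).
Implicit Types (x y z : 'cV[A]_d) (a : A).

Lemma bilDl x y z : bil S (x + y) z = bil S x z + bil S y z.
Proof. by rewrite /bil raddfD /= !mulmxDl mxE. Qed.
Lemma bilDr x y z : bil S z (x + y) = bil S z x + bil S z y.
Proof. by rewrite /bil mulmxDr mxE. Qed.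
Lemma bilZl a x y : bil S (a *: x) y = a * bil S x y.
Proof. by rewrite /bil linearZ /= -!scalemxAl mxE. Qed.
Lemma bilZr a x y : bil S x (a *: y) = a * bil S x y.
Proof. by rewrite /bil -scalemxAr mxE. Qed.
Lemma bilNl x y : bil S (- x) y = - bil S x y.
Proof. by rewrite -scaleN1r bilZl mulN1r. Qed.
Lemma bilNr x y : bil S x (- y) = - bil S x y.
Proof. by rewrite -scaleN1r bilZr mulN1r. Qed.
Lemma bil0l x : bil S 0 x = 0.
Proof. by rewrite -(scale0r x) bilZl mul0r. Qed.
Lemma bil0r x : bil S x 0 = 0.
Proof. by rewrite -(scale0r x) bilZr mul0r. Qed.

Lemma bilE x y : bil S x y = \sum_i \sum_j x i 0 * (S i j)%:~R * y j 0.
Proof.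
rewrite /bil mxE exchange_big /=; apply: eq_bigr => j _; rewrite mxE mulr_suml.
by apply: eq_bigr => i _; rewrite !mxE.
Qed.

Lemma bilC x y : S^T = S -> bil S x y = bil S y x.
Proof.
move=> Ssym; rewrite !bilE exchange_big; apply: eq_bigr => i _; apply: eq_bigr => j _.
have -> : S j i = S i j by rewrite -{1}Ssym mxE.
by ring.
Qed.

End Bilinear.

Definition bil_lin := (bilDl, bilDr, bilZl, bilZr, bilNl, bilNr).

Lemma bil_map (A A' : comNzRingType) (f : {rmorphism A -> A'}) d (S : 'M[int]_d) (x y : 'cV[A]_d) :
  f (bil S x y) = bil S (map_mx f x) (map_mx f y).
Proof.
rewrite !bilE rmorph_sum; apply: eq_bigr => i _; rewrite rmorph_sum; apply: eq_bigr => j _.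
by rewrite !rmorphM /= rmorph_int !mxE.
Qed.

Lemma bil_pull (A : comNzRingType) d e (S : 'M[int]_d) (S' : 'M[int]_e) (g : 'M[int]_(d, e))
    (x y : 'cV[A]_e) : g^T *m S *m g = S' ->
  bil S (map_mx intr g *m x) (map_mx intr g *m y) = bil S' x y.
Proof. by move=> <-; rewrite /bil trmx_mul map_trmx !map_mxM !mulmxA. Qed.

Lemma bil_mull (A : comNzRingType) d e (S : 'M[int]_d) (g : 'M[int]_(d, e)) (x : 'cV[A]_e) (y : 'cV[A]_d) :
  bil S (map_mx intr g *m x) y = (x^T *m (map_mx intr (g^T *m S) *m y)) ord0 ord0.
Proof. by rewrite /bil trmx_mul map_trmx !map_mxM !mulmxA. Qed.

Lemma mx_bil_inj d (S S' : 'M[int]_d) : (forall x y : 'cV[int]_d, bil S x y = bil S' x y) -> S = S'.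
Proof.
move=> H; apply/matrixP => i j; have := H (delta_mx i 0) (delta_mx j 0).
have E (T : 'M[int]_d) : bil T (delta_mx i 0) (delta_mx j 0) = T i j.
  rewrite bilE (bigD1 i) //= (bigD1 j) //= !mxE !eqxx mul1r mulr1 intz.
  rewrite !big1 ?addr0 // => [k ki|k kj]; last by rewrite !mxE (negbTE kj) mulr0.
  by apply: big1 => l _; rewrite !mxE (negbTE ki) !mul0r.
by rewrite !E.
Qed.

Section Signature.
Variables (R : realType) (n : nat) (S : 'M[int]_n.+2).
Hypothesis hS : has_signature_2n R S.
Local Notation VR := 'cV[R]_n.+2.
Implicit Types (u h x y : VR).

Let Ssym : S^T = S := hS.1.

(* A combination of u, h, x whose two positive coordinates vanish has
   non-positive norm. *)
Lemma signature_orth_neg u h x : 0 < bil S u u -> 0 < bil S h h -> bil S u h = 0 ->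
  bil S x u = 0 -> bil S x h = 0 -> x != 0 -> bil S x x < 0.
Proof.
case: hS => _ [P Pu PSP] u0 h0 uh xu xh x0.
rewrite ltNge; apply/negP => xx.
pose c (v : VR) := invmx P *m v.
have cK v : P *m c v = v by rewrite mulmxA mulmxV ?mul1mx.
have q v : bil S v v = \sum_(j < n.+2) (if (j < 2)%N then 1 else -1) * c v j 0 ^+ 2.
  rewrite -{1 2}(cK v); move: (c v) => w; rewrite /bil trmx_mul.
  have -> : w^T *m P^T *m map_mx intr S *m (P *m w) = w^T *m (P^T *m map_mx intr S *m P) *m w.
    by rewrite !mulmxA.
  rewrite PSP mul_mx_diag mxE; apply: eq_bigr => j _; by rewrite !mxE (ord1 ord0) mulrAC -expr2 mulrC; congr (_ * _); case: ifP.
have cL a b e : c (a *: u + b *: h + e *: x) = a *: c u + b *: c h + e *: c x.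
  by rewrite /c 2!mulmxDr -!scalemxAr.
have c0 : c 0 = 0 by exact: mulmx0.
clearbody c; pose N : 'M[R]_(3, 2) := \matrix_(i, j)
  c (if i == 0 then u else if i == 1 then h else x) (widen_ord (isT : (2 <= n.+2)%N) j) 0.
have : kermx N != 0.
  rewrite -mxrank_eq0 mxrank_ker -lt0n subn_gt0; apply: leq_ltn_trans (rank_leq_col _) _.
  by [].
move=> /rowV0Pn[w /sub_kermxP wN w0].
pose v : VR := w 0 0 *: u + w 0 1 *: h + w 0 2%:R *: x.
have cv (j : 'I_n.+2) : (j < 2)%N -> c v j 0 = 0.
  move=> j2; have := congr1 (fun M : 'M_(1, 2) => M 0 (Ordinal j2)) wN.
  rewrite mxE 3!big_ord_recl big_ord0 !mxE addr0 /=.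
  have -> : widen_ord (isT : (2 <= n.+2)%N) (Ordinal j2) = j by apply: val_inj.
  rewrite /v cL !mxE => <-.
  by rewrite addrA; congr (_ * _ + _ * _ + _ * _); congr (w _ _); apply: val_inj.
have v0 : bil S v v <= 0.
  rewrite q; apply: sumr_le0 => j _; case: ifP => [/cv ->|_]; first by rewrite expr0n mulr0.
  by rewrite mulN1r oppr_le0 sqr_ge0.
have vE : bil S v v = w 0 0 ^+ 2 * bil S u u + w 0 1 ^+ 2 * bil S h h + w 0 2%:R ^+ 2 * bil S x x.
  rewrite /v !bil_lin (bilC h u) // (bilC u x) // (bilC h x) // uh xu xh; ring.
have h1 := mulr_ge0 (sqr_ge0 (w 0 0)) (ltW u0).
have h2 := mulr_ge0 (sqr_ge0 (w 0 1)) (ltW h0).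
have h3 := mulr_ge0 (sqr_ge0 (w 0 2%:R)) xx.
have /eqP : w 0 0 ^+ 2 * bil S u u = 0 by lra.
rewrite mulf_eq0 (gt_eqF u0) orbF sqrf_eq0 => /eqP w00.
have /eqP : w 0 1 ^+ 2 * bil S h h = 0 by lra.
rewrite mulf_eq0 (gt_eqF h0) orbF sqrf_eq0 => /eqP w01.
have w02 : w 0 2%:R != 0.
  apply: contraNneq w0 => w02; apply/eqP/rowP => j; rewrite mxE.
  by case: j => [[|[|[|]]]] // Hj; [rewrite -w00|rewrite -w01|rewrite -w02]; congr (w _ _); apply: val_inj.
have vv0 : bil S v v = 0 by lra.
have cv0 : c v = 0.
  apply/colP => j; rewrite [RHS]mxE; apply/eqP; have [/cv -> //|j2] := ltnP j 2.
  rewrite -sqrf_eq0 -oppr_eq0 -mulN1r; apply/eqP; move: vv0; rewrite q.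
  have F0 (i : 'I_n.+2) : true -> 0 <= - ((if (i < 2)%N then 1 else -1) * c v i 0 ^+ 2).
    move=> _; case: ifP => [/cv ->|_]; first by rewrite expr0n mulr0 oppr0.
    by rewrite mulN1r opprK sqr_ge0.
  move=> /(congr1 -%R); rewrite oppr0 -sumrN => /(psumr_eq0P F0)/(_ j isT)/eqP.
  by rewrite oppr_eq0 ltnNge j2 /= => /eqP.
move: cv0; rewrite /v w00 w01 !scale0r !add0r => /(congr1 (mulmx P)); rewrite cK mulmx0.
by move/eqP; rewrite scaler_eq0 (negbTE w02) (negbTE x0).
Qed.

Lemma signature_positive_pair : exists u h, [/\ 0 < bil S u u, 0 < bil S h h & bil S u h = 0].
Proof.
case: hS => _ [P Pu PSP].
have E (i j : 'I_n.+2) : bil S (col i P) (col j P) =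
   (diag_mx (\row_(j < n.+2) (if (j < 2)%N then 1 else -1)) : 'M[R]_n.+2) i j.
  rewrite -PSP /bil tr_col -row_mul -!row_mul !mxE; apply: eq_bigr => k _.
  by rewrite !mxE.
by exists (col 0 P), (col 1 P); rewrite !E !mxE /= !ltr01.
Qed.

Variable h : VR.
Hypothesis h0 : 0 < bil S h h.

Lemma orth_cone_neq0 u y : bil S u h = 0 -> bil S y h = 0 -> 0 < bil S u u ->
  0 <= bil S y y -> y != 0 -> bil S y u != 0.
Proof.
move=> uh yh u0 yy y0; apply/negP => /eqP yu.
by have := signature_orth_neg u0 h0 uh yu yh y0; rewrite ltNge yy.
Qed.

(** Reversed Cauchy-Schwarz inequality: the combination [w] of y and y' is orthogonal to both [u]
    and [h], so its norm is at most 0, and expanding this norm bounds (y, y') from below. *)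
Lemma orth_cone_pos u y y' : bil S u h = 0 -> bil S y h = 0 -> bil S y' h = 0 ->
  0 < bil S u u -> 0 < bil S y y -> 0 <= bil S y' y' -> 0 < bil S y u -> 0 < bil S y' u ->
  0 < bil S y y'.
Proof.
move=> uh yh y'h u0 yy y'y' yu y'u.
pose w := bil S y' u *: y - bil S y u *: y'.
have wu : bil S w u = 0 by rewrite /w !bil_lin; ring.
have wh : bil S w h = 0 by rewrite /w !bil_lin yh y'h; ring.
have ww : bil S w w <= 0.
  have [->|w0] := eqVneq w 0; first by rewrite bil0l.
  exact/ltW/(signature_orth_neg u0 h0).
have E : bil S w w = bil S y' u ^+ 2 * bil S y y + bil S y u ^+ 2 * bil S y' y' -
    2 * (bil S y u * bil S y' u) * bil S y y'.
  by rewrite /w !bil_lin (bilC y' y) //; ring.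
have p1 : 0 < bil S y' u ^+ 2 * bil S y y by rewrite mulr_gt0 // exprn_gt0.
have p2 : 0 <= bil S y u ^+ 2 * bil S y' y' by rewrite mulr_ge0 // sqr_ge0.
have p3 : 0 < 2 * (bil S y u * bil S y' u) by rewrite !mulr_gt0.
rewrite -(pmulr_rgt0 _ p3); lra.
Qed.

Lemma orth_cone_convex u y y' (t : R) : bil S u h = 0 -> bil S y h = 0 -> bil S y' h = 0 ->
  0 < bil S u u -> 0 < bil S y y -> 0 < bil S y' y' -> 0 < bil S y u -> 0 < bil S y' u ->
  0 <= t <= 1 ->
  0 < bil S (y + t *: (y' - y)) (y + t *: (y' - y)) /\ 0 < bil S (y + t *: (y' - y)) u.
Proof.
move=> uh yh y'h u0 yy y'y' yu y'u /andP[t0 t1].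
have yy' := orth_cone_pos uh yh y'h u0 yy (ltW y'y') yu y'u.
have E : bil S (y + t *: (y' - y)) (y + t *: (y' - y)) =
  (1 - t) ^+ 2 * bil S y y + 2 * (t * (1 - t) * bil S y y') + t ^+ 2 * bil S y' y'.
  by rewrite !bil_lin (bilC y' y) //; ring.
have E' : bil S (y + t *: (y' - y)) u = (1 - t) * bil S y u + t * bil S y' u.
  by rewrite !bil_lin; ring.
have t1' : 0 <= 1 - t by lra.
rewrite E E'; have [->|tn] := eqVneq t 0.
  by rewrite subr0 expr1n expr0n /= !mul0r !mul1r mulr0 !addr0.
have tp : 0 < t by rewrite lt_neqAle eq_sym tn.
split; last by apply: ltr_wpDl; rewrite ?mulr_ge0 ?mulr_gt0 // ltW.
apply: ltr_wpDl; last by rewrite mulr_gt0 // exprn_gt0.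
by rewrite addr_ge0 ?mulr_ge0 ?sqr_ge0 // ltW.
Qed.

(* A frequency l + j whose projection l lies outside the open cone is not in the
   dual cone. *)
Lemma orth_cone_dual u l j : bil S u h = 0 -> bil S l h = 0 -> bil S j h = 0 ->
  0 < bil S u u -> bil S l j = 0 -> bil S u j = 0 -> bil S j j < 0 ->
  ~ (0 < bil S l l /\ 0 < bil S l u) ->
  exists y, exists s t, [/\ y = s *: u + t *: (l + j), 0 < bil S y y, 0 < bil S y u & bil S (l + j) y < 0].
Proof.
move=> uh lh jh u0 lj uj jj Nl.
have ju : bil S j u = 0 by rewrite bilC.
have jl : bil S j l = 0 by rewrite bilC.
set k := l + j.
have ku : bil S k u = bil S l u by rewrite /k bilDl ju addr0.
have kk : bil S k k = bil S l l + bil S j j by rewrite /k !bil_lin lj jl; ring.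
have [lu|lu] := ltP (bil S l u) 0.
  by exists u, 1, 0; rewrite scale1r scale0r addr0 ku.
have ll : bil S l l <= 0.
  rewrite leNgt; apply/negP => ll; apply: Nl; split => //.
  rewrite lt_neqAle lu andbT eq_sym; apply: (orth_cone_neq0 uh lh u0 (ltW ll)).
  by apply: contraTneq ll => ->; rewrite bil0l ltxx.
have kn : bil S k k < 0 by lra.
have uk : bil S u k = bil S l u by rewrite bilC.
set a := bil S l u in ku lu uk; set U := bil S u u in u0; set N := bil S k k in kn kk.
(* With s = e - a/N the vector u + s k pairs with k to e N < 0 and has norm U - a^2/N + e^2 N. The
   choice of e keeps U + e^2 N positive, because (U - N)^2 + U N > 0. *)
pose e := U / (U - N); have UN : 0 < U - N by lra.
have e0 : 0 < e by rewrite divr_gt0.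
pose s := e - a / N.
clearbody k; exists (1 *: u + s *: k), 1, s; split => //.
- have E : bil S (1 *: u + s *: k) (1 *: u + s *: k) = U - a ^+ 2 / N + e ^+ 2 * N.
    by rewrite !bil_lin -/U -/N ku uk /s; field; rewrite lt_eqF.
  have h1 : 0 <= - (a ^+ 2 / N) by rewrite -mulrN -invrN divr_ge0 ?sqr_ge0 // oppr_ge0 ltW.
  have h2 : 0 < U + e ^+ 2 * N.
    have -> : U + e ^+ 2 * N = U * ((U - N) ^+ 2 + U * N) / (U - N) ^+ 2.
      by rewrite /e; field; rewrite gt_eqF.
    rewrite divr_gt0 ?exprn_gt0 // mulr_gt0 //; nra.
  by rewrite E; lra.
- rewrite !bil_lin ku -/U mul1r; have : 0 <= s * a.
    have aN : 0 <= - (a / N) by rewrite -mulrN -invrN divr_ge0 // oppr_ge0 ltW.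
    by rewrite mulr_ge0 // /s; lra.
  by lra.
- rewrite bilDr !bilZr ku -/N /s mulrBl mulrVK ?unitfE ?lt_eqF //.
  have : e * N < 0 by rewrite pmulr_rlt0.
  by lra.
Qed.

End Signature.

(** * Rational linear algebra with integral matrices *)

Lemma kernel_factor (F : fieldType) d q e (N : 'M[F]_(q, d)) (X : 'M[F]_(e, d)) :
  (forall x : 'cV[F]_d, N *m x = 0 -> X *m x = 0) -> exists Z, X = Z *m N.
Proof.
move=> H; suff /submxP : (X <= N)%MS by [].
rewrite submxE; apply/eqP/matrixP => i j.
have : X *m col j (cokermx N) = 0 by apply: H; rewrite colE mulmxA mulmx_coker mul0mx.
by rewrite colE mulmxA -colE => /(congr1 (fun v : 'cV_e => v i 0)); rewrite [in X in X -> _]mxE => ->; rewrite !mxE.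
Qed.

Lemma common_denominator d e (X : 'M[rat]_(d, e)) :
  exists (D : nat) (Y : 'M[int]_(d, e)), (0 < D)%N /\ D%:R *: X = map_mx intr Y.
Proof.
pose D := (\prod_i \prod_j `|denq (X i j)|)%N.
have D0 : (0 < D)%N.
  by rewrite prodn_gt0 // => i; rewrite prodn_gt0 // => j; rewrite absz_gt0 denq_neq0.
have dD i j : (`|denq (X i j)| %| D)%N.
  by rewrite /D (bigD1 i) //= (bigD1 j) //= -mulnA dvdn_mulr.
exists D, (\matrix_(i, j) (numq (X i j) * (D %/ `|denq (X i j)|)%N%:Z)); split => //.
apply/matrixP => i j; rewrite !mxE rmorphM /= -{1}(divnK (dD i j)) natrM.
rewrite -mulrA mulrC; congr (_ * _); rewrite -[X in _ * X]divq_num_den mulrC.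
have -> : (`|denq (X i j)|%N)%:R = (denq (X i j))%:~R :> rat by rewrite -[in RHS]absz_denq.
by rewrite divfK // intr_eq0 denq_neq0.
Qed.

(** The columns of [E] are integral but only a rational basis of the kernel, not necessarily a basis
    of its integral points. [P] gives coordinates: on the kernel the third identity reads x = E (P
    x). *)
Lemma kernel_basis d q (N : 'M[rat]_(q, d)) :
  exists (a : nat) (E : 'M[int]_(d, a)) (P : 'M[rat]_(a, d)) (Z : 'M[rat]_(d, q)),
  [/\ N *m map_mx intr E = 0, P *m map_mx intr E = 1%:M,
      1%:M = map_mx intr E *m P + Z *m N & (d <= a + q)%N].
Proof.
pose K := kermx N^T; pose a := \rank K; pose E0 := (row_base K)^T.
have NE0 : N *m E0 = 0.
  apply: trmx_inj; rewrite trmx_mul trmx0 trmxK; apply/sub_kermxP.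
  by rewrite eq_row_base submx_refl.
pose P0 := (pinvmx (row_base K))^T.
have PE0 : P0 *m E0 = 1%:M.
  by apply: trmx_inj; rewrite trmx_mul !trmxK trmx1 mulmxVp ?row_base_free.
have [Z HZ] : exists Z, 1%:M - E0 *m P0 = Z *m N.
  apply: kernel_factor => x Nx.
  have /submxP[y xy] : (x^T <= row_base K)%MS.
    by rewrite eq_row_base; apply/sub_kermxP; rewrite -trmx_mul Nx trmx0.
  have -> : x = E0 *m y^T by apply: trmx_inj; rewrite trmx_mul !trmxK.
  by rewrite mulmxBl mul1mx -mulmxA (mulmxA P0) PE0 mul1mx subrr.
have [D [E [D0 HE]]] := common_denominator E0.
have Dn : (D%:R : rat) != 0 by rewrite pnatr_eq0 -lt0n.
exists a, E, (D%:R^-1 *: P0), Z; rewrite -HE; split.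
- by rewrite -scalemxAr NE0 scaler0.
- by rewrite -scalemxAr -scalemxAl scalerA divff // scale1r PE0.
- by rewrite -scalemxAl -scalemxAr scalerA divff // scale1r -HZ addrC subrK.
have -> : d = \rank (E0 *m P0 + Z *m N)%R.
  by rewrite -HZ addrC subrK mxrank1.
apply: leq_trans (mxrank_add _ _) (leq_add _ _).
  exact: leq_trans (mxrankM_maxl _ _) (rank_leq_col _).
exact: leq_trans (mxrankM_maxr _ _) (rank_leq_row _).
Qed.

Section GenericVector.
Variables (d : nat) (G : 'M[int]_d) (V : 'cV[int]_d -> Prop).
Hypothesis V0 : V 0.
Hypothesis VD : forall (k : int) x y, V x -> V y -> V (k *: x + y).

Lemma generic_vector (s : seq 'cV[int]_d) :
  (forall r, r \in s -> exists2 w, V w & bil G w r != 0) ->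
  exists2 w, V w & forall r, r \in s -> bil G w r != 0.
Proof.
elim: s => [|r s IH] H; first by exists 0.
have [|w Vw Hw] := IH; first by move=> r' r's; apply: H; rewrite inE r's orbT.
have [wr|wr] := eqVneq (bil G w r) 0; last first.
  by exists w => // r'; rewrite inE => /orP[/eqP ->|/Hw].
have [|x Vx xr] := H r; first exact: mem_head.
(* [M] exceeds every |(x, r')|, so adding x to M w cannot cancel a non-zero pairing of w, whereas r,
   orthogonal to w, is now detected by x. *)
pose M : int := 1 + \sum_(r' <- s) `|bil G x r'|.
exists (M *: w + x); first exact: VD.
move=> r'; rewrite inE bilDl bilZl => /orP[/eqP ->|r's]; first by rewrite wr mulr0 add0r.
have MM : `|bil G x r'| < M.
  rewrite /M addrC ltzD1 (big_rem _ r's) /= lerDl; exact: sumr_ge0.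
have w1 : 1 <= `|bil G w r'| by rewrite -gtz0_ge1 normr_gt0 Hw.
apply/negP => /eqP E; have : `|M * bil G w r'| = `|bil G x r'|.
  by rewrite (_ : M * _ = - bil G x r') ?normrN //; apply/eqP; rewrite -addr_eq0 E.
have M0 : 0 < M by apply: le_lt_trans MM.
rewrite normrM (gtr0_norm M0) => E'; have : M <= M * `|bil G w r'| by rewrite ler_peMr // ltW.
by rewrite E' leNgt MM.
Qed.

End GenericVector.

(** Sylvester's identity, from two factorisations of one block matrix. It reduces the determinants
    of reflections, Eichler transformations and extended isometries to smaller ones. *)
Lemma det1D_mulmx (R : comNzRingType) d e (X : 'M[R]_(d, e)) (Y : 'M[R]_(e, d)) :
  \det (1%:M + X *m Y) = \det (1%:M + Y *m X).
Proof.
have E1 : block_mx 1%:M (- X) Y 1%:M =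
    block_mx 1%:M 0 Y 1%:M *m block_mx 1%:M (- X) 0 (1%:M + Y *m X).
  by rewrite mulmx_block !mul1mx !mul0mx !mulmx1 ?mulmx0 !addr0 mulmxN [1%:M + _]addrC addKr.
have E2 : block_mx 1%:M (- X) Y 1%:M =
    block_mx (1%:M + X *m Y) (- X) 0 1%:M *m block_mx 1%:M 0 Y 1%:M.
  by rewrite mulmx_block !mul1mx !mul0mx !mulmx1 ?mulmx0 ?add0r mulNmx addrK.
have := congr1 determinant E1; rewrite {1}E2 !det_mulmx !det_ublock !det_lblock !det1.
by rewrite !mul1r !mulr1.
Qed.

(** * Pell's equation *)

Section Pell.
Variable D : nat.

Lemma pigeonhole (T : finType) m (f : 'I_m -> T) : (#|T| < m)%N ->
  exists i j : 'I_m, (i < j)%N /\ f i = f j.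
Proof.
move=> Tm; have /injectivePn[i [j ij fij]] : ~~ injectiveb f.
  apply/negP => /injectiveP/leq_card; rewrite card_ord leqNgt Tm //.
have [lt|gt|/val_inj E] := ltngtP i j; first by exists i, j.
- by exists j, i.
by rewrite E eqxx in ij.
Qed.

Section Approximation.
Variables (R : realType).
Hypothesis nonsquare : forall k : nat, (k * k)%N != D.
Let s : R := Num.sqrt D%:R.

Let s2 : s * s = D%:R.
Proof. by rewrite -expr2 sqr_sqrtr ?ler0n. Qed.

Let s0 : 0 <= s. Proof. exact: sqrtr_ge0. Qed.

Let norm_form (x y : int) : (x%:~R - y%:~R * s) * (x%:~R + y%:~R * s) = (x * x - D%:Z * (y * y))%:~R.
Proof.
rewrite rmorphB !rmorphM /= -[D%:Z%:~R]/(D%:R) -s2; ring.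
Qed.

Let irrational (x y : int) : y != 0 -> x%:~R - y%:~R * s != 0.
Proof.
move=> y0; apply/negP => /eqP E; have := norm_form x y; rewrite E mul0r => /esym/eqP.
rewrite intr_eq0 subr_eq0 => /eqP xy.
have : (D %| 0)%N by rewrite dvdn0.
have {}xy : (`|x| * `|x| = D * (`|y| * `|y|))%N by rewrite -!abszM xy !abszM.
have dyx : (`|y| %| `|x|)%N.
  have : (`|y| ^ 2 %| `|x| ^ 2)%N by rewrite -!mulnn xy dvdn_mull.
  by rewrite dvdn_pexp2r.
have [q qx] := dvdnP dyx; move=> _; have /eqP[] := nonsquare q.
have y0' : (0 < `|y| * `|y|)%N by rewrite muln_gt0 absz_gt0 y0.
by apply/eqP; rewrite -(eqn_pmul2r y0') -xy qx mulnACA.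
Qed.

(** The fractional parts of j s for the N + 1 values j = 0, ..., N fall into N boxes of length
    1/N. *)
Let dirichlet (N : nat) : (0 < N)%N -> exists x y : int,
  [/\ 0 < y <= N%:Z & `|x%:~R - y%:~R * s| < (N%:R : R)^-1].
Proof.
move=> N0; pose fr (j : nat) : R := j%:R * s - (Num.floor (j%:R * s))%:~R.
have fr0 j : 0 <= fr j by rewrite subr_ge0 floor_le.
have fr1 j : fr j < 1 by rewrite ltrBlDl -intrD1 floorD1_gt.
have box (j : nat) : (Num.truncn (N%:R * fr j) < N)%N.
  rewrite truncn_lt_nat ?mulr_ge0 ?ler0n //.
  by rewrite gtr_pMr ?ltr0n.
pose f (j : 'I_N.+1) : 'I_N := Ordinal (box j).
have [|i [j [ij /(congr1 val) /= fij]]] := @pigeonhole _ _ f; first by rewrite card_ord.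
exists (Num.floor (j%:R * s) - Num.floor (i%:R * s)), (j%:Z - i%:Z); split.
  by have := ltn_ord j; lia.
have -> : (Num.floor (j%:R * s) - Num.floor (i%:R * s))%:~R - (j%:Z - i%:Z)%:~R * s = fr i - fr j.
  by rewrite /fr !rmorphB /= -![_%:Z%:~R]/(_%:R); ring.
have Np : (0 : R) < N%:R by rewrite ltr0n.
have h k : (Num.truncn (N%:R * fr k))%:R <= N%:R * fr k < (Num.truncn (N%:R * fr k))%:R + 1.
  by rewrite natr1 truncn_itv // mulr_ge0 // ltW.
have /andP[h1 h2] := h i; have /andP[h3 h4] := h j; rewrite fij in h1 h2.
rewrite -(ltr_pM2l Np) mulfV ?gt_eqF // -[N%:R in X in X < _]gtr0_norm // -normrM mulrBr ltr_norml.
by apply/andP; split; lra.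
Qed.

(** For |x - y s| < 1/N and 0 < y <= N the norm is at most (1/N)(1/N + 2 N s), a bound that does not
    depend on N. *)
Let approx (e : R) : 0 < e -> exists x y : int,
  [/\ y != 0, `|x%:~R - y%:~R * s| < e & `|(x * x - D%:Z * (y * y))%:~R| <= 2 * s + 1].
Proof.
move=> e0; pose N := (Num.truncn e^-1).+1.
have Np : (0 : R) < N%:R by rewrite ltr0n.
have Ne : (N%:R : R)^-1 < e.
  by rewrite -[ltRHS]invrK ltf_pV2 ?posrE ?invr_gt0 //; exact: truncnS_gt.
have [//|x [y [/andP[y0 yN] H]]] := @dirichlet N.
exists x, y; split; [by rewrite gt_eqF|exact: lt_trans Ne|].
rewrite -norm_form normrM.
have yr0 : (0 : R) < y%:~R by rewrite ltr0z.
have yrN : (y%:~R : R) <= N%:R by have : (y%:~R : R) <= N%:Z%:~R by rewrite ler_int.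
have h2 : `|x%:~R + y%:~R * s| <= N%:R^-1 + 2 * N%:R * s.
  have -> : x%:~R + y%:~R * s = (x%:~R - y%:~R * s) + 2 * y%:~R * s by ring.
  apply: le_trans (ler_normD _ _) (lerD (ltW H) _).
  rewrite !normrM (ger0_norm s0) (gtr0_norm yr0) (ger0_norm (ler0n _ 2)).
  by rewrite ler_wpM2r // ler_wpM2l // yrN.
apply: le_trans (ler_pM (normr_ge0 _) (normr_ge0 _) (ltW H) h2) _.
have N1 : (N%:R : R)^-1 <= 1 by rewrite invf_le1 // ler1n.
have -> : N%:R^-1 * (N%:R^-1 + 2 * N%:R * s) = N%:R^-1 * N%:R^-1 + 2 * s.
  by field; rewrite gt_eqF.
rewrite addrC lerD2l -[leRHS]mulr1 ler_pM // invr_ge0 ltW //.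
Qed.

(** The classical argument: among infinitely many x - y s of bounded norm, two have the same norm k
    and are congruent modulo k; their quotient is then an integral element of norm 1. *)
Lemma pell_nontrivial : exists x y : int, y != 0 /\ x * x - D%:Z * (y * y) = 1.
Proof.
pose v (p : int * int) : R := `|p.1%:~R - p.2%:~R * s|.
pose nf (p : int * int) : int := p.1 * p.1 - D%:Z * (p.2 * p.2).
have stepP (e : R) : exists p : int * int, 0 < e ->
    [/\ p.2 != 0, v p < e & `|(nf p)%:~R| <= 2 * s + 1].
  have [e0|e0] := ltP 0 e; last by exists (0, 0).
  by have [x [y H]] := approx e0; exists (x, y).
have [p Hp] := choice stepP.
(* Each approximation is asked to be better than the previous one, so the values v(f n) strictly
   decrease and the elements are distinct. *)
pose f n := iter n (fun q => p (v q)) (p 1).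
have vpos n : 0 < v (f n) /\ (f n).2 != 0 /\ `|(nf (f n))%:~R| <= 2 * s + 1.
  have P (e : R) : 0 < e -> 0 < v (p e) /\ (p e).2 != 0 /\ `|(nf (p e))%:~R| <= 2 * s + 1.
    move=> /Hp[h1 h2 h3]; split; last by [].
    by rewrite normr_gt0; exact: irrational.
  by elim: n => [|n [IH _]]; apply: P.
have vdec n : v (f n.+1) < v (f n) by have [_ ? _] := Hp _ (vpos n).1.
have vlt : {homo (fun n => v (f n)) : m n / (m < n)%N >-> n < m}.
  by apply: homo_ltn => [y x z xy yz|n]; [exact: lt_trans yz xy|exact: vdec].
pose K := Num.truncn (2 * s + 1); have K0 : 0 <= 2 * s + 1 by rewrite addr_ge0 // mulr_ge0.
have nK n : (`|nf (f n)| <= K)%N.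
  have [_ [_ h]] := vpos n; rewrite /K truncn_ge_nat //; apply: le_trans h.
  by rewrite -intr_norm -abszE.
have nf0 n : nf (f n) != 0.
  apply/eqP => E; have := norm_form (f n).1 (f n).2; rewrite -/(nf _) E => /eqP.
  have [h [h2 _]] := vpos n; move: h; rewrite normr_gt0 => /negbTE h.
  rewrite mulf_eq0 h /= => /eqP h'; have := @irrational (f n).1 (- (f n).2).
  by rewrite oppr_eq0 rmorphN mulNr opprK h' eqxx => /(_ h2).
(* One modulus divisible by every possible norm, since these are non-zero and at most K in absolute
   value. *)
pose M := K`!%:Z; have M0 : 0 < M by rewrite ltz_nat fact_gt0.
have mge (x : int) : 0 <= (x %% M)%Z by apply: modz_ge0; rewrite gt_eqF.
have mM (x : int) : (`|(x %% M)%Z| < K`!)%N by have := mge x; have := ltz_pmod x M0; rewrite /M; lia.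
have mK n : (`|(nf (f n) + K%:Z)%R| < K.*2.+1)%N by have := nK n; lia.
pose cl n : 'I_K.*2.+1 * 'I_K`! * 'I_K`! :=
  (Ordinal (mK n), Ordinal (mM (f n).1), Ordinal (mM (f n).2)).
have [|i [j [ij]]] := @pigeonhole _ _ (fun k : 'I_(#|{: 'I_K.*2.+1 * 'I_K`! * 'I_K`!}|.+1) => cl k).
  by [].
case=> e1 e2 e3.
have k_ : nf (f i) = nf (f j) by have := nK i; have := nK j; lia.
have c (x y : int) : `|(x %% M)%Z|%N = `|(y %% M)%Z|%N -> exists q, x = y + q * nf (f j).
  move=> E; have E' : (x %% M = y %% M)%Z.
    by rewrite -(gez0_abs (mge x)) E gez0_abs.
  have : (nf (f j) %| M)%Z.
    by rewrite dvdzE /= dvdn_fact // absz_gt0 nf0 nK.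
  move=> /dvdzP[t Mt]; exists (((x %/ M)%Z - (y %/ M)%Z) * t).
  by rewrite -mulrA -Mt {1}(divz_eq x M) {1}(divz_eq y M) E'; ring.
have [q1 Q1] := c _ _ e2; have [q2 Q2] := c _ _ e3.
have vij : v (f i) != v (f j) by rewrite gt_eqF // vlt.
move: vij (nf0 j) k_ Q1 Q2; rewrite /nf /v.
case: (f i) (f j) => [x1 y1] [x2 y2] /=; set k := x2 * x2 - _ => vij k0 k1 Q1 Q2.
(* The quotient of the two elements of norm k. *)
pose X := 1 + q1 * x2 - D%:Z * (q2 * y2); pose Y := q1 * y2 - q2 * x2.
have EX : x1 * x2 - D%:Z * (y1 * y2) = k * X by rewrite Q1 Q2 /X /k; ring.
have EY : x1 * y2 - x2 * y1 = k * Y by rewrite Q1 Q2 /Y /k; ring.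
have N1 : X * X - D%:Z * (Y * Y) = 1.
  have kk : k * k != 0 by rewrite mulf_neq0.
  apply: (mulfI kk); rewrite mulr1.
  have -> : k * k * (X * X - D%:Z * (Y * Y)) = (k * X) * (k * X) - D%:Z * ((k * Y) * (k * Y)) by ring.
  by rewrite -EX -EY -{1}k1 /k; ring.
(* Y = 0 would force X = 1 or X = -1, and the two elements would have equal absolute value. *)
exists X, Y; split => //; apply/eqP => Y0.
have XX : X * X = 1 by move: N1; rewrite Y0 !mulr0 subr0.
have /eqP vE : `|x1%:~R - y1%:~R * s| = `|x2%:~R - y2%:~R * s|; last by rewrite vE in vij.
have E : (x1%:~R - y1%:~R * s) * k%:~R = (k * X)%:~R * (x2%:~R - y2%:~R * s).
  have -> : (k * X)%:~R = (k * X)%:~R + (k * Y)%:~R * s :> R by rewrite Y0 mulr0 mul0r addr0.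
  rewrite -EX -EY /k -norm_form !rmorphB !rmorphM /= -[D%:Z%:~R]/(D%:R) -s2; ring.
have kr : (k%:~R : R) != 0 by rewrite intr_eq0.
have {}E : x1%:~R - y1%:~R * s = X%:~R * (x2%:~R - y2%:~R * s).
  by apply: (mulfI kr); rewrite mulrC E rmorphM mulrA.
rewrite E normrM; suff -> : `|X%:~R : R| = 1 by rewrite mul1r.
have /eqP : `|X| * `|X| = 1 by rewrite -normrM XX normr1.
by rewrite -expr2 sqrp_eq1 // => /eqP h1; rewrite -intr_norm h1.
Qed.

End Approximation.

(** Multiplication by a fixed solution with x1 >= 2 strictly increases the first coordinate. *)
Lemma pell_large (R : realType) (nonsquare : forall k : nat, (k * k)%N != D) (n : nat) :
  exists x y : int, [/\ n%:Z <= x, 0 <= y & x * x = 1 + D%:Z * (y * y)].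
Proof.
have [x [y [y0 Hxy]]] := @pell_nontrivial R nonsquare.
have [x1 [y1 [x10 y10 H1]]] : exists x1 y1 : int, [/\ 0 < x1, 0 < y1 & x1 * x1 = 1 + D%:Z * (y1 * y1)].
  have yy : 0 < `|y| by rewrite normr_gt0.
  have x0 : x != 0 by apply/eqP => x0; move: Hxy; rewrite x0; have : 0 <= D%:Z by []; nia.
  exists `|x|, `|y|; rewrite -!normrM !normr_gt0; split => //.
  by rewrite !ger0_norm -?expr2 ?sqr_ge0 // !expr2; lia.
have D0 : (0 < D)%N by have := nonsquare 0%N; lia.
have x12 : 2 <= x1.
  rewrite leNgt; apply/negP => x12; have p : 0 < D%:Z * (y1 * y1) by rewrite !mulr_gt0 // ltz_nat.
  have x1E : x1 = 1 by lia.
  by rewrite x1E in H1; lia.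
suff [X [Y [nX Y0 H]]] : exists x y : int, [/\ n%:Z < x, 0 <= y & x * x = 1 + D%:Z * (y * y)].
  by exists X, Y; split => //; exact: ltW.
elim: n => [|n [X [Y [nX Y0 H]]]]; first by exists 1, 0; split => //; rewrite mulr0.
exists (x1 * X + D%:Z * (y1 * Y)), (x1 * Y + y1 * X); split.
- have : 0 <= D%:Z * (y1 * Y) by rewrite !mulr_ge0 // ltW.
  by nia.
- by rewrite addr_ge0 // mulr_ge0 //; lia.
- have -> : (x1 * X + D%:Z * (y1 * Y)) * (x1 * X + D%:Z * (y1 * Y)) =
     (x1 * x1) * (X * X) + 2 * D%:Z * (x1 * X * (y1 * Y)) + D%:Z * (y1 * y1) * (D%:Z * (Y * Y)) by ring.
  have -> : 1 + D%:Z * ((x1 * Y + y1 * X) * (x1 * Y + y1 * X)) = 1 + D%:Z * (x1 * x1) * (Y * Y) +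
     2 * D%:Z * (x1 * X * (y1 * Y)) + D%:Z * (y1 * y1) * (X * X) by ring.
  by rewrite H H1; ring.
Qed.
End Pell.

(** * Continuity and differentiability of matrix expressions *)

Lemma cont_sum (T : topologicalType) (K : numFieldType) (V : normedModType K) (I : Type)
    (r : seq I) (F : I -> T -> V) (x : T) :
  (forall i, {for x, continuous (F i)}) -> {for x, continuous (fun y => \sum_(i <- r) F i y)}.
Proof.
move=> HF; elim: r => [|i r IH].
  have -> : (fun y => \sum_(i <- [::]) F i y) = fun _ => 0 by apply/funext => y; rewrite big_nil.
  exact: cvg_cst.
have -> : (fun y => \sum_(j <- i :: r) F j y) = fun y => F i y + \sum_(j <- r) F j y.
  by apply/funext => y; rewrite big_cons.
exact: cvgD (HF i) IH.
Qed.

Section MatrixMaps.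
Variable R : realType.

Lemma dif_sum (V W : normedModType R[i]) n (F : 'I_n -> V -> W) p :
  (forall i, differentiable (F i) p) -> differentiable (fun q => \sum_i F i q) p.
Proof.
move=> HF; have -> : (fun q => \sum_i F i q) = \sum_i F i by apply/funext => q; rewrite fct_sumE.
exact: differentiable_sum.
Qed.

Lemma dif_coord (V : normedModType R[i]) d (f : V -> 'cV[R[i]]_d) i p :
  differentiable f p -> differentiable (fun q => f q i 0) p.
Proof.
move=> df; apply: (@dif_comp R V _ _ f (fun w => w i 0)) => //.
exact: differentiable_coord.
Qed.

Lemma dif_mulmx (V : normedModType R[i]) d e (A : 'M[R[i]]_(d, e)) (f : V -> 'cV[R[i]]_e) p :
  differentiable f p -> differentiable (fun q => A *m f q) p.
Proof.
move=> df; have -> : (fun q => A *m f q) = fun q => \sum_j f q j 0 *: col j A.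
  apply/funext => q; apply/colP => i; rewrite mxE summxE; apply: eq_bigr => j _.
  by rewrite !mxE mulrC.
by apply: dif_sum => j; apply: difZl; exact: dif_coord.
Qed.

Lemma dif_bil (V : normedModType R[i]) d (S : 'M[int]_d) (f g : V -> 'cV[R[i]]_d) p :
  differentiable f p -> differentiable g p -> differentiable (fun q => bil S (f q) (g q)) p.
Proof.
move=> df dg; have -> : (fun q => bil S (f q) (g q)) =
   fun q => \sum_i \sum_j f q i 0 * (S i j)%:~R * g q j 0.
  by apply/funext => q; rewrite bilE.
apply: dif_sum => i; apply: dif_sum => j.
by apply: difM; [apply: difM; [exact: dif_coord|exact: difC]|exact: dif_coord].
Qed.

Lemma cont_coord (T : topologicalType) d (f : T -> 'cV[R[i]]_d) i x :
  {for x, continuous f} -> {for x, continuous (fun y => f y i 0)}.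
Proof.
move=> cf; apply: (@cont_comp T _ _ f (fun w : 'cV[R[i]]_d => w i 0)) => //.
exact/differentiable_continuous/differentiable_coord.
Qed.

Lemma cont_bil (T : topologicalType) d (S : 'M[int]_d) (f g : T -> 'cV[R[i]]_d) x :
  {for x, continuous f} -> {for x, continuous g} ->
  {for x, continuous (fun y => bil S (f y) (g y))}.
Proof.
move=> cf cg; have -> : (fun y => bil S (f y) (g y)) =
   fun y => \sum_i \sum_j f y i 0 * (S i j)%:~R * g y j 0.
  by apply/funext => q; rewrite bilE.
apply: cont_sum => i; apply: cont_sum => j.
by apply: contM; [apply: contM; [exact: cont_coord|exact: contC]|exact: cont_coord].
Qed.

Lemma cont_mulmx (T : topologicalType) d e (A : 'M[R[i]]_(d, e)) (f : T -> 'cV[R[i]]_e) x :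
  {for x, continuous f} -> {for x, continuous (fun y => A *m f y)}.
Proof.
move=> cf; apply: (@cont_comp T _ _ f (fun w : 'cV[R[i]]_e => A *m w) x cf).
have H : differentiable (fun w : 'cV[R[i]]_e => A *m w) (f x).
  by apply: (@dif_mulmx _ d e A (fun w => w)); exact: dif_id.
exact: (differentiable_continuous H).
Qed.

Lemma cont_conj (T : topologicalType) d (f : T -> 'cV[R[i]]_d) x :
  {for x, continuous f} -> {for x, continuous (fun y => map_mx conjc (f y))}.
Proof.
move=> cf; apply: (@cont_comp T _ _ f (fun w : 'cV[R[i]]_d => map_mx conjc w) x cf).
apply/cont_nrm => e e0; exists e => // q qe; apply: nrm_mx_lt => // i j.
rewrite !mxE -raddfB nrm_conjc; apply: le_lt_trans qe.
by have := nrm_coord (q - f x) i j; rewrite !mxE.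
Qed.

Lemma map_conj_ratr d e (b : 'M[rat]_(d, e)) :
  map_mx conjc (map_mx ratr b : 'M[R[i]]_(d, e)) = map_mx ratr b.
Proof. by apply/matrixP => i j; rewrite !mxE fmorph_rat. Qed.

Lemma map_conj_intr d e (b : 'M[int]_(d, e)) :
  map_mx conjc (map_mx intr b : 'M[R[i]]_(d, e)) = map_mx intr b.
Proof. by apply/matrixP => i j; rewrite !mxE rmorph_int. Qed.

End MatrixMaps.

(** * The period domain *)

Section DomainCone.
Variables (R : realType) (n : nat) (S : 'M[int]_n.+2).
Hypothesis Ssym : S^T = S.
Local Notation VC := 'cV[R[i]]_n.+2.
Implicit Types (Z W V : VC).
Local Notation conj Z := (map_mx conjc Z).

Lemma bil_conj Z W : (bil S Z W)^*%C = bil S (conj Z) (conj W).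
Proof. exact: bil_map. Qed.

Lemma conjK Z : conj (conj Z) = Z.
Proof. by apply/colP => i; rewrite !mxE conjcK. Qed.

Lemma conj_hermitian Z : (bil S Z (conj Z))^*%C = bil S Z (conj Z).
Proof. by rewrite bil_conj conjK bilC. Qed.

Lemma period_coneE Z :
  period_cone S Z <-> bil S Z Z = 0 /\ 0 < complex.Re (bil S Z (conj Z)).
Proof.
rewrite /period_cone /= ltcE /=; split=> [[-> /andP[_ ->]]|[-> ->]] //.
split => //; rewrite andbT; have := conj_hermitian Z.
case: (bil S Z (conj Z)) => a b /= [] /eqP; rewrite eq_sym -addr_eq0 => /eqP bb.
by apply/eqP; lra.
Qed.

Lemma period_cone_scale (t : R[i]) Z : t != 0 -> period_cone S Z -> period_cone S (t *: Z).
Proof.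
move=> t0 [ZZ Zp]; split; first by rewrite bilZl bilZr ZZ !mulr0.
have -> : conj (t *: Z) = t^*%C *: conj Z by apply/colP => i; rewrite !mxE rmorphM.
by rewrite bilZl bilZr mulrA pmulr_lgt0 // mul_conjC_gt0.
Qed.

Lemma period_cone_isometry d (S' : 'M[int]_d.+2) (g : 'M[int]_(d.+2, n.+2)) Z :
  g^T *m S' *m g = S -> period_cone S Z -> period_cone S' (map_mx intr g *m Z).
Proof.
move=> gS [ZZ Zp]; split; first by rewrite (bil_pull _ _ gS).
by rewrite map_mxM map_conj_intr (bil_pull _ _ gS).
Qed.

Variable D : set VC.
Hypothesis hD : is_domain_cone S D.

Lemma domain_sub Z : D Z -> period_cone S Z.
Proof. by case: hD => x _ -> /connected_component_sub. Qed.

Lemma domain_point : exists Z, D Z.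
Proof. by case: hD => x px ->; exists x; exact: connected_component_refl. Qed.

Lemma domain_connected : connected D.
Proof. by case: hD => x _ ->; exact: component_connected. Qed.

Lemma domain_max (A : set VC) Z : connected A -> A `<=` period_cone S -> A Z -> D Z -> A `<=` D.
Proof.
case: hD => x px -> cA Ap AZ DZ; rewrite (same_connected_component DZ).
exact: connected_component_max.
Qed.

Lemma domain_path (f : R -> VC) : (forall t, 0 <= t <= 1 -> {for t, continuous f}) ->
  (forall t, 0 <= t <= 1 -> period_cone S (f t)) -> D (f 0) -> D (f 1).
Proof.
move=> cf pf D0; apply: (@domain_max (f @` `[0, 1]) (f 0)) => //.
- apply: connected_continuous_connected; first exact: segment_connected.
  by apply: continuous_in_subspaceT => t; rewrite inE /= in_itv /=; exact: cf.
- by move=> _ [t + <-]; rewrite /= in_itv /=; exact: pf.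
- by exists 0 => //=; rewrite in_itv /= lexx ler01.
- by exists 1 => //=; rewrite in_itv /= lexx ler01.
Qed.

Lemma domain_scale (t : R[i]) Z : t != 0 -> D Z -> D (t *: Z).
Proof.
have seg (u : R[i]) W : ~~ (complex.Re u <= 0) || (complex.Im u != 0) -> D W -> D (u *: W).
  move=> u0 DW; have := @domain_path (fun s : R => (1 + s%:C * (u - 1)) *: W).
  have -> : (1 + 0%:C * (u - 1)) *: W = W by rewrite rmorph0 mul0r addr0 scale1r.
  have -> : (1 + 1%:C * (u - 1)) *: W = u *: W by rewrite rmorph1 mul1r addrC subrK.
  move=> H; apply: H (DW) => s s01; first by cont.
  apply: period_cone_scale; last exact: domain_sub.
  case: u u0 => a b /= u0; rewrite eq_complex /= oppr0 !addr0 !mul0r !subr0 add0r.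
  apply/negP => /andP[/eqP h1 /eqP h2]; move/andP: s01 => [s0 s1].
  case/orP: u0 => [|b0].
    rewrite -ltNge => a0; have [sE|sn] := eqVneq s 0; first by rewrite sE in h1; lra.
    have : 0 < s by rewrite lt_neqAle eq_sym sn.
    by nra.
  move/eqP: h2; rewrite addr0 mulf_eq0 (negbTE b0) orbF => /eqP s0'; by rewrite s0' in h1; lra.
move=> t0 DZ; have [H|] := boolP (~~ (complex.Re t <= 0) || (complex.Im t != 0)).
  exact: seg.
rewrite negb_or !negbK => /andP[tr /eqP ti].
(* The segment from 1 to u passes through 0 only if u is real and not positive. A negative t is
   split into two non-real factors. *)
have -> : t *: Z = 'i *: ((- 'i * t) *: Z).
  by rewrite scalerA mulNr mulrN mulrA -expr2 sqr_i mulN1r opprK.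
apply: (seg 'i); first by rewrite /= oner_eq0 orbT.
apply: (seg (- 'i * t)) => //; case: t t0 tr ti => a b t0 /= a0 b0.
move: t0; rewrite b0 eq_complex /= eqxx andbT => t0.
have -> : - 0 * 0 + -1 * a = - a by ring.
by rewrite oppr_eq0 t0 orbT.
Qed.

(** A holomorphic retraction, near [Z], of the ambient space onto the quadric: V is moved along the
    fixed isotropic vector conj Z until its norm is 0. It turns functions on the cone into functions
    on an open set. *)
Definition retract Z V : VC := V - (bil S V V / (2 * bil S V (conj Z))) *: conj Z.

Lemma retract_id Z V : bil S V V = 0 -> retract Z V = V.
Proof. by move=> VV; rewrite /retract VV mul0r scale0r subr0. Qed.

Lemma retract_isotropic Z V : bil S Z Z = 0 -> bil S V (conj Z) != 0 ->
  bil S (retract Z V) (retract Z V) = 0.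
Proof.
move=> ZZ VZ; have cZ : bil S (conj Z) (conj Z) = 0 by rewrite -bil_conj ZZ rmorph0.
rewrite /retract; set k := _ / _; rewrite !bil_lin cZ (bilC (conj Z)) // /k.
by field.
Qed.

Lemma retract_differentiable Z V : bil S V (conj Z) != 0 -> differentiable (retract Z) V.
Proof.
move=> VZ; rewrite /retract.
apply: (@differentiableB _ _ _ (fun V => V) (fun V => (bil S V V / (2 * bil S V (conj Z))) *: conj Z)).
  exact: dif_id.
apply: difZl; apply: difM; first by apply: dif_bil; exact: dif_id.
apply: difV; last by rewrite mulf_neq0 // pnatr_eq0.
apply: difM; first exact: difC.
by apply: dif_bil; [exact: dif_id|exact: differentiable_cst].
Qed.

Lemma domain_retract Z : D Z -> exists2 d : R, 0 < d & forall V, nrm (V - Z) < d ->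
  bil S V (conj Z) != 0 /\ D (retract Z V).
Proof.
move=> DZ; have [ZZ] := domain_sub DZ; set N := bil S Z (conj Z) => N0.
have N0' : N != 0 by rewrite gt_eqF.
have [d1 d10 H1] : exists2 d : R, 0 < d & forall V, nrm (V - Z) < d -> bil S V (conj Z) != 0.
  have c1 : {for Z, continuous (fun V => bil S V (conj Z))}.
    by apply: cont_bil; [exact: cont_id|exact: contC].
  have Np : 0 < nrm N by rewrite nrm_gt0.
  have [d d0 H] := (cont_nrm _ _).1 c1 _ Np; exists d; first exact: d0.
  by move=> V /H; apply: contraTneq => ->; rewrite sub0r nrmN ltxx.
have rc V : bil S V (conj Z) != 0 -> {for V, continuous (retract Z)}.
  by move=> /retract_differentiable/differentiable_continuous.
have [d2 d20 H2] : exists2 d : R, 0 < d & forall V, nrm (V - Z) < d ->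
    0 < complex.Re (bil S (retract Z V) (conj (retract Z V))).
  have c2 : {for Z, continuous (fun V => bil S (retract Z V) (conj (retract Z V)))}.
    by apply: cont_bil; [|apply: cont_conj]; exact: rc.
  have RN : 0 < complex.Re N by move: N0; rewrite ltcE /= => /andP[].
  have [d d0 H] := (cont_nrm _ _).1 c2 _ RN; exists d; first exact: d0.
  move=> V /H.
  rewrite (retract_id _ ZZ) -/N => /(le_lt_trans (Re_le_nrm _)).
  by rewrite raddfB /= ltr_norml => /andP[]; lra.
exists (Num.min d1 d2) => [|V]; first by rewrite lt_min d10.
rewrite lt_min => /andP[V1 V2]; split; first exact: H1.
pose f (t : R) := Z + t%:C *: (V - Z).
have fd (t d : R) : 0 <= t <= 1 -> nrm (V - Z) < d -> nrm (f t - Z) < d.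
  move=> /andP[t0 t1] h; rewrite /f addrC addKr nrmZ nrm_real ger0_norm //.
  by apply: le_lt_trans h; rewrite ler_piMl // nrm_ge0.
have f0 : retract Z (f 0) = Z by rewrite /f rmorph0 scale0r addr0 retract_id.
have f1 : f 1 = V by rewrite /f rmorph1 scale1r addrC subrK.
rewrite -f1; apply: (@domain_path (fun t => retract Z (f t))); last by rewrite f0.
all: move=> t t01.
  apply: (@cont_comp _ _ _ f (retract Z)).
    by rewrite /f; apply: contD; [exact: contC|by cont].
  exact: (rc _ (H1 _ (fd _ _ t01 V1))).
apply/period_coneE; split; last by apply: H2; exact: fd.
exact: (retract_isotropic ZZ (H1 _ (fd _ _ t01 V1))).
Qed.

Lemma signature_det_neq0 : has_signature_2n R S -> \det S != 0.
Proof.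
case=> _ [P _ E]; have := congr1 determinant E; rewrite !det_mulmx det_diag det_map_mx /=.
apply: contra_eqN => /eqP ->; rewrite rmorph0 mulr0 mul0r eq_sym; apply/prodf_neq0 => i _.
by rewrite mxE; case: ifP => _; rewrite ?oppr_eq0 oner_eq0.
Qed.

Lemma isometry_unit (g : 'M[int]_n.+2) : \det S != 0 -> in_O S g -> \det g * \det g = 1.
Proof.
move=> dS /(congr1 determinant); rewrite !det_mulmx det_tr => E.
by apply: (mulIf dS); rewrite mul1r -[RHS]E; ring.
Qed.

(** The image of a component is connected and lies in the period cone, so one point decides where it
    goes; the inverse of [g] gives the other inclusion. *)
Lemma isometry_Oplus (g : 'M[int]_n.+2) Z : \det S != 0 -> in_O S g -> D Z ->
  D (map_mx intr g *m Z) -> Oplus S D g.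
Proof.
move=> dS gO DZ DgZ.
have sub (h : 'M[int]_n.+2) W : in_O S h -> D W -> D (map_mx intr h *m W) ->
    forall V, D V -> D (map_mx intr h *m V).
  move=> hO DW DhW V DV.
  apply: (@domain_max ((fun V => map_mx intr h *m V) @` D) (map_mx intr h *m W)) => //.
  - apply: connected_continuous_connected; first exact: domain_connected.
    apply: continuous_subspaceT => U; apply: cont_mulmx; exact: cont_id.
  - by move=> _ [U DU <-]; apply: period_cone_isometry hO _; exact: domain_sub.
  - by exists W.
  - by exists V.
have gu : g \in unitmx.
  by rewrite unitmxE; apply/unitrP; exists (\det g); rewrite isometry_unit.
have giO : in_O S (invmx g).
  by rewrite /in_O -{1}gO -!mulmxA mulmxV // mulmx1 trmx_inv mulmxA mulVmx ?mul1mx ?unitmx_tr.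
have giK V : map_mx intr g *m (map_mx intr (invmx g) *m V) = V.
  by rewrite mulmxA -map_mxM mulmxV // map_mx1 mul1mx.
split => //; apply/seteqP; split => [_ [V DV <-]|V DV]; first exact: (sub g Z).
exists (map_mx intr (invmx g) *m V) => //.
apply: (sub (invmx g) (map_mx intr g *m Z)) => //.
by rewrite mulmxA -map_mxM mulVmx // map_mx1 mul1mx.
Qed.

End DomainCone.

Section TubePoint.
Variables (R : realType) (n : nat) (S : 'M[int]_n.+2).
Hypothesis Ssym : S^T = S.
Variables (c : 'cV[int]_n.+2) (b : 'cV[rat]_n.+2).
Hypothesis cc : bil S c c = 0.
Hypothesis cb : bil S (map_mx intr c) b = 1.
Local Notation VC := 'cV[R[i]]_n.+2.
Local Notation conj Z := (map_mx conjc Z).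

Let cC : VC := map_mx intr c.
Let bC : VC := map_mx ratr b.

Let ccC : bil S cC cC = 0.
Proof. by rewrite -bil_map cc rmorph0. Qed.

Let cbC : bil S cC bC = 1.
Proof.
have -> : cC = map_mx ratr (map_mx intr c : 'cV[rat]_n.+2).
  by apply/colP => i; rewrite !mxE ratr_int.
by rewrite -bil_map cb rmorph1.
Qed.

Let bbC : bil S bC bC = ratr (bil S b b).
Proof. by rewrite -bil_map. Qed.

Lemma tube_point_dot_c (x : VC) : bil S x cC = 0 -> bil S (tube_point S c b x) cC = 1.
Proof. by move=> xc; rewrite /tube_point !bil_lin xc ccC (bilC bC) // cbC; ring. Qed.

(** For Z the tube point and y the imaginary part of [x], the coefficient of c makes (Z, Z) vanish,
    and (Z, conj Z) = 2 (y, y). *)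
Lemma tube_point_period (x : VC) : bil S x cC = 0 -> bil S x bC = 0 ->
  0 < bil S (map_mx (@complex.Im R) x) (map_mx (@complex.Im R) x) ->
  period_cone S (tube_point S c b x).
Proof.
move=> xc xb yy; have bc : bil S bC cC = 1 by rewrite bilC.
have cx : bil S cC x = 0 by rewrite bilC.
have bx : bil S bC x = 0 by rewrite bilC.
have xE : x = map_mx (real_complex R) (map_mx (@complex.Re R) x) +
   'i *: map_mx (real_complex R) (map_mx (@complex.Im R) x).
  by apply/colP => i; rewrite !mxE -complexRIE.
apply/(period_coneE Ssym); split.
  by rewrite /tube_point -/cC -/bC -bbC !bil_lin xc xb ccC cbC bc bx cx; field.
have cxc : bil S (conj x) cC = 0 by have := congr1 conjc xc; rewrite bil_conj map_conj_intr rmorph0.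
have cxb : bil S (conj x) bC = 0 by have := congr1 conjc xb; rewrite bil_conj map_conj_ratr rmorph0.
have ccx : bil S cC (conj x) = 0 by rewrite bilC.
have cbx : bil S bC (conj x) = 0 by rewrite bilC.
have -> : conj (tube_point S c b x) = conj x + bC - ((bil S (conj x) (conj x) + bil S bC bC) / 2) *: cC.
  rewrite /tube_point -bbC map_mxB map_mxD map_mxZ map_conj_ratr map_conj_intr.
  by rewrite rmorphM fmorphV rmorph_nat rmorphD /= !bil_conj map_conj_ratr.
rewrite /tube_point -/cC -/bC -bbC !bil_lin ccC cbC bc ccx cbx xb xc ?bx ?cx.
move: yy xE; move: (map_mx _ x) (map_mx _ x) => p q qq xE.
have cxE : conj x = map_mx (real_complex R) p - 'i *: map_mx (real_complex R) q.
  rewrite xE; apply/colP => i; rewrite !mxE; apply/eqP; rewrite eq_complex /=.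
  by rewrite !mul0r !mul1r !subr0 !addr0 !add0r !eqxx.
set bb := bil S bC bC; rewrite cxE xE !bil_lin.
have e (u v : 'cV[R]_n.+2) : bil S (map_mx (real_complex R) u) (map_mx (real_complex R) v) = (bil S u v)%:C.
  by rewrite -bil_map.
rewrite !e (bilC q p) //; set w := (X in complex.Re X).
have -> : w = - ('i * 'i) * (2 * (bil S q q)%:C).
  by rewrite /w; field.
rewrite -expr2 sqr_i opprK mul1r -(rmorph_nat (real_complex R)) -rmorphM /=.
by rewrite mulr_gt0.
Qed.

End TubePoint.

Lemma map_intz d e (g : 'M[int]_(d, e)) : map_mx intr g = g :> 'M[int]_(d, e).
Proof. by apply/matrixP => i j; rewrite mxE intz. Qed.

(** * Isometries *)

Section Isometries.
Variables (d : nat) (S : 'M[int]_d).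
Hypothesis Ssym : S^T = S.
Implicit Types (x y c l r u v : 'cV[int]_d).

Lemma isometryP (g : 'M[int]_d) :
  (forall x y, bil S (g *m x) (g *m y) = bil S x y) -> g^T *m S *m g = S.
Proof.
move=> H; apply: mx_bil_inj => x y; rewrite -[RHS]H -[X in bil S (X *m x)]map_intz.
by rewrite -[X in bil S _ (X *m y)]map_intz (bil_pull _ _ (erefl (g^T *m S *m g))).
Qed.

Lemma rank_one_mul (A : comNzRingType) x y (Z : 'cV[A]_d) :
  map_mx intr (x *m (y^T *m S)) *m Z = bil S (map_mx intr y) Z *: map_mx intr x.
Proof.
rewrite !map_mxM -!mulmxA; have -> : map_mx intr y^T *m (map_mx intr S *m Z) = (bil S (map_mx intr y) Z)%:M.
  by rewrite mulmxA [LHS]mx11_scalar /bil map_trmx.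
by rewrite mul_mx_scalar.
Qed.

Lemma dot_mx11 x y : x^T *m S *m y = (bil S x y)%:M.
Proof. by rewrite [LHS]mx11_scalar /bil map_intz. Qed.

(** For (r, r) = -2 this is the reflection in the hyperplane orthogonal to [r]. *)
Definition reflection r : 'M[int]_d := 1%:M + r *m (r^T *m S).

Lemma reflection_mul (A : comNzRingType) r (Z : 'cV[A]_d) :
  map_mx intr (reflection r) *m Z = Z + bil S (map_mx intr r) Z *: map_mx intr r.
Proof. by rewrite map_mxD map_mx1 mulmxDl mul1mx rank_one_mul. Qed.

Lemma reflection_isometry r : bil S r r = -2 -> (reflection r)^T *m S *m reflection r = S.
Proof.
move=> rr; apply: isometryP => x y.
rewrite -[reflection r]map_intz !reflection_mul map_intz !bil_lin rr (bilC x r) //; ring.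
Qed.

Lemma reflection_det r : bil S r r = -2 -> \det (reflection r) = -1.
Proof.
move=> rr; rewrite det1D_mulmx dot_mx11 rr -raddfD /= det_scalar1 //.
Qed.

(** The Eichler transvection of an isotropic [c] and [l] orthogonal to it, with q = (l, l)/2. The
    form 1 + X Y with two columns in X lets [det1D_mulmx] compute its determinant. *)
Definition eichler c l (q : int) : 'M[int]_d :=
  1%:M + row_mx l c *m col_mx (c^T *m S) (- (l^T *m S) - q *: (c^T *m S)).

Lemma eichler_mul (A : comNzRingType) c l q (Z : 'cV[A]_d) :
  map_mx intr (eichler c l q) *m Z = Z + bil S (map_mx intr c) Z *: map_mx intr l
   - (bil S (map_mx intr l) Z + q%:~R * bil S (map_mx intr c) Z) *: map_mx intr c.
Proof.
have -> : eichler c l q = 1%:M + l *m (c^T *m S) - c *m (l^T *m S) - q *: (c *m (c^T *m S)).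
  by rewrite /eichler mul_row_col mulmxBr mulmxN -scalemxAr !addrA.
rewrite !map_mxB map_mxD map_mx1 map_mxZ !mulmxBl mulmxDl mul1mx -scalemxAl !rank_one_mul.
by rewrite scalerDl scalerA opprD addrA.
Qed.

Lemma eichler_isometry c l q : bil S c c = 0 -> bil S l c = 0 -> bil S l l = 2 * q ->
  (eichler c l q)^T *m S *m eichler c l q = S.
Proof.
move=> cc lc ll; apply: isometryP => x y.
have cl : bil S c l = 0 by rewrite bilC.
rewrite -[eichler c l q]map_intz !eichler_mul !map_intz !bil_lin cc lc cl ll.
by rewrite (bilC x c) // (bilC x l) // intz; ring.
Qed.

Lemma eichler_det c l q : bil S c c = 0 -> bil S l c = 0 -> \det (eichler c l q) = 1.
Proof.
move=> cc lc; have cl : bil S c l = 0 by rewrite bilC.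
rewrite det1D_mulmx mul_col_row [1%:M]scalar_mx_block add_block_mx.
rewrite !mulmxBl !mulNmx -!scalemxAl !dot_mx11 cl lc cc.
by rewrite !(raddf0, scaler0, oppr0, addr0) det_lblock !det1 mulr1.
Qed.

(* With a = (u,u), -b = (v,v), this is the automorphism of the plane spanned by
   u and v attached to the square of the solution (x, y) of x^2 - ab y^2 = 1. *)
Definition pell_isometry u v (x y : int) : 'M[int]_d :=
  1%:M + (- 2 * bil S v v * (y * y) *: u + 2 * (x * y) *: v) *m (u^T *m S)
       - (2 * bil S u u * (y * y) *: v + 2 * (x * y) *: u) *m (v^T *m S).

Lemma pell_mul (A : comNzRingType) u v (x y : int) (Z : 'cV[A]_d) :
  map_mx intr (pell_isometry u v x y) *m Z = Z
   + bil S (map_mx intr u) Z *: map_mx intr (- 2 * bil S v v * (y * y) *: u + 2 * (x * y) *: v)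
   - bil S (map_mx intr v) Z *: map_mx intr (2 * bil S u u * (y * y) *: v + 2 * (x * y) *: u).
Proof. by rewrite map_mxB map_mxD map_mx1 mulmxBl mulmxDl mul1mx !rank_one_mul. Qed.

Lemma pell_isometryP u v (x y : int) : bil S u v = 0 -> x * x = 1 - bil S u u * bil S v v * (y * y) ->
  (pell_isometry u v x y)^T *m S *m pell_isometry u v x y = S.
Proof.
move=> uv xx; apply: isometryP => z w; have vu : bil S v u = 0 by rewrite bilC.
rewrite -[pell_isometry u v x y]map_intz !pell_mul !map_intz !bil_lin uv vu.
rewrite (bilC z u) // (bilC z v) //.
move: (bil S u u) (bil S v v) xx (bil S u z) (bil S v z) (bil S u w) (bil S v w) (bil S z w).
move=> a b xx uz vz uw vw zw.
have xyxy : x * y * (x * y) = (1 - a * b * (y * y)) * (y * y) by rewrite -xx; ring.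
apply/eqP; rewrite -subr_eq0; apply/eqP.
transitivity (4 * (b * uz * uw + a * vz * vw) * (x * y * (x * y) - (1 - a * b * (y * y)) * (y * y))); first by ring.
by rewrite xyxy subrr mulr0.
Qed.

End Isometries.

(** * Division by roots *)

Section Quotient.
Variables (R : realType) (n : nat) (S : 'M[int]_n.+2).
Hypothesis Ssym : S^T = S.
Hypothesis dS : \det S != 0.
Local Notation VC := 'cV[R[i]]_n.+2.
Local Notation conj Z := (map_mx conjc Z).
Local Notation ir r := (map_mx intr r : VC).
Implicit Types (Z W V : VC) (r : 'cV[int]_n.+2).
Variable D : set VC.
Hypothesis hD : is_domain_cone S D.

Lemma near_ball (P : VC -> Prop) Z (d : R) : 0 < d -> (forall V, nrm (V - Z) < d -> P V) ->
  \forall V \near Z, P V.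
Proof. by move=> d0 H; apply/nbhs_nrm; exists d. Qed.

Lemma near_imp (P P' : VC -> Prop) Z : (\forall V \near Z, P V) -> (forall V, P V -> P' V) ->
  \forall V \near Z, P' V.
Proof. by move=> /(nbhs_nrm Z P)[d d0 H] PP'; apply: (near_ball d0) => V /H/PP'. Qed.

Lemma near_and (P P' : VC -> Prop) Z : (\forall V \near Z, P V) -> (\forall V \near Z, P' V) ->
  \forall V \near Z, P V /\ P' V.
Proof.
move=> /(nbhs_nrm Z P)[d d0 H] /(nbhs_nrm Z P')[d' d'0 H'].
apply: (@near_ball _ _ (Num.min d d')) => [|V]; first by rewrite lt_min d0.
by rewrite lt_min => /andP[/H ? /H' ?].
Qed.

Lemma near_all_seq (T : eqType) (s : seq T) (P : T -> VC -> Prop) Z :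
  (forall a, a \in s -> \forall V \near Z, P a V) -> \forall V \near Z, forall a, a \in s -> P a V.
Proof.
elim: s => [|a s IH] H; first exact: (near_ball ltr01).
have h1 := H a (mem_head _ _).
have h2 : \forall V \near Z, forall a', a' \in s -> P a' V.
  by apply: IH => a' a's; apply: H; rewrite inE a's orbT.
apply: (near_imp (near_and h1 h2)) => V [PV sV] a'; rewrite inE => /orP[/eqP ->|] //; exact: sV.
Qed.

Lemma bil_bounded (W : VC) : exists k : R, forall V, nrm (bil S V W) <= k * nrm V.
Proof.
exists (\sum_i \sum_j nrm ((S i j)%:~R : R[i]) * nrm (W j 0)) => V; rewrite bilE.
apply: le_trans (nrm_le_sum _ _ _) _; rewrite mulr_suml; apply: ler_sum => i _.
apply: le_trans (nrm_le_sum _ _ _) _; rewrite mulr_suml; apply: ler_sum => j _.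
rewrite !nrmM mulrC mulrA mulrAC [nrm (W j 0) * _]mulrC ler_wpM2l ?mulr_ge0 ?nrm_ge0 //.
exact: nrm_coord.
Qed.

Lemma near_neq0 (f : VC -> R[i]) Z : {for Z, continuous f} -> f Z != 0 ->
  \forall V \near Z, f V != 0.
Proof.
move=> cf f0; have f0' : 0 < nrm (f Z) by rewrite nrm_gt0.
have [d d0 H] := (cont_nrm _ _).1 cf _ f0'; apply/nbhs_nrm; exists d; first exact: d0.
by move=> q /H; apply: contraTneq => ->; rewrite sub0r nrmN ltxx.
Qed.

Lemma bilr_continuous (W : VC) V : {for V, continuous (fun U : VC => bil S U W)}.
Proof. by apply: cont_bil; [exact: cont_id|exact: contC]. Qed.

Lemma conj_orth Z r : bil S Z (ir r) = 0 -> bil S (conj Z) (ir r) = 0.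
Proof. by move=> /(congr1 conjc); rewrite bil_conj map_conj_intr rmorph0. Qed.

Lemma retract_orth Z V r : bil S Z (ir r) = 0 -> bil S (retract S Z V) (ir r) = bil S V (ir r).
Proof. by move=> /conj_orth Zr; rewrite /retract !bil_lin Zr mulr0 subr0. Qed.

Lemma near_domain_retract Z : D Z -> \forall V \near Z, bil S V (conj Z) != 0 /\ D (retract S Z V).
Proof. by move=> /(domain_retract Ssym hD)[d d0 H]; apply/nbhs_nrm; exists d. Qed.

Lemma retract_continuous Z : D Z -> {for Z, continuous (retract S Z)}.
Proof.
move=> /(near_domain_retract)/nbhs_singleton[/retract_differentiable H _].
exact: differentiable_continuous.
Qed.

Lemma retract_center Z : D Z -> retract S Z Z = Z.
Proof. by move=> /(domain_sub hD)[ZZ _]; exact: retract_id. Qed.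

Lemma near_retract Z (P : VC -> Prop) : D Z -> (\forall V \near Z, P V) ->
  \forall V \near Z, P (retract S Z V).
Proof.
move=> DZ PZ; have c := retract_continuous DZ.
by apply: c; rewrite (retract_center DZ).
Qed.

(** Moves [Z] slightly along an integral w that pairs non-trivially with all of [s], then retracts
    to the cone. Retraction preserves the pairings with those r that are orthogonal to [Z]; the
    other pairings stay non-zero by continuity. *)
Lemma domain_dense (s : seq 'cV[int]_n.+2) Z (e : R) :
  (forall r, r \in s -> bil S r r != 0) -> D Z -> 0 < e ->
  exists W, [/\ D W, nrm (W - Z) < e & forall r, r \in s -> bil S W (ir r) != 0].
Proof.
move=> sS DZ e0.
have [|w _ Hw] := @generic_vector _ S (fun=> True) I (fun _ _ _ _ _ => I) s.
  by move=> r rs; exists r => //; exact: sS.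
have n1 : \forall V \near Z, nrm (V - Z) < e by apply/nbhs_nrm; exists e.
have n3 : \forall V \near Z, forall r, r \in s -> bil S Z (ir r) != 0 -> bil S V (ir r) != 0.
  apply: near_all_seq => r _; have [Zr|Zr] := eqVneq (bil S Z (ir r)) 0; first exact: (near_ball ltr01).
  have nn := @near_neq0 (fun U => bil S U (ir r)) Z (@bilr_continuous (ir r) Z) Zr.
  by apply: (near_imp nn) => V.
have [d d0 H] : exists2 d : R, 0 < d & forall V, nrm (V - Z) < d ->
   [/\ D (retract S Z V), nrm (retract S Z V - Z) < e &
     forall r, r \in s -> bil S Z (ir r) != 0 -> bil S (retract S Z V) (ir r) != 0].
  apply/nbhs_nrm; apply: near_imp (near_and (near_and (near_domain_retract DZ) (near_retract DZ n1)) (near_retract DZ n3)) _.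
  by move=> V [[[_ h1] h2] h3].
pose t : R := d / (nrm (ir w) + 1).
have w1 : 0 < nrm (ir w) + 1 by rewrite ltr_wpDl ?nrm_ge0.
have t0 : 0 < t by rewrite divr_gt0.
have [|h1 h2 h3] := H (Z + t%:C *: ir w).
  rewrite addrC addKr nrmZ nrm_real gtr0_norm // /t mulrAC ltr_pdivrMr //.
  by rewrite ltr_pM2l // ltrDl.
exists (retract S Z (Z + t%:C *: ir w)); split => // r rs.
have [Zr|Zr] := eqVneq (bil S Z (ir r)) 0; last exact: h3.
rewrite retract_orth // bilDl bilZl Zr add0r mulf_neq0 //; last first.
  by rewrite -bil_map intr_eq0 Hw.
by rewrite -(rmorph0 (real_complex R)) (inj_eq (@complexI R)) gt_eqF.
Qed.

(** Continuity relative to [D]: a local holomorphic extension controls a function on the cone only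
    along [D]. *)
Definition continuous_along (f : VC -> R[i]) Z := forall e : R, 0 < e ->
  exists2 d : R, 0 < d & forall W, D W -> nrm (W - Z) < d -> nrm (f W - f Z) < e.

Lemma holomorphic_along F Z : holomorphic_on D F -> D Z -> continuous_along F Z.
Proof.
move=> hF DZ e e0; have [H /nbhs_nrm[d d0 HH]] := hF Z DZ.
have [|dH FH] := HH Z; first by rewrite subrr nrm0.
have [d' d'0 H'] := (cont_nrm _ _).1 (differentiable_continuous dH) _ e0.
exists (Num.min d d') => [|W DW]; first by rewrite lt_min d0.
rewrite lt_min => /andP[W1 W2]; rewrite FH // (HH W W1).2 //; exact: H'.
Qed.

(** Identities for [Q] are proved by cancelling the root product where it is non-zero and extended
    by this lemma. *)
Lemma dense_eq (s : seq 'cV[int]_n.+2) (f g : VC -> R[i]) Z (e : R) :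
  (forall r, r \in s -> bil S r r != 0) -> D Z -> 0 < e ->
  continuous_along f Z -> continuous_along g Z ->
  (forall W, D W -> nrm (W - Z) < e -> (forall r, r \in s -> bil S W (ir r) != 0) -> f W = g W) ->
  f Z = g Z.
Proof.
move=> sS DZ e0 cf cg fg; apply/eqP; rewrite -subr_eq0; apply/negPn/negP => fg0.
pose h := nrm (f Z - g Z) / 2; have h0 : 0 < h by rewrite divr_gt0 // nrm_gt0.
have [d1 d10 H1] := cf h h0; have [d2 d20 H2] := cg h h0.
have m0 : 0 < Num.min e (Num.min d1 d2) by rewrite !lt_min e0 d10.
have [W [DW]] := domain_dense sS DZ m0; rewrite !lt_min => /and3P[We W1 W2] Ws.
have := H1 W DW W1; have := H2 W DW W2; rewrite (fg W DW We Ws) => a1 a2.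
have : nrm (f Z - g Z) <= nrm (g W - g Z) + nrm (g W - f Z).
  have -> : f Z - g Z = (g W - g Z) - (g W - f Z) by ring.
  by apply: le_trans (nrmD _ _) _; rewrite nrmN.
by rewrite /h in a1 a2; lra.
Qed.

Lemma small_avoid (s : seq (R[i] * R[i])) : (forall p, p \in s -> p.2 != 0) ->
  exists2 t0 : R, 0 < t0 & forall t : R, 0 < t -> t < t0 -> forall p, p \in s -> p.1 + t%:C * p.2 != 0.
Proof.
elim: s => [|[a b] s IH] H; first by exists 1.
have [p ps|t1 t10 H1] := IH; first by apply: H; rewrite inE ps orbT.
have b0 : b != 0 by apply: (H (a, b)); exact: mem_head.
have nb : 0 < nrm b by rewrite nrm_gt0.
have [t2 t20 H2] : exists2 t2 : R, 0 < t2 & forall t : R, 0 < t -> t < t2 -> a + t%:C * b != 0.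
  have [->|a0] := eqVneq a 0.
    exists 1 => // t t0 _; rewrite add0r mulf_neq0 //.
    by rewrite -(rmorph0 (real_complex R)) (inj_eq (@complexI R)) gt_eqF.
  exists (nrm a / nrm b) => [|t t0]; first by rewrite divr_gt0 ?nrm_gt0.
  rewrite ltr_pdivlMr // => tb; apply: contraTneq tb => /eqP; rewrite addr_eq0 => /eqP ->.
  by rewrite nrmN nrmM nrm_real gtr0_norm // ltxx.
exists (Num.min t1 t2) => [|t t0]; first by rewrite lt_min t10.
rewrite lt_min => /andP[tt1 tt2] p; rewrite inE => /orP[/eqP ->|]; [exact: H2|exact: H1].
Qed.

(** Divides by one linear form at a time. The bound on (r, r')^2 makes r and r' linearly
    independent, so the quotient by the other forms still vanishes on the hyperplane of [r]. *)
Lemma local_division (s : seq 'cV[int]_n.+2) (h : VC -> R[i]) Z :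
  uniq s -> (forall r, r \in s -> bil S r r = -2) ->
  (forall r r', r \in s -> r' \in s -> r != r' -> bil S r r' ^+ 2 != 4) ->
  (\forall V \near Z, differentiable h V) ->
  (forall r, r \in s -> bil S Z (ir r) = 0) ->
  (\forall V \near Z, forall r, r \in s -> bil S V (ir r) = 0 -> h V = 0) ->
  exists k : VC -> R[i], \forall V \near Z, differentiable k V /\ h V = (\prod_(r <- s) bil S V (ir r)) * k V.
Proof.
elim: s => [|r s IH] /=.
  move=> _ _ _ dh _ _; exists h; apply: filterS dh => V dV.
  by rewrite big_nil mul1r.
move=> /andP[rs us] ss pw dh Zs hs.
have rr : bil S r r = -2 by apply: ss; exact: mem_head.
have [|||||k] := IH us.
- by move=> r' r's; apply: ss; rewrite inE r's orbT.
- by move=> r1 r2 h1 h2; apply: pw; rewrite inE ?h1 ?h2 orbT.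
- exact: dh.
- by move=> r' r's; apply: Zs; rewrite inE r's orbT.
- by apply: near_imp hs _ => V HV r' r's; apply: HV; rewrite inE r's orbT.
move=> hk; have [d d0 Hd] := (nbhs_nrm _ _).1 (near_and hk hs).
have [|||w wr Hw] := @generic_vector _ S (fun w => bil S w r = 0) _ _ s.
- by rewrite bil0l.
- by move=> a x y xr yr; rewrite bilDl bilZl xr yr mulr0 addr0.
(* This vector is orthogonal to r and pairs with r' to (r, r')^2 - 4. *)
- move=> r' r's; exists (2 *: r' + bil S r r' *: r).
    by rewrite !bil_lin rr (bilC r') //; ring.
  have r'r' : bil S r' r' = -2 by apply: ss; rewrite inE r's orbT.
  rewrite !bil_lin r'r'; apply/negP => /eqP E.
  have rr' : r != r' by apply: contraNneq rs => ->.
  have r'rs : r' \in r :: s by rewrite inE r's orbT.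
  by have := pw r r' (mem_head _ _) r'rs rr'; rewrite expr2; lia.
(* The product over [s] may vanish at V. A small step along w stays in the hyperplane of r and
   leaves the others; there k must vanish, so k(V) = 0 by continuity. *)
have k0 V : nrm (V - Z) < d -> bil S V (ir r) = 0 -> k V = 0.
  move=> VZ Vr; have [[dk _] _] := Hd V VZ.
  apply: nrm0_eq0; apply/eqP; rewrite eq_le nrm_ge0 andbT leNgt; apply/negP => kV.
  have [d1 d10 H1] := (cont_nrm _ _).1 (differentiable_continuous dk) _ kV.
  have [p /mapP[r' r's ->]|t1 t10 H2] := @small_avoid [seq (bil S V (ir r'), bil S (ir w) (ir r')) | r' <- s].
    by rewrite /= -bil_map intr_eq0 Hw.
  pose e := Num.min (d - nrm (V - Z)) d1.
  have e0 : 0 < e by rewrite lt_min d10 subr_gt0 VZ.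
  have w1 : 0 < nrm (ir w) + 1 by rewrite ltr_wpDl ?nrm_ge0.
  pose t := Num.min (t1 / 2) (e / (nrm (ir w) + 1)).
  have t0 : 0 < t by rewrite lt_min !divr_gt0.
  have tt1 : t < t1 by rewrite gt_min; apply/orP; left; lra.
  have te : nrm (t%:C *: ir w) < e.
    rewrite nrmZ nrm_real gtr0_norm //; apply: (@le_lt_trans _ _ (e / (nrm (ir w) + 1) * nrm (ir w))).
      by rewrite ler_wpM2r ?nrm_ge0 // ge_min lexx orbT.
    by rewrite mulrAC ltr_pdivrMr // ltr_pM2l // ltrDl.
  have [te1 te2] : nrm (t%:C *: ir w) < d - nrm (V - Z) /\ nrm (t%:C *: ir w) < d1.
    by move: te; rewrite lt_min => /andP.
  have [|[_ hV] hz] := Hd (V + t%:C *: ir w).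
    by rewrite addrAC; apply: le_lt_trans (nrmD _ _) _; lra.
  move: (hz r (mem_head _ _)); rewrite bilDl bilZl Vr add0r -bil_map wr rmorph0 mulr0 => /(_ erefl).
  have P0 : \prod_(r' <- s) bil S (V + t%:C *: ir w) (ir r') != 0.
    rewrite prodf_seq_neq0; apply/allP => r' r's; rewrite bilDl bilZl.
    exact: (H2 t t0 tt1 (_, _) (map_f _ r's)).
  rewrite hV => /eqP; rewrite mulf_eq0 (negbTE P0) => /eqP kt.
  have := H1 (V + t%:C *: ir w); rewrite addrC addKr kt sub0r nrmN ltxx => /(_ te2) //.
have [K HK] := bil_bounded (ir r).
have [||||||g dg [d' d'0 Hg]] := @divide_linear R VC k (fun V => bil S V (ir r)) (- 2^-1 *: ir r) Z d K.
- by move=> a x y; rewrite bilDl bilZl.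
- exact: HK.
- by rewrite bilZl -bil_map rr rmorphN rmorph_nat; field.
- exact: d0.
- by move=> V /Hd[[]].
- exact: k0.
exists g; apply/nbhs_nrm; exists (Num.min d d') => [|V]; first by rewrite lt_min d0.
rewrite lt_min => /andP[/Hd[[_ hV] _] /Hg[dgV kV]]; split => //.
by rewrite hV kV big_cons; ring.
Qed.

Lemma isometry_root_product (g : 'M[int]_n.+2) (s : seq 'cV[int]_n.+2) Z : in_O S g ->
  (forall r, r \in s -> g *m r = r) ->
  \prod_(r <- s) bil S (map_mx intr g *m Z) (ir r) = \prod_(r <- s) bil S Z (ir r).
Proof.
move=> gO gr; rewrite big_seq [RHS]big_seq; apply: eq_bigr => r rs.
by rewrite -{1}(gr r rs) map_mxM (bil_pull _ _ gO).
Qed.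

Variable Phi : VC -> R[i].
Hypothesis hPhi : holomorphic_on D Phi.
Hypothesis PhiO : forall g Z, Oplus S D g -> D Z -> Phi (map_mx intr g *m Z) = (\det g)%:~R * Phi Z.

Lemma reflection_vanish r Z : bil S r r = -2 -> D Z -> bil S Z (ir r) = 0 -> Phi Z = 0.
Proof.
move=> rr DZ Zr.
have gZ : map_mx intr (reflection S r) *m Z = Z.
  by rewrite reflection_mul (bilC _ Z) // Zr scale0r addr0.
have gO : Oplus S D (reflection S r).
  apply: (isometry_Oplus hD dS (reflection_isometry Ssym rr) DZ).
  by rewrite gZ.
have := PhiO gO DZ; rewrite gZ reflection_det // rmorphN rmorph1 mulN1r => /eqP.
by rewrite -addr_eq0 -mulr2n mulrn_eq0 /= => /eqP.
Qed.

Variable s : seq 'cV[int]_n.+2.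
Hypothesis us : uniq s.
Hypothesis s2 : forall r, r \in s -> bil S r r = -2.
Hypothesis s4 : forall r r', r \in s -> r' \in s -> r != r' -> bil S r r' ^+ 2 != 4.

Let s20 r : r \in s -> bil S r r != 0. Proof. by move=> /s2 ->. Qed.

(** [retract] makes the local extension of [Phi] vanish on root hyperplanes in an open set, not only
    along [D]. Division is needed only for the roots orthogonal to [Z]; the other factors are
    invertible nearby. *)
Lemma local_quotient Z : D Z -> exists q : VC -> R[i],
  \forall W \near Z, differentiable q W /\ (D W -> Phi W = q W * \prod_(r <- s) bil S W (ir r)).
Proof.
move=> DZ; have [H nH] := hPhi DZ.
pose s0 := [seq r <- s | bil S Z (ir r) == 0]; pose s1 := [seq r <- s | bil S Z (ir r) != 0].
have s0P r : r \in s0 -> bil S Z (ir r) = 0 /\ r \in s by rewrite mem_filter => /andP[/eqP].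
have n1 := near_retract DZ nH; have n2 := near_domain_retract DZ.
have n12 := near_and n1 n2.
have [||||||k nk] := @local_division s0 (fun V => H (retract S Z V)) Z.
- exact: filter_uniq.
- by move=> r /s0P[_]; exact: s2.
- by move=> r r' /s0P[_ h] /s0P[_ h']; exact: s4.
- apply: near_imp n12 _ => V [[dH _] [VZ _]].
  by apply: (@dif_comp _ _ _ _ (retract S Z) H); [exact: retract_differentiable|].
- by move=> r /s0P[].
- apply: near_imp n12 _ => V [[_ HV] [VZ DV]] r /s0P[Zr rs] Vr.
  by rewrite -(HV DV); apply: (reflection_vanish (s2 rs) DV); rewrite retract_orth.
have n3 : \forall V \near Z, forall r, r \in s1 -> bil S V (ir r) != 0.
  apply: near_all_seq => r; rewrite mem_filter => /andP[Zr _].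
  have nn := @near_neq0 (fun U => bil S U (ir r)) Z (@bilr_continuous (ir r) Z) Zr.
  by apply: (near_imp nn) => V.
exists (fun W => k W * (\prod_(r <- s1) bil S W (ir r))^-1).
apply: near_imp (near_and (near_and n12 nH) (near_and nk n3)) _ => W [[[[_ HW] [WZ DrW]] [_ PW]] [[dk hW] W1]].
have P1 : \prod_(r <- s1) bil S W (ir r) != 0.
  by rewrite prodf_seq_neq0; apply/allP => r rs1; exact: W1.
split.
  apply: difM => //; apply: difV => //.
  have dp (t : seq 'cV[int]_n.+2) : differentiable (fun W : VC => \prod_(r <- t) bil S W (ir r)) W.
    elim: t => [|r t IH].
      have -> : (fun W : VC => \prod_(r <- [::]) bil S W (ir r)) = fun _ => 1.
        by apply/funext => U; rewrite big_nil.
      exact: difC.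
    have -> : (fun W : VC => \prod_(r <- r :: t) bil S W (ir r)) =
       fun W => bil S W (ir r) * \prod_(r <- t) bil S W (ir r).
      by apply/funext => U; rewrite big_cons.
    by apply: difM => //; apply: dif_bil; [exact: dif_id|exact: differentiable_cst].
  exact: dp.
move=> DW; have [WW _] := domain_sub hD DW.
have rW : retract S Z W = W by exact: retract_id.
have -> : \prod_(r <- s) bil S W (ir r) = (\prod_(r <- s0) bil S W (ir r)) * \prod_(r <- s1) bil S W (ir r).
  rewrite (bigID (fun r => bil S Z (ir r) == 0)) /= -big_filter; congr (_ * _).
  by rewrite -big_filter.
rewrite PW // -{1}rW hW; move: (\prod_(r <- s0) _) (k W) (\prod_(r <- s1) _) P1 => a b c c0.
by field.
Qed.

(** [Q] takes at each Z the value of a local quotient chosen at Z. Near Z all these choices agree on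
    [D], because they agree off the root hyperplanes. *)
Lemma quotient_exists : exists Q : VC -> R[i], holomorphic_on D Q /\
  forall Z, D Z -> Phi Z = Q Z * \prod_(r <- s) bil S Z (ir r).
Proof.
have ex Z : exists q : VC -> R[i], D Z ->
   \forall W \near Z, differentiable q W /\ (D W -> Phi W = q W * \prod_(r <- s) bil S W (ir r)).
  have [DZ|nDZ] := pselect (D Z); last by exists (fun=> 0).
  by have [q Hq] := local_quotient DZ; exists q.
have [q Hq] := choice ex.
have qc Z W (d : R) : nrm (W - Z) < d -> D W ->
   (forall V, nrm (V - Z) < d -> differentiable (q Z) V) -> continuous_along (q Z) W.
  move=> WZ DW dq e e0; have [d' d'0 H'] := (cont_nrm _ _).1 (differentiable_continuous (dq W WZ)) _ e0.
  by exists d' => // V _; exact: H'.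
exists (fun Z => q Z Z); split=> [Z DZ|Z DZ]; last by have [_] := nbhs_singleton (Hq Z DZ); apply.
exists (q Z); have [d d0 Hd] := (nbhs_nrm _ _).1 (Hq Z DZ).
apply/nbhs_nrm; exists d => // W WZ; split; first exact: (Hd W WZ).1.
move=> DW; have [d' d'0 Hd'] := (nbhs_nrm _ _).1 (Hq W DW).
pose e := Num.min d' (d - nrm (W - Z)); have e0 : 0 < e by rewrite lt_min d'0 subr_gt0.
apply: (@dense_eq s _ _ W e) => //.
- apply: (qc W W d' _ DW) => [|V VW]; first by rewrite subrr nrm0.
  exact: (Hd' V VW).1.
- by apply: (qc Z W d WZ DW) => V VZ; exact: (Hd V VZ).1.
move=> V DV; rewrite lt_min => /andP[V1 V2] Vs.
have P1 : \prod_(r <- s) bil S V (ir r) != 0.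
  by rewrite prodf_seq_neq0; apply/allP => r rs; exact: Vs.
have VZ : nrm (V - Z) < d.
  by rewrite -(subrK W V) -addrA; apply: le_lt_trans (nrmD _ _) _; lra.
by apply: (mulIf P1); rewrite -(Hd' V V1).2 // -(Hd V VZ).2.
Qed.

Variable Q : VC -> R[i].
Hypothesis hQ : holomorphic_on D Q.
Hypothesis PhiQ : forall Z, D Z -> Phi Z = Q Z * \prod_(r <- s) bil S Z (ir r).

Lemma quotient_isometry (g : 'M[int]_n.+2) Z : Oplus S D g -> (forall r, r \in s -> g *m r = r) ->
  D Z -> Q (map_mx intr g *m Z) = (\det g)%:~R * Q Z.
Proof.
move=> gO gs DZ; have gD W : D W -> D (map_mx intr g *m W).
  by move=> DW; case: gO => _ <-; exists W.
apply: (@dense_eq s (fun Z => Q (map_mx intr g *m Z)) (fun Z => (\det g)%:~R * Q Z) Z 1) => //.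
- move=> e e0; have [d d0 H] := holomorphic_along hQ (gD Z DZ) e0.
  have c : {for Z, continuous (fun W : VC => map_mx intr g *m W)}.
    by apply: cont_mulmx; exact: cont_id.
  have [d' d'0 H'] := (cont_nrm _ _).1 c _ d0.
  by exists d' => // W DW WZ; apply: H; [exact: gD|exact: H'].
- move=> e e0; pose K := nrm ((\det g)%:~R : R[i]) + 1.
  have K0 : 0 < K by rewrite ltr_wpDl ?nrm_ge0.
  have [d d0 H] := holomorphic_along hQ DZ (divr_gt0 e0 K0).
  exists d => // W DW WZ; rewrite -mulrBr nrmM.
  have := H W DW WZ; rewrite ltr_pdivlMr // => h; apply: le_lt_trans h.
  by rewrite mulrC ler_wpM2l ?nrm_ge0 // /K lerDl.
move=> W DW _ Ws; have P1 : \prod_(r <- s) bil S W (ir r) != 0.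
  by rewrite prodf_seq_neq0; apply/allP => r rs; exact: Ws.
apply: (mulIf P1); rewrite -mulrA -PhiQ // -PhiO // PhiQ; last exact: gD.
by rewrite isometry_root_product //; case: gO.
Qed.

Lemma quotient_scale (k : nat) (t : R[i]) Z :
  (forall t Z, t != 0 -> D Z -> Phi (t *: Z) = t ^- k * Phi Z) -> t != 0 -> D Z ->
  Q (t *: Z) = t ^- (k + size s) * Q Z.
Proof.
move=> hk t0 DZ; have tD W : D W -> D (t *: W) by move=> DW; exact: (domain_scale hD t0 DW).
apply: (@dense_eq s (fun Z => Q (t *: Z)) (fun Z => t ^- (k + size s) * Q Z) Z 1) => //.
- move=> e e0; have [d d0 H] := holomorphic_along hQ (tD Z DZ) e0.
  have nt : 0 < nrm t by rewrite nrm_gt0.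
  exists (d / nrm t) => [|W DW WZ]; first by rewrite divr_gt0.
  by apply: H; [exact: tD|rewrite -scalerBr nrmZ mulrC -ltr_pdivlMr].
- move=> e e0; pose K := nrm (t ^- (k + size s)) + 1.
  have K0 : 0 < K by rewrite ltr_wpDl ?nrm_ge0.
  have [d d0 H] := holomorphic_along hQ DZ (divr_gt0 e0 K0).
  exists d => // W DW WZ; rewrite -mulrBr nrmM.
  have := H W DW WZ; rewrite ltr_pdivlMr // => h; apply: le_lt_trans h.
  by rewrite mulrC ler_wpM2l ?nrm_ge0 // /K lerDl.
move=> W DW _ Ws; have P1 : \prod_(r <- s) bil S W (ir r) != 0.
  by rewrite prodf_seq_neq0; apply/allP => r rs; exact: Ws.
have tn : t ^+ size s != 0 by rewrite expf_neq0.
have PE : \prod_(r <- s) bil S (t *: W) (ir r) = t ^+ size s * \prod_(r <- s) bil S W (ir r).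
  elim: (s) => [|r t' IH]; first by rewrite !big_nil mulr1.
  by rewrite !big_cons IH bilZl exprS; ring.
apply: (mulIf P1); apply: (mulfI tn).
have := hk t W t0 DW; rewrite {1}(PhiQ DW) {1}(PhiQ (tD W DW)) PE exprD invfM => E.
have -> : t ^+ size s * (Q (t *: W) * \prod_(r <- s) bil S W (ir r)) =
   Q (t *: W) * (t ^+ size s * \prod_(r <- s) bil S W (ir r)) by ring.
by rewrite E; field; rewrite tn expf_neq0.
Qed.

End Quotient.

Lemma diff_near (R : realType) (V : normedModType R[i]) (f g : V -> R[i]) (p : V) (d : R) : 0 < d ->
  (forall q, nrm (q - p) < d -> f q = g q) -> differentiable g p -> differentiable f p.
Proof.
move=> d0 fg dg.
have [K HK] : exists K : R, forall v, nrm ('d g p v) <= K * nrm v.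
  have c0 : {for (0 : V), continuous ('d g p)} by exact: diff_continuous.
  have [e e0 H] := (cont_nrm _ _).1 c0 _ ltr01.
  exists (2 / e) => v; have [->|v0] := eqVneq v 0; first by rewrite linear0 !nrm0 mulr0.
  have nv : 0 < nrm v by rewrite nrm_gt0.
  pose v' := (e / (2 * nrm v))%:C *: v; have := H v'.
  have -> : 'd g p 0 = 0 by exact: linear0.
  have -> : 'd g p v' = (e / (2 * nrm v))%:C * 'd g p v by exact: linearZ.
  rewrite (subr0 v') (subr0 (_ * _)) nrmZ nrmM !nrm_real.
  rewrite gtr0_norm ?divr_gt0 ?mulr_gt0 // => /(_ _)-h.
  have : e / (2 * nrm v) * nrm ('d g p v) < 1.
    apply: h; have -> : e / (2 * nrm v) * nrm v = e / 2 by field; rewrite gt_eqF.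
    by lra.
  rewrite mulrAC ltr_pdivrMr ?mulr_gt0 // mul1r => /ltW.
  by rewrite mulrAC ler_pdivlMr // mulrC.
apply: (@eps_diff R V f ('d g p) p K) => //; first exact: linearP.
move=> e e0; have [d' d'0 H] := diff_eps dg e0.
exists (Num.min d d') => [|v]; first by rewrite lt_min d0.
rewrite lt_min => /andP[v1 v2]; rewrite !fg ?subrr ?nrm0 //; first exact: H.
by rewrite addrC addKr.
Qed.

Lemma map_intr_inj (F : numDomainType) d e (X Y : 'M[int]_(d, e)) :
  map_mx intr X = map_mx intr Y :> 'M[F]_(d, e) -> X = Y.
Proof.
move=> /matrixP H; apply/matrixP => i j; apply: (@intr_inj F).
by have := H i j; rewrite !mxE.
Qed.

(** * Koecher's principle *)

Section Cone.
Variables (R : realType) (n m : nat) (G : 'M[int]_n.+2).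
Hypothesis hG : has_signature_2n R G.
Variables (c : 'cV[int]_n.+2) (b : 'cV[rat]_n.+2).
Hypothesis cc : bil G c c = 0.
Hypothesis cb : bil G (map_mx intr c) b = 1.
Variable A : 'M[int]_(n.+2, m).
Hypothesis Ac : A^T *m G *m c = 0.
Hypothesis Ab : map_mx intr (A^T *m G) *m b = 0.

Let Gsym : G^T = G := hG.1.

Definition lin (F : comNzRingType) (y : 'cV[F]_m) : 'cV[F]_n.+2 := map_mx intr A *m y.

Lemma linD (F : comNzRingType) (y y' : 'cV[F]_m) : lin (y + y') = lin y + lin y'.
Proof. exact: mulmxDr. Qed.

Lemma linB (F : comNzRingType) (y y' : 'cV[F]_m) : lin (y - y') = lin y - lin y'.
Proof. exact: mulmxBr. Qed.

Lemma linZ (F : comNzRingType) (a : F) (y : 'cV[F]_m) : lin (a *: y) = a *: lin y.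
Proof. by rewrite /lin scalemxAr. Qed.

Lemma map_lin (F F' : comNzRingType) (f : {rmorphism F -> F'}) (y : 'cV[F]_m) :
  map_mx f (lin y) = lin (map_mx f y).
Proof. by rewrite /lin map_mxM; congr (_ *m _); apply/matrixP => i j; rewrite !mxE rmorph_int. Qed.

Lemma lin_dot_c (F : comNzRingType) (y : 'cV[F]_m) : bil G (lin y) (map_mx intr c) = 0.
Proof. by rewrite /lin bil_mull -map_mxM Ac raddf0 mulmx0 mxE. Qed.

Lemma lin_dot_b (F : numFieldType) (y : 'cV[F]_m) : bil G (lin y) (map_mx ratr b) = 0.
Proof.
rewrite /lin bil_mull; have -> : map_mx intr (A^T *m G) = map_mx ratr (map_mx intr (A^T *m G) : 'M[rat]_(m, n.+2)) :> 'M[F]_(m, n.+2).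
  by apply/matrixP => i j; rewrite !mxE ratr_int.
by rewrite -map_mxM Ab raddf0 mulmx0 mxE.
Qed.

(** A vector of norm 1 in the plane of b and c. It is the second positive direction, so that vectors
    orthogonal to b and c obey the hyperbolic inequalities. *)
Definition pos_vector : 'cV[R]_n.+2 := map_mx ratr b + ((1 - ratr (bil G b b)) / 2) *: map_mx intr c.

Lemma lin_dot_pos (y : 'cV[R]_m) : bil G (lin y) pos_vector = 0.
Proof. by rewrite /pos_vector bilDr bilZr lin_dot_c lin_dot_b mulr0 addr0. Qed.

Lemma pos_vector_pos : 0 < bil G pos_vector pos_vector.
Proof.
have ccR : bil G (map_mx intr c) (map_mx intr c) = 0 :> R by rewrite -bil_map cc rmorph0.
have cbR : bil G (map_mx intr c) (map_mx ratr b) = 1 :> R.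
  have -> : map_mx intr c = map_mx ratr (map_mx intr c : 'cV[rat]_n.+2) :> 'cV[R]_n.+2.
    by apply/colP => i; rewrite !mxE ratr_int.
  by rewrite -bil_map cb rmorph1.
have bcR : bil G (map_mx ratr b) (map_mx intr c) = 1 :> R by rewrite bilC.
rewrite /pos_vector !bil_lin ccR cbR bcR -bil_map.
have -> : forall x : R, x + (1 - x) / 2 * 1 + ((1 - x) / 2 * 1 + (1 - x) / 2 * ((1 - x) / 2 * 0)) = 1.
  by move=> x; field.
exact: ltr01.
Qed.

Variable u0 : 'cV[R]_m.
Hypothesis u0_pos : 0 < bil G (lin u0) (lin u0).

(** The sign of the pairing with [u0] selects one of the two components of the vectors of positive
    norm. *)
Definition cone (y : 'cV[R]_m) := 0 < bil G (lin y) (lin y) /\ 0 < bil G (lin y) (lin u0).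

Lemma cone_scale (t : R) y : 0 < t -> cone y -> cone (t *: y).
Proof.
by move=> t0 [h1 h2]; rewrite /cone !linZ !bilZl bilZr !mulr_gt0.
Qed.

Lemma cone_convex y y' (t : R) : cone y -> cone y' -> 0 <= t <= 1 -> cone (y + t *: (y' - y)).
Proof.
move=> [h1 h2] [h3 h4] t01; rewrite /cone linD linZ linB.
exact: (orth_cone_convex hG pos_vector_pos (lin_dot_pos u0) (lin_dot_pos y) (lin_dot_pos y')).
Qed.

Lemma cone_open y : cone y -> exists2 d : R, 0 < d &
  forall y' : 'cV[R]_m, (forall i, `|y' i 0 - y i 0| < d) -> cone y'.
Proof.
move=> [h1 h2]; pose Y (y : 'cV[R]_m) : 'cV[R[i]]_m := map_mx (real_complex R) y.
have open (f : 'cV[R[i]]_m -> R[i]) (e : R) : {for Y y, continuous f} -> 0 < e ->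
    exists2 d : R, 0 < d & forall y' : 'cV[R]_m, (forall i, `|y' i 0 - y i 0| < d) -> nrm (f (Y y') - f (Y y)) < e.
  move=> cf e0; have [d d0 H] := (cont_nrm _ _).1 cf _ e0.
  exists d => // y' yy; apply: H; apply: nrm_mx_lt => // i j.
  by rewrite !ord1 !mxE -rmorphB /= nrm_real.
have cl : {for Y y, continuous (fun z : 'cV[R[i]]_m => lin z)}.
  by apply: cont_mulmx; exact: cont_id.
have bl (v w : 'cV[R]_m) : bil G (lin (Y v)) (lin (Y w)) = (bil G (lin v) (lin w))%:C.
  by rewrite -!map_lin -bil_map.
have [d1 d10 H1] := open (fun z => bil G (lin z) (lin z)) _ (cont_bil cl cl) h1.
have c2 : {for Y y, continuous (fun _ : 'cV[R[i]]_m => lin (Y u0))} by exact: contC.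
have [d2 d20 H2] := open (fun z => bil G (lin z) (lin (Y u0))) _ (cont_bil cl c2) h2.
exists (Num.min d1 d2) => [|y' yy]; first by rewrite lt_min d10.
split.
  have := H1 y'; rewrite !bl -rmorphB /= nrm_real => /(_ _)-h.
  have : `|bil G (lin y') (lin y') - bil G (lin y) (lin y)| < bil G (lin y) (lin y).
    by apply: h => i; have := yy i; rewrite lt_min => /andP[].
  by rewrite ltr_norml => /andP[]; lra.
have := H2 y'; rewrite !bl -rmorphB /= nrm_real => /(_ _)-h.
have : `|bil G (lin y') (lin u0) - bil G (lin y) (lin u0)| < bil G (lin y) (lin u0).
  by apply: h => i; have := yy i; rewrite lt_min => /andP[].
by rewrite ltr_norml => /andP[]; lra.
Qed.

(** Both conditions are open and homogeneous: round N y down in each coordinate, with 1/N so small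
    that neither the cone nor the sign of the pairing with [k] is lost. *)
Lemma cone_integral (k : 'rV[R]_m) y : cone y -> (k *m y) 0 0 < 0 ->
  exists2 w : 'cV[int]_m, cone (map_mx intr w) & (k *m map_mx intr w) 0 0 < 0.
Proof.
move=> Cy ky; have [d d0 H] := cone_open Cy.
pose M := 1 + \sum_i `|k 0 i|; have M0 : 0 < M by rewrite ltr_wpDr ?sumr_ge0.
pose e := Num.min d (- (k *m y) 0 0 / M).
have e0 : 0 < e by rewrite lt_min d0 divr_gt0 // oppr_gt0.
pose N := (Num.truncn e^-1).+1; have N0 : (0 : R) < N%:R by rewrite ltr0n.
have Ne : (N%:R : R)^-1 < e.
  by rewrite -[ltRHS]invrK ltf_pV2 ?posrE ?invr_gt0 //; exact: truncnS_gt.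
pose w : 'cV[int]_m := \col_i Num.floor (N%:R * y i 0).
pose y' : 'cV[R]_m := (N%:R)^-1 *: map_mx intr w.
have wy' : map_mx intr w = N%:R *: y' by rewrite scalerA divff ?scale1r // gt_eqF.
have yy i : `|y' i 0 - y i 0| < e.
  have h1 := floor_le (N%:R * y i 0); have h2 := floorD1_gt (N%:R * y i 0); rewrite intrD in h2.
  have -> : y' i 0 - y i 0 = N%:R^-1 * ((Num.floor (N%:R * y i 0))%:~R - N%:R * y i 0).
    by rewrite !mxE mulrBr mulKf // gt_eqF.
  rewrite normrM gtr0_norm ?invr_gt0 //; apply: le_lt_trans Ne.
  have Ni : 0 <= (N%:R : R)^-1 by rewrite invr_ge0 ltW.
  by rewrite ler_piMr // ler_norml; apply/andP; split; lra.
have y'C : cone y' by apply: H => i; apply: lt_le_trans (yy i) _; rewrite ge_min lexx.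
exists w; first by rewrite wy'; exact: cone_scale.
rewrite wy' -scalemxAr mxE pmulr_rlt0 //.
have : `|(k *m y') 0 0 - (k *m y) 0 0| <= \sum_i `|k 0 i| * e.
  rewrite !mxE -sumrB; apply: le_trans (ler_norm_sum _ _ _) _; apply: ler_sum => i _.
  by rewrite -mulrBr normrM ler_wpM2l // ltW.
rewrite -mulr_suml => h; have : (\sum_i `|k 0 i|) * e < M * e by rewrite ltr_pM2r // /M; lra.
have : M * e <= - (k *m y) 0 0.
  by rewrite mulrC -ler_pdivlMr // /e ge_min lexx orbT.
by move: h; rewrite ler_norml => /andP[]; lra.
Qed.

Lemma cone_orth_neg (y v : 'cV[R]_m) : cone y -> bil G (lin v) (lin y) = 0 -> lin v != 0 ->
  bil G (lin v) (lin v) < 0.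
Proof.
move=> [y0 _] vy v0.
exact: (signature_orth_neg hG y0 pos_vector_pos (lin_dot_pos y) vy (lin_dot_pos v) v0).
Qed.

Hypothesis A_inj : forall v : 'cV[int]_m, lin v = 0 -> v = 0.
Hypothesis m3 : (2 < m)%N.

Let orth_vector q (X : 'M[int]_(m, q)) : (q < m)%N -> exists2 v : 'cV[int]_m, v != 0 &
  forall i, bil G (lin v) (lin (col i X)) = 0.
Proof.
move=> qm; have [a [E [P [Z [NE PE _ da]]]]] := kernel_basis (map_mx intr (X^T *m A^T *m G *m A) : 'M[rat]_(q, m)).
have a0 : (0 < a)%N by lia.
pose j := Ordinal a0; exists (col j E).
  apply/negP => /eqP E0; have := congr1 (fun M : 'M_a => M j j) PE; rewrite !mxE eqxx.
  under eq_bigr => i _ do rewrite mxE; rewrite big1 => [/eqP|i _].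
    by rewrite eq_sym oner_eq0.
  by have := congr1 (fun M : 'cV_m => M i 0) E0; rewrite !mxE => ->; rewrite mulr0.
have {}NE : X^T *m A^T *m G *m A *m E = 0.
  apply: (@map_intr_inj rat).
  by rewrite map_mxM NE raddf0.
move=> i; rewrite bilC // /lin !map_intz /bil map_intz.
have -> : (A *m col i X)^T *m G *m (A *m col j E) = row i (X^T *m A^T *m G *m A *m col j E).
  by rewrite trmx_mul tr_col -!row_mul !mulmxA.
by rewrite colE mulmxA NE mul0mx !mxE.
Qed.

(* If -u^2 v1^2 = s^2 and v2 is orthogonal to u and v1, then for
   D = -u^2 v2^2 the number (s D)^2 + D lies strictly between consecutive
   squares. *)
Lemma nonsquare_orth (u : 'cV[int]_m) : cone (map_mx intr u) -> exists v : 'cV[int]_m,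
  [/\ bil G (lin u) (lin v) = 0, bil G (lin v) (lin v) < 0 &
   forall k : nat, (k * k)%N != `|(bil G (lin u) (lin u) * bil G (lin v) (lin v))%R|%N].
Proof.
move=> Cu.
have cast (v w : 'cV[int]_m) : (bil G (lin v) (lin w))%:~R = bil G (lin (map_mx intr v)) (lin (map_mx intr w)) :> R.
  by rewrite bil_map !map_lin.
have u2 : 0 < bil G (lin u) (lin u) by have [h _] := Cu; rewrite -(ltr0z R) cast.
have neg (v : 'cV[int]_m) : v != 0 -> bil G (lin v) (lin u) = 0 -> bil G (lin v) (lin v) < 0.
  move=> v0 vu; rewrite -(ltrz0 R) cast; apply: (cone_orth_neg Cu).
    by rewrite -cast vu.
  apply: contra v0 => /eqP v0; apply/eqP/A_inj.
  apply: (@map_intr_inj R).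
  by rewrite map_lin v0 raddf0.
have [v1 v10 H1] := @orth_vector 1 u (ltnW m3).
have v1u : bil G (lin v1) (lin u) = 0 by have := H1 0; rewrite col_id.
have v1n := neg v1 v10 v1u.
pose al := `|(bil G (lin u) (lin u) * bil G (lin v1) (lin v1))%R|%N.
have [[s Es]|ns] := pselect (exists s, (s * s)%N = al); last first.
  exists v1; split => //; first by rewrite bilC.
  by move=> k; apply/eqP => E; apply: ns; exists k.
have [v2 v20 H2] := @orth_vector 2 (row_mx u v1) m3.
have v2u : bil G (lin v2) (lin u) = 0.
  have := H2 (lshift 1 (0 : 'I_1)); have -> : col (lshift 1 (0 : 'I_1)) (row_mx u v1) = u by rewrite colKl col_id.
  by [].
have v2v1 : bil G (lin v2) (lin v1) = 0.
  have := H2 (rshift 1 (0 : 'I_1)); have -> : col (rshift 1 (0 : 'I_1)) (row_mx u v1) = v1 by rewrite colKr col_id.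
  by [].
have v2n := neg v2 v20 v2u.
pose be := `|(bil G (lin u) (lin u) * bil G (lin v2) (lin v2))%R|%N.
exists (be%:Z *: v1 + v2); have vE : lin (be%:Z *: v1 + v2) = be%:Z *: lin v1 + lin v2 by rewrite linD linZ.
have v12 : bil G (lin v1) (lin v2) = 0 by rewrite bilC.
have E : bil G (lin (be%:Z *: v1 + v2)) (lin (be%:Z *: v1 + v2)) =
   be%:Z ^+ 2 * bil G (lin v1) (lin v1) + bil G (lin v2) (lin v2).
  by rewrite vE !bil_lin v12 v2v1; ring.
split.
- by rewrite vE bilC // bilDl bilZl v1u v2u mulr0 addr0.
- rewrite E; apply: ltr_wnDl => //; rewrite mulr_ge0_le0 ?sqr_ge0 // ltW //.
move=> k; rewrite E mulrDr.
have be0 : (0 < be)%N by rewrite absz_gt0; apply: mulf_neq0; [rewrite gt_eqF|rewrite lt_eqF].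
have -> : `|(bil G (lin u) (lin u) * (be%:Z ^+ 2 * bil G (lin v1) (lin v1)) +
   bil G (lin u) (lin u) * bil G (lin v2) (lin v2))%R|%N = (be * be * al + be)%N.
  rewrite /al {4}/be; move: u2 v1n v2n.
  move: (bil G (lin u) (lin u)) (bil G (lin v1) (lin v1)) (bil G (lin v2) (lin v2)) (be) => a x y e a0 x0 y0.
  have h1 : a * x < 0 by rewrite pmulr_rlt0.
  have h2 : a * y < 0 by rewrite pmulr_rlt0.
  have h3 : a * (e%:Z ^+ 2 * x) = e%:Z ^+ 2 * (a * x) by ring.
  rewrite h3 expr2; have : e%:Z * e%:Z * (a * x) <= 0 by rewrite mulr_ge0_le0 // ltW.
  move: h1 h2; move: (a * x) (a * y) => X Y X0 Y0.
  have -> : (e * e * `|X|)%N = `|(e%:Z * e%:Z * X)%R|%N by rewrite !abszM.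
  by move: (e%:Z * e%:Z * X) => W; lia.
rewrite -Es; have -> : (be * be * (s * s) + be = (s * be) * (s * be) + be)%N by ring.
have al0 : (0 < al)%N by rewrite absz_gt0; apply: mulf_neq0; [rewrite gt_eqF|rewrite lt_eqF].
have s0 : (0 < s)%N by case: (posnP s) => // sE; rewrite sE in Es; lia.
apply/eqP => kE; have h1 : (s * be < k)%N by rewrite -ltn_sqr -!mulnn kE; lia.
have h2 : (k < (s * be).+1)%N.
  rewrite -ltn_sqr -!mulnn kE; have : (be <= s * be)%N by rewrite leq_pmull.
  by nia.
by lia.
Qed.

End Cone.

(** * Frequencies as linear forms *)

Section Weight.
Variables (R : realType) (m : nat).
Local Notation VC := 'cV[R[i]]_m.

Fixpoint wt (s : seq 'I_m) (ks : seq int) : 'rV[R]_m :=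
  match s, ks with
  | i :: s', k :: ks' => k%:~R *: delta_mx 0 i + wt s' ks'
  | _, _ => 0
  end.

Lemma chi_wt s ks (z : VC) : chi s ks z = epi ((map_mx (real_complex R) (wt s ks) *m z) 0 0).
Proof.
elim: s ks => [|i s IH] [|k ks]; try by rewrite [wt _ _]/= map_mx0 mul0mx mxE epi0.
rewrite [chi _ _ _]/= [wt _ _]/= IH map_mxD map_mxZ mulmxDl -scalemxAl [in RHS]mxE epiD; congr (epi _ * _).
rewrite [in RHS]mxE rmorph_int; congr (_ * _); rewrite [in RHS]mxE (bigD1 i) //= big1 ?addr0 => [|j ji].
  by rewrite !mxE !eqxx rmorph1 mul1r.
by rewrite !mxE (negbTE ji) andbF rmorph0 mul0r.
Qed.

Lemma nrm_chi s ks (z : VC) : nrm (chi s ks z) = expR (- (2 * pi * (wt s ks *m Imv z) 0 0)).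
Proof.
rewrite chi_wt nrm_epi; congr (expR (- (_ * _))).
rewrite !mxE raddf_sum; apply: eq_bigr => j _; rewrite !mxE.
by case: (z j 0) => x y /=; rewrite mul0r addr0.
Qed.

Lemma wt_cat s s' ks ks' : size ks = size s -> wt (s ++ s') (ks ++ ks') = wt s ks + wt s' ks'.
Proof.
elim: s ks => [|i s IH] [|k ks] //=; first by rewrite add0r.
by move=> [sz]; rewrite IH // addrA.
Qed.

End Weight.

Lemma pell_bound (N : nat) (x : int) : N.+1%:Z <= x -> N.+1%:Z <= 2 * x * x - 1.
Proof.
move=> Nx; have x1 : 1 <= x by lia.
have : x * 1 <= x * x by rewrite ler_wpM2l //; lia.
by rewrite -mulrA; lia.
Qed.

Section Koecher.
Variables (R : realType) (n m : nat) (G : 'M[int]_n.+2).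
Hypothesis hG : has_signature_2n R G.
Hypothesis evenG : even_lattice G.
Variables (c : 'cV[int]_n.+2) (b : 'cV[rat]_n.+2).
Hypothesis cc : bil G c c = 0.
Hypothesis cb : bil G (map_mx intr c) b = 1.
Variable A : 'M[int]_(n.+2, m).
Hypothesis Ac : A^T *m G *m c = 0.
Hypothesis Ab : map_mx intr (A^T *m G) *m b = 0.
Variable u0 : 'cV[R]_m.
Hypothesis u0_pos : 0 < bil G (lin A u0) (lin A u0).
Local Notation VC := 'cV[R[i]]_n.+2.
Local Notation WC := 'cV[R[i]]_m.
Local Notation Omega := (cone G A u0).

Let Gsym : G^T = G := hG.1.
Let dG : \det G != 0 := signature_det_neq0 hG.
Let openO y (h : Omega y) := cone_open h.
Let convexO := cone_convex hG cc cb Ac Ab u0_pos.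

Variable D : set VC.
Hypothesis hD : is_domain_cone G D.

Definition tau (z : WC) : VC := tube_point G c b (lin A z).

Lemma lin_Im (z : WC) : map_mx (@complex.Im R) (lin A z) = lin A (Imv z).
Proof.
apply/colP => i; rewrite !mxE raddf_sum; apply: eq_bigr => j _; rewrite !mxE.
rewrite -!(rmorph_int (real_complex R)); case: (z j 0) => x y /=.
by rewrite mul0r addr0.
Qed.

Lemma tau_period z : in_tube Omega z -> period_cone G (tau z).
Proof.
move=> [zp _]; apply: (tube_point_period Gsym cc cb); [exact: lin_dot_c|exact: lin_dot_b|].
by rewrite lin_Im.
Qed.

Lemma tau_differentiable z : differentiable tau z.
Proof.
have dl : differentiable (fun z : WC => lin A z) z by apply: dif_mulmx; exact: dif_id.
rewrite /tau /tube_point.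
apply: (@differentiableB _ _ _ (fun z => lin A z + map_mx ratr b)
  (fun z => ((bil G (lin A z) (lin A z) + ratr (bil G b b)) / 2) *: map_mx intr c)).
  by apply: difDv dl (differentiable_cst _ _).
apply: difZl; apply: difM; last exact: difC.
by apply: difD; [exact: dif_bil|exact: difC].
Qed.

Variable z0 : WC.
Hypothesis z0T : in_tube Omega z0.
Hypothesis z0D : D (tau z0).

Lemma tau_domain z : in_tube Omega z -> D (tau z).
Proof.
move=> zT; pose f (t : R) : WC := z0 + t%:C *: (z - z0).
have f0 : f 0 = z0 by rewrite /f rmorph0 scale0r addr0.
have f1 : f 1 = z by rewrite /f rmorph1 scale1r addrC subrK.
have fT t : 0 <= t <= 1 -> in_tube Omega (f t).
  move=> t01; rewrite /in_tube; have -> : Imv (f t) = Imv z0 + t *: (Imv z - Imv z0).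
    apply/colP => j; rewrite !mxE raddfD /=; congr (_ + _).
    by case: (z j 0) => x y; case: (z0 j 0) => x' y' /=; rewrite mul0r addr0.
  exact: convexO.
rewrite -f1; apply: (domain_path hD (f := fun t => tau (f t))); last by rewrite f0.
  move=> t _; apply: (@cont_comp _ _ _ f tau).
    by rewrite /f; apply: contD; [exact: contC|cont].
  by have := tau_differentiable (f t); exact: differentiable_continuous.
by move=> t t01; apply: tau_period; exact: fT.
Qed.

(** The transvection acts on tube coordinates as translation by [x]: the coefficients of c match
    because (v + x)^2 = v^2 + 2 (v, x) + 2 q. *)
Lemma eichler_tube_point (v : VC) (x : 'cV[int]_n.+2) (q : int) :
  bil G x c = 0 -> bil G (map_mx intr x) b = 0 -> bil G x x = 2 * q ->
  bil G v (map_mx intr c) = 0 -> bil G v (map_mx ratr b) = 0 ->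
  map_mx intr (eichler G c x q) *m tube_point G c b v = tube_point G c b (v + map_mx intr x).
Proof.
move=> xc xb xx vc vb.
have xbC : bil G (map_mx intr x) (map_mx ratr b) = 0 :> R[i].
  have -> : map_mx intr x = map_mx ratr (map_mx intr x : 'cV[rat]_n.+2) :> VC.
    by apply/colP => i; rewrite !mxE ratr_int.
  by rewrite -bil_map xb rmorph0.
have xcC : bil G (map_mx intr x) (map_mx intr c) = 0 :> R[i] by rewrite -bil_map xc rmorph0.
rewrite eichler_mul (bilC (map_mx intr c) _ Gsym) (tube_point_dot_c Gsym cc cb vc) scale1r mulr1.
have -> : bil G (map_mx intr x) (tube_point G c b v) = bil G v (map_mx intr x).
  by rewrite /tube_point !bil_lin xbC xcC mulr0 subr0 addr0 (bilC _ _ Gsym).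
rewrite /tube_point; have -> : bil G (v + map_mx intr x) (v + map_mx intr x) =
   bil G v v + 2 * bil G v (map_mx intr x) + 2 * q%:~R.
  have E : bil G (map_mx intr x) (map_mx intr x) = 2 * q%:~R :> R[i].
    by rewrite -bil_map xx rmorphM rmorph_nat.
  by rewrite !bil_lin E (bilC (map_mx intr x) v Gsym); ring.
by apply/colP => i; rewrite !mxE; field.
Qed.

Lemma even_half (x : 'cV[int]_n.+2) : exists q, bil G x x = 2 * q.
Proof. by have /dvdzP[q E] := evenG x; exists q; rewrite E mulrC. Qed.

(* g is an Eichler transformation. *)
Lemma tau_translate z (w : 'cV[R]_m) (x : 'cV[int]_n.+2) :
  bil G x c = 0 -> bil G (map_mx intr x) b = 0 -> map_mx intr x = lin A w -> in_tube Omega z ->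
  exists g, [/\ Oplus G D g, \det g = 1, tau (z + map_mx (real_complex R) w) = map_mx intr g *m tau z &
    forall r, bil G x r = 0 -> bil G c r = 0 -> g *m r = r].
Proof.
move=> xc xb xw zT; have [q xx] := even_half x.
exists (eichler G c x q).
have E : tau (z + map_mx (real_complex R) w) = map_mx intr (eichler G c x q) *m tau z.
  rewrite /tau (eichler_tube_point xc xb xx (lin_dot_c Ac z) (lin_dot_b Ab z)).
  rewrite linD -map_lin -xw; congr (tube_point _ _ _ (_ + _)).
  by apply/colP => i; rewrite !mxE rmorph_int.
split => //.
- apply: (isometry_Oplus hD dG (eichler_isometry Gsym cc xc xx) (tau_domain zT)).
  rewrite -E; apply: tau_domain; rewrite /in_tube.
  have -> : Imv (z + map_mx (real_complex R) w) = Imv z; last by [].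
  by apply/colP => i; rewrite !mxE raddfD /= addr0.
- exact: eichler_det.
move=> r xr cr; rewrite -[eichler _ _ _ _]map_intz eichler_mul !map_intz xr cr.
by rewrite mulr0 addr0 !scale0r subr0 addr0.
Qed.

Variable Phi : VC -> R[i].
Hypothesis hPhi : holomorphic_on D Phi.
Hypothesis PhiO : forall g Z, Oplus G D g -> D Z -> Phi (map_mx intr g *m Z) = (\det g)%:~R * Phi Z.

(** [tau] takes values in the cone, so composing a local extension of [F] with it gives the function
    itself near [z]. *)
Lemma holomorphic_tau (F : VC -> R[i]) z : holomorphic_on D F -> in_tube Omega z ->
  differentiable (fun z => F (tau z)) z.
Proof.
move=> hF zT; have [H /nbhs_nrm[d d0 HH]] := hF _ (tau_domain zT).
have dH : differentiable (fun z => H (tau z)) z.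
  apply: (@dif_comp _ _ _ _ tau H); first exact: tau_differentiable.
  by have [|] := HH (tau z); rewrite ?subrr ?nrm0.
have [d1 d10 H1] := tube_box openO zT.
have [d2 d20 H2] := (cont_nrm _ _).1 (differentiable_continuous (tau_differentiable z)) _ d0.
apply: (@diff_near _ _ _ (fun z => H (tau z)) z (Num.min d1 d2)) => //.
  by rewrite lt_min d10.
move=> w; rewrite lt_min => /andP[w1 w2].
have wT : in_tube Omega w.
  apply: H1 => j; apply: le_lt_trans w1; have := nrm_coord (w - z) j 0; by rewrite !mxE.
by have [_] := HH (tau w) (H2 w w2); apply; exact: tau_domain.
Qed.

Definition Psi z := Phi (tau z).

Lemma Psi_translate z (w : 'cV[R]_m) (x : 'cV[int]_n.+2) :
  bil G x c = 0 -> bil G (map_mx intr x) b = 0 -> map_mx intr x = lin A w -> in_tube Omega z ->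
  Psi (z + map_mx (real_complex R) w) = Psi z.
Proof.
move=> xc xb xw zT; have [g [gO g1 E _]] := tau_translate xc xb xw zT.
by rewrite /Psi E (PhiO gO (tau_domain zT)) g1 mul1r.
Qed.

Lemma Psi_class : tube_class Omega Psi.
Proof.
split=> [z zT|z i zT]; first exact: holomorphic_tau.
have -> : ev R i = map_mx (real_complex R) (delta_mx i 0).
  by apply/colP => j; rewrite !mxE; case: (_ && _); rewrite ?rmorph1 ?rmorph0.
have E : lin A (delta_mx i 0 : 'cV[int]_m) = col i A by rewrite /lin map_intz -colE.
apply: (@Psi_translate _ _ (col i A)) zT.
- by rewrite -E -[c]map_intz lin_dot_c.
- have := lin_dot_b Ab (map_mx intr (delta_mx i 0 : 'cV[int]_m) : 'cV[rat]_m).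
  rewrite -map_lin E => <-; congr (bil _ _ _).
  by apply/colP => j; rewrite !mxE -[LHS]divq_num_den [RHS]/ratr.
rewrite -E map_lin; congr (lin A _).
by apply/colP => j; rewrite !mxE; case: (_ && _).
Qed.

Hypothesis A_inj : forall v : 'cV[int]_m, lin A v = 0 -> v = 0.
Hypothesis m3 : (2 < m)%N.

(* The unit of norm one attached to u, v moves the line through the positive
   vector u far away, while |Psi| is invariant. *)
Lemma pell_orbit (u v : 'cV[int]_m) (x y : int) :
  cone G A u0 (map_mx intr u) -> bil G (lin A u) (lin A v) = 0 ->
  x * x = 1 - bil G (lin A u) (lin A u) * bil G (lin A v) (lin A v) * (y * y) -> x != 0 ->
  let y' : 'cV[R]_m := (2 * x * x - 1)%:~R *: map_mx intr u +
     (2 * x * y * bil G (lin A u) (lin A u))%:~R *: map_mx intr v in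
  cone G A u0 y' /\ forall w : WC, Imv w = y' ->
    exists2 w', Imv w' = map_mx intr u & nrm (Psi w) = nrm (Psi w').
Proof.
move=> Cu uv xx x0 y'; set a := bil G (lin A u) (lin A u) in xx y' *; set b' := bil G (lin A v) (lin A v) in xx.
have cast (v1 w1 : 'cV[int]_m) : (bil G (lin A v1) (lin A w1))%:~R = bil G (lin A (map_mx intr v1)) (lin A (map_mx intr w1)) :> R.
  by rewrite bil_map !map_lin.
have vu : bil G (lin A v) (lin A u) = 0 by rewrite bilC.
have aR : a%:~R = bil G (lin A (map_mx intr u)) (lin A (map_mx intr u)) :> R by rewrite /a cast.
have bR : b'%:~R = bil G (lin A (map_mx intr v)) (lin A (map_mx intr v)) :> R by rewrite /b' cast.
have uvR : bil G (lin A (map_mx intr u)) (lin A (map_mx intr v)) = 0 :> R by rewrite -cast uv.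
have vuR : bil G (lin A (map_mx intr v)) (lin A (map_mx intr u)) = 0 :> R by rewrite -cast vu.
have [up uu0] := Cu; have a0 : (0 : R) < a%:~R by rewrite aR.
have xxR : x%:~R * x%:~R = 1 - a%:~R * b'%:~R * (y%:~R * y%:~R) :> R.
  by rewrite -!rmorphM xx rmorphB rmorph1 !rmorphM.
have X0 : (0 : R) < (2 * x * x - 1)%:~R.
  by rewrite ltr0z -mulrA; have : 0 < x * x by [rewrite -expr2 exprn_even_gt0]; lia.
have y'2 : bil G (lin A y') (lin A y') = a%:~R.
  rewrite /y' linD !linZ !bil_lin uvR vuR -aR -bR.
  rewrite !(rmorphB, rmorphM, rmorph1, rmorph_nat).
  transitivity ((2 * (x%:~R * x%:~R) - 1) ^+ 2 * a%:~R + 4 * (x%:~R * x%:~R) * (y%:~R * y%:~R) * a%:~R * (a%:~R * b'%:~R) : R); first by ring.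
  by rewrite xxR; ring.
have y'u : 0 < bil G (lin A y') (lin A (map_mx intr u)).
  by rewrite /y' linD !linZ !bil_lin vuR -aR mulr0 addr0 mulr_gt0.
have y'C : cone G A u0 y'.
  split; first by rewrite y'2.
  apply: (orth_cone_pos hG (pos_vector_pos hG cc cb) (lin_dot_pos Ac Ab (map_mx intr u))) => //.
  - exact: lin_dot_pos.
  - exact: lin_dot_pos.
  - by rewrite y'2.
  - exact: ltW.
  - by rewrite bilC.
split => // w wy'.
(* [f] is the isometry [g] in tube coordinates. The sign of x gives the inverse unit, which takes y'
   back to u. *)
pose f (F : fieldType) (w1 : 'cV[F]_m) : 'cV[F]_m := w1
   + bil G (lin A (map_mx intr u)) (lin A w1) *: map_mx intr (- 2 * b' * (y * y) *: u + 2 * (- x * y) *: v)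
   - bil G (lin A (map_mx intr v)) (lin A w1) *: map_mx intr (2 * a * (y * y) *: v + 2 * (- x * y) *: u).
pose g := pell_isometry G (lin A u) (lin A v) (- x) y.
have fg (F : fieldType) (w1 : 'cV[F]_m) : map_mx intr g *m lin A w1 = lin A (f F w1).
  have ml (v1 : 'cV[int]_m) : map_mx intr (lin A v1) = lin A (map_mx intr v1) :> 'cV[F]_n.+2 by exact: map_lin.
  by rewrite /g pell_mul /f linB linD !linZ !ml !map_mxD !map_mxZ !linD !linZ !ml.
have gO : in_O G g by apply: pell_isometryP; rewrite ?mulrNN.
have wT : in_tube Omega w by rewrite /in_tube wy'.
have fI : Imv (f _ w) = f _ (Imv w).
  have IM (k : int) (z : R[i]) : complex.Im (k%:~R * z) = k%:~R * complex.Im z by exact: Im_intM.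
  have IB (v1 : 'cV[int]_m) : complex.Im (bil G (lin A (map_mx intr v1)) (lin A w)) =
      bil G (lin A (map_mx intr v1)) (lin A (Imv w)).
    rewrite !bilE raddf_sum; apply: eq_bigr => i _; rewrite raddf_sum; apply: eq_bigr => j _.
    have E : lin A (map_mx intr v1) i 0 = (lin A v1 i 0)%:~R :> R[i].
      by rewrite -map_lin mxE.
    have E' : lin A (map_mx intr v1) i 0 = (lin A v1 i 0)%:~R :> R.
      by rewrite -map_lin mxE.
    have E2 : lin A (Imv w) j 0 = complex.Im (lin A w j 0) by rewrite -lin_Im mxE.
    by rewrite E2 E E' -!intrM; exact: IM.
  rewrite /f; apply/colP => i; rewrite !mxE !raddfB !raddfD /=.
  by congr (_ + _ - _); rewrite -!intrD mulrC IM IB mulrC.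
have fu : f _ (Imv w) = map_mx intr u.
  rewrite wy' /f /y' linD !linZ !bil_lin -!cast uv vu -/a -/b' !rmorph0.
  apply/colP => i; rewrite !mxE !(rmorphD, rmorphN, rmorphM, rmorph1, rmorph_nat, rmorphB).
  rewrite /=; apply/eqP; rewrite -subr_eq0; apply/eqP.
  transitivity ((x%:~R * x%:~R - (1 - a%:~R * b'%:~R * (y%:~R * y%:~R))) *
     (2 * (u i 0)%:~R - 4 * x%:~R * y%:~R * a%:~R * (v i 0)%:~R) : R); last by rewrite xxR subrr mul0r.
  by ring.
have w'T : in_tube Omega (f _ w) by rewrite /in_tube fI fu.
(* In particular [g] fixes b and c, and so commutes with the passage from tube coordinates to the
   cone. *)
have gc (v1 : 'cV[R[i]]_n.+2) : bil G (map_mx intr (lin A u)) v1 = 0 -> bil G (map_mx intr (lin A v)) v1 = 0 ->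
    map_mx intr g *m v1 = v1.
  by move=> h1 h2; rewrite /g pell_mul h1 h2 !scale0r addr0 subr0.
have gt : map_mx intr g *m tau w = tau (f _ w).
  rewrite /tau /tube_point -fg (bil_pull _ _ gO) mulmxBr mulmxDr -scalemxAr.
  have gb : map_mx intr g *m map_mx ratr b = map_mx ratr b :> VC.
    by apply: gc; rewrite map_lin; exact: lin_dot_b.
  have gcc : map_mx intr g *m map_mx intr c = map_mx intr c :> VC.
    by apply: gc; rewrite map_lin; exact: lin_dot_c.
  by rewrite gb gcc.
have gOp : Oplus G D g.
  apply: (isometry_Oplus hD dG gO (tau_domain wT)); rewrite gt; exact: tau_domain.
exists (f _ w); first by rewrite fI.
have e : Psi (f _ w) = (\det g)%:~R * Psi w.
  by transitivity (Phi (map_mx intr g *m tau w)); [rewrite gt|exact: PhiO gOp (tau_domain wT)].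
rewrite e; move: (Psi w) => psi.
have /eqP := isometry_unit dG gO; rewrite -expr2 sqrf_eq1 => /orP[] /eqP ->.
  by rewrite mul1r.
by rewrite rmorphN rmorph1 mulN1r nrmN.
Qed.

Lemma imaginary_point (y : 'cV[R]_m) : exists z : WC, Imv z = y.
Proof. by exists (\col_i (0 +i* y i 0)); apply/colP => i; rewrite !mxE. Qed.

(** As [s] contains every variable, the coefficient is a constant a. |Psi| is bounded over an
    integral u in the cone with k.u < 0, hence by the same bound over its images under units. If a
    were not 0, the term a e(k.z) would exceed that bound over an image far enough out. *)
Lemma koecher (s : seq 'I_m) (ks : seq int) (y : 'cV[R]_m) z :
  size ks = size s -> (forall i, i \in s) -> cone G A u0 y -> (wt R s ks *m y) 0 0 < 0 ->
  in_tube Omega z -> As s ks Psi z = 0.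
Proof.
move=> sz sall Cy ky zT; have [u Cu ku] := cone_integral Cy ky.
have [v [uv v0 nsq]] := nonsquare_orth hG cc cb Ac Ab u0_pos A_inj m3 Cu.
have [zu zuE] := imaginary_point (map_mx intr u).
have zuT : in_tube Omega zu by rewrite /in_tube zuE.
have [e [B [e0 B0 HB]]] := local_bound openO Psi_class zuT.
have PsiB w : Imv w = map_mx intr u -> nrm (Psi w) <= B.
  by move=> wE; apply: (HB w _).2 => j; rewrite wE zuE subrr normr0 ltW.
set k : R := (wt R s ks *m map_mx intr u) 0 0 in ku.
apply/eqP/negPn/negP => az; set a := As s ks Psi z in az.
have a0 : 0 < nrm a by rewrite nrm_gt0.
have const w : in_tube Omega w -> As s ks Psi w = a.
  move=> wT; apply: (invariant_const openO convexO (S := predT)) => // i _.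
  by apply: (As_invariant openO convexO Psi_class sz); left.
have pk : 0 < 2 * pi * - k :> R by rewrite !mulr_gt0 ?pi_gt0 // oppr_gt0.
(* Since exp t >= 1 + t, a factor X >= N already makes |a| exp(-2 pi X k) larger than B. *)
pose N := (Num.truncn (B / (nrm a * (2 * pi * - k)))).+1.
have BN : B < nrm a * (2 * pi * - k) * N%:R.
  have ap : 0 < nrm a * (2 * pi * - k) by rewrite mulr_gt0.
  have := truncnS_gt (B / (nrm a * (2 * pi * - k))).
  by rewrite -/N ltr_pdivrMr // mulrC.
have [x [y1 [Nx _ xy]]] := @pell_large _ R nsq N.
have u2 : 0 < bil G (lin A u) (lin A u).
  by have [h _] := Cu; rewrite -(ltr0z R) bil_map !map_lin.
have xE : x * x = 1 - bil G (lin A u) (lin A u) * bil G (lin A v) (lin A v) * (y1 * y1).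
  rewrite xy; have : bil G (lin A u) (lin A u) * bil G (lin A v) (lin A v) < 0 by rewrite pmulr_rlt0.
  by move: (bil G (lin A u) (lin A u) * _) => t t0; rewrite abszE ltr0_norm // mulNr.
have x0 : x != 0 by rewrite gt_eqF //; apply: lt_le_trans Nx.
have xE' : x * x = 1 - bil G (lin A u) (lin A u) * bil G (lin A v) (lin A v) * (- y1 * - y1).
  by rewrite mulrNN.
pose X : R := (2 * x * x - 1)%:~R.
have NX : N%:R <= X.
  have -> : (N%:R : R) = N%:Z%:~R by [].
  by rewrite ler_int; exact: pell_bound Nx.
have small y' : cone G A u0 y' ->
   (forall w, Imv w = y' -> exists2 w', Imv w' = map_mx intr u & nrm (Psi w) = nrm (Psi w')) ->
   (wt R s ks *m y') 0 0 <= X * k -> False.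
  move=> Cy' orb wy'; have [w wE] := imaginary_point y'.
  have wT : in_tube Omega w by rewrite /in_tube wE.
  have := As_line_bound openO (s := s) (ks := ks) (B := B) Psi_class wT _ sz.
  rewrite const // nrmM nrm_chi wE => /(_ _)-h.
  have {}h : nrm a * expR (- (2 * pi * (wt R s ks *m y') 0 0)) <= B.
    by apply: h => w1 /orb[w' w'E ->]; exact: PsiB.
  have : 2 * pi * - k * N%:R <= - (2 * pi * (wt R s ks *m y') 0 0).
    apply: (@le_trans _ _ (2 * pi * - k * X)); first by rewrite ler_wpM2l // ltW.
    have -> : 2 * pi * - k * X = - (2 * pi * (X * k)) by ring.
    by rewrite lerN2 ler_wpM2l // mulr_ge0 // ltW // pi_gt0.
  move=> h1; have := expR_ge1Dx (- (2 * pi * (wt R s ks *m y') 0 0)).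
  set E := expR _ in h *; move=> h2.
  have : nrm a * (2 * pi * - k * N%:R) <= nrm a * E by rewrite ler_wpM2l ?nrm_ge0 //; lra.
  by rewrite mulrA; lra.
have [C1 o1] := pell_orbit Cu uv xE x0; have [C2 o2] := pell_orbit Cu uv xE' x0.
(* The units of (x, y) and (x, -y) send u to vectors with sum 2 X u, so one of the two pairs with
   the frequency to at most X k, whatever its pairing with v. *)
set y2 := _ + _ in C1 o1; set y3 := _ + _ in C2 o2.
have y23 : y2 + y3 = (2 * X) *: map_mx intr u.
  by apply/colP => i; rewrite /y2 /y3 !mxE -/X !(rmorphM, rmorphN) /=; ring.
clearbody y2 y3.
have sum : (wt R s ks *m y2) 0 0 + (wt R s ks *m y3) 0 0 = 2 * (X * k).
  transitivity ((wt R s ks *m (y2 + y3)) 0 0).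
    by rewrite mulmxDr; move: (_ *m y2) (_ *m y3) => p q; rewrite [RHS]mxE.
  by rewrite y23 -scalemxAr /k; move: (_ *m _) => p; rewrite mxE mulrA.
have [h|h] := leP ((wt R s ks *m y2) 0 0) (X * k); first exact: (small y2).
by apply: (small y3) => //; lra.
Qed.

End Koecher.

(** * The orthogonal complement of L *)

Section Perp.
Variables (R : realType) (G : 'M[int]_28) (n : nat) (S : 'M[int]_n.+2) (B : 'M[int]_(28, n.+2)).
Hypothesis hG : has_signature_2n R (n := 26) G.
Hypothesis hS : has_signature_2n R S.
Hypothesis hB : B^T *m G *m B = S.

Let Gsym : G^T = G := hG.1.
Let Ssym : S^T = S := hS.1.

Lemma perp_orth (F : comNzRingType) (r : 'cV[int]_28) (Z : 'cV[F]_n.+2) :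
  (forall x : 'cV[int]_n.+2, bil G r (B *m x) = 0) ->
  bil G (map_mx intr B *m Z) (map_mx intr r) = 0.
Proof.
move=> H; rewrite bil_mull -map_mxM; have -> : B^T *m G *m r = 0.
  apply/colP => i; have := H (delta_mx i 0); rewrite bilC // -{1}[B]map_intz bil_mull map_intz.
  by rewrite trmx_delta -rowE [in X in X -> _]mxE => ->; rewrite mxE.
by rewrite raddf0 mulmx0 mxE.
Qed.

Lemma perp_negative (x : 'cV[R]_28) :
  (forall y : 'cV[R]_n.+2, bil G x (map_mx intr B *m y) = 0) -> x != 0 -> bil G x x < 0.
Proof.
move=> xB x0; have [u [h [u0 h0 uh]]] := signature_positive_pair hS.
apply: (signature_orth_neg hG (u := map_mx intr B *m u) (h := map_mx intr B *m h)) => //;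
  by rewrite (bil_pull _ _ hB).
Qed.

Variable rs : {fset 'cV[int]_28}.
Hypothesis hrs : is_pm_representatives G B rs.

Lemma root_norm r : r \in rs -> bil G r r = -2.
Proof. by move=> /hrs.1[]. Qed.

Lemma root_perp r : r \in rs -> forall x : 'cV[int]_n.+2, bil G r (B *m x) = 0.
Proof. by move=> /hrs.1[]. Qed.

Lemma root_orth (F : comNzRingType) r (Z : 'cV[F]_n.+2) : r \in rs ->
  bil G (map_mx intr B *m Z) (map_mx intr r) = 0.
Proof. by move=> /root_perp; exact: perp_orth. Qed.

Lemma perp_root_opp r : perp_roots G B r -> perp_roots G B (- r).
Proof.
by move=> [rr rB]; split=> [|x]; rewrite !bilNl ?bilNr ?opprK ?rB ?oppr0.
Qed.

Lemma root_opp r : r \in rs -> - r \notin rs.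
Proof. by move=> rrs; have := hrs.2 r (hrs.1 r rrs); rewrite rrs. Qed.

(** r + r' and r - r' are non-zero, as only one of each pair of opposite roots is chosen, and they
    lie in a negative definite space. So -4 + 2 (r, r') and -4 - 2 (r, r') are both negative. *)
Lemma roots_pairwise r r' : r \in rs -> r' \in rs -> r != r' -> bil G r r' ^+ 2 != 4.
Proof.
move=> rr r'r rr'.
have neg (x : 'cV[int]_28) : x != 0 -> (forall y : 'cV[R]_n.+2, bil G (map_mx intr B *m y) (map_mx intr x) = 0) ->
    bil G x x < 0.
  move=> x0 xB; rewrite -(ltrz0 R) bil_map; apply: perp_negative.
    by move=> y; rewrite bilC.
  by apply: contra x0 => /eqP E; apply/eqP/(@map_intr_inj R); rewrite E raddf0.
have h1 : bil G (r - r') (r - r') < 0.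
  apply: neg => [|y]; first by rewrite subr_eq0.
  by rewrite map_mxB bilDr bilNr !root_orth // subr0.
have h2 : bil G (r + r') (r + r') < 0.
  apply: neg => [|y]; last by rewrite map_mxD bilDr !root_orth // addr0.
  by rewrite addr_eq0; apply/eqP => E; have := root_opp r'r; rewrite -E rr.
move: h1 h2; rewrite !bil_lin !root_norm // (bilC r' r) //; move: (bil G r r') => k h1 h2.
by apply/eqP; rewrite expr2; nia.
Qed.

Lemma card_roots : half_number_of_roots G B = #|` rs|.
Proof.
rewrite /half_number_of_roots; have -> : perp_roots G B = [set` (rs `|` [fset - r | r in rs])%fset].
  apply/seteqP; split=> [r hr|r] /=.
    have := hrs.2 r hr; rewrite !inE; case: (r \in rs) => //= nr.
    by apply/imfsetP; exists (- r) => //; rewrite opprK.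
  rewrite !inE => /orP[/hrs.1 //|/imfsetP[r' /= /hrs.1 hr' ->]].
  exact: perp_root_opp.
rewrite set_fsetK; have -> : #|` rs `|` [fset - r | r in rs]|%fset = (#|` rs| + #|` rs|)%N.
  have dis : [disjoint rs & [fset - r | r in rs]]%fset.
    apply/fdisjointP => r rrs; apply/negP => /imfsetP[r' /= r'rs E].
    by have := root_opp r'rs; rewrite -E rrs.
  have := cardfsUI rs [fset - r | r in rs]%fset.
  have /eqP -> : (rs `&` [fset - r | r in rs] == fset0)%fset by rewrite -/(fdisjoint _ _).
  rewrite cardfs0 addn0 => ->; congr (_ + _)%N; apply: card_in_imfset => x y _ _ /=.
  exact: oppr_inj.
by rewrite addnn doubleK.
Qed.

Variable DM : set 'cV[R[i]]_28.
Hypothesis hDM : is_domain_cone (n := 26) G DM.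
Variable DL : set 'cV[R[i]]_n.+2.
Hypothesis hDL : is_domain_cone S DL.
Hypothesis hsub : forall Z, DL Z -> DM (map_mx intr B *m Z).

(* The extension acts as g on L and trivially on its orthogonal complement. *)
Lemma stable_extension (g : 'M[int]_n.+2) : stable_Oplus S DL g ->
  exists g' : 'M[int]_28, [/\ Oplus (n := 26) G DM g', \det g' = \det g, g' *m B = B *m g &
    forall r, r \in rs -> g' *m r = r].
Proof.
move=> [[gO gD] gs].
have dS : (map_mx intr S : 'M[rat]_n.+2) \in unitmx.
  rewrite unitmxE unitfE det_map_mx intr_eq0; exact: signature_det_neq0 hS.
(* The orthogonal projection to L in coordinates of L. Its columns, the projections of the basis of
   M, lie in the dual of L, so g - 1 maps them into L: this gives the integral matrix [K], and the
   extension is 1 + B K. *)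
pose pr : 'M[rat]_(n.+2, 28) := invmx (map_mx intr S) *m map_mx intr (B^T *m G).
have Spr : map_mx intr S *m pr = map_mx intr (B^T *m G) by rewrite mulKVmx.
have col_ex (j : 'I_28) : exists y : 'cV[int]_n.+2, (map_mx intr g - 1%:M) *m col j pr = map_mx intr y.
  have [|y Hy] := gs (col j pr); last by exists y; rewrite mulmxBl mul1mx.
  have E : map_mx intr S *m col j pr = map_mx intr (col j (B^T *m G)).
    by rewrite (colE j pr) mulmxA Spr -colE map_col.
  by move=> x; rewrite bilC // /bil map_trmx -mulmxA E -map_mxM mxE intr_int.
have [y Hy] := choice col_ex.
pose K : 'M[int]_(n.+2, 28) := \matrix_(i, j) y j i 0.
have KE : map_mx intr K = (map_mx intr g - 1%:M) *m pr.
  apply/matrixP => i j; have := congr1 (fun M : 'cV_n.+2 => M i 0) (Hy j).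
  by rewrite colE mulmxA -colE !mxE.
have prB : pr *m map_mx intr B = 1%:M.
  by rewrite -mulmxA -map_mxM hB mulVmx.
clearbody pr; have KB : K *m B = g - 1%:M.
  by apply: (@map_intr_inj rat); rewrite map_mxM KE -mulmxA prB mulmx1 map_mxB map_mx1.
have g'B : (1%:M + B *m K) *m B = B *m g.
  by rewrite mulmxDl mul1mx -mulmxA KB mulmxBr mulmx1 addrC subrK.
have trSpr : pr^T *m map_mx intr S = map_mx intr (G *m B).
  have -> : G *m B = (B^T *m G)^T by rewrite trmx_mul trmxK Gsym.
  have -> : map_mx intr (B^T *m G)^T = (map_mx intr (B^T *m G))^T :> 'M[rat]_(28, n.+2) by rewrite map_trmx.
  rewrite -Spr trmx_mul; congr (_ *m _).
  by apply/matrixP => i j; rewrite !mxE -[in LHS]Ssym mxE.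
have g'O : in_O (n := 26) G (1%:M + B *m K).
  apply: (@map_intr_inj rat).
  pose gq : 'M[rat]_n.+2 := map_mx intr g; pose Sq : 'M[rat]_n.+2 := map_mx intr S.
  have E : (1%:M + B *m K)^T *m G *m (1%:M + B *m K) =
     G + K^T *m (B^T *m G) + (G *m B) *m K + K^T *m (B^T *m G *m B) *m K.
    have -> : (1%:M + B *m K)^T = 1%:M + K^T *m B^T by rewrite raddfD /= trmx1 trmx_mul.
    rewrite !(mulmxDl, mulmxDr) !mul1mx !mulmx1 !mulmxA.
    by rewrite addrA addrAC.
  have gS : gq^T *m Sq *m gq = Sq by rewrite /gq /Sq map_trmx -!map_mxM gO.
  have t1 : map_mx intr (K^T *m (B^T *m G)) = pr^T *m ((gq - 1%:M)^T *m Sq) *m pr.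
    by rewrite map_mxM -map_trmx KE -Spr trmx_mul !mulmxA.
  have t2 : map_mx intr (G *m B *m K) = pr^T *m (Sq *m (gq - 1%:M)) *m pr.
    by rewrite map_mxM -trSpr KE !mulmxA.
  have t3 : map_mx intr (K^T *m S *m K) = pr^T *m ((gq - 1%:M)^T *m Sq *m (gq - 1%:M)) *m pr.
    by rewrite !map_mxM -map_trmx KE trmx_mul !mulmxA.
  rewrite E hB !map_mxD t1 t2 t3 -!addrA -!mulmxDl -!mulmxDr.
  suff -> : (gq - 1%:M)^T *m Sq + (Sq *m (gq - 1%:M) + (gq - 1%:M)^T *m Sq *m (gq - 1%:M)) = 0.
    by rewrite mulmx0 mul0mx addr0.
  have -> : (gq - 1%:M)^T = gq^T - 1%:M by rewrite raddfB /= trmx1.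
  rewrite !(mulmxBl, mulmxBr, mul1mx, mulmx1) gS.
  by move: (gq^T *m Sq) (Sq *m gq) => X Y; apply/matrixP => i j; rewrite !mxE; ring.
have [Z DZ] := domain_point hDL.
exists (1%:M + B *m K); split => //.
- apply: (isometry_Oplus hDM (signature_det_neq0 hG) g'O (hsub DZ)).
  rewrite mulmxA -map_mxM g'B map_mxM -mulmxA; apply: hsub.
  by rewrite -gD; exists Z.
(* det(1 + B K) = det(1 + K B), and K B = g - 1. *)
- by rewrite det1D_mulmx KB addrC subrK.
move=> r rrs; rewrite mulmxDl mul1mx -mulmxA.
suff -> : K *m r = 0 by rewrite mulmx0 addr0.
have E0 : B^T *m G *m r = 0.
  apply/colP => i; have := root_orth (delta_mx i 0 : 'cV[int]_n.+2) rrs.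
  by rewrite bil_mull !map_intz trmx_delta -rowE [in X in X -> _]mxE => ->; rewrite mxE.
have prr : pr *m map_mx intr r = 0.
  by rewrite -(mulKmx dS (pr *m _)) (mulmxA (map_mx intr S)) Spr -map_mxM E0 raddf0 mulmx0.
by apply: (@map_intr_inj rat); rewrite map_mxM KE raddf0 -mulmxA prr mulmx0.
Qed.

Variable F : 'cV[R[i]]_n.+2 -> R[i].
Variable Q : 'cV[R[i]]_28 -> R[i].
Hypothesis hQ : holomorphic_on (n := 26) DM Q.
Hypothesis hF : forall Z, DL Z -> F Z = Q (map_mx intr B *m Z).

Lemma pullback_holomorphic : holomorphic_on DL F.
Proof.
move=> Z DZ; have [H /nbhs_nrm[d d0 HH]] := hQ (hsub DZ).
exists (fun W => H (map_mx intr B *m W)).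
have cB : {for Z, continuous (fun W : 'cV[R[i]]_n.+2 => map_mx intr B *m W)}.
  by apply: cont_mulmx; exact: cont_id.
have [d' d'0 H'] := (cont_nrm _ _).1 cB _ d0.
apply/nbhs_nrm; exists d' => // W WZ; have [dH FH] := HH _ (H' W WZ); split.
  have dB : differentiable (fun W : 'cV[R[i]]_n.+2 => (map_mx intr B : 'M[R[i]]_(28, n.+2)) *m W) W.
    by apply: dif_mulmx; exact: dif_id.
  exact: (dif_comp dB dH).
by move=> DW; rewrite hF // FH //; exact: hsub.
Qed.

End Perp.

(** * Fourier coefficients at a cusp *)

Section Slices.
Variable R : realType.

Lemma As_cat m (s s' : seq 'I_m) (ks ks' : seq int) (phi : 'cV[R[i]]_m -> R[i]) :
  size ks = size s -> As (s ++ s') (ks ++ ks') phi = As s' ks' (As s ks phi).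
Proof. by elim: s ks phi => [|i s IH] [|k ks] phi //= [sz]; exact: IH. Qed.

Lemma As_slice a p (s : seq 'I_a) (ks : seq int) (phi : 'cV[R[i]]_(a + p) -> R[i]) z x :
  As [seq lshift p i | i <- s] ks phi (col_mx z x) = As s ks (fun z => phi (col_mx z x)) z.
Proof.
elim: s ks phi => [|i s IH] [|k ks] phi //=; rewrite IH; congr (As s ks _ z).
apply/funext => w; congr dmean; apply/funext => t; rewrite col_mxEu; congr (phi _ * _).
by rewrite /ev delta_mx_ushift scale_col_mx add_col_mx scaler0 addr0.
Qed.

Lemma seq_enum a (ks : seq int) : size ks = a -> ks = [seq nth 0 ks (i : 'I_a) | i <- enum 'I_a].
Proof.
move=> sz; apply: (@eq_from_nth _ 0) => [|i ia]; first by rewrite size_map size_enum_ord.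
rewrite sz in ia; rewrite (nth_map (Ordinal ia)) ?size_enum_ord //.
by rewrite (nth_enum_ord (Ordinal ia) ia).
Qed.

Lemma wt_enum a m (f : 'I_a -> 'I_m) (ks : seq int) (y : 'cV[R]_m) : size ks = a ->
  (wt R [seq f i | i <- enum 'I_a] ks *m y) 0 0 = \sum_(i < a) (nth 0 ks i)%:~R * y (f i) 0.
Proof.
move=> sz; rewrite [in LHS](seq_enum sz) -[in RHS]big_enum /=.
elim: (enum 'I_a) => [|i s IH]; first by rewrite /= mul0mx big_nil mxE.
rewrite /= mulmxDl -scalemxAl -rowE big_cons -IH.
by move: (wt _ _ _ *m y) => q; rewrite !mxE.
Qed.

Lemma chi_enum a (ks : seq int) (z : 'cV[R[i]]_a) : size ks = a ->
  chi (enum 'I_a) ks z = epi (\sum_(i < a) (nth 0 ks i)%:~R * z i 0).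
Proof.
move=> sz; rewrite [in LHS](seq_enum sz) -[in RHS]big_enum /=.
elim: (enum 'I_a) => [|i s IH]; first by rewrite /= big_nil epi0.
by rewrite /= big_cons epiD IH.
Qed.

Lemma chi_nseq0 m (s : seq 'I_m) (z : 'cV[R[i]]_m) : chi s (nseq (size s) 0) z = 1.
Proof. by elim: s => //= i s ->; rewrite mul0r epi0 mulr1. Qed.

(** Equal to 2 cos(2 pi t) - 2: differentiable, of period 1, real on the real line, and zero at 0
    but not at real t strictly between 0 and 1. *)
Definition pbump (t : R[i]) : R[i] := epi t + epi (- t) - 2.

Lemma pbump_period t : pbump (t + 1) = pbump t.
Proof. by rewrite /pbump opprD !epiD !epiN epi1 invr1 !mulr1. Qed.

Lemma pbump0 : pbump 0 = 0.
Proof. by rewrite /pbump oppr0 epi0; ring. Qed.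

Lemma pbump_real (t : R) : exists r : R, pbump t%:C = r%:C.
Proof.
exists (2 * cos (2 * pi * t) - 2); rewrite /pbump -rmorphN !epi_real mulrN cosN sinN.
rewrite rmorphB rmorphM rmorph_nat /=; apply/eqP; rewrite eq_complex /= !(mul0r, mulr0, subr0, addr0, addrN, oppr0).
by apply/andP; split; apply/eqP; ring.
Qed.

Lemma pbump_neq0 (t : R) : 0 < t -> t < 1 -> pbump t%:C != 0.
Proof.
move=> t0 t1; apply/eqP => E.
have e1 : epi t%:C = 1.
  have e0 := epi_neq0 t%:C; move: E; rewrite /pbump epiN; move: (epi _) e0 => e e0 E.
  have : (e - 1) ^+ 2 = 0 by transitivity (e * (e + e^-1 - 2)); [field|rewrite E mulr0].
  by move=> /eqP; rewrite sqrf_eq0 subr_eq0 => /eqP.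
have [k] := epi_eq1 e1; rewrite -(rmorph_int (real_complex R)) => /complexI tk.
by move: t0 t1; rewrite tk ltr0z -[1](@mulr1z R) ltr_int; lia.
Qed.

Lemma pbump_differentiable t : differentiable pbump t.
Proof.
rewrite /pbump; apply: difD; last exact: difC.
apply: difD; first exact: epi_differentiable.
apply: (@dif_comp R _ _ _ (fun t : R[i] => - t) (@epi R)); last exact: epi_differentiable.
by have := @differentiableN _ _ _ _ _ (@dif_id R _ t).
Qed.

(** Uniform in the real part of t: the value at that real part is real, and the difference is at
    most |e(iy) - 1| + |e(-iy) - 1|. *)
Lemma pbump_Im (e : R) : 0 < e -> exists2 d : R, 0 < d &
  forall t, `|complex.Im t| < d -> `|complex.Im (pbump t)| < e.
Proof.
move=> e0; have e2 : 0 < e / 2 by rewrite divr_gt0.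
have [d d0 H] := (cont_nrm _ _).1 (@epi_continuous R 0) _ e2; rewrite epi0 in H.
exists d => // t; set y := complex.Im t => yd; set x := complex.Re t.
have tE : t = x%:C + 'i * y%:C by rewrite -complexRIE.
have [r rE] := pbump_real x.
have small (s : R[i]) : nrm s < d -> nrm (epi s - 1) < e / 2 by move=> sd; apply: H; rewrite subr0.
have xn (s : R[i]) : complex.Im s = 0 -> nrm (epi s) = 1 by move=> s0; rewrite nrm_epi s0 mulr0 oppr0 expR0.
have -> : complex.Im (pbump t) = complex.Im (pbump t - pbump x%:C).
  by rewrite rE raddfB /= subr0.
apply: le_lt_trans (Im_le_nrm _) _.
have -> : pbump t - pbump x%:C = epi x%:C * (epi ('i * y%:C) - 1) + epi (- x)%:C * (epi (- ('i * y%:C)) - 1).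
  by rewrite /pbump tE opprD !epiD rmorphN; ring.
have h1 : nrm (epi x%:C * (epi ('i * y%:C) - 1)) < e / 2.
  by rewrite nrmM xn // mul1r; apply: small; rewrite nrmM nrm_i mul1r nrm_real.
have h2 : nrm (epi (- x)%:C * (epi (- ('i * y%:C)) - 1)) < e / 2.
  by rewrite nrmM xn // mul1r; apply: small; rewrite nrmN nrmM nrm_i mul1r nrm_real.
by apply: le_lt_trans (nrmD _ _) _; rewrite [e]splitr; exact: ltrD.
Qed.

Variables (a p : nat) (Omega : 'cV[R]_(a + p) -> Prop).
Hypothesis openO : forall y, Omega y -> exists2 d : R, 0 < d &
  forall y' : 'cV[R]_(a + p), (forall i, `|y' i 0 - y i 0| < d) -> Omega y'.
Variable H : 'cV[R[i]]_(a + p) -> R[i].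
Hypothesis H_dif : forall z, in_tube Omega z -> differentiable H z.
Hypothesis H_per : forall z (i : 'I_a), in_tube Omega z -> H (z + ev R (lshift p i)) = H z.

(* The coefficient is continuous in the slice parameter; composing with the
   periodic function [pbump] makes H periodic in that parameter as well. *)
Lemma As_limit (x0 : 'cV[R]_p) (ks : seq int) z : size ks = a -> in_tube Omega (col_mx z 0) ->
  (forall t : R, t != 0 -> As (enum 'I_a) ks (fun z => H (col_mx z (map_mx (real_complex R) (t *: x0)))) z = 0) ->
  As (enum 'I_a) ks (fun z => H (col_mx z 0)) z = 0.
Proof.
move=> sz zT Hz; pose X0 : 'cV[R[i]]_p := map_mx (real_complex R) x0.
(* [g] sends (w, t) to (w, pbump(t) x0). The extra variable makes the coefficient over the slice t a
   function in a tube class, hence continuous at t = 0. *)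
pose M1 : 'M[R[i]]_(a + p, a + 1) := block_mx 1%:M 0 0 0.
pose g (v : 'cV[R[i]]_(a + 1)) := M1 *m v + pbump (v (rshift a 0) 0) *: col_mx 0 X0.
have gE w t : g (col_mx w t%:M) = col_mx w (pbump t *: X0).
  rewrite /g mul_block_col !mul1mx !mul0mx !addr0 col_mxEd mxE eqxx mulr1n.
  by rewrite scale_col_mx add_col_mx scaler0 addr0 add0r.
have vE (v : 'cV[R[i]]_(a + 1)) : v = col_mx (usubmx v) (v (rshift a 0) 0)%:M.
  by rewrite -{1}[v]vsubmxK; congr col_mx; apply/colP => k; rewrite !mxE !ord1 eqxx mulr1n.
have [d0 d00 Hd0] := openO zT.
pose M := 1 + \sum_i `|x0 i 0|; have M0 : 0 < M by rewrite ltr_wpDr ?sumr_ge0.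
have [d1 d10 Hd1] := pbump_Im (divr_gt0 d00 M0).
pose d := Num.min d0 d1; have dpos : 0 < d by rewrite lt_min d00.
pose v0 : 'cV[R[i]]_(a + 1) := col_mx z 0.
pose Om (y : 'cV[R]_(a + 1)) := forall i, `|y i 0 - Imv v0 i 0| < d.
have openOm y : Om y -> exists2 e : R, 0 < e & forall y' : 'cV[R]_(a + 1), (forall i, `|y' i 0 - y i 0| < e) -> Om y'.
  move=> yO; pose e := \big[Num.min/d]_i (d - `|y i 0 - Imv v0 i 0|).
  exists e; first by apply: lt_bigmin => // i _; rewrite subr_gt0.
  move=> y' yy i; have -> : y' i 0 - Imv v0 i 0 = (y' i 0 - y i 0) + (y i 0 - Imv v0 i 0) by rewrite addrA subrK.
  apply: le_lt_trans (ler_normD _ _) _; rewrite -ltrBrDr; apply: lt_le_trans (yy i) _.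
  exact: bigmin_le.
have convexOm y y' (t : R) : Om y -> Om y' -> 0 <= t <= 1 -> Om (y + t *: (y' - y)).
  move=> yO yO' /andP[t0 t1] i; move: (yO i) (yO' i); rewrite !mxE.
  move: (y i 0) (y' i 0) (complex.Im _) => u u' w h1 h2.
  have -> : u + t * (u' - u) - w = (1 - t) * (u - w) + t * (u' - w) by ring.
  have t1' : 0 <= 1 - t by lra.
  apply: le_lt_trans (ler_normD _ _) _; rewrite !normrM (ger0_norm t0) (ger0_norm t1').
  have : Num.max `|u - w| `|u' - w| < d by rewrite gt_max h1.
  apply: le_lt_trans; rewrite -[leRHS]mul1r -[X in _ <= X * _](subrK t 1) [leRHS]mulrDl.
  by apply: lerD; rewrite ler_wpM2l // le_max lexx ?orbT.
have gT v : in_tube Om v -> in_tube Omega (g v).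
  move=> vT; apply: Hd0 => i; rewrite (vE v) gE; case: (split_ordP i) => j ->; rewrite [Imv _ _ _]mxE [Imv _ _ _]mxE !(col_mxEu, col_mxEd).
    have := vT (lshift 1 j); rewrite [Imv _ _ _]mxE [Imv _ _ _]mxE {1}(vE v) /v0 !col_mxEu.
    by rewrite lt_min => /andP[].
  have := vT (rshift a 0); rewrite [Imv _ _ _]mxE [Imv _ _ _]mxE /v0 col_mxEd !mxE subr0 lt_min => /andP[_ /Hd1].
  move: (pbump _) => -[w w']; rewrite /= subr0 mulr0 add0r.
  have x0M : `|x0 j 0| <= M.
    by rewrite /M (bigD1 j) //= addrCA lerDl addr_ge0 ?sumr_ge0.
  by rewrite ltr_pdivlMr // normrM => h; apply: le_lt_trans h; rewrite ler_wpM2l.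
pose h v := H (g v).
have hclass : tube_class Om h.
  split=> [v vT|v i vT].
    have dg : differentiable g v.
      rewrite /g; apply: difDv.
        by apply: (@dif_mulmx R _ _ _ M1 (fun v => v)); exact: dif_id.
      apply: difZl; apply: (@dif_comp R _ _ _ (fun v : 'cV[R[i]]_(a + 1) => v (rshift a 0) 0) pbump).
        exact: differentiable_coord.
      exact: pbump_differentiable.
    exact: (dif_comp dg (H_dif (gT v vT))).
  rewrite /h; case: (split_ordP i) => j ->.
    rewrite -(H_per j (gT v vT)) (vE v) /ev !delta_mx_ushift add_col_mx addr0 !gE.
    by rewrite add_col_mx addr0.
  rewrite (vE v) [j]ord1 /ev delta_mx_dshift add_col_mx addr0 (_ : delta_mx 0 0 = 1%:M).
    by rewrite -raddfD /= !gE pbump_period.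
  by apply/matrixP => k l; rewrite !mxE !ord1 eqxx.
pose A v := As [seq lshift 1 i | i <- enum 'I_a] ks h v.
have AE t : A (col_mx z t%:M) = As (enum 'I_a) ks (fun z => H (col_mx z (pbump t *: X0))) z.
  by rewrite /A As_slice; congr (As _ _ _ z); apply/funext => w; rewrite /h gE.
have A0 : A v0 = As (enum 'I_a) ks (fun z => H (col_mx z 0)) z.
  have -> : v0 = col_mx z 0%:M by rewrite /v0 raddf0.
  by rewrite AE; congr (As _ _ _ z); apply/funext => w; rewrite pbump0 scale0r.
rewrite -A0; apply/eqP; rewrite -[_ == _]negbK; apply/negP => An.
have v0T : in_tube Om v0 by move=> i; rewrite subrr normr0.
have cA : {for v0, continuous A}.
  exact: (differentiable_continuous ((As_class openOm _ ks hclass).1 v0 v0T)).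
have nA : 0 < nrm (A v0) by rewrite nrm_gt0.
have [e e0 He] := (cont_nrm _ _).1 cA _ nA.
pose t := Num.min (e / 2) (1 / 2).
have t0 : 0 < t by rewrite lt_min !divr_gt0.
have t1 : t < 1 by rewrite gt_min; apply/orP; right; lra.
have te : t < e by rewrite gt_min; apply/orP; left; lra.
have := He (col_mx z (t%:C)%:M); rewrite AE => /(_ _)-Hc.
have [r rE] := pbump_real t; have r0 : r != 0.
  by apply: contra (pbump_neq0 t0 t1) => /eqP r0; rewrite rE r0 rmorph0.
have E0 : As (enum 'I_a) ks (fun z => H (col_mx z (pbump t%:C *: X0))) z = 0.
  rewrite -(Hz r r0); congr (As _ _ _ z); apply/funext => w; congr (H (col_mx w _)).
  by rewrite rE map_mxZ.
rewrite E0 sub0r nrmN ltxx in Hc; have : false; last by [].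
apply: Hc; apply: nrm_mx_lt => // i j; rewrite ord1 /v0 [_ i 0]mxE [X in _ + X]mxE.
case: (split_ordP i) => k ->; rewrite !(col_mxEu, col_mxEd); first by rewrite subrr nrm0.
by rewrite !mxE ord1 eqxx mulr1n subr0 nrm_real gtr0_norm.
Qed.

End Slices.

Lemma det_neq0 (R : realFieldType) d (M : 'M[int]_d) :
  (forall x : 'cV[R]_d, map_mx intr M *m x = 0 -> x = 0) -> \det M != 0.
Proof.
move=> H; rewrite -(@intr_eq0 R) -det_map_mx -det_tr; apply/det0P => -[v v0 vM].
move/eqP: v0; apply; apply: trmx_inj; rewrite trmx0; apply: H.
by apply: trmx_inj; rewrite trmx_mul trmxK vM trmx0.
Qed.

Lemma slice_differentiable (R : realType) a p (H : 'cV[R[i]]_(a + p) -> R[i]) (z : 'cV[R[i]]_a) x :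
  differentiable H (col_mx z x) -> differentiable (fun z => H (col_mx z x)) z.
Proof.
have sE (w : 'cV[R[i]]_a) : col_mx w x = (col_mx 1%:M 0 : 'M_(a + p, a)) *m w + col_mx 0 x.
  by rewrite mul_col_mx mul1mx mul0mx add_col_mx addr0 add0r.
have -> : (fun z => H (col_mx z x)) = fun z => H ((col_mx 1%:M 0 : 'M_(a + p, a)) *m z + col_mx 0 x).
  by apply/funext => w; rewrite sE.
have dg : differentiable (fun z : 'cV[R[i]]_a => (col_mx 1%:M 0 : 'M_(a + p, a)) *m z + col_mx 0 x) z.
  by apply: difDv; [apply: dif_mulmx; exact: dif_id|exact: differentiable_cst].
rewrite sE => dH; exact: (dif_comp dg dH).
Qed.

(** * A cusp of L inside a cusp of II_{2,26}: coordinates z along L (columns of [E]) and x along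
    L^perp (columns of [W]) *)

Section CuspCoefficients.
Variables (R : realType) (G : 'M[int]_28) (n : nat) (S : 'M[int]_n.+2) (B : 'M[int]_(28, n.+2)).
Hypothesis hG : has_signature_2n R (n := 26) G.
Hypothesis evenG : even_lattice G.
Hypothesis hS : has_signature_2n R S.
Hypothesis hB : B^T *m G *m B = S.
Variable rs : {fset 'cV[int]_28}.
Hypothesis hrs : is_pm_representatives G B rs.
Variable r0 : 'cV[int]_28.
Hypothesis r0rs : r0 \in rs.
Variable D : set 'cV[R[i]]_28.
Hypothesis hD : is_domain_cone (n := 26) G D.
Variable Phi : 'cV[R[i]]_28 -> R[i].
Hypothesis hPhi : holomorphic_on (n := 26) D Phi.
Hypothesis PhiO : forall g Z, Oplus (n := 26) G D g -> D Z -> Phi (map_mx intr g *m Z) = (\det g)%:~R * Phi Z.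
Variable Q : 'cV[R[i]]_28 -> R[i].
Hypothesis hQ : holomorphic_on (n := 26) D Q.
Hypothesis PhiQ : forall Z, D Z -> Phi Z = Q Z * \prod_(r <- rs) bil G Z (map_mx intr r).
Variables (c : 'cV[int]_n.+2) (b : 'cV[rat]_n.+2).
Hypothesis cc : bil S c c = 0.
Hypothesis cb : bil S (map_mx intr c) b = 1.
Variables (a p : nat) (E : 'M[int]_(n.+2, a)) (W : 'M[int]_(28, p)).
Variables (PE : 'M[rat]_(a, n.+2)) (PW : 'M[rat]_(p, 28)).
Hypothesis Ec : E^T *m S *m c = 0.
Hypothesis Eb : map_mx intr (E^T *m S) *m b = 0.
Hypothesis PEE : PE *m map_mx intr E = 1%:M.
Hypothesis WB : W^T *m G *m B = 0.
Hypothesis PWW : PW *m map_mx intr W = 1%:M.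
Hypothesis W_perp : forall x : 'cV[int]_28, B^T *m G *m x = 0 -> map_mx intr x = map_mx intr W *m (PW *m map_mx intr x).
Hypothesis ap : (2 < a + p)%N.

Local Notation c' := (B *m c).
Local Notation b' := (map_mx intr B *m b).
Local Notation A := (row_mx (B *m E) W).

Let Gsym : G^T = G := hG.1.

Let cc' : bil G c' c' = 0.
Proof. by have := bil_pull c c hB; rewrite map_intz cc. Qed.

Let cb' : bil G (map_mx intr c') b' = 1.
Proof. by rewrite map_mxM (bil_pull _ _ hB). Qed.

Let AG : A^T *m G = col_mx (E^T *m (B^T *m G)) (W^T *m G).
Proof. by rewrite tr_row_mx mul_col_mx trmx_mul mulmxA. Qed.

Let EBB : E^T *m (B^T *m G) *m B = E^T *m S.
Proof. by rewrite -mulmxA hB. Qed.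

Let Ac : A^T *m G *m c' = 0.
Proof. by rewrite AG mul_col_mx !(mulmxA _ B) EBB Ec WB mul0mx col_mx0. Qed.

Let Ab : map_mx intr (A^T *m G) *m b' = 0.
Proof.
by rewrite AG map_col_mx mul_col_mx !(mulmxA _ (map_mx intr B)) -!map_mxM EBB WB Eb raddf0 mul0mx col_mx0.
Qed.

Lemma linA (F : comNzRingType) (y : 'cV[F]_a) (x : 'cV[F]_p) :
  lin A (col_mx y x) = map_mx intr B *m (map_mx intr E *m y) + map_mx intr W *m x.
Proof. by rewrite /lin map_row_mx mul_row_col map_mxM mulmxA. Qed.

Lemma E_dot_c (F : comNzRingType) (y : 'cV[F]_a) : bil S (map_mx intr E *m y) (map_mx intr c) = 0.
Proof. by rewrite bil_mull -map_mxM Ec raddf0 mulmx0 mxE. Qed.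

Lemma E_dot_b (y : 'cV[rat]_a) : bil S (map_mx intr E *m y) b = 0.
Proof. by rewrite bil_mull Eb mulmx0 mxE. Qed.

Lemma perp_dot (F : comNzRingType) (x : 'cV[F]_p) (y : 'cV[F]_n.+2) :
  bil G (map_mx intr W *m x) (map_mx intr B *m y) = 0.
Proof. by rewrite bil_mull (mulmxA _ (map_mx intr B)) -map_mxM WB raddf0 mul0mx mulmx0 mxE. Qed.

Lemma dotA (F : comNzRingType) (y y' : 'cV[F]_a) (x x' : 'cV[F]_p) :
  bil G (lin A (col_mx y x)) (lin A (col_mx y' x')) =
  bil S (map_mx intr E *m y) (map_mx intr E *m y') + bil G (map_mx intr W *m x) (map_mx intr W *m x').
Proof.
rewrite !linA !bilDl !bilDr (bil_pull _ _ hB) (bilC (map_mx intr B *m _) (map_mx intr W *m _) Gsym).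
by rewrite !perp_dot addr0 add0r.
Qed.

Lemma map_ratr_int (F : numFieldType) d e (X : 'M[int]_(d, e)) :
  map_mx ratr (map_mx intr X : 'M[rat]_(d, e)) = map_mx intr X :> 'M[F]_(d, e).
Proof. by apply/matrixP => i j; rewrite !mxE ratr_int. Qed.

Lemma E_inj (F : numFieldType) (y : 'cV[F]_a) : map_mx intr E *m y = 0 -> y = 0.
Proof.
move=> Ey; have : map_mx ratr PE *m (map_mx intr E *m y) = 0 by rewrite Ey mulmx0.
by rewrite mulmxA -map_ratr_int -map_mxM PEE map_mx1 mul1mx.
Qed.

Lemma W_inj (F : numFieldType) (x : 'cV[F]_p) : map_mx intr W *m x = 0 -> x = 0.
Proof.
move=> Wx; have : map_mx ratr PW *m (map_mx intr W *m x) = 0 by rewrite Wx mulmx0.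
by rewrite mulmxA -map_ratr_int -map_mxM PWW map_mx1 mul1mx.
Qed.

Lemma W_negative (x : 'cV[R]_p) : x != 0 -> bil G (map_mx intr W *m x) (map_mx intr W *m x) < 0.
Proof.
move=> x0; apply: (perp_negative hG hS hB) => [y|]; first exact: perp_dot.
by apply: contra x0 => /eqP/W_inj ->.
Qed.

Lemma A_inj (v : 'cV[int]_(a + p)) : lin A v = 0 -> v = 0.
Proof.
move=> /(congr1 (map_mx (intr : int -> R))); rewrite raddf0 map_lin => v0.
apply: (@map_intr_inj R); rewrite raddf0; move: (map_mx _ v) v0 => u; rewrite -[u]vsubmxK => u0.
have x0 : dsubmx u = 0.
  apply/eqP/negPn/negP => /W_negative; have := dotA 0 (usubmx u) (dsubmx u) (dsubmx u).
  rewrite u0 bil0r mulmx0 bil0l add0r => <-; by rewrite ltxx.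
have : map_mx intr E *m usubmx u = 0.
  apply/eqP/negPn/negP => Eu; move: u0; rewrite x0 linA mulmx0 addr0 => Bu.
  have : map_mx intr S *m (map_mx intr E *m usubmx u) = 0.
    by rewrite -hB map_mxM -mulmxA Bu mulmx0.
  have Su : (map_mx intr S : 'M[R]_n.+2) \in unitmx.
    by rewrite unitmxE unitfE det_map_mx intr_eq0; exact: signature_det_neq0 hS.
  by move=> /(congr1 (mulmx (invmx (map_mx intr S)))); rewrite mulKmx // mulmx0 => /eqP; rewrite (negbTE Eu).
by move=> /E_inj ->; rewrite x0 col_mx0.
Qed.

Variable v0 : 'cV[R]_a.
Hypothesis v0_pos : 0 < bil S (map_mx intr E *m v0) (map_mx intr E *m v0).

Local Notation u0 := (col_mx v0 0).
Local Notation Omega := (cone G A u0).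

Definition slice_cone (y : 'cV[R]_a) := Omega (col_mx y 0).

Let u0_pos : 0 < bil G (lin A u0) (lin A u0).
Proof. by rewrite dotA mulmx0 bil0l addr0. Qed.

Lemma slice_coneE y : slice_cone y <-> 0 < bil S (map_mx intr E *m y) (map_mx intr E *m y) /\
  0 < bil S (map_mx intr E *m y) (map_mx intr E *m v0).
Proof. by rewrite /slice_cone /cone !dotA mulmx0 bil0l !addr0. Qed.

Let openO y (h : Omega y) := cone_open h.
Let convexO := cone_convex hG cc' cb' Ac Ab u0_pos.

Lemma slice_open y : slice_cone y -> exists2 d : R, 0 < d &
  forall y' : 'cV[R]_a, (forall i, `|y' i 0 - y i 0| < d) -> slice_cone y'.
Proof.
move=> /cone_open[d d0 H]; exists d => // y' yy; apply: H => i.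
case: (split_ordP i) => j ->; rewrite !(col_mxEu, col_mxEd) //.
by rewrite mxE subrr normr0.
Qed.

Lemma slice_convex y y' (t : R) : slice_cone y -> slice_cone y' -> 0 <= t <= 1 ->
  slice_cone (y + t *: (y' - y)).
Proof.
move=> h h' t01; have := convexO h h' t01.
by rewrite opp_col_mx add_col_mx scale_col_mx add_col_mx subr0 scaler0 addr0.
Qed.

Lemma in_tube_slice z (x : 'cV[R]_p) : in_tube slice_cone z -> in_tube Omega (col_mx z (map_mx (real_complex R) x)).
Proof.
rewrite /in_tube /slice_cone; suff -> : Imv (col_mx z (map_mx (real_complex R) x)) = col_mx (Imv z) 0 by [].
by rewrite /Imv map_col_mx; congr col_mx; apply/colP => i; rewrite !mxE.
Qed.

Variable z0 : 'cV[R[i]]_a.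
Hypothesis z0T : in_tube slice_cone z0.
Local Notation tauA := (tau G c' b' A).
Hypothesis z0D : D (tauA (col_mx z0 0)).

Let z0T' : in_tube Omega (col_mx z0 0).
Proof. by have := in_tube_slice 0 z0T; rewrite raddf0. Qed.

(** The Eichler transformation of a vector of L fixes every root of L^perp and has determinant 1, so
    [quotient_isometry] applies. Translations along L^perp may move the roots. *)
Lemma slice_translate z (w : 'cV[R]_a) (x : 'cV[int]_n.+2) :
  bil S x c = 0 -> bil S (map_mx intr x) b = 0 -> map_mx intr x = map_mx intr E *m w ->
  in_tube Omega z -> Q (tauA (z + col_mx (map_mx (real_complex R) w) 0)) = Q (tauA z).
Proof.
move=> xc xb xw zT.
have Bxc : bil G (B *m x) c' = 0 by have := bil_pull x c hB; rewrite map_intz xc.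
have Bxb : bil G (map_mx intr (B *m x)) b' = 0 by rewrite map_mxM (bil_pull _ _ hB).
have BxA : map_mx intr (B *m x) = lin A (col_mx w 0) by rewrite linA mulmx0 addr0 -xw map_mxM.
have [g [gO g1 gE gr]] := tau_translate hG evenG cc' cb' Ac Ab u0_pos hD z0T' z0D Bxc Bxb BxA zT.
have -> : col_mx (map_mx (real_complex R) w) 0 = map_mx (real_complex R) (col_mx w 0 : 'cV[R]_(a + p)).
  by rewrite map_col_mx raddf0.
have s2 r : r \in enum_fset rs -> bil G r r = -2 by exact: (root_norm hrs).
have gs r : r \in enum_fset rs -> g *m r = r.
  move=> rrs; have rB (y : 'cV[int]_n.+2) : bil G (B *m y) r = 0.
    by have := root_orth hG hrs y rrs; rewrite !map_intz.
  by apply: gr; rewrite rB.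
have DZ := tau_domain hG cc' cb' Ac Ab u0_pos hD z0T' z0D zT.
rewrite gE; apply: etrans (quotient_isometry Gsym hD PhiO s2 hQ PhiQ gO gs DZ) _.
by rewrite g1 mul1r.
Qed.

Lemma slice_period z (i : 'I_a) : in_tube Omega z -> Q (tauA (z + ev R (lshift p i))) = Q (tauA z).
Proof.
move=> zT; have -> : ev R (lshift p i) = col_mx (map_mx (real_complex R) (delta_mx i 0)) 0.
  by rewrite map_delta_mx; exact: delta_mx_ushift.
have Ei (F : comNzRingType) : map_mx intr (col i E) = map_mx intr E *m delta_mx i 0 :> 'cV[F]_n.+2.
  by rewrite map_col colE.
apply: (@slice_translate _ _ (col i E)) zT => //.
- by have := E_dot_c (delta_mx i 0 : 'cV[int]_a); rewrite !map_intz -colE.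
- by rewrite Ei; exact: E_dot_b.
- exact: Ei.
Qed.

Lemma slice_class (x : 'cV[R]_p) :
  tube_class slice_cone (fun z => Q (tauA (col_mx z (map_mx (real_complex R) x)))).
Proof.
split=> [z zT|z i zT].
  apply: (slice_differentiable (H := fun z => Q (tauA z))).
  exact: (holomorphic_tau hG cc' cb' Ac Ab u0_pos hD z0T' z0D hQ (in_tube_slice x zT)).
have -> : col_mx (z + ev R i) (map_mx (real_complex R) x) = col_mx z (map_mx (real_complex R) x) + ev R (lshift p i).
  by rewrite /ev delta_mx_ushift add_col_mx addr0.
exact: slice_period (in_tube_slice x zT).
Qed.

Lemma tau_root z (x : 'cV[R[i]]_p) r : r \in rs ->
  bil G (tauA (col_mx z x)) (map_mx intr r) = bil G (map_mx intr W *m x) (map_mx intr r).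
Proof.
move=> rrs; rewrite /tau /tube_point linA.
have -> : map_mx ratr b' = map_mx intr B *m map_mx ratr b :> 'cV[R[i]]_28 by rewrite map_mxM map_ratr_int.
have gen (u1 u2 u3 w q : 'cV[R[i]]_28) k : bil G u1 q = 0 -> bil G u2 q = 0 -> bil G u3 q = 0 ->
    bil G (u1 + w + u2 - k *: u3) q = bil G w q.
  by move=> h1 h2 h3; rewrite !bil_lin h1 h2 h3 mulr0 subr0 addr0 add0r.
by rewrite map_mxM; apply: gen; exact: (root_orth hG hrs _ rrs).
Qed.

Lemma generic_perp : exists x0 : 'cV[R]_p, forall r, r \in rs ->
  bil G (map_mx intr W *m x0) (map_mx intr r) != 0.
Proof.
pose V (w : 'cV[int]_28) := exists x : 'cV[int]_p, w = W *m x.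
have [| | |w [x ->] wr] := @generic_vector _ G V _ _ rs.
- by exists 0; rewrite mulmx0.
- by move=> k _ _ [x ->] [y ->]; exists (k *: x + y); rewrite mulmxDr scalemxAr.
(* A root is itself a rational combination of the columns of [W]; if it were orthogonal to all of
   them, its norm would be 0. *)
- move=> r rrs; apply: contrapT => nw.
  have rW (x : 'cV[int]_p) : bil G (W *m x) r = 0.
    by apply: contrapT => /eqP h; apply: nw; exists (W *m x) => //; exists x.
  have E0 : B^T *m G *m r = 0.
    apply/colP => i; have := root_orth hG hrs (delta_mx i 0 : 'cV[int]_n.+2) rrs.
    by rewrite bil_mull !map_intz trmx_delta -rowE [in X in X -> _]mxE => ->; rewrite mxE.
  have W0 : W^T *m G *m r = 0.
    apply/colP => i; have := rW (delta_mx i 0).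
    rewrite -[W in bil _ (W *m _)]map_intz bil_mull !map_intz trmx_delta -rowE [in X in X -> _]mxE => ->.
    by rewrite mxE.
  have : bil G (map_mx intr r) (map_mx intr r) = 0 :> rat.
    rewrite {1}(W_perp E0) bil_mull -map_mxM W0 raddf0 mulmx0 mxE //.
  by rewrite -bil_map (root_norm hrs rrs) => /eqP; rewrite intr_eq0.
exists (map_mx intr x) => r rrs; rewrite -map_mxM -bil_map intr_eq0; exact: wr.
Qed.

(** The Gram matrix of [W] is definite, hence invertible; a multi-index becomes a vector of L^perp
    whose norm has a sign. *)
Lemma perp_dual (js : seq int) : exists x : 'cV[R]_p, forall x' : 'cV[R]_p,
  bil G (map_mx intr W *m x) (map_mx intr W *m x') = \sum_(i < p) (nth 0 js i)%:~R * x' i 0.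
Proof.
have Tu : (map_mx intr (W^T *m G *m W) : 'M[R]_p) \in unitmx.
  rewrite unitmxE unitfE det_map_mx intr_eq0; apply: (@det_neq0 R) => x Tx.
  apply/eqP/negPn/negP => /W_negative; rewrite bil_mull (mulmxA _ (map_mx intr W)) -map_mxM Tx.
  by rewrite mulmx0 mxE ltxx.
pose k : 'cV[R]_p := \col_i (nth 0 js i)%:~R.
exists (invmx (map_mx intr (W^T *m G *m W)) *m k) => x'.
rewrite (bilC (map_mx intr W *m _) _ Gsym) bil_mull (mulmxA _ (map_mx intr W)) -map_mxM mulKVmx // mxE.
by apply: eq_bigr => i _; rewrite !mxE mulrC.
Qed.

Section Vanishing.
Variables (ks : seq int) (yk : 'cV[R]_a).
Hypothesis sk : size ks = a.
Hypothesis kyk : forall y : 'cV[R]_a, bil S (map_mx intr E *m yk) (map_mx intr E *m y) = \sum_(i < a) (nth 0 ks i)%:~R * y i 0.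
Hypothesis bad : ~ (0 < bil S (map_mx intr E *m yk) (map_mx intr E *m yk) /\
                    0 < bil S (map_mx intr E *m yk) (map_mx intr E *m v0)).

Let sL : seq 'I_(a + p) := [seq lshift p i | i <- enum 'I_a].
Let sW : seq 'I_(a + p) := [seq rshift a i | i <- enum 'I_p].
Let size_sL : size sL = a. Proof. by rewrite size_map size_enum_ord. Qed.
Let size_sW : size sW = p. Proof. by rewrite size_map size_enum_ord. Qed.

Let psi := Psi G c' b' A Phi.
Let psi_class : tube_class Omega psi :=
  Psi_class hG evenG cc' cb' Ac Ab u0_pos hD z0T' z0D hPhi PhiO.
Let psiL := As sL ks psi.
Let psiL_class : tube_class Omega psiL := As_class openO sL ks psi_class.

Lemma mixed_coef_eq0 (js : seq int) z : size js = p -> js != nseq p 0 -> in_tube Omega z ->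
  As sW js psiL z = 0.
Proof.
move=> sj j0 zT; rewrite -As_cat ?size_sL //.
have [xj Hxj] := perp_dual js.
have xj0 : xj != 0.
  apply: contra j0 => /eqP xj0; apply/eqP/(@eq_from_nth _ 0); first by rewrite size_nseq.
  move=> i; rewrite sj => ip; have := Hxj (delta_mx (Ordinal ip) 0).
  rewrite xj0 mulmx0 bil0l (bigD1 (Ordinal ip)) //= big1 ?addr0 => [|k ki].
    by rewrite mxE !eqxx mulr1 nth_nseq ip => /esym/eqP; rewrite intr_eq0 => /eqP.
  by rewrite mxE (negbTE ki) mulr0.
pose h := pos_vector R G c' b'.
have h0 : 0 < bil G h h := pos_vector_pos hG cc' cb'.
have lh v : bil G (lin A v) h = 0 := lin_dot_pos Ac Ab v.
have [||||||| |y [s [t [yE yy yu ly]]]] := @orth_cone_dual R 26 G hG h h0 (lin A u0) (lin A (col_mx yk 0)) (lin A (col_mx 0 xj)).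
- exact: lh.
- exact: lh.
- exact: lh.
- exact: u0_pos.
- by rewrite dotA !mulmx0 bil0r bil0l addr0.
- by rewrite dotA !mulmx0 bil0r bil0l addr0.
- by rewrite dotA mulmx0 bil0l add0r; exact: W_negative.
- by rewrite !dotA !mulmx0 !bil0l !addr0.
(* The coefficients returned by [orth_cone_dual] exhibit y in the image of [lin A], which yields the
   tube coordinates required by [koecher]. *)
pose v := s *: u0 + t *: col_mx yk xj.
have lk : lin A (col_mx yk 0) + lin A (col_mx 0 xj) = lin A (col_mx yk xj).
  by rewrite -linD add_col_mx addr0 add0r.
have yv : y = lin A v by rewrite yE lk /v linD !linZ.
apply: (@koecher _ _ _ _ hG evenG _ _ cc' cb' _ Ac Ab _ u0_pos _ hD _ z0T' z0D _ hPhi PhiO A_inj ap _ _ v) => //.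
- by rewrite !size_cat size_sL size_sW sk sj.
- by move=> i; rewrite mem_cat; case: (split_ordP i) => j ->; rewrite map_f ?mem_enum ?orbT.
- by rewrite /cone -yv.
rewrite wt_cat ?size_sL // mulmxDl; move: ly; rewrite lk yv.
have -> : forall X Y : 'M[R]_1, (X + Y) 0 0 = X 0 0 + Y 0 0 by move=> X Y; rewrite mxE.
rewrite !wt_enum // -[v]vsubmxK dotA kyk Hxj; congr (_ + _ < _).
  by apply: eq_bigr => i _; rewrite col_mxEu.
by apply: eq_bigr => i _; rewrite col_mxEd.
Qed.

(** Expanding [psiL] along L^perp, only the zero frequency survives [mixed_coef_eq0]; so [psiL]
    equals its own zeroth coefficient, which does not depend on x. *)
Lemma psiL_const z (x : 'cV[R]_p) : in_tube slice_cone z ->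
  psiL (col_mx z (map_mx (real_complex R) x)) = psiL (col_mx z 0).
Proof.
move=> zT; have E0 w : in_tube Omega w -> psiL w = As sW (nseq p 0) psiL w.
  move=> wT; apply/eqP; rewrite -subr_eq0; apply/negPn/negP => ne.
  have n0 : 0 < nrm (psiL w - As sW (nseq p 0) psiL w) by rewrite nrm_gt0.
  have [K0 HK] := fourier_converges openO convexO sW psiL_class wT (e := nrm (psiL w - As sW (nseq p 0) psiL w) / 2) (divr_gt0 n0 (ltr0Sn _ _)).
  have := HK K0 (leqnn _); rewrite size_sW (bigD1_seq (nseq p 0)) /=; last exact: zbox_uniq.
    have chi1 k : k = size sW -> chi sW (nseq k 0) w = 1 by move=> ->; exact: chi_nseq0.
    rewrite (chi1 p) // mulr1 big_seq_cond big1 ?addr0 => [|js].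
      by rewrite nrmB; lra.
    rewrite mem_zbox => /andP[/andP[/eqP sj _] j0].
    by rewrite mixed_coef_eq0 // mul0r.
  by rewrite mem_zbox size_nseq eqxx all_nseq /= orbT.
have T1 := in_tube_slice x zT; have T2 := in_tube_slice 0 zT; rewrite raddf0 in T2.
rewrite !E0 //; apply: (invariant_const openO convexO (S := [pred i : 'I_(a + p) | (a <= i)%N])) => //.
  move=> i /= ai; apply: (As_invariant openO convexO psiL_class); first by rewrite size_nseq.
  left; case: (split_ordP i) ai => j -> /=; first by rewrite leqNgt ltn_ord.
  by move=> _; rewrite map_f ?mem_enum.
move=> i /=; case: (split_ordP i) => j ->; first by rewrite !col_mxEu.
by rewrite /= leq_addr.
Qed.

(** [x0] is orthogonal to no root. On the slice t x0 with t non-zero the root product is a non-zero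
    constant [N], and N times the coefficient of [Q] is [psiL], which may be computed at x = 0,
    where it vanishes. [As_limit] then reaches t = 0. *)
Lemma bad_coef_eq0 z : in_tube slice_cone z -> As (enum 'I_a) ks (fun z => Q (tauA (col_mx z 0))) z = 0.
Proof.
move=> zT; have [x0 Hx0] := generic_perp.
have dif w : in_tube Omega w -> differentiable (fun z => Q (tauA z)) w.
  exact: (holomorphic_tau hG cc' cb' Ac Ab u0_pos hD z0T' z0D hQ).
have T0 := in_tube_slice 0 zT; rewrite raddf0 in T0.
apply: (As_limit openO dif slice_period (x0 := x0) sk T0) => t t0.
pose X : 'cV[R[i]]_p := map_mx (real_complex R) (t *: x0).
pose N := \prod_(r <- rs) bil G (map_mx intr W *m X) (map_mx intr r).
have PsiE x w : in_tube slice_cone w -> psi (col_mx w (map_mx (real_complex R) x)) =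
    \prod_(r <- rs) bil G (map_mx intr W *m map_mx (real_complex R) x) (map_mx intr r) *
    Q (tauA (col_mx w (map_mx (real_complex R) x))).
  move=> wT; rewrite /psi /Psi PhiQ; last first.
    exact: (tau_domain hG cc' cb' Ac Ab u0_pos hD z0T' z0D (in_tube_slice x wT)).
  have e : \prod_(r <- rs) bil G (tauA (col_mx w (map_mx (real_complex R) x))) (map_mx intr r) =
      \prod_(r <- rs) bil G (map_mx intr W *m map_mx (real_complex R) x) (map_mx intr r).
    by rewrite big_seq [RHS]big_seq; apply: eq_bigr => r rrs; exact: tau_root.
  by rewrite [LHS]mulrC e.
have N0 : N != 0.
  rewrite prodf_seq_neq0; apply/allP => r rrs; apply/implyP => _.
  have -> : map_mx intr r = map_mx (real_complex R) (map_mx intr r : 'cV[R]_28).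
    by apply/colP => i; rewrite !mxE rmorph_int.
  have -> : map_mx intr W *m X = map_mx (real_complex R) (map_mx intr W *m (t *: x0)).
    rewrite map_mxM; congr (_ *m _); apply/matrixP => i j; by rewrite !mxE rmorph_int.
  by rewrite -bil_map fmorph_eq0 -scalemxAr bilZl mulf_neq0 // Hx0.
have zero w : in_tube slice_cone w -> As (enum 'I_a) ks (fun z => N * Q (tauA (col_mx z X))) w = 0.
  move=> wT; transitivity (psiL (col_mx w X)).
    by rewrite /psiL As_slice; apply: (As_ext _ _ _ wT) => u uT; rewrite PsiE.
  rewrite /X psiL_const // /psiL As_slice.
  (* At x = 0 the factor of [r0] vanishes: here the existence of a root enters. *)
  have E0 u : in_tube slice_cone u -> psi (col_mx u 0) = (fun _ => 0) u * Q (tauA (col_mx u (map_mx (real_complex R) 0))).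
    move=> uT; have := PsiE 0 u uT; rewrite raddf0 => ->; congr (_ * _).
    by rewrite (big_rem r0) //= mulmx0 bil0l mul0r.
  transitivity (As (enum 'I_a) ks (fun u => (fun _ => 0) u * Q (tauA (col_mx u (map_mx (real_complex R) 0)))) w).
    exact: As_ext E0 _ wT.
  exact: (etrans (As_factor slice_open ks (slice_class 0) wT (P := fun _ => 0) (fun _ _ _ _ => erefl)) (mul0r _)).
have := zero z zT; rewrite (As_factor slice_open _ (slice_class (t *: x0)) zT (P := fun _ => N)) //.
by move/eqP; rewrite mulf_eq0 (negbTE N0) => /eqP.
Qed.

End Vanishing.

(** [x] is any vector of L_{c,b}, possibly with non-integral coordinates [w] in the basis [E]. The
    translation multiplies a coefficient by its character, while the coefficient is constant and the
    function invariant. *)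
Lemma coef_translate (ks : seq int) z (w : 'cV[R]_a) (x : 'cV[int]_n.+2) :
  size ks = a -> bil S x c = 0 -> bil S (map_mx intr x) b = 0 -> map_mx intr x = map_mx intr E *m w ->
  in_tube slice_cone z -> As (enum 'I_a) ks (fun z => Q (tauA (col_mx z 0))) z != 0 ->
  epi (\sum_(i < a) (nth 0 ks i)%:~R * (w i 0)%:C) = 1.
Proof.
move=> sk xc xb xw zT az; pose phi z := Q (tauA (col_mx z 0)).
have phiC : tube_class slice_cone phi by have := slice_class 0; rewrite raddf0.
pose wC := map_mx (real_complex R) w.
have Iw : Imv wC = 0 by apply/colP => i; rewrite !mxE.
have H u : in_tube slice_cone u -> phi (u + wC) = 1 * phi u.
  move=> uT; have T0 := in_tube_slice 0 uT; rewrite raddf0 in T0.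
  have := slice_translate xc xb xw T0; rewrite add_col_mx addr0 mul1r; exact.
have := As_translate slice_open (enum 'I_a) ks phiC Iw H zT; rewrite mul1r.
have -> : As (enum 'I_a) ks phi (z + wC) = As (enum 'I_a) ks phi z.
  apply: (invariant_const slice_open slice_convex (S := predT)) => //.
    move=> i _; apply: (As_invariant slice_open slice_convex phiC); first by rewrite size_enum_ord.
    by left; rewrite mem_enum.
  by rewrite /in_tube /Imv raddfD /= -/(Imv _) -/(Imv _) Iw addr0.
rewrite -[RHS]mulr1 => /(mulfI az); rewrite chi_enum // => e; rewrite -[RHS]e; congr epi.
by apply: eq_bigr => i _; rewrite mxE.
Qed.

Variable Z : 'M[rat]_(n.+2, 1 + 1).
Hypothesis EPZ : 1%:M = map_mx intr E *m PE + Z *m col_mx (map_mx intr (c^T *m S)) (b^T *m map_mx intr S).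

Let Ssym : S^T = S := hS.1.

(** The morphism [f] lets one statement serve rational, real and complex vectors. *)
Lemma cusp_span (F : fieldType) (f : {rmorphism rat -> F}) (x : 'cV[F]_n.+2) :
  bil S x (map_mx intr c) = 0 -> bil S x (map_mx f b) = 0 ->
  x = map_mx intr E *m (map_mx f PE *m x).
Proof.
have fi d e (X : 'M[int]_(d, e)) : map_mx f (map_mx intr X) = map_mx intr X.
  by apply/matrixP => i j; rewrite !mxE rmorph_int.
move=> xc xb; have := congr1 (fun M => map_mx f M *m x) EPZ.
rewrite map_mx1 mul1mx map_mxD !map_mxM map_col_mx map_mxM !fi mulmxDl -!mulmxA mul_col_mx => {1}->.
have -> : map_mx intr c^T *m map_mx intr S *m x = 0.
  by apply/colP => i; rewrite ord1 [RHS]mxE -[RHS]xc (bilC x _ Ssym) /bil map_trmx.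
have -> : map_mx f (b^T *m map_mx intr S) *m x = 0.
  by apply/colP => i; rewrite ord1 [RHS]mxE -[RHS]xb (bilC x _ Ssym) /bil map_trmx map_mxM fi.
by rewrite col_mx0 mulmx0 addr0.
Qed.

Let gram_unit : (map_mx intr (E^T *m S *m E) : 'M[rat]_a) \in unitmx.
Proof.
rewrite unitmxE unitfE det_map_mx intr_eq0; apply: (@det_neq0 R) => x Tx.
have xE (y : 'cV[R]_a) : bil S (map_mx intr E *m x) (map_mx intr E *m y) = 0.
  by rewrite (bilC (map_mx intr E *m x) _ Ssym) bil_mull (mulmxA _ (map_mx intr E)) -map_mxM Tx mulmx0 mxE.
apply: E_inj; apply/eqP/negPn/negP => Ex.
have := signature_orth_neg hS v0_pos (pos_vector_pos hS cc cb) (lin_dot_pos (A := E) Ec Eb v0) (xE v0)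
  (lin_dot_pos (A := E) Ec Eb x) Ex.
by rewrite xE ltxx.
Qed.

Definition dual_coord (ks : seq int) : 'cV[rat]_a :=
  invmx (map_mx intr (E^T *m S *m E)) *m \col_i (nth 0 ks i)%:~R.

(** The vector of L_{c,b} over the rationals whose pairings with the columns of [E] are [ks]. *)
Definition freq (ks : seq int) : 'cV[rat]_n.+2 := map_mx intr E *m dual_coord ks.

Lemma map_freq (F : fieldType) (f : {rmorphism rat -> F}) ks :
  map_mx f (freq ks) = map_mx intr E *m map_mx f (dual_coord ks).
Proof.
by rewrite /freq map_mxM; congr (_ *m _); apply/matrixP => i j; rewrite !mxE rmorph_int.
Qed.

Lemma freq_dot (F : fieldType) (f : {rmorphism rat -> F}) ks (y : 'cV[F]_a) :
  bil S (map_mx f (freq ks)) (map_mx intr E *m y) = \sum_(i < a) (nth 0 ks i)%:~R * y i 0.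
Proof.
rewrite (bilC (map_mx f _) _ Ssym) bil_mull map_freq (mulmxA _ (map_mx intr E)) -map_mxM.
have -> : map_mx intr (E^T *m S *m E) = map_mx f (map_mx intr (E^T *m S *m E)).
  by apply/matrixP => i j; rewrite !mxE rmorph_int.
rewrite -map_mxM mulKVmx // mxE; apply: eq_bigr => i _.
by rewrite !mxE rmorph_int mulrC.
Qed.

(** [numq] only converts pairings that are integers; for other l the result is meaningless. *)
Definition freq_index (l : 'cV[rat]_n.+2) : seq int :=
  [seq numq ((map_mx intr (E^T *m S) *m l) i 0) | i <- enum 'I_a].

Lemma freqK ks : size ks = a -> freq_index (freq ks) = ks.
Proof.
move=> sk; rewrite [RHS](seq_enum sk); apply: eq_map => i.
by rewrite /freq mulmxA -map_mxM mulKVmx // mxE numq_int.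
Qed.

Let phi z := Q (tauA (col_mx z 0)).
Let phi_class : tube_class slice_cone phi.
Proof. by have := slice_class 0; rewrite raddf0. Qed.

Definition coef (ks : seq int) : R[i] := As (enum 'I_a) ks phi z0.

Lemma coefE ks z : size ks = a -> in_tube slice_cone z -> As (enum 'I_a) ks phi z = coef ks.
Proof.
move=> sk zT; apply: (invariant_const slice_open slice_convex (S := predT)) => // i _.
by apply: (As_invariant slice_open slice_convex phi_class); [rewrite size_enum_ord|left; rewrite mem_enum].
Qed.

Lemma coef_dual ks : size ks = a -> coef ks != 0 -> Lcb_dual S c b (freq ks).
Proof.
move=> sk k0; split; [exact: E_dot_c|exact: E_dot_b|move=> x xc xb].
have xcQ : bil S (map_mx intr x) (map_mx intr c) = 0 :> rat by rewrite -bil_map xc rmorph0.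
have := cusp_span (f := idfun) xcQ; rewrite !map_mx_id // => /(_ xb).
move: (PE *m _) => w xw.
have xwR : map_mx intr x = map_mx intr E *m map_mx ratr w :> 'cV[R]_n.+2.
  by rewrite -map_ratr_int xw map_mxM map_ratr_int.
have := coef_translate sk xc xb xwR z0T k0 => /epi_eq1[k kE].
have := freq_dot idfun ks w; rewrite map_mx_id // -xw => ->.
have : ratr (\sum_(i < a) (nth 0 ks i)%:~R * w i 0) = k%:~R :> R[i].
  rewrite -kE rmorph_sum; apply: eq_bigr => i _; rewrite rmorphM /= ratr_int mxE.
  by rewrite (fmorph_rat (real_complex R)).
rewrite -(ratr_int R[i]) => /(fmorph_inj (@ratr R[i])) ->; exact: intr_int.
Qed.

Lemma coef_positive ks : size ks = a -> coef ks != 0 ->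
  0 < bil S (freq ks) (freq ks) /\ 0 < bil S (map_mx ratr (freq ks)) (map_mx intr E *m v0).
Proof.
move=> sk k0; have kyk (y : 'cV[R]_a) : bil S (map_mx intr E *m map_mx ratr (dual_coord ks)) (map_mx intr E *m y) =
    \sum_(i < a) (nth 0 ks i)%:~R * y i 0 by rewrite -map_freq freq_dot.
have [h1 h2] : 0 < bil S (map_mx intr E *m map_mx ratr (dual_coord ks) : 'cV[R]_n.+2) (map_mx intr E *m map_mx ratr (dual_coord ks)) /\
    0 < bil S (map_mx intr E *m map_mx ratr (dual_coord ks)) (map_mx intr E *m v0).
  apply: contrapT => bad; move/eqP: k0; apply; exact: (bad_coef_eq0 sk kyk bad z0T).
by rewrite -map_freq in h1 h2; split=> //; rewrite -bil_map ltr0q in h1.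
Qed.

Variable C : set 'cV[R]_n.+2.
Hypothesis hC : forall x, C x <-> Lcb_positive S c b x /\ 0 < bil S x (map_mx intr E *m v0).
Variable F : 'cV[R[i]]_n.+2 -> R[i].
Hypothesis hF : forall z, tube S c b C z -> F (tube_point S c b z) = Q (map_mx intr B *m tube_point S c b z).

Lemma tube_point_pull z : map_mx intr B *m tube_point S c b z = tube_point G c' b' (map_mx intr B *m z) :> 'cV[R[i]]_28.
Proof.
rewrite /tube_point mulmxBr mulmxDr -scalemxAr (bil_pull _ _ hB) (bil_pull _ _ hB) -map_mxM.
by rewrite (map_mxM _ (map_mx intr B)) map_ratr_int.
Qed.

Lemma tube_coord z : tube S c b C z -> exists2 w, in_tube slice_cone w & z = map_mx intr E *m w.
Proof.
move=> [[rc rb] Cz]; have [[[ic ib] zz] zv] := (hC _).1 Cz.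
have zE : z = map_mx (real_complex R) (map_mx (@complex.Re R) z) +
   'i *: map_mx (real_complex R) (map_mx (@complex.Im R) z).
  by apply/colP => i; rewrite !mxE -complexRIE.
have lift (x : 'cV[R]_n.+2) (y : 'cV[R]_n.+2) (y' : 'cV[R[i]]_n.+2) : y' = map_mx (real_complex R) y -> bil S x y = 0 ->
    bil S (map_mx (real_complex R) x) y' = 0 by move=> -> h; rewrite -bil_map h rmorph0.
have cR : map_mx intr c = map_mx (real_complex R) (map_mx intr c) :> 'cV[R[i]]_n.+2.
  by apply/colP => i; rewrite !mxE rmorph_int.
have bR : map_mx ratr b = map_mx (real_complex R) (map_mx ratr b) :> 'cV[R[i]]_n.+2.
  by apply/colP => i; rewrite !mxE fmorph_rat.
have zc : bil S z (map_mx intr c) = 0 by rewrite zE bilDl bilZl !(lift _ _ _ cR) // mulr0 addr0.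
have zb : bil S z (map_mx ratr b) = 0 by rewrite zE bilDl bilZl !(lift _ _ _ bR) // mulr0 addr0.
exists (map_mx ratr PE *m z); last exact: cusp_span zc zb.
rewrite /in_tube; apply/slice_coneE.
have -> : map_mx intr E *m Imv (map_mx ratr PE *m z) = map_mx (@complex.Im R) z.
  rewrite [in RHS](cusp_span zc zb); symmetry; exact: lin_Im.
by [].
Qed.

Lemma cusp_expansion : exists2 f, is_fourier_expansion S c b C F f &
  forall l, f l != 0 -> closure C (map_mx ratr l) /\ 0 < bil S l l.
Proof.
(* The test discards the vectors that are no frequency, where [freq_index] has no meaning. *)
pose f l := if freq (freq_index l) == l then coef (freq_index l) else 0.
have si l : size (freq_index l) = a by rewrite size_map size_enum_ord.
have fE ks : size ks = a -> f (freq ks) = coef ks by move=> sk; rewrite /f freqK // eqxx.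
have fP l : f l != 0 -> exists ks, [/\ size ks = a, l = freq ks & coef ks != 0].
  rewrite /f; case: (freq (freq_index l) =P l) => [E0 k0|_]; last by rewrite eqxx.
  by exists (freq_index l).
exists f => [|l /fP[ks [sk -> k0]]]; last first.
  have [h1 h2] := coef_positive sk k0; split => //.
  apply: subset_closure; apply/hC; split=> //; split; last by rewrite -bil_map ltr0q.
  by rewrite map_freq; split; [exact: E_dot_c|exact: (lin_dot_b (A := E) Eb)].
split=> [l /fP[ks [sk -> k0]]|z zC]; first exact: coef_dual.
have [w wT zw] := tube_coord zC.
have phiw : F (tube_point S c b z) = phi w.
  by rewrite hF // tube_point_pull /phi /tau linA mulmx0 addr0 zw.
have term ks : size ks = a -> f (freq ks) * cexp ((0 +i* (2 * pi)) * bil S (map_mx ratr (freq ks)) z) =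
    As (enum 'I_a) ks phi w * chi (enum 'I_a) ks w.
  by move=> sk; rewrite fE // coefE // chi_enum // zw freq_dot.
have box_freq K : uniq [seq freq ks | ks <- zbox K a].
  rewrite map_inj_in_uniq ?zbox_uniq // => ks ks'; rewrite !mem_zbox => /andP[/eqP sk _] /andP[/eqP sk' _] E0.
  by rewrite -(freqK sk) E0 freqK.
have [M HM] := fourier_abs_bounded slice_open slice_convex (enum 'I_a) phi_class wT.
rewrite phiw; apply: (totally_exhaustion (Bx := fun K => [seq freq ks | ks <- zbox K a]) (M := M)) => //.
- move=> K K' KK' _ /mapP[ks + ->]; rewrite mem_zbox => /andP[sk aK]; apply: map_f.
  by rewrite mem_zbox sk; apply: sub_all aK => k /leq_trans; apply.
- move=> l; rewrite mulf_eq0 negb_or => /andP[/fP[ks [sk -> _]] _].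
  exists (\max_(k <- ks) `|k|)%N; apply: map_f; rewrite mem_zbox sk eqxx /=.
  by apply/allP => k kk; rewrite (big_rem k) //= leq_maxl.
- move=> e e0; have [K0 HK] := fourier_converges slice_open slice_convex (enum 'I_a) phi_class wT e0.
  exists K0 => K KK; have := HK K KK; rewrite size_enum_ord big_map.
  by congr (nrm (_ - _) <= _); rewrite big_seq [RHS]big_seq; apply: eq_bigr => ks; rewrite mem_zbox => /andP[/eqP sk _]; rewrite term.
move=> K; have := HM K; rewrite size_enum_ord big_map.
by congr (_ <= _); rewrite big_seq [RHS]big_seq; apply: eq_bigr => ks; rewrite mem_zbox => /andP[/eqP sk _]; rewrite term.
Qed.

End CuspCoefficients.

(** * The component C^+ as half of the positive cone *)

Section CuspDatum.
Variables (R : realType) (n : nat) (S : 'M[int]_n.+2).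
Hypothesis hS : has_signature_2n R S.
Variables (c : 'cV[int]_n.+2) (b : 'cV[rat]_n.+2).
Hypothesis cc : bil S c c = 0.
Hypothesis cb : bil S (map_mx intr c) b = 1.

Let Ssym : S^T = S := hS.1.
Let h : 'cV[R]_n.+2 := pos_vector R S c b.

Lemma Lcb_dot_pos (x : 'cV[R]_n.+2) : Lcb_real S c b x -> bil S x h = 0.
Proof. by move=> [xc xb]; rewrite /h /pos_vector bilDr bilZr xc xb mulr0 addr0. Qed.

Lemma Lcb_line (x y : 'cV[R]_n.+2) (t : R) : Lcb_real S c b x -> Lcb_real S c b y ->
  Lcb_real S c b (x + t *: (y - x)).
Proof.
by move=> [xc xb] [yc yb]; split; rewrite !bil_lin ?xc ?xb ?yc ?yb subrr mulr0 addr0.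
Qed.

Lemma real_bil_continuous (y : 'cV[R]_n.+2) : continuous (fun x : 'cV[R]_n.+2 => bil S x y).
Proof.
move=> x; have -> : (fun x : 'cV[R]_n.+2 => bil S x y) = fun x => \sum_i \sum_j x i 0 * (S i j)%:~R * y j 0.
  by apply/funext => w; rewrite bilE.
apply: cont_sum => i; apply: cont_sum => j.
have ci : {for x, continuous (fun w : 'cV[R]_n.+2 => w i 0)} by exact: coord_continuous.
have cs : {for x, continuous (fun _ : 'cV[R]_n.+2 => (S i j)%:~R : R)} by apply: cst_continuous.
have cy : {for x, continuous (fun _ : 'cV[R]_n.+2 => y j 0 : R)} by apply: cst_continuous.
exact: cvgM (cvgM ci cs) cy.
Qed.

(* The linear form (., y0) has no zero on the vectors of positive norm. *)
Lemma component_cone (C : set 'cV[R]_n.+2) y0 : is_component (Lcb_positive S c b) C -> C y0 ->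
  forall x, C x <-> Lcb_positive S c b x /\ 0 < bil S x y0.
Proof.
move=> [x1 x1L ->] Cy0 x; have h0 : 0 < bil S h h := pos_vector_pos hS cc cb.
have [y0L y00] : Lcb_positive S c b y0 by exact: connected_component_sub Cy0.
rewrite (same_connected_component Cy0); split=> [Cx|[[xL xx] xy]].
  have Lx := connected_component_sub Cx; split => //.
  rewrite ltNge; apply/negP => xy.
  have cI : connected ((fun x : 'cV[R]_n.+2 => bil S x y0) @` connected_component (Lcb_positive S c b) y0).
    apply: connected_continuous_connected; first exact: component_connected.
    exact/continuous_subspaceT/real_bil_continuous.
  have /connected_intervalP/(_ (bil S x y0) (bil S y0 y0)) := cI.
  case/(_ _ _ 0) => [|||w Cw w0].
  - by exists x.
  - by exists y0 => //; exact: connected_component_refl.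
  - by rewrite xy ltW.
  have [wL ww] := connected_component_sub Cw.
  have := orth_cone_neq0 hS h0 (Lcb_dot_pos y0L) (Lcb_dot_pos wL) y00 (ltW ww).
  rewrite w0 eqxx => /(_ _)-H; suff : false by []; apply: H.
  by apply: contraTneq ww => ->; rewrite bil0l ltxx.
pose f (t : R) : 'cV[R]_n.+2 := y0 + t *: (x - y0).
suff H : f @` `[0, 1] `<=` connected_component (Lcb_positive S c b) y0.
  by apply: H; exists 1; rewrite ?/f ?scale1r ?[y0 + _]addrC ?subrK //= in_itv /= lexx ler01.
apply: connected_component_max.
- by exists 0; rewrite ?/f ?scale0r ?addr0 //= in_itv /= lexx ler01.
- move=> _ [t + <-]; rewrite /= in_itv /= => t01; split; first exact: Lcb_line.
  have [] := orth_cone_convex hS h0 (Lcb_dot_pos y0L) (Lcb_dot_pos y0L) (Lcb_dot_pos xL) y00 y00 xx y00 xy t01.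
  by [].
- apply: connected_continuous_connected; first exact: segment_connected.
  apply: continuous_subspaceT => t; apply: cvgD; first exact: cvg_cst.
  by apply: cvgZr_tmp; exact: cvg_id.
Qed.

End CuspDatum.

(** * Vanishing at all cusps *)

Section Pullback.
Variables (R : realType) (G : 'M[int]_28) (n : nat) (S : 'M[int]_n.+2) (B : 'M[int]_(28, n.+2)).
Hypothesis hG : has_signature_2n R (n := 26) G.
Hypothesis evenG : even_lattice G.
Hypothesis hS : has_signature_2n R S.
Hypothesis hB : B^T *m G *m B = S.
Variable rs : {fset 'cV[int]_28}.
Hypothesis hrs : is_pm_representatives G B rs.
Hypothesis hroots : perp_roots G B !=set0.
Variables (DM : set 'cV[R[i]]_28) (DL : set 'cV[R[i]]_n.+2).
Hypothesis hDM : is_domain_cone (n := 26) G DM.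
Hypothesis hsub : forall Z, DL Z -> DM (map_mx intr B *m Z).
Variable Phi : 'cV[R[i]]_28 -> R[i].
Hypothesis hPhi : holomorphic_on (n := 26) DM Phi.
Hypothesis PhiO : forall g Z, Oplus (n := 26) G DM g -> DM Z -> Phi (map_mx intr g *m Z) = (\det g)%:~R * Phi Z.
Variable Q : 'cV[R[i]]_28 -> R[i].
Hypothesis hQ : holomorphic_on (n := 26) DM Q.
Hypothesis PhiQ : forall Z, DM Z -> Phi Z = Q Z * \prod_(r <- rs) bil G Z (map_mx intr r).
Variable F : 'cV[R[i]]_n.+2 -> R[i].
Hypothesis hF : forall Z, DL Z -> F Z = Q (map_mx intr B *m Z).

Lemma pullback_vanishing : vanishing_at_cusps S DL F.
Proof.
move=> c b C [_ cc _ cb [Ccomp Ctube]]; have Ssym : S^T = S := hS.1.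
have [y0 Cy0] : exists y, C y by have [x xL ->] := Ccomp; exists x; exact: connected_component_refl.
have hC := component_cone hS cc cb Ccomp Cy0.
have [[[y0c y0b] y00] _] := (hC y0).1 Cy0.
have [a [E [PE [Z [NE PEE EPZ na]]]]] :=
  kernel_basis (col_mx (map_mx intr (c^T *m S)) (b^T *m map_mx intr S) : 'M[rat]_(1 + 1, n.+2)).
have [p [W [PW [Z2 [NW PWW WPZ np]]]]] := kernel_basis (map_mx intr (B^T *m G) : 'M[rat]_(n.+2, 28)).
have [NEc NEb] : map_mx intr (c^T *m S) *m map_mx intr E = 0 :> 'M[rat]_(1, a) /\ b^T *m map_mx intr S *m map_mx intr E = 0.
  by move: NE; rewrite mul_col_mx => /eqP; rewrite col_mx_eq0 => /andP[/eqP ? /eqP].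
have Ec : E^T *m S *m c = 0.
  apply: trmx_inj; rewrite !trmx_mul trmxK Ssym trmx0 mulmxA.
  by apply: (@map_intr_inj rat); rewrite map_mxM NEc raddf0.
have Eb : map_mx intr (E^T *m S) *m b = 0.
  apply: trmx_inj; rewrite trmx_mul map_trmx trmx_mul trmxK Ssym trmx0.
  by rewrite map_mxM mulmxA.
have WB : W^T *m G *m B = 0.
  apply: trmx_inj; rewrite !trmx_mul trmxK (hG.1 : G^T = G) trmx0 mulmxA.
  by apply: (@map_intr_inj rat); rewrite map_mxM NW raddf0.
have Wperp (x : 'cV[int]_28) : B^T *m G *m x = 0 -> map_mx intr x = map_mx intr W *m (PW *m map_mx intr x).
  move=> Bx; rewrite -[LHS]mul1mx WPZ mulmxDl -!mulmxA -map_mxM Bx raddf0 mulmx0 addr0 //.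
(* The kernels give a >= n and p >= 26 - n, so the rank is at least 26 for every n. *)
have ap : (2 < a + p)%N by lia.
have [r0 r0rs] : exists r, r \in rs.
  have [r /hrs.2] := hroots; case rrs: (r \in rs); first by exists r.
  by move=> /= h; exists (- r).
pose v0 : 'cV[R]_a := map_mx ratr PE *m y0.
have y0E : y0 = map_mx intr E *m v0 := cusp_span hS EPZ y0c y0b.
have v0_pos : 0 < bil S (map_mx intr E *m v0) (map_mx intr E *m v0) by rewrite -y0E.
(* The base point i v0 has its imaginary part in C, so its tube point lies in [DL] and the image in
   [DM]. By convexity this places the whole tube in [DM]. *)
clearbody v0; pose z0 : 'cV[R[i]]_a := 'i *: map_mx (real_complex R) v0.
have z0I : Imv z0 = v0.
  by apply/colP => i; rewrite !mxE /= mul0r mul1r add0r.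
have z0T : in_tube (slice_cone G B E W v0) z0.
  by rewrite /in_tube z0I; exact: (slice_coneE hG hB E WB v0 v0).2.
have Ez0 : map_mx intr E *m z0 = 'i *: map_mx (real_complex R) y0.
  rewrite /z0 -scalemxAr y0E map_mxM; congr (_ *: _); congr (_ *m _).
  by apply/matrixP => i j; rewrite !mxE rmorph_int.
have tz : tube S c b C (map_mx intr E *m z0).
  rewrite Ez0; split.
    have -> : map_mx (@complex.Re R) ('i *: map_mx (real_complex R) y0) = 0.
      by apply/colP => i; rewrite !mxE /= mul0r mulr0 subr0.
    by split; rewrite bil0l.
  have -> : map_mx (@complex.Im R) ('i *: map_mx (real_complex R) y0) = y0; last by [].
  by apply/colP => i; rewrite !mxE /= mul0r mul1r add0r.
have z0D : DM (tau G (B *m c) (map_mx intr B *m b) (row_mx (B *m E) W) (col_mx z0 0)).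
  rewrite /tau (linA B E W) mulmx0 addr0 -(tube_point_pull hB); exact/hsub/Ctube.
apply: (cusp_expansion hG evenG hS hB hrs r0rs hDM hPhi PhiO hQ PhiQ cc cb Ec Eb PEE WB PWW Wperp ap v0_pos z0T z0D EPZ).
  by move=> x; rewrite -y0E; exact: hC.
by move=> z zC; apply: hF; exact: Ctube.
Qed.

End Pullback.

Theorem corollary8p12 (R : realType)
    (G : 'M[int]_28) (hG : is_II_2_26 R G)
    (DM : set 'cV[R[i]]_28) (hDM : is_domain_cone (n := 26) G DM)
    (Phi : 'cV[R[i]]_28 -> R[i]) (hPhi : is_borcherds_form G DM Phi)
    (n : nat) (hn : (1 <= n)%N)
    (S : 'M[int]_n.+2) (hS : has_signature_2n R S)
    (B : 'M[int]_(28, n.+2)) (hB : B^T *m G *m B = S)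
    (DL : set 'cV[R[i]]_n.+2) (hDL : is_domain_cone S DL)
    (hsub : forall Z, DL Z -> DM (map_mx intr B *m Z))
    (hroots : perp_roots G B !=set0)
    (rs : {fset 'cV[int]_28}) (hrs : is_pm_representatives G B rs) :
  (exists F, is_quasi_pullback G B DM DL rs Phi F) /\
  (forall F, is_quasi_pullback G B DM DL rs Phi F ->
     cusp_form_det S DL (stable_Oplus S DL)
       (12 + half_number_of_roots G B) F).
Proof.
have [sG evenG _] := hG; have [[holPhi wtPhi PhiO _] _] := hPhi.
have Gsym : G^T = G := sG.1.
have s2 r : r \in enum_fset rs -> bil G r r = -2 by exact: (root_norm hrs).
split.
  have [Q [hQ PhiQ]] := quotient_exists Gsym (signature_det_neq0 sG) hDM holPhi PhiO (fset_uniq rs) s2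
    (fun r r' => @roots_pairwise R G n S B sG hS hB rs hrs r r').
  by exists (fun Z => Q (map_mx intr B *m Z)), Q; split.
move=> F [Q [hQ PhiQ hF]].
have van := pullback_vanishing sG evenG hS hB hrs hroots hDM hsub holPhi PhiO hQ PhiQ hF.
split => //; split.
- exact: (pullback_holomorphic hsub hQ hF).
- move=> t Z t0 DZ; rewrite !hF //; last exact: (domain_scale hDL t0 DZ).
  rewrite -scalemxAr (card_roots hrs).
  exact: (quotient_scale Gsym hDM s2 hQ PhiQ wtPhi t0 (hsub _ DZ)).
- move=> g Z gS DZ; have [g' [g'O dg g'B g'r]] := stable_extension sG hS hB hrs hDM hDL hsub gS.
  have DgZ : DL (map_mx intr g *m Z) by have [[_ <-] _] := gS; exists Z.
  rewrite !hF // mulmxA -map_mxM -g'B map_mxM -mulmxA -dg.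
  exact: (quotient_isometry Gsym hDM PhiO s2 hQ PhiQ g'O g'r (hsub _ DZ)).
(* The cusp condition contains the boundary condition, with the same expansion. *)
move=> _ c b C /van[f fE fC]; exists f => // l /fC[]//.
Qed.
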